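(* Let $\tilde w=s_{\beta_1}\cdots s_{\beta_r}$ be an expression (not necessarily reduced) in simple reflections of the Weyl group of a Kac-Moody group $G$, let $Z(\tilde w)$ be the associated Bott-Samelson-Demazure-Hansen variety and $Y_{\tilde w}$ its toric limit. Let $T_X$ denote the tangent bundle of $X$. (1) If $\tilde w$ satisfies condition $I$, then $H^i(Y_{\tilde w},T_{Y_{\tilde w}})=0$ for all $i\ge1$. In particular, $Y_{\tilde w}$ is locally rigid. (2) If $\tilde w$ satisfies condition $I$, then $H^i(Z(\tilde w),T_{Z(\tilde w)})=0$ for all $i\ge1$. In particular, $Z(\tilde w)$ is locally rigid.
   Context: We work over $\mathbb C$. $G$ is the Kac-Moody group of a generalized Cartan matrix, with maximal torus $T$, Borel subgroup $B\supset T$, simple roots $S$, minimal parabolic subgroups $P_\alpha$ ($\alpha\in S$). An expression is a finite sequence $\tilde w=s_{\beta_1}\cdots s_{\beta_r}$ of simple reflections, $\beta_i\in S$. Put $\beta_{ij}:=\langle\beta_j,\check\beta_i\rangle$, where $\check\beta_i$ is the coroot of $\beta_i$. $Z(\tilde w)=P_{\beta_1}\times\cdots\times P_{\beta_r}/B^r$ with action $(p_1,\dots,p_r)\cdot(b_1,\dots,b_r)=(p_1b_1,b_1^{-1}p_2b_2,\dots,b_{r-1}^{-1}p_rb_r)$; it is a smooth projective variety of dimension $r$. Toric limit: choose an injective one-parameter subgroup $\lambda:\mathbb G_m\to T$ and $q>0$ with $\alpha(\lambda(u))=u^q$ for all $\alpha\in S$; let $\Psi_u(b)=\lambda(u)b\lambda(u)^{-1}$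 for $u\ne0$, $b\in B$, extended to $u=0$ by the projection $\Psi_0:B\to T$. Let $\mathcal X=\mathbb A^1\times P_{\beta_1}\times\cdots\times P_{\beta_r}/B^r$ with action $(u,p_1,\dots,p_r)\cdot(b_1,\dots,b_r)=(u,p_1b_1,\Psi_u(b_1)^{-1}p_2b_2,\dots,\Psi_u(b_{r-1})^{-1}p_rb_r)$. The projection $\mathcal X\to\mathbb A^1$ is smooth projective with fibres over $u\neq0$ isomorphic to $Z(\tilde w)$; $Y_{\tilde w}$ is the fibre over $0$. It is the smooth projective toric variety whose fan in $\mathbb R^r$ is as follows (known): with $e_1^+,\dots,e_r^+$ the standard basis of $\mathbb Z^r$ and $e_i^-:=-e_i^+-\sum_{j>i}\beta_{ij}e_j^+$, the cones are those generated by subsets of $\{e_1^{\pm},\dots,e_r^{\pm}\}$ containing no pair $\{e_i^+,e_i^-\}$. Condition $I$: for $1\le i\le r$ let $\eta_i^+=\{j: i<j\le r,\ \beta_{ij}>0\}$, $\eta_i^-=\{j: i<j\le r,\ \beta_{ij}<0\}$. $\tilde w$ satisfies condition $I$ if for every $1\le i\le r$: $|\eta_i^+|=0$, $|\eta_i^-|\le1$, and if $\eta_i^-=\{l\}$ then $\beta_{il}=-1$. A smooth projective variety is locally rigid if it has no nontrivial local (infinitesimal) deformations. *)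

(* Defs.v *)
From HB Require Import structures.
From mathcomp Require Import all_boot all_order all_algebra.
From mathcomp Require Import mxtens complex.
From mathcomp Require Import boolp classical_sets reals.

Set Implicit Arguments.
Unset Strict Implicit.
Unset Printing Implicit Defensive.

Import Order.TTheory GRing.Theory Num.Theory.
Local Open Scope classical_set_scope.
Local Open Scope ring_scope.

(* A variety is given by its closed points, its Zariski-open sets, and the
   functions regular on each open set.  A function regular on U is a total
   function whose values outside U are irrelevant.  The sheaf axioms are not
   fields: they hold for the three constructions used below (zariski, quotient,
   subspace). *)
Record fspace (K : Type) := FSpace {
  point :> Type;
  opn : set (set point);
  reg : set point -> set (point -> K) }.

Inductive gen_alg (K : pzRingType) (X : Type) (S : set (X -> K)) : set (X -> K) :=
| gen_in f : S f -> gen_alg S f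
| gen_cst c : gen_alg S (fun=> c)
| gen_add f g : gen_alg S f -> gen_alg S g -> gen_alg S (fun x => f x + g x)
| gen_mul f g : gen_alg S f -> gen_alg S g -> gen_alg S (fun x => f x * g x).

(* The (pro-)affine variety with set of points X whose coordinate ring is the
   algebra generated by the functions in S. *)
Definition zariski (K : fieldType) (X : Type) (S : set (X -> K)) : fspace K :=
  @FSpace K X
    [set U : set X | forall x, U x -> exists a, [/\ gen_alg S a, a x != 0
                                         & forall y, a y != 0 -> U y]]
    (fun U => [set f | forall x, U x -> exists a b,
       [/\ gen_alg S a, gen_alg S b, b x != 0
         & forall y, U y -> b y != 0 -> f y = a y / b y]]).

(* The points of the quotient are the classes [set y | E x y]. *)
Definition quot_point (X : Type) (E : X -> X -> Prop) : Type :=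
  {c : set X | exists x, c = [set y | E x y]}.

Definition quot_proj (X : Type) (E : X -> X -> Prop) (x : X) : quot_point E :=
  exist _ [set y | E x y] (ex_intro _ x erefl).

Definition quotient (K : Type) (X : fspace K) (E : X -> X -> Prop) : fspace K :=
  @FSpace K (quot_point E)
    [set U : set (quot_point E) | opn (@quot_proj X E @^-1` U)]
    (fun U => [set f : quot_point E -> K |
       @reg K X (@quot_proj X E @^-1` U) (fun x => f (quot_proj E x))]).

(* Regular functions on a subspace are the local restrictions of regular
   functions. *)
Definition subspace (K : Type) (X : fspace K) (A : set X) : fspace K :=
  @FSpace K {x : X | A x}
    [set V : set {x : X | A x} | exists2 U : set X, opn U & V = @sval X A @^-1` U]
    (fun V => [set f | forall x, V x -> exists (U : set X) (F : X -> K),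
       [/\ opn U, U (sval x), reg U F
         & forall y, V y -> U (sval y) -> f y = F (sval y)]]).

(* A derivation of the sheaf of functions of U, i.e. a section over U of the
   tangent sheaf: a compatible family of derivations D_V of the algebras of
   functions regular on V, for V open in U.  Thanks to [vf_local] the family is
   encoded by one operator on partially regular functions. *)
Record vfield (K : pzRingType) (X : fspace K) (U : set X)
    (D : (X -> K) -> (X -> K)) : Prop := VField {
  vf_reg : forall V f, opn V -> V `<=` U -> reg V f -> reg V (D f);
  vf_local : forall V f g, opn V -> V `<=` U -> reg V f -> reg V g ->
    {in V, f =1 g} -> {in V, D f =1 D g};
  vf_scale : forall V c f, opn V -> V `<=` U -> reg V f ->
    {in V, forall x, D (fun y => c * f y) x = c * D f x};
  vf_add : forall V f g, opn V -> V `<=` U -> reg V f -> reg V g ->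
    {in V, forall x, D (fun y => f y + g y) x = D f x + D g x};
  vf_leibniz : forall V f g, opn V -> V `<=` U -> reg V f -> reg V g ->
    {in V, forall x, D (fun y => f y * g y) x = D f x * g x + f x * D g x} }.

Definition vfield_eq (K : pzRingType) (X : fspace K) (U : set X)
    (D D' : (X -> K) -> (X -> K)) : Prop :=
  forall V f, opn V -> V `<=` U -> reg V f -> {in V, D f =1 D' f}.

Definition is_cover (K : Type) (X : fspace K) (I : Type) (U : I -> set X) : Prop :=
  (forall i, opn (U i)) /\ (forall x, exists i, U i x).

Definition meet (X I : Type) (U : I -> set X) k (s : 'I_k -> I) : set X :=
  [set x | forall j, U (s j) x].

(* Cochains are indexed by the number k of open sets that are intersected, so
   k = p.+1 in degree p. *)
Definition cochain (K : pzRingType) (X : fspace K) (I : Type) (k : nat) : Type :=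
  ('I_k -> I) -> (X -> K) -> (X -> K).

Definition is_cochain (K : pzRingType) (X : fspace K) (I : Type) (U : I -> set X)
    k (c : cochain X I k) : Prop :=
  forall s, vfield (meet U s) (c s).

Definition cobound (K : pzRingType) (X : fspace K) (I : Type) k
    (c : cochain X I k) : cochain X I k.+1 :=
  fun s f x => \sum_(j < k.+1) (-1) ^+ j * c (s \o lift j) f x.

(* H^p (X, T_X) = 0 for p >= 1, where H^p is the colimit of Cech cohomology over
   the finite open covers: every cocycle becomes a coboundary on a refinement.
   (Covers by finitely many open sets are cofinal since X is noetherian.) *)
Definition tangent_cohomology_vanishes (K : pzRingType) (X : fspace K) (p : nat) :
    Prop :=
  forall (I : finType) (U : I -> set X) (c : cochain X I p.+1),
    is_cover U -> is_cochain U c ->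
    (forall s, vfield_eq (meet U s) (cobound c s) (fun _ _ => 0)) ->
    exists (J : finType) (V : J -> set X) (t : J -> I) (b : cochain X J p),
      [/\ is_cover V, (forall j, V j `<=` U (t j)), is_cochain V b
        & forall s, vfield_eq (meet V s) (c (t \o s)) (cobound b s)].

(* A is a finite-dimensional local K-algebra with residue map aug : A -> K. *)
Record artin_local (K : comNzRingType) (A : comAlgType K)
    (aug : {rmorphism A -> K}) : Prop := ArtinLocal {
  al_aug : forall c, aug (c%:A) = c;
  al_fin : exists (d : nat) (v : 'I_d -> A),
    forall a, exists c : 'I_d -> K, a = \sum_i c i *: v i;
  al_nil : forall a, aug a = 0 -> exists k, a ^+ k = 0 }.

Definition opens (K : Type) (X : fspace K) : Type := {U : set X | opn U}.

Definition oset (K : Type) (X : fspace K) (U : opens X) : set X := sval U.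

(* A deformation of X over Spec A, as a sheaf of flat A-algebras dO on the space
   X together with an isomorphism of dO / m_A dO with the sheaf of X, given by
   the reduction map dred.  Flatness is the equational criterion, on stalks. *)
Record deformation (K : comNzRingType) (X : fspace K) (A : comAlgType K)
    (aug : {rmorphism A -> K}) := Deformation {
  dO : opens X -> comPzRingType;
  dres : forall U V : opens X, oset V `<=` oset U -> {rmorphism dO U -> dO V};
  dstr : forall U, {rmorphism A -> dO U};
  dred : forall U, dO U -> (X -> K);
  dres_id : forall U (h : oset U `<=` oset U) s, dres h s = s;
  dres_comp : forall U V W (h : oset V `<=` oset U) (h' : oset W `<=` oset V)
    (h'' : oset W `<=` oset U) s, dres h' (dres h s) = dres h'' s;
  dres_str : forall U V (h : oset V `<=` oset U) a, dres h (dstr U a) = dstr V a;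
  dsep : forall U (s t : dO U),
    (forall x, oset U x -> exists V (h : oset V `<=` oset U),
       oset V x /\ dres h s = dres h t) -> s = t;
  dglue : forall U (C : set (opens X)) (s : forall V, dO V),
    oset U = \bigcup_(V in C) oset V ->
    (forall V V' W (h : oset W `<=` oset V) (h' : oset W `<=` oset V'),
       C V -> C V' -> dres h (s V) = dres h' (s V')) ->
    exists t : dO U, forall V (h : oset V `<=` oset U), C V -> dres h t = s V;
  dred_reg : forall U s, reg (oset U) (@dred U s);
  dred_res : forall U V (h : oset V `<=` oset U) s,
    {in oset V, dred (dres h s) =1 dred s};
  dred_str : forall U a, {in oset U, forall x, dred (dstr U a) x = aug a};
  dred_add : forall U (s t : dO U),
    {in oset U, forall x, dred (s + t) x = dred s x + dred t x};
  dred_mul : forall U (s t : dO U),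
    {in oset U, forall x, dred (s * t) x = dred s x * dred t x};
  dred_surj : forall U f x, reg (oset U) f -> oset U x ->
    exists (V : opens X) (s : dO V),
      [/\ oset V x, oset V `<=` oset U & {in oset V, dred s =1 f}];
  dred_ker : forall U (s : dO U) x, {in oset U, dred s =1 (fun=> 0)} -> oset U x ->
    exists V (h : oset V `<=` oset U) k (a : 'I_k -> A) (t : 'I_k -> dO V),
      [/\ oset V x, (forall i, aug (a i) = 0)
        & dres h s = \sum_i dstr V (a i) * t i];
  dflat : forall U k (a : 'I_k -> A) (s : 'I_k -> dO U) x,
    \sum_i dstr U (a i) * s i = 0 -> oset U x ->
    exists V (h : oset V `<=` oset U) l (b : 'I_k -> 'I_l -> A) (t : 'I_l -> dO V),
      [/\ oset V x,
          (forall i, dres h (s i) = \sum_j dstr V (b i j) * t j)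
        & forall j, \sum_i a i * b i j = 0] }.

(* The functions U -> A in O_X(U) (x) A, the algebra of functions on the trivial
   deformation X x Spec A. *)
Definition areg (K : comNzRingType) (X : fspace K) (A : comAlgType K)
    (U : set X) : set (X -> A) :=
  [set F | exists d (v : 'I_d -> A) (f : 'I_d -> X -> K),
     (forall i, reg U (f i)) /\ {in U, forall x, F x = \sum_i f i x *: v i}].

(* An isomorphism phi of the deformation with X x Spec A, inducing the identity
   on X. *)
Definition trivial_deformation (K : comNzRingType) (X : fspace K)
    (A : comAlgType K) (aug : {rmorphism A -> K}) (d : deformation X aug) : Prop :=
  exists phi : forall U, dO d U -> (X -> A),
    (forall U s, areg (oset U) (phi U s)) /\
    (forall U F, areg (oset U) F -> exists s, {in oset U, phi U s =1 F}) /\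
    (forall U s t, {in oset U, phi U s =1 phi U t} -> s = t) /\
    (forall U s t, {in oset U, forall x, phi U (s + t) x = phi U s x + phi U t x}) /\
    (forall U s t, {in oset U, forall x, phi U (s * t) x = phi U s x * phi U t x}) /\
    (forall U a, {in oset U, forall x, phi U (dstr d U a) x = a}) /\
    (forall U V (h : oset V `<=` oset U) s,
       {in oset V, phi V (dres d h s) =1 phi U s}) /\
    (forall U s, {in oset U, forall x, aug (phi U s x) = dred s x}).

Definition locally_rigid (K : comNzRingType) (X : fspace K) : Prop :=
  forall (A : comAlgType K) (aug : {rmorphism A -> K}), artin_local aug ->
  forall d : deformation X aug, trivial_deformation d.

Record is_gcm n (a : 'M[int]_n) : Prop := IsGCM {
  gcm_diag : forall i, a i i = 2;
  gcm_off : forall i j, i != j -> a i j <= 0;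
  gcm_zero : forall i j, a i j = 0 -> a j i = 0 }.

(* An integral form of the minimal realization of a generalized Cartan matrix: the
   character lattice X(T) is Z^m, the cocharacter lattice its dual, and the rows
   of root and coroot are the simple roots and the simple coroots. *)
Record km_datum (n m : nat) := KMDatum {
  gcm : 'M[int]_n;
  root : 'M[int]_(n, m);
  coroot : 'M[int]_(n, m);
  kmd_gcm : is_gcm gcm;
  kmd_pairing : coroot *m root^T = gcm;
  kmd_root_free : row_free (map_mx intr root : 'M[rat]_(n, m));
  kmd_coroot_free : row_free (map_mx intr coroot : 'M[rat]_(n, m));
  kmd_rank : (m + \rank (map_mx intr gcm : 'M[rat]_n) = n + n)%N }.

Definition bracket (K : pzRingType) d (x y : 'M[K]_d) : 'M[K]_d := x *m y - y *m x.

(* The action of the k-th basis element of the cocharacter lattice on a module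
   with a basis of weight vectors, of weights wt. *)
Definition hmat (K : pzRingType) m d (wt : 'I_d -> 'rV[int]_m) (k : 'I_m) : 'M[K]_d :=
  diag_mx (\row_j (wt j 0 k)%:~R).

(* A finite-dimensional module, with a basis of weight vectors of weights in
   X(T), over the Borel subalgebra b of the Kac-Moody algebra.  The algebra b is
   presented by the Chevalley generators it contains and the relations between
   them. *)
Record bmod (K : numFieldType) n m (G : km_datum n m) (d : nat) := BMod {
  wt : 'I_d -> 'rV[int]_m;
  emat : 'I_n -> 'M[K]_d;
  bmod_he : forall k i, bracket (hmat K wt k) (emat i) = (root G i k)%:~R *: emat i;
  bmod_serre : forall i j, i != j ->
    iter `|1 - gcm G i j|%N (bracket (emat i)) (emat j) = 0 }.

(* The same for the minimal parabolic subalgebra p_a = b + C f_a. *)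
Record pmod (K : numFieldType) n m (G : km_datum n m) (a : 'I_n) (d : nat) := PMod {
  pmod_b :> bmod K G d;
  fmat : 'M[K]_d;
  pmod_hf : forall k, bracket (hmat K (wt pmod_b) k) fmat = - (root G a k)%:~R *: fmat;
  pmod_ef : forall i, bracket (emat pmod_b i) fmat =
    if i == a then \sum_k (coroot G a k)%:~R *: hmat K (wt pmod_b) k else 0 }.

Definition tens_action (K : comNzRingType) d e (x : 'M[K]_d) (y : 'M[K]_e) :
  'M[K]_(d * e) := x *t 1%:M + 1%:M *t y.

Definition bmod_hom (K : numFieldType) n m (G : km_datum n m) d e
    (r : bmod K G d) (s : bmod K G e) (F : 'M[K]_(e, d)) : Prop :=
  (forall k, F *m hmat K (wt r) k = hmat K (wt s) k *m F) /\
  (forall i, F *m emat r i = emat s i *m F).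

Definition bmod_tens (K : numFieldType) n m (G : km_datum n m) d e
    (r : bmod K G d) (s : bmod K G e) (t : bmod K G (d * e)) : Prop :=
  (forall k, hmat K (wt t) k = tens_action (hmat K (wt r) k) (hmat K (wt s) k)) /\
  (forall i, emat t i = tens_action (emat r i) (emat s i)).

Definition bmod_unit (K : numFieldType) n m (G : km_datum n m) (t : bmod K G 1) : Prop :=
  (forall k, hmat K (wt t) k = 0) /\ (forall i, emat t i = 0).

Definition pmod_hom (K : numFieldType) n m (G : km_datum n m) a d e
    (r : pmod K G a d) (s : pmod K G a e) (F : 'M[K]_(e, d)) : Prop :=
  bmod_hom r s F /\ F *m fmat r = fmat s *m F.

Definition pmod_tens (K : numFieldType) n m (G : km_datum n m) a d e
    (r : pmod K G a d) (s : pmod K G a e) (t : pmod K G a (d * e)) : Prop :=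
  bmod_tens r s t /\ fmat t = tens_action (fmat r) (fmat s).

Definition pmod_unit (K : numFieldType) n m (G : km_datum n m) a (t : pmod K G a 1) :
    Prop :=
  bmod_unit t /\ fmat t = 0.

(* Tensor automorphisms of the forgetful functor of a category of modules. *)
Record tensor_aut (K : numFieldType) (M : nat -> Type)
    (hom : forall d e, M d -> M e -> 'M[K]_(e, d) -> Prop)
    (tens : forall d e, M d -> M e -> M (d * e)%N -> Prop)
    (one : M 1 -> Prop) (g : forall d, M d -> 'M[K]_d) : Prop := TensorAut {
  ta_unit : forall d (r : M d), g d r \in unitmx;
  ta_nat : forall d e (r : M d) (s : M e) F, hom d e r s F ->
    F *m g d r = g e s *m F;
  ta_tens : forall d e (r : M d) (s : M e) t, tens d e r s t ->
    g (d * e)%N t = g d r *t g e s;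
  ta_one : forall t, one t -> g 1 t = 1%:M }.

Definition bfam (K : numFieldType) n m (G : km_datum n m) : Type :=
  forall d, bmod K G d -> 'M[K]_d.

(* The Borel subgroup B = T x| U and the minimal parabolic subgroup P_a of the
   Kac-Moody group are the (pro-algebraic) groups whose finite-dimensional
   representations are the modules above; an element is the family of matrices
   by which it acts on them. *)
Definition borel (K : numFieldType) n m (G : km_datum n m) : Type :=
  {g : bfam K G | tensor_aut (@bmod_hom K n m G) (@bmod_tens K n m G)
                    (@bmod_unit K n m G) g}.

Definition parab (K : numFieldType) n m (G : km_datum n m) (a : 'I_n) : Type :=
  {g : forall d, pmod K G a d -> 'M[K]_d |
     tensor_aut (@pmod_hom K n m G a) (@pmod_tens K n m G a) (@pmod_unit K n m G a) g}.

Definition parab_coef (K : numFieldType) n m (G : km_datum n m) (a : 'I_n)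
    d (r : pmod K G a d) (i j : 'I_d) (g : parab K G a) : K := sval g d r i j.

(* The value at t in T = (K^* )^m of the character mu. *)
Definition char_val (K : numFieldType) m (mu : 'rV[int]_m) (t : 'I_m -> K) : K :=
  \prod_k t k ^ mu 0 k.

Definition torus_elt (K : numFieldType) n m (G : km_datum n m) (t : 'I_m -> K) :
    bfam K G :=
  fun d r => diag_mx (\row_j char_val (wt r j) t).

Definition cochar (K : numFieldType) m (lam : 'rV[int]_m) (u : K) : 'I_m -> K :=
  fun k => u ^ lam 0 k.

(* Psi_u.  In a basis of weight vectors, b = t v with t in T diagonal and v in U
   strictly raising weights, so the projection of b to T is the diagonal part. *)
Definition Psi (K : numFieldType) n m (G : km_datum n m) (lam : 'rV[int]_m) (u : K)
    (b : bfam K G) : bfam K G :=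
  fun d r =>
    if u == 0 then diag_mx (\row_j b d r j j)
    else let l := torus_elt (cochar lam u) r in l *m b d r *m invmx l.

(* (y_1, ..., y_r) = (p_1 b_1, psi(b_1)^-1 p_2 b_2, ..., psi(b_{r-1})^-1 p_r b_r)
   where, with indices starting at 0, b_i is [b i]. *)
Definition twisted_orbit (K : numFieldType) n m (G : km_datum n m) r
    (w : r.-tuple 'I_n) (psi : bfam K G -> bfam K G)
    (p y : forall i, parab K G (tnth w i)) : Prop :=
  exists b : nat -> borel K G, forall (i : 'I_r) d (M : pmod K G (tnth w i) d),
    sval (y i) d M =
      (if val i is k.+1 then invmx (psi (sval (b k)) d M) else 1%:M)
        *m sval (p i) d M *m sval (b i) d M.

Definition parab_prod (K : numFieldType) n m (G : km_datum n m) r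
    (w : r.-tuple 'I_n) : fspace K :=
  zariski [set f : (forall i, parab K G (tnth w i)) -> K |
    exists i d (M : pmod K G (tnth w i) d) k l,
      f = (fun p => parab_coef M k l (p i))].

Definition bsdh (K : numFieldType) n m (G : km_datum n m) r (w : r.-tuple 'I_n) :
    fspace K :=
  @quotient K (parab_prod K G w) (twisted_orbit id).

Definition line_parab_prod (K : numFieldType) n m (G : km_datum n m) r
    (w : r.-tuple 'I_n) : fspace K :=
  zariski [set f : K * (forall i, parab K G (tnth w i)) -> K |
    f = fst \/ exists i d (M : pmod K G (tnth w i) d) k l,
      f = (fun p => parab_coef M k l (p.2 i))].

Definition family_orbit (K : numFieldType) n m (G : km_datum n m) r
    (w : r.-tuple 'I_n) (lam : 'rV[int]_m)
    (p y : K * (forall i, parab K G (tnth w i))) : Prop :=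
  p.1 = y.1 /\ twisted_orbit (Psi lam p.1) p.2 y.2.

Definition toric_family (K : numFieldType) n m (G : km_datum n m) r
    (w : r.-tuple 'I_n) (lam : 'rV[int]_m) : fspace K :=
  @quotient K (line_parab_prod K G w) (family_orbit lam).

Definition toric_limit (K : numFieldType) n m (G : km_datum n m) r
    (w : r.-tuple 'I_n) (lam : 'rV[int]_m) : fspace K :=
  @subspace K (toric_family K G w lam)
    [set c | exists p, c = quot_proj (family_orbit lam) (0, p)].

Definition degenerating (K : numFieldType) n m (G : km_datum n m)
    (lam : 'rV[int]_m) (q : nat) : Prop :=
  [/\ (0 < q)%N,
      (forall u v : K, u != 0 -> v != 0 -> cochar lam u =1 cochar lam v -> u = v)
    & forall (i : 'I_n) (u : K), u != 0 ->
        char_val (row i (root G)) (cochar lam u) = u ^+ q].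

Definition beta n m (G : km_datum n m) r (w : r.-tuple 'I_n) (i j : 'I_r) : int :=
  gcm G (tnth w i) (tnth w j).

Definition eta_pos n m (G : km_datum n m) r (w : r.-tuple 'I_n) (i : 'I_r) :
    {set 'I_r} := [set j : 'I_r | (i < j)%N && (0 < beta G w i j)].

Definition eta_neg n m (G : km_datum n m) r (w : r.-tuple 'I_n) (i : 'I_r) :
    {set 'I_r} := [set j : 'I_r | (i < j)%N && (beta G w i j < 0)].

Definition condition_I n m (G : km_datum n m) r (w : r.-tuple 'I_n) : Prop :=
  forall i : 'I_r,
    [/\ #|eta_pos G w i| = 0%N, (#|eta_neg G w i| <= 1)%N
      & forall l, eta_neg G w i = [set l]%SET -> beta G w i l = -1].

(* Main.v *)
(* Under condition I the letters of w are distinct and beta_ij is 0 or -1 for i < j, the value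
   -1 being taken for at most one j = l(i).  Both Z(w) and its toric limit then have the same
   atlas as a smooth toric variety, the Bott tower with e_i^- = - e_i^+ + e_l(i)^+: with s_+(x) =
   exp(x f) and s_-(x) = exp((x - 1) e) exp(f) representing the two charts of P_a / B = P^1,
   every orbit contains some (s_e1(x_1), ..., s_er(x_r)), and two such points are equivalent
   exactly when their homogeneous coordinates (x_i : 1) or (1 : x_i) are related by the torus
   of the Cox construction.  Indeed, as the letters are distinct, the element of B that is
   pushed through position i acts as an element of T on every module that matters later.

   Since B and P_a are only given by tensor automorphisms of their categories of modules, one
   must show that an element p of P_a fixing the base point of P_a / B comes from B.  For a
   B-module M and k large the sections over P_a / B of the bundle of M twisted by 2k form a
   P_a-module whose evaluation at the base point is onto M with a kernel that p preserves;
   the action of p on the quotient, suitably rescaled, is that of the element of B.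

   The tangent sheaf of a Bott tower is computed as a sheaf of derivations of the function
   field.  By Serre's argument on affine charts and a double complex, its Cech cohomology is
   that of the standard cover, which splits into weight spaces; each of these is contracted by
   a cone, or by a prism between two sign vectors.  Rigidity follows from H^1 = 0 by lifting
   the chart coordinates and correcting them successively along a flag of ideals of the
   Artin algebra. *)
Require Import Defs.
From HB Require Import structures.
From mathcomp Require Import all_boot all_order all_algebra finmap.
From mathcomp Require Import mxtens complex boolp classical_sets cardinality reals.
From mathcomp Require lebesgue_measure.
From mathcomp Require Import mpoly ring zify.
Set Implicit Arguments.
Unset Strict Implicit.
Unset Printing Implicit Defensive.

Import Order.TTheory GRing.Theory Num.Theory.
Local Open Scope classical_set_scope.
Local Open Scope ring_scope.

(** * Nullstellensatz over R[i] *)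

(** All functions and vector fields are read as elements and derivations of one function field,
    which is possible because the spaces are irreducible. Cech cochains then take values in a fixed
    vector space, open sets enter only through subgroups of it and restriction maps disappear; hence
    the exactness lemmas can be combinatorial statements about lists.

    An element of P_a is known only through its matrices, so its image in P_a / B must be read on a
    concrete module. The three-dimensional module [L2] serves for this: the last column of the
    matrix is a point of a conic, the image of P^1 in degree 2. Degree 2 and the even twists 2k are
    chosen because they involve multiples of the simple root only; odd ones would need a weight of
    pairing 1 with the coroot, which the given lattice may lack.

    The identity and the maps Psi_u share the properties collected in [twist_family], so that one
    computation of orbits yields the atlases of both varieties. *)

Lemma real_uncountable (R : realType) : ~ countable [set: R].
Proof.
move=> h; have : countable [set` `[0%R : R, 1%R]].
  by apply: sub_countable h; apply: subset_card_le.
move/lebesgue_measure.countable_lebesgue_measure0.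
rewrite lebesgue_measure.lebesgue_measure_itv /= constructive_ereal.lte_fin ltr01.
rewrite -constructive_ereal.EFinB subr0.
by move=> /(congr1 constructive_ereal.fine) /= /eqP; rewrite oner_eq0.
Qed.

(** A countable union of finite fibres would be countable. Together with algebraic closedness, this
    is what the ground field contributes to the Nullstellensatz below. *)
Lemma real_big_fiber (R : realType) (T : countType) (N : R -> T) :
  exists t, forall k, exists s : seq R,
    [/\ uniq s, size s = k & forall x, x \in s -> N x = t].
Proof.
have [t ht] : exists t, infinite_set [set x | N x = t].
  apply: contrapT => /forallNP h; apply: (@real_uncountable R).
  have -> : [set: R] = \bigcup_(t in [set: T]) [set x | N x = t].
    by rewrite predeqE => x; split=> // _; exists (N x).
  apply: bigcup_countable => // t _; apply: finite_set_countable.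
  exact: contrapT (h t).
exists t => k; have [B BN kB] := infinite_set_fset k ht.
exists (take k (enum_fset B)); split.
- exact/take_uniq/fset_uniq.
- by rewrite size_take_min; apply/minn_idPl.
- by move=> x /mem_take xB; apply: BN.
Qed.

Lemma mpoly_gen_ind n (K : nzRingType) (P : {mpoly K[n]} -> Prop) :
  (forall c, P c%:MP) -> (forall i, P 'X_i) -> (forall p q, P p -> P q -> P (p + q)) ->
  (forall p q, P p -> P q -> P (p * q)) -> forall p, P p.
Proof.
move=> PC PX PD PM; elim/mpolyind => [|c m p _ _ IH]; first by rewrite -mpolyC0.
apply: (PD) => //; rewrite -mul_mpolyC; apply: (PM) => //; rewrite mpolyXE_id.
elim/big_ind : _ => [|p1 p2|i _]; [by rewrite -mpolyC1|exact: PM|].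
by elim: (m i) => [|k IHk]; rewrite ?expr0 -?mpolyC1 // exprS; apply: (PM).
Qed.

Section Null.
Variables (R : realType) (n : nat).
Local Notation K := R[i].
Local Notation P := {mpoly K[n]}.

Record ideal (I : set P) : Prop := Ideal {
  ideal0 : I 0;
  idealD : forall p q, I p -> I q -> I (p + q);
  idealM : forall p q, I q -> I (p * q) }.

Definition add_gen (I : set P) (t : P) : set P := [set p | exists r, I (p - t * r)].

Lemma add_gen_ideal I t : ideal I -> ideal (add_gen I t).
Proof.
move=> [I0 ID IM]; split.
- by exists 0; rewrite mulr0 subr0.
- move=> p q [r hr] [s hs]; exists (r + s).
  by rewrite mulrDr opprD addrACA; apply: ID.
- move=> p q [r hr]; exists (p * r).
  by rewrite mulrCA -mulrBr; apply: IM.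
Qed.

Lemma lin_dep (s : nat) (m : nat) (f : 'I_m -> P) :
  (forall i, msize (f i) <= s)%N -> (#|{: 'X_{1..n < s}}| < m)%N ->
  exists v : 'I_m -> K, (exists i, v i != 0) /\ \sum_i v i *: f i = 0.
Proof.
move=> hs hm.
pose d := #|{: 'X_{1..n < s}}|.
pose M : 'M[K]_(m, d) := \matrix_(i, j) (f i)@_(enum_val j : 'X_{1..n < s}).
have [i hi] : exists i, row i (kermx M) != 0.
  apply/existsP; rewrite -negb_forall; apply: contraL hm => /forallP h.
  have k0 : kermx M == 0.
    by apply/eqP/row_matrixP => i; rewrite row0; apply/eqP.
  by rewrite -leqNgt -/d; move: k0; rewrite kermx_eq0 => /eqP <-; apply: rank_leq_col.
pose v := row i (kermx M).
have vM : v *m M = 0 by rewrite -row_mul mulmx_ker row0.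
exists (v 0); split.
  by case/rV0Pn: hi => j hj; exists j.
apply/mpolyP => mm; rewrite mcoeff0 raddf_sum /=.
under eq_bigr do rewrite mcoeffZ.
have [hmm|hmm] := ltnP (mdeg mm) s.
  have /rowP/(_ (enum_rank (BMultinom hmm))) := vM.
  rewrite !mxE => h; rewrite -[RHS]h; apply: eq_bigr => j _.
  by rewrite [M _ _]mxE enum_rankK.
rewrite big1 // => j _; rewrite memN_msupp_eq0 ?mulr0 //.
by apply: contraL hmm => /msize_mdeg_lt hh; rewrite -ltnNge (leq_trans hh).
Qed.

(** If every [a] failed, each would give a relation g^k = (t - a) r modulo [I]. Uncountably many [a]
    share the exponent k and the size of r, so some of these r are linearly dependent. Clearing the
    factors t - a then puts g^k Q(t) in [I] for a nonzero polynomial Q in one variable, whose linear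
    factors can be removed one at a time. *)
Lemma null_step I g t : ideal I -> (forall k, ~ I (g ^+ k)) ->
  exists a : K, forall k, ~ add_gen I (t - a%:MP) (g ^+ k).
Proof.
move=> II hg; apply: contrapT => /forallNP h.
have {h}/choice[kr hkr] : forall a : K, exists kr : nat * P,
    I (g ^+ kr.1 - (t - a%:MP) * kr.2).
  move=> a; have /existsNP[k /contrapT[r hr]] := h a.
  by exists (k, r).
(* A factor t - b can be traded for a power of [g], since some power of [g] is a multiple of t - b
   modulo [I]. *)
have kill (bs : seq K) : forall k, ~ I (g ^+ k * \prod_(b <- bs) (t - b%:MP)).
  elim: bs => [|b bs IH] k; first by rewrite big_nil mulr1.
  rewrite big_cons => hI; apply: (IH (k + (kr b).1)%N).
  have -> : g ^+ (k + (kr b).1) * \prod_(j <- bs) (t - j%:MP) =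
     (g ^+ k * \prod_(j <- bs) (t - j%:MP)) * (g ^+ (kr b).1 - (t - b%:MP) * (kr b).2)
     + (kr b).2 * (g ^+ k * ((t - b%:MP) * \prod_(j <- bs) (t - j%:MP))).
    rewrite exprD; ring.
  by apply: (idealD II); apply: (idealM II).
have [[k s] fib] := @real_big_fiber R (nat * nat)%type
   (fun x => ((kr x%:C%C).1, msize (kr x%:C%C).2)).
pose D := #|{: 'X_{1..n < s}}|.
have [l [ul sl hl]] := fib D.+1.
pose a (i : 'I_D.+1) : K := (nth 0 l i)%:C%C.
have ainj : injective a.
  by move=> i j [] /eqP; rewrite nth_uniq ?sl // => /eqP; exact: val_inj.
have ha i : (kr (a i)).1 = k /\ msize (kr (a i)).2 = s.
  by have /hl[-> ->] : nth 0 l i \in l by rewrite mem_nth ?sl.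
have [v [[i0 vi0] hv]] := @lin_dep s D.+1 (fun i => (kr (a i)).2)
  (fun i => eq_leq (ha i).2) (ltnSn _).
pose Q : {poly K} := \sum_i v i *: \prod_(j | j != i) ('X - (a j)%:P).
(* At [a i0] only the term of index [i0] survives. *)
have Q0 : Q != 0.
  apply/eqP => /(congr1 (fun q => q.[a i0])) /eqP.
  rewrite horner0 horner_sum (bigD1 i0) //= [X in _ + X]big1 ?addr0.
    rewrite hornerZ horner_prod mulf_eq0 (negPf vi0) /= prodf_seq_eq0.
    move=> /hasP[j _ /andP[ji]]; rewrite hornerXsubC subr_eq0 => /eqP/ainj e.
    by rewrite e eqxx in ji.
  move=> i ii0; rewrite hornerZ horner_prod (bigD1 i0) /= 1?eq_sym //.
  by rewrite hornerXsubC subrr mul0r mulr0.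
pose ev (q : {poly K}) : P := (map_poly (@mpolyC n K) q).[t].
have evM p q : ev (p * q) = ev p * ev q by rewrite /ev rmorphM hornerM.
have ev1 : ev 1 = 1 by rewrite /ev rmorph1 hornerC.
have evX b : ev ('X - b%:P) = t - b%:MP.
  by rewrite /ev rmorphB /= map_polyX map_polyC /= hornerXsubC.
have evP (J : Type) (r : seq J) (p : pred J) (b : J -> K) :
   ev (\prod_(j <- r | p j) ('X - (b j)%:P)) = \prod_(j <- r | p j) (t - (b j)%:MP).
  by rewrite (big_morph ev evM ev1); apply: eq_bigr => j _; rewrite evX.
have [bs Qbs] := closed_field_poly_normal Q.
apply: (kill bs k).
have -> : g ^+ k * \prod_(b <- bs) (t - b%:MP) =
    (lead_coef Q)^-1%:MP * (g ^+ k * ev Q).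
  rewrite [in ev Q]Qbs -mul_polyC evM evP /ev map_polyC hornerC /= mulrCA.
  by congr (_ * _); rewrite mulrA -mpolyCM mulVf ?lead_coef_eq0 // mpolyC1 mul1r.
apply: (idealM II).
have -> : g ^+ k * ev Q = \sum_i ((v i)%:MP * \prod_(j | j != i) (t - (a j)%:MP)) *
   (g ^+ k - (t - (a i)%:MP) * (kr (a i)).2).
  under [RHS]eq_bigr do rewrite mulrBr.
  rewrite sumrB [X in _ - X](_ : _ = 0) ?subr0.
    rewrite /ev raddf_sum /= horner_sum mulr_sumr; apply: eq_bigr => i _.
    rewrite mulrC; congr (_ * _); rewrite -mul_polyC.
    by rewrite -[LHS]/(ev (_ * _)) evM evP /ev map_polyC hornerC.
  transitivity ((\prod_j (t - (a j)%:MP)) * \sum_i v i *: (kr (a i)).2); last first.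
    by rewrite hv mulr0.
  rewrite mulr_sumr.
  apply: eq_bigr => i _; rewrite [in RHS](bigD1 i) //= -mul_mpolyC.
  ring.
elim/big_ind : _ => [|p q|i _]; [exact: ideal0|exact: idealD|].
by apply: (idealM II); have := hkr (a i); rewrite (ha i).1.
Qed.

(** Fixing the coordinates one after the other by [null_step] gives an ideal J above [I] that
    contains all X_i - a_i and no power of [g]. Modulo J every polynomial equals its value at [a],
    so [a] is a zero of [I]; but g(a) = 0 would put [g] in J. *)
Theorem nullstellensatz (I : set P) g : ideal I ->
  (forall x : 'I_n -> K, (forall p, I p -> p.@[x] = 0) -> g.@[x] = 0) ->
  exists k, I (g ^+ k).
Proof.
move=> II hz; apply: contrapT => /forallNP hg.
have step m : (m <= n)%N -> exists (a : 'I_n -> K) (J : set P), [/\ ideal J,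
    I `<=` J, forall k, ~ J (g ^+ k)
  & forall i : 'I_n, (i < m)%N -> J ('X_i - (a i)%:MP)].
  elim: m => [|m IH] hm; first by exists (fun=> 0), I; split.
  have [a [J [iJ IJ hJ aJ]]] := IH (ltnW hm).
  have [b hb] := null_step 'X_(Ordinal hm) iJ hJ.
  exists (fun i => if i == Ordinal hm then b else a i), (add_gen J ('X_(Ordinal hm) - b%:MP)).
  split=> //; first exact: add_gen_ideal.
    by move=> p /IJ Jp; exists 0; rewrite mulr0 subr0.
  move=> i; case: eqP => [-> _|/eqP ni].
    by exists 1; rewrite mulr1 subrr; apply: ideal0.
  rewrite ltnS leq_eqVlt => /orP[/eqP e|/aJ h].
    by case/eqP: ni; apply: val_inj.
  by exists 0; rewrite mulr0 subr0.
have [a [J [iJ IJ hJ aJ]]] := step n (leqnn n).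
have cong p : J (p - p.@[a]%:MP).
  elim/mpoly_gen_ind : p => [c|i|p q hp hq|p q hp hq].
  - by rewrite mevalC subrr; apply: ideal0.
  - by rewrite mevalXU; apply: aJ.
  - by rewrite mevalD mpolyCD opprD addrACA; apply: idealD.
  - rewrite mevalM mpolyCM.
    have -> : p * q - p.@[a]%:MP * q.@[a]%:MP =
        q * (p - p.@[a]%:MP) + p.@[a]%:MP * (q - q.@[a]%:MP) by ring.
    by apply: (idealD iJ); apply: (idealM iJ).
have z p : I p -> p.@[a] = 0.
  move=> /IJ Jp; apply/eqP; apply: contrapT => /negP pa.
  apply: (hJ 0%N); rewrite expr0.
  have -> : 1 = (p.@[a]^-1)%:MP * p - (p.@[a]^-1)%:MP * (p - p.@[a]%:MP).
    by rewrite mulrBr opprB addrC subrK -mpolyCM mulVf.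
  rewrite -mulrN; apply: (idealD iJ); first exact: (idealM iJ).
  by rewrite mulrN -mulNr; apply: (idealM iJ).
apply: (hJ 1%N); rewrite expr1; have := cong g.
by rewrite (hz _ z) mpolyC0 subr0.
Qed.
End Null.

(** * Cech cochains indexed by lists *)

Section ListCech.
Variable E : zmodType.

(** The alternating sum of the values of [c] on the list with one entry deleted. With cochains
    indexed by lists, this recursion absorbs all signs and index shifts. *)
Fixpoint dif (J : Type) (c : seq J -> E) (s : seq J) : E :=
  if s is x :: s' then c s' - dif (fun t => c (x :: t)) s' else 0.

Definition subgroup (P : set E) := P 0 /\ forall x y, P x -> P y -> P (x - y).

Lemma subgroupN P x : subgroup P -> P x -> P (- x).
Proof. by case=> P0 PB Px; rewrite -sub0r; apply: PB. Qed.

Lemma subgroupD P x y : subgroup P -> P x -> P y -> P (x + y).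
Proof. by move=> sP Px Py; rewrite -[y]opprK; apply: sP.2 => //; apply: subgroupN. Qed.

Section OneDirection.
Variable J : eqType.
Implicit Types (c b : seq J -> E) (s t : seq J) (F : seq J -> set E).

Lemma dif_eq k c c' s : size s = k.+1 ->
  (forall t, size t = k -> {subset t <= s} -> c t = c' t) -> dif c s = dif c' s.
Proof.
elim: s k c c' => [|x s IH] [|k] c c' //= [ks] h.
  by move/size0nil: ks => ->; rewrite /= h.
rewrite h //; last by move=> y ys; rewrite inE ys orbT.
congr (_ - _); apply: (IH k) => // t kt ts; apply: h; first by rewrite /= kt.
by move=> y; rewrite !inE => /orP[->//|/ts ->]; rewrite orbT.
Qed.

Lemma difB c c' s : dif (fun t => c t - c' t) s = dif c s - dif c' s.
Proof.
elim: s c c' => [|x s IH] c c' /=; first by rewrite subr0.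
by rewrite IH !opprD !opprK addrACA.
Qed.

Lemma dif_cst0 s : dif (fun=> 0) s = 0.
Proof. by elim: s => //= x s ->; rewrite subrr. Qed.

Lemma dif_dif c s : dif (dif c) s = 0.
Proof.
elim: s c => [|x s IH] c //=.
by rewrite difB IH subr0 subrr.
Qed.

Lemma dif_in (P : set E) k c s : subgroup P -> size s = k.+1 ->
  (forall t, size t = k -> {subset t <= s} -> P (c t)) -> P (dif c s).
Proof.
move=> sP; elim: s k c => [|x s IH] [|k] c //= [ks] h.
  move/size0nil: ks => ->; rewrite /= subr0; exact: h.
apply: sP.2; first by apply: h => // y ys; rewrite inE ys orbT.
apply: (IH k) => // t kt ts; apply: h; first by rewrite /= kt.
by move=> y; rewrite !inE => /orP[->//|/ts ->]; rewrite orbT.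
Qed.

(** [F s] stands for the sections over the intersection of the open sets indexed by [s], all inside
    the ambient group [E]; restrictions are inclusions and stay invisible. *)
Definition cocycle F k c := (forall s, size s = k -> F s (c s)) /\
  (forall s, size s = k.+1 -> dif c s = 0).

Definition exact_at F k := forall c, cocycle F k.+1 c ->
  exists b, (forall s, size s = k -> F s (b s)) /\
            forall s, size s = k.+1 -> dif b s = c s.

(** The hypothesis says that intersecting with the open set of index [x] creates no new sections, so
    [c (x :: s)] is already a primitive. *)
Lemma cone_exact F k x : (forall s e, F (x :: s) e -> F s e) -> exact_at F k.
Proof.
move=> hF c [cF c0]; exists (fun s => c (x :: s)); split=> [s ks|s ks].
  by apply: hF; apply: cF; rewrite /= ks.
by have /eqP := c0 (x :: s) (congr1 S ks); rewrite /= subr_eq0 => /eqP.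
Qed.

(* The homotopy between the identity and the map induced by [f] on indices. *)
Fixpoint prism (f : J -> J) c s : E :=
  if s is x :: s' then c (x :: map f s) - prism f (fun t => c (x :: t)) s' else 0.

Lemma prismB f c c' s : prism f (fun t => c t - c' t) s = prism f c s - prism f c' s.
Proof.
elim: s c c' => [|x s IH] c c' /=; first by rewrite subr0.
by rewrite IH !opprD !opprK addrACA.
Qed.

Lemma dif_map f c s : dif c (map f s) = dif (fun t => c (map f t)) s.
Proof. by elim: s c => //= x s IH c; rewrite IH. Qed.

Lemma dif_prism f c s :
  dif (prism f c) s + prism f (dif c) s = c (map f s) - c s.
Proof.
elim: s c => [|x s IH] c /=; first by rewrite addr0 subrr.
rewrite difB prismB.
have -> : prism f (fun t => dif (fun u => c (x :: u)) t) s =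
  c (x :: map f s) - c (x :: s) - dif (prism f (fun t => c (x :: t))) s.
  by rewrite -(IH (fun t => c (x :: t))) addrC addKr.
rewrite (dif_map f (fun t => c (x :: f x :: t))).
rewrite !opprB !addrA.
rewrite [LHS](ACl ((4*8)*(1*10)*(2*9)*(3*5)*(6*7))%AC) /=.
by rewrite !subrr !addNr !addr0.
Qed.

Lemma prism_in f F k c : (forall s, size s = k.+1 -> F s (c s)) ->
  (forall s, size s = k -> subgroup (F s)) ->
  (forall s1 x s2 e, F (s1 ++ x :: map f (x :: s2)) e -> F (s1 ++ x :: s2) e) ->
  forall s, size s = k -> F s (prism f c s).
Proof.
move=> cF sF hF.
(* The recursion of [prism] moves entries of the list into the argument of [c]; the induction
   therefore carries the prefix [u] already passed. *)
have H u s : (size (u ++ s) = k) ->  F (u ++ s) (prism f (fun t => c (u ++ t)) s).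
  elim: s u => [|x s IH] u ks /=; first exact: (sF _ ks).1.
  apply: (sF _ ks).2.
    apply: hF; apply: cF; move: ks; rewrite !size_cat /= size_map; lia.
  have := IH (rcons u x); rewrite cat_rcons => /(_ ks).
  by under [X in prism f X]eq_fun do rewrite cat_rcons.
by move=> s; apply: (H [::]).
Qed.

(** When the sections over the indices moved by [f] vanish, the map induced by [f] is zero and the
    prism is, up to sign, a contracting homotopy. *)
Lemma prism_exact f F k :
  (forall s, size s = k -> subgroup (F s)) ->
  (forall s1 x s2 e, F (s1 ++ x :: map f (x :: s2)) e -> F (s1 ++ x :: s2) e) ->
  (forall s e, size s = k.+1 -> F (map f s) e -> e = 0) -> exact_at F k.
Proof.
move=> sF hF h0 c [cF c0]; exists (fun s => - prism f c s); split.
  by move=> s ks; apply: subgroupN; [exact: sF|exact: (prism_in cF sF hF)].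
move=> s ks.
have difN b u : dif (fun t => - b t) u = - dif b u.
  rewrite -[RHS]sub0r -{1}(dif_cst0 u) -difB.
  by congr dif; apply/funext => v; rewrite sub0r.
have p0 : prism f (dif c) s = 0.
  have H u v : (size (u ++ v) = k.+1)%N ->
      prism f (fun t => dif c (u ++ t)) v = 0.
    elim: v u => [|x v IH] u kuv //=.
    rewrite c0 ?sub0r; last by move: kuv; rewrite !size_cat /= size_map; lia.
    have := IH (rcons u x); rewrite cat_rcons => /(_ kuv).
    by under [X in prism f X]eq_fun do rewrite cat_rcons; move=> ->; rewrite oppr0.
  exact: (H [::]).
have /eqP := dif_prism f c s; rewrite p0 addr0.
have -> : c (map f s) = 0.
  by apply: (h0 s) => //; apply: cF; rewrite size_map.
by rewrite difN sub0r => /eqP ->; rewrite opprK.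
Qed.

End OneDirection.

Lemma difC (I J : eqType) (z : seq I -> seq J -> E) u s :
  dif (fun u' => dif (z u') s) u = dif (fun s' => dif (fun u' => z u' s') u) s.
Proof.
elim: u z => [|x u IH] z /=; first by rewrite dif_cst0.
by rewrite (IH (fun t => z (x :: t))) -difB.
Qed.

(* Comparison of the Cech complexes of two covers through their double complex. *)
Section DoubleComplex.
Variables (I J : eqType) (i0 : I) (j0 : J) (G : seq I -> seq J -> set E).
Hypothesis sG : forall u s, subgroup (G u s).
Hypothesis mG : forall u u' s s', {subset u <= u'} -> {subset s <= s'} ->
  G u s `<=` G u' s'.
Hypothesis glueG : forall s e, (forall i, G [:: i] s e) -> G [::] s e.
Hypothesis exW : forall u k, (0 < size u)%N -> exact_at (G u) k.
Hypothesis exV : forall s k, (0 < k)%N -> exact_at (G^~ s) k.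

Lemma exW_choice k q (z : seq I -> seq J -> E) : (0 < q)%N ->
  (forall u s, size u = q -> size s = k.+1 -> G u s (z u s)) ->
  (forall u s, size u = q -> size s = k.+2 -> dif (z u) s = 0) ->
  exists a : seq I -> seq J -> E, forall u, size u = q ->
    (forall s, size s = k -> G u s (a u s)) /\
    (forall s, size s = k.+1 -> dif (a u) s = z u s).
Proof.
move=> q0 zG zW.
suff /choice[a ha] u : exists b : seq J -> E, size u = q ->
    (forall s, size s = k -> G u s (b s)) /\
    (forall s, size s = k.+1 -> dif b s = z u s) by exists a.
have [qu|nqu] := EM (size u = q); last by exists (z u).
have u0 : (0 < size u)%N by rewrite qu.
have [|b [bG bz]] := exW u0 (k := k) (c := z u); last by exists b.
by split=> s ks; [exact: zG|exact: zW].
Qed.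

(** Lift [z] along the second index to [a]. The first differential [e] of [a] is closed in both
    directions and one step lower, so by induction it lifts to some [b'] closed in the first
    direction, which is there the differential of some [f]. Then [a] minus the second differential
    of [f] lifts [z] and is closed in the first direction. *)
Lemma zigzag k q (z : seq I -> seq J -> E) : (1 < q + k)%N -> (0 < q)%N ->
  (forall u s, size u = q -> size s = k.+1 -> G u s (z u s)) ->
  (forall u s, size u = q -> size s = k.+2 -> dif (z u) s = 0) ->
  (forall u s, size u = q.+1 -> size s = k.+1 -> dif (z^~ s) u = 0) ->
  exists b : seq I -> seq J -> E,
  [/\ forall u s, size u = q -> size s = k -> G u s (b u s),
      forall u s, size u = q -> size s = k.+1 -> dif (b u) s = z u s
    & forall u s, size u = q.+1 -> size s = k -> dif (b^~ s) u = 0].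
Proof.
elim: k q z => [|k IH] q z qk q0 zG zW zV.
  have [a ha] := exW_choice q0 zG zW.
  exists a; split.
  - by move=> u s qu; apply: (ha u qu).1.
  - by move=> u s qu; apply: (ha u qu).2.
  - move=> u s qu /size0nil ->.
    (* On a one-element list the differential returns the value at the empty list, so closedness of
       [z] passes to [a]. *)
    have := @difC I J a u [:: j0]; rewrite /= subr0 => <-.
    rewrite -[RHS](zV u [:: j0]) //; apply: dif_eq qu _ => t qt _.
    by rewrite -(ha t qt).2.
have [a ha] := exW_choice q0 zG zW.
pose e u s := dif (a^~ s) u.
have eG u s : size u = q.+1 -> size s = k.+1 -> G u s (e u s).
  move=> qu ks; apply: (dif_in (sG u s) qu) => t qt tu.
  by apply: (@mG t u s s) => //; apply: (ha t qt).1.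
have eW u s : size u = q.+1 -> size s = k.+2 -> dif (e u) s = 0.
  move=> qu ks; rewrite /e -difC -[RHS](zV u s) //.
  by apply: dif_eq qu _ => t qt _; apply: (ha t qt).2.
have eV u s : size u = q.+2 -> size s = k.+1 -> dif (e^~ s) u = 0.
  by move=> _ _; rewrite /e (dif_dif (a^~ s)).
have [||b' [bG bW bV]] := IH q.+1 e _ _ eG eW eV; rewrite ?addSnnS //.
have [f hf] : exists f : seq J -> seq I -> E, forall s, size s = k ->
    (forall u, size u = q -> G u s (f s u)) /\
    (forall u, size u = q.+1 -> dif (f s) u = b' u s).
  suff /choice[f hf] s : exists f : seq I -> E, size s = k ->
    (forall u, size u = q -> G u s (f u)) /\
    (forall u, size u = q.+1 -> dif f u = b' u s) by exists f.
  have [ks|nks] := EM (size s = k); last by exists (b'^~ s).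
  have [|f [fG fb]] := @exV s q q0 (b'^~ s); last by exists f.
  by split=> u qu; [exact: bG|exact: bV].
exists (fun u s => a u s - dif (f^~ u) s); split=> u s qu ks.
- apply: (sG u s).2; first exact: (ha u qu).1.
  apply: (dif_in (sG u s) ks) => t kt ts.
  by apply: (@mG u u t s) => //; apply: (hf t kt).1.
- by rewrite difB (dif_dif (f^~ u)) subr0; apply: (ha u qu).2.
- rewrite (difB (a^~ s)) -[dif (a^~ s) u]/(e u s).
  rewrite (difC (fun u s => f s u)) -(bW u s) //; apply/eqP; rewrite subr_eq0.
  by apply/eqP; apply: dif_eq ks _ => t kt _; rewrite (hf t kt).2.
Qed.

(** The cocycle is regarded as constant in the first index. The primitive given by the zigzag is
    closed in that index, hence independent of it, and glues. *)
Theorem exact_of_double k : (0 < k)%N -> exact_at (G [::]) k.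
Proof.
move=> k0 c [cG c0].
have [//|//||||b [bG bW bV]] := @zigzag k 1 (fun _ s => c s).
- by move=> u s _ /cG; apply: mG.
- by move=> u s _; apply: c0.
- by move=> [|x [|y []]] //= s _ _; rewrite !subr0 subrr.
have bE s x y : size s = k -> b [:: x] s = b [:: y] s.
  by move=> ks; have /eqP := bV [:: x; y] s erefl ks; rewrite /= subr0 subr_eq0 => /eqP.
exists (b [:: i0]); split=> s ks; last exact: bW.
by apply: glueG => i; rewrite (bE _ _ i ks); apply: bG.
Qed.

End DoubleComplex.
End ListCech.

(** * Bott towers in Cox coordinates *)

(** Used for the torus element of a change of charts, each entry of which depends on earlier entries
    only. *)
Lemma triangular_rec r (T : Type) (t0 : T) (H : 'I_r -> ('I_r -> T) -> T) :
  (forall (i : 'I_r) f g, (forall k : 'I_r, (k < i)%N -> f k = g k) -> H i f = H i g) ->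
  exists f, forall i, f i = H i f.
Proof.
move=> hH; suff /(_ r (leqnn r))[f hf] : forall m, (m <= r)%N ->
    exists f, forall i : 'I_r, (i < m)%N -> f i = H i f.
  by exists f => i; apply: hf.
elim=> [|m IH] hm; first by exists (fun=> t0).
have [f hf] := IH (ltnW hm).
exists (fun i => if i == Ordinal hm then H i f else f i) => i.
rewrite ltnS leq_eqVlt; have [-> _|ni /orP[/eqP e|im]] := eqVneq i (Ordinal hm).
- apply: hH => k /=; case: eqP => [->|//]; by rewrite ltnn.
- by case/eqP: ni; apply: val_inj.
- rewrite hf //; apply: hH => k ki; case: eqP => // e.
  by move: ki; rewrite e /= ltnNge ltnW.
Qed.

Section Cox.
Variables (r : nat) (nx : rel 'I_r).
Hypothesis nx_lt : forall k i, nx k i -> (k < i)%N.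

Definition signs := {ffun 'I_r -> bool}.

Definition plus : signs := [ffun=> true].

Section Field.
Variable L : fieldType.
Implicit Types (a x mu lam : 'I_r -> L) (e : signs).

(* In the chart [e] the Cox coordinates (y_i, z_i) of a point are (a_i, 1) or (1, a_i). *)
Definition ycox e a i := if e i then a i else 1.
Definition zcox e a i := if e i then 1 else a i.

(** The Cox torus acts on z_i with weight lam_i and on y_i with weight lam_i divided by the product
    of the lam_k with [nx k i]; the division has been cleared. *)
Definition cox_rel e a e' a' lam := forall i,
  [/\ lam i != 0, zcox e' a' i = lam i * zcox e a i
    & ycox e' a' i * \prod_(k | nx k i) lam k = lam i * ycox e a i].

(** The coordinate that must become 1 in the chart [e'] determines [lam i] from the earlier entries.
    That coordinate is nonzero by assumption where the two charts differ and equals 1 where they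
    agree. *)
Lemma cox_change e a e' : (forall i, e i != e' i -> a i != 0) ->
  exists a' lam, cox_rel e a e' a' lam.
Proof.
move=> a0; have [|lam hlam] := @triangular_rec r L 0 (fun i f =>
    if e' i then (zcox e a i)^-1 else (\prod_(k | nx k i) f k) / ycox e a i).
  by move=> i f g fg; congr (if _ then _ else _ / _); apply: eq_bigr => k /nx_lt/fg.
have zy0 i : (if e' i then zcox e a i else ycox e a i) != 0.
  by rewrite /zcox /ycox; case: ifP => ei'; case: ifP => ei;
     rewrite ?oner_neq0 ?a0 // ei ei'.
have lam0 j : lam j != 0.
  elim: {j}(j : nat).+1 {-2}j (ltnSn j) => // m IH j hj; rewrite hlam.
  have := zy0 j; case: ifP => _ zj; rewrite ?invr_eq0 // mulf_neq0 ?invr_eq0 //.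
  by apply/prodf_neq0 => k /nx_lt kj; apply: IH; lia.
have p0 i : \prod_(k | nx k i) lam k != 0 by apply/prodf_neq0.
exists (fun i => if e' i then lam i * ycox e a i / \prod_(k | nx k i) lam k
   else lam i * zcox e a i), lam => i.
have := zy0 i; rewrite [zcox e' _ _]/zcox [ycox e' _ _]/ycox; case: ifP => ei' zy.
  by split; [exact: lam0 | rewrite hlam ei' mulVf | rewrite divfK].
by split; [exact: lam0 | | rewrite mul1r [in RHS]hlam ei' divfK].
Qed.

Lemma cox_from_base e x : (forall i, x i != 0) ->
  exists a mu, cox_rel plus x e a mu.
Proof. by move=> x0; apply: cox_change. Qed.

Lemma cox_relV e a e' a' lam : cox_rel e a e' a' lam ->
  cox_rel e' a' e a (fun i => (lam i)^-1).
Proof.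
move=> h i; have [l0 hz hy] := h i.
have p0 : \prod_(k | nx k i) lam k != 0 by apply/prodf_neq0 => k _; case: (h k).
split; first by rewrite invr_eq0.
  by rewrite hz mulKf.
rewrite prodfV; apply: (mulfI l0); rewrite mulrA -hy mulVKf //.
by rewrite mulfK.
Qed.

Lemma cox_rel_neq0 e a e' a' lam i : cox_rel e a e' a' lam -> e i != e' i -> a' i != 0.
Proof.
move=> h; have [l0] := h i; rewrite /zcox /ycox.
case: (e i); case: (e' i) => // + + _; first by rewrite mulr1 => -> _.
by rewrite mulr1 => _ h2; apply: contraNneq l0 => ai; rewrite -h2 ai mul0r.
Qed.

Lemma cox_to_base e a : (forall i, a i != 0) ->
  exists x mu, (forall i, x i != 0) /\ cox_rel plus x e a mu.
Proof.
move=> a0; have [|x [mu h]] := @cox_change e a plus; first by move=> i _.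
exists x, (fun i => (mu i)^-1); split; last exact: cox_relV.
move=> i; have [m0 _] := h i; rewrite {1}/ycox /plus ffunE => hx.
have y0 : ycox e a i != 0 by rewrite /ycox; case: ifP; rewrite ?oner_neq0.
by apply: contraNneq (mulf_neq0 m0 y0) => x0; rewrite -hx x0 mul0r.
Qed.

Lemma cox_relM e a e' a' e'' a'' lam mu :
  cox_rel e a e' a' lam -> cox_rel e' a' e'' a'' mu ->
  cox_rel e a e'' a'' (fun i => mu i * lam i).
Proof.
move=> h h' i; have [l0 hz hy] := h i; have [m0 hz' hy'] := h' i.
split; first exact: mulf_neq0.
  by rewrite hz' hz mulrA.
by rewrite big_split /= mulrA hy' -mulrA hy mulrA.
Qed.

End Field.

(** * Chart coordinates as rational functions *)

Section Generic.
Variable K : fieldType.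
Local Notation P := {mpoly K[r]}.
Variables (F : fieldType) (tofrac : {rmorphism P -> F}).
Hypothesis tofrac_inj : injective tofrac.

Lemma embed_eq0 p : (tofrac p == 0) = (p == 0).
Proof. by rewrite -(inj_eq tofrac_inj) rmorph0. Qed.

Definition genx (i : 'I_r) : F := tofrac 'X_i.

Lemma genx_neq0 i : genx i != 0.
Proof.
rewrite /genx embed_eq0; apply/eqP => /(congr1 (fun p : P => p@_U_(i)%MM)).
by rewrite mcoeffX eqxx mcoeff0 => /eqP; rewrite oner_eq0.
Qed.

Definition gena (e : signs) : 'I_r -> F := sval (cid (cox_from_base e genx_neq0)).
Definition genmu (e : signs) : 'I_r -> F := sval (cid (svalP (cid (cox_from_base e genx_neq0)))).

Lemma genP e : cox_rel plus genx e (gena e) (genmu e).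
Proof. exact: svalP (cid (svalP (cid (cox_from_base e genx_neq0)))). Qed.

Definition genlam e e' i := genmu e' i / genmu e i.

Lemma genlamP e e' : cox_rel e (gena e) e' (gena e') (genlam e e').
Proof. exact: cox_relM (cox_relV (genP e)) (genP e'). Qed.

Lemma gena_neq0 e i : gena e i != 0.
Proof.
have h := genP e; have [m0] := h i.
have p0 : \prod_(k | nx k i) genmu e k != 0 by apply/prodf_neq0 => k _; case: (h k).
rewrite /zcox /ycox !ffunE; case: ifP => _ hz hy.
  apply: contraTneq (mulf_neq0 m0 (genx_neq0 i)) => a0.
  by rewrite -hy a0 mul0r negbK.
by rewrite hz mulr1.
Qed.

Lemma gena_plus i : gena plus i = genx i.
Proof.
have h := genP plus.
have mu1 k : genmu plus k = 1 by have [_] := h k; rewrite /zcox !ffunE mulr1.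
have [_ _] := h i; rewrite /ycox !ffunE mu1 mul1r big1 ?mulr1 //.
Qed.

(** The coordinate ring of the chart [e] inside the function field, whose generators are the
    coordinates of the chart [plus]. *)
Definition cox_iota (e : signs) (p : P) : F := mmap (tofrac \o @mpolyC r K) (gena e) p.

Lemma iotaC e c : cox_iota e c%:MP = tofrac c%:MP. Proof. exact: mmapC. Qed.
Lemma iotaD e p q : cox_iota e (p + q) = cox_iota e p + cox_iota e q. Proof. exact: rmorphD. Qed.
Lemma iotaM e p q : cox_iota e (p * q) = cox_iota e p * cox_iota e q. Proof. exact: rmorphM. Qed.
Lemma iotaX e i : cox_iota e 'X_i = gena e i.
Proof. by rewrite /cox_iota mmapX mmap1U. Qed.
Lemma iota_plus p : cox_iota plus p = tofrac p.
Proof.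
elim/mpoly_gen_ind : p => [c|i|p q hp hq|p q hp hq]; first exact: iotaC.
- by rewrite iotaX gena_plus.
- by rewrite iotaD rmorphD hp hq.
- by rewrite iotaM rmorphM hp hq.
Qed.

(* [valc e a f v]: the rational function [f], regular at the point of coordinates [a]
   in the chart [e], has the value [v] there. *)
Definition valc (e : signs) (a : 'I_r -> K) (f : F) (v : K) := exists p q : P,
  [/\ q.@[a] != 0, cox_iota e q != 0, f = cox_iota e p / cox_iota e q & v = p.@[a] / q.@[a]].

Lemma valc_iota e a p : valc e a (cox_iota e p) p.@[a].
Proof.
exists p, 1; rewrite meval1 oner_eq0 -mpolyC1 iotaC mpolyC1 rmorph1 oner_eq0.
by rewrite !divr1.
Qed.

Lemma valcC e a c : valc e a (tofrac c%:MP) c.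
Proof. by have := valc_iota e a c%:MP; rewrite iotaC mevalC. Qed.

Lemma valcD e a f v g w : valc e a f v -> valc e a g w -> valc e a (f + g) (v + w).
Proof.
move=> [p [q [qa q0 -> ->]]] [p' [q' [qa' q0' -> ->]]].
exists (p * q' + p' * q), (q * q'); rewrite mevalM iotaM !mulf_neq0 //; split=> //.
  by rewrite iotaD !iotaM addf_div.
by rewrite mevalD !mevalM addf_div.
Qed.

Lemma valcM e a f v g w : valc e a f v -> valc e a g w -> valc e a (f * g) (v * w).
Proof.
move=> [p [q [qa q0 -> ->]]] [p' [q' [qa' q0' -> ->]]].
exists (p * p'), (q * q'); rewrite !mevalM !iotaM !mulf_neq0 //; split=> //;
by rewrite mulf_div.
Qed.

Lemma valcV e a f v : f != 0 -> v != 0 -> valc e a f v -> valc e a f^-1 v^-1.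
Proof.
move=> f0 v0 [p [q [qa q0 ef ev]]]; exists q, p.
have pa : p.@[a] != 0 by apply: contraNneq v0 => pa; rewrite ev pa mul0r.
have p0 : cox_iota e p != 0 by apply: contraNneq f0 => pe; rewrite ef pe mul0r.
by split=> //; rewrite ?ef ?ev invf_div.
Qed.

Lemma valc_prod e a (S : pred 'I_r) (f : 'I_r -> F) (v : 'I_r -> K) :
  (forall k, S k -> valc e a (f k) (v k)) ->
  valc e a (\prod_(k | S k) f k) (\prod_(k | S k) v k).
Proof.
move=> h; apply: (big_ind2 (valc e a)) => //.
  by have := valcC e a 1; rewrite rmorph1.
by move=> *; apply: valcM.
Qed.

Lemma genlam_neq0 e e' i : genlam e e' i != 0.
Proof. by case: (genlamP e e' i). Qed.

(** The entry [lam i] and the new i-th coordinate are products and quotients of old coordinates and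
    earlier entries of [lam], so regularity and values propagate by strong induction on [i]. The
    four cases are the signs of the two charts at [i]. *)
Lemma valc_trans_lam e a e' a' lam : cox_rel e a e' a' lam ->
  forall i, valc e a (genlam e e' i) (lam i) /\ valc e a (gena e' i) (a' i).
Proof.
move=> h i; elim: {i}(i : nat).+1 {-2}i (ltnSn i) => // m IH i im.
have IHk k : nx k i -> valc e a (genlam e e' k) (lam k).
  by move=> /nx_lt ki; apply: (IH k _).1; lia.
have hp := valc_prod IHk.
have [gl0 gz gy] := genlamP e e' i; have [l0 hz hy] := h i.
have gp0 : \prod_(k | nx k i) genlam e e' k != 0.
  by apply/prodf_neq0 => k _; exact: genlam_neq0.
have p0 : \prod_(k | nx k i) lam k != 0 by apply/prodf_neq0 => k _; case: (h k).
have v1 : valc e a 1 1 by have := valcC e a 1; rewrite rmorph1.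
have va : valc e a (gena e i) (a i) by rewrite -iotaX -(mevalXU a i); exact: valc_iota.
have vpV := valcV gp0 p0 hp.
move: gz gy hz hy; rewrite /zcox /ycox; case: ifP => ei'; case: ifP => ei.
- rewrite !mulr1 => gz gy hz hy; rewrite -gz -hz; split=> //.
  rewrite -(mulfK gp0 (gena e' i)) gy -(mulfK p0 (a' i)) hy -gz -hz !mul1r.
  exact: valcM.
- rewrite !mulr1 => gz gy hz hy.
  have ai0 : a i != 0 by apply: contra_eq_neq hz => ->; rewrite mulr0 oner_eq0.
  have gl : genlam e e' i = (gena e i)^-1.
    by rewrite -[RHS]mul1r gz mulfK // gena_neq0.
  have ll : lam i = (a i)^-1 by rewrite -[RHS]mul1r hz mulfK.
  have vl : valc e a (genlam e e' i) (lam i).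
    by rewrite gl ll; apply: valcV => //; exact: gena_neq0.
  split=> //; rewrite -(mulfK gp0 (gena e' i)) gy -(mulfK p0 (a' i)) hy.
  exact: valcM.
- rewrite !mulr1 !mul1r => gz gy hz hy.
  have ai0 : a i != 0 by apply: contra_neq p0 => ai; rewrite hy ai mulr0.
  suff vl : valc e a (genlam e e' i) (lam i) by split=> //; rewrite gz hz.
  rewrite -(mulfK (gena_neq0 e i) (genlam e e' i)) -gy -(mulfK ai0 (lam i)) -hy.
  by apply: valcM => //; apply: valcV => //; exact: gena_neq0.
- rewrite !mulr1 !mul1r => gz gy hz hy.
  suff vl : valc e a (genlam e e' i) (lam i).
    by split=> //; rewrite gz hz; apply: valcM.
  by rewrite -gy -hy.
Qed.

Lemma valc_trans e a e' a' lam f v : cox_rel e a e' a' lam ->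
  valc e' a' f v -> valc e a f v.
Proof.
move=> h; have hi p : valc e a (cox_iota e' p) p.@[a'].
  elim/mpoly_gen_ind : p => [c|i|p q hp hq|p q hp hq].
  - by rewrite iotaC mevalC; exact: valcC.
  - by rewrite iotaX mevalXU; exact: (valc_trans_lam h i).2.
  - by rewrite iotaD mevalD; exact: valcD.
  - by rewrite iotaM mevalM; exact: valcM.
move=> [p [q [qa q0 -> ->]]]; apply: valcM; first exact: hi.
by apply: valcV.
Qed.

Lemma valc_base_inj a f v w : valc plus a f v -> valc plus a f w -> v = w.
Proof.
move=> [p [q [qa q0 -> ->]]] [p' [q' [qa' q0' + ->]]].
rewrite !iota_plus in q0 q0' * => /eqP.
rewrite eqr_div // -!rmorphM => /eqP/tofrac_inj/(congr1 (meval a)).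
by rewrite !mevalM => /eqP; rewrite -eqr_div // => /eqP.
Qed.

End Generic.

(** * Values of rational functions at points *)

Section Points.
Variable R : realType.
Local Notation K := R[i].
Local Notation P := {mpoly K[r]}.
Variables (F : fieldType) (tofrac : {rmorphism P -> F}).
Hypothesis tofrac_inj : injective tofrac.
Local Notation iota := (cox_iota tofrac_inj).
Local Notation valc := (valc tofrac_inj).

(** The Nullstellensatz for the zero ideal. *)
Lemma mpoly_nz_pt (p : P) : p != 0 -> exists a, p.@[a] != 0.
Proof.
move=> p0; apply: contrapT => /forallNP h.
have [|a _|k] := @nullstellensatz R r [set q | q = 0] p.
- split=> //= [? ? -> ->|? ? ->]; by rewrite ?addr0 ?mulr0.
- by apply/eqP; apply: contrapT => /negP; exact: h.
- by move=> /= /eqP; rewrite expf_eq0 (negPf p0) andbF.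
Qed.

Definition all_vars : P := \prod_i 'X_i.

Lemma all_vars_neq0 : all_vars != 0.
Proof. by apply/prodf_neq0 => i _; rewrite -(embed_eq0 tofrac_inj) genx_neq0. Qed.

Lemma all_varsP a : all_vars.@[a] != 0 -> forall i, a i != 0.
Proof.
rewrite rmorph_prod /= => /prodf_neq0 h i.
by have := h i isT; rewrite mevalXU.
Qed.

(* A condition P(a) <> 0 in one chart holds on a nonempty open set of the torus. *)
Lemma torus_point e (p : P) : p != 0 -> exists D : P, D != 0 /\
  forall x, D.@[x] != 0 -> (forall i, x i != 0) /\
    exists b mu, cox_rel plus x e b mu /\ p.@[b] != 0.
Proof.
move=> p0; have [b] := mpoly_nz_pt (mulf_neq0 p0 all_vars_neq0).
rewrite mevalM mulf_eq0 negb_or => /andP[pb /all_varsP b0].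
have [x [mu [x0 hx]]] := cox_to_base e b0.
have [A [B [Bx B0 fAB vAB]]] := valc_trans hx (valc_iota tofrac_inj e b p).
have A0 : A != 0 by apply: contraNneq pb => A0; rewrite vAB A0 meval0 mul0r.
have B00 : B != 0 by apply: contraNneq Bx => ->; rewrite meval0.
exists (A * B * all_vars); split; first by rewrite !mulf_neq0 // all_vars_neq0.
move=> y; rewrite !mevalM !mulf_eq0 !negb_or => /andP[/andP[Ay By] /all_varsP y0].
split; first exact: y0.
have [b' [nu hb']] := cox_from_base e y0; exists b', nu; split; first exact: hb'.
have h1 := valc_trans hb' (valc_iota tofrac_inj e b' p).
rewrite (valc_base_inj h1 (w := A.@[y] / B.@[y])); last by exists A, B.
by rewrite mulf_neq0 // invr_eq0.
Qed.

Lemma iota_inj e p : iota e p = 0 -> p = 0.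
Proof.
move=> h; apply/eqP; apply: contrapT => /negP p0.
have [D [D0 hD]] := torus_point e p0; have [x Dx] := mpoly_nz_pt D0.
have [x0 [b [mu [hb pb]]]] := hD x Dx.
have := valc_trans hb (valc_iota tofrac_inj e b p); rewrite h => h1.
have := valcC tofrac_inj plus x 0; rewrite mpolyC0 rmorph0 => h2.
by rewrite (valc_base_inj h1 h2) eqxx in pb.
Qed.

Lemma valc_inj e a f v w : valc e a f v -> valc e a f w -> v = w.
Proof.
move=> [p [q [qa q0 -> ->]]] [p' [q' [qa' q0' + ->]]] => /eqP.
rewrite eqr_div // -!iotaM => /eqP h.
have : p * q' = p' * q.
  by apply/eqP; rewrite -subr_eq0; apply/eqP/(@iota_inj e); rewrite /iota rmorphB /= -/iota; move: h; rewrite /iota => ->; rewrite subrr.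
move/(congr1 (meval a)); rewrite !mevalM => /eqP; rewrite -eqr_div // => /eqP //.
Qed.

Lemma valc_intro e a p q : q.@[a] != 0 -> valc e a (iota e p / iota e q) (p.@[a] / q.@[a]).
Proof.
move=> qa; exists p, q; split=> //.
by apply/eqP => /iota_inj q0; rewrite q0 meval0 eqxx in qa.
Qed.

End Points.
End Cox.

(** * Derivations of the function field *)

Section Derivation.
Variables (r : nat) (K : fieldType).
Local Notation P := {mpoly K[r]}.
Variables (F : fieldType) (tofrac : {rmorphism P -> F}).
Hypothesis tofrac_inj : injective tofrac.
Hypothesis fracP : forall f : F, exists a b : P, b != 0 /\ f = tofrac a / tofrac b.

(** The quotient rule applied to a chosen fraction; by [der_frac] the choice is immaterial. *)
Definition der (k : 'I_r) (f : F) : F :=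
  let a := sval (cid (fracP f)) in let b := sval (cid (svalP (cid (fracP f)))) in
  (tofrac a^`M(k) * tofrac b - tofrac a * tofrac b^`M(k)) / tofrac b ^+ 2.

Lemma tofrac_neq0 (b : P) : b != 0 -> tofrac b != 0.
Proof. by rewrite (embed_eq0 tofrac_inj). Qed.

Lemma der_frac k a b : b != 0 -> der k (tofrac a / tofrac b) =
  (tofrac a^`M(k) * tofrac b - tofrac a * tofrac b^`M(k)) / tofrac b ^+ 2.
Proof.
move=> b0; rewrite /der; case: (cid (fracP _)) => a' /= h; case: cid => b' /= [b0' e].
have e1 : a * b' = a' * b.
  apply: tofrac_inj; rewrite !rmorphM; apply/eqP.
  by rewrite -eqr_div ?tofrac_neq0 // e.
have e2 : a^`M(k) * b' + a * b'^`M(k) = a'^`M(k) * b + a' * b^`M(k).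
  by rewrite -!mderivM e1.
have /(congr1 tofrac) := e1; have /(congr1 tofrac) := e2.
rewrite !(rmorphD, rmorphM) /=.
have := tofrac_neq0 b0; have := tofrac_neq0 b0'.
move: (tofrac a^`M(k)) (tofrac b^`M(k)) (tofrac a'^`M(k)) (tofrac b'^`M(k)).
move: (tofrac a) (tofrac b) (tofrac a') (tofrac b').
move=> A B A' B' dA dB dA' dB' B0' B0 h2 h1.
apply/eqP; rewrite eqr_div ?expf_neq0 //; apply/eqP.
have -> : (dA' * B' - A' * dB') * B ^+ 2 = (dA' * B) * B' * B - (A' * B) * dB' * B.
  ring.
have -> : dA' * B = dA * B' + A * dB' - A' * dB by rewrite h2; ring.
transitivity (dA * B * B' ^+ 2 + A * B' * dB' * B - (A' * B) * dB * B' - (A' * B) * dB' * B).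
  ring.
rewrite -h1; ring.
Qed.

Lemma der_poly k p : der k (tofrac p) = tofrac p^`M(k).
Proof.
have := der_frac k p (oner_neq0 P); rewrite rmorph1 divr1 => ->.
by rewrite -mpolyC1 mderivC rmorph0 mulr0 subr0 mulr1 expr1n divr1.
Qed.

Lemma derD k f g : der k (f + g) = der k f + der k g.
Proof.
have [a [b [b0 ->]]] := fracP f; have [c [d [d0 ->]]] := fracP g.
rewrite addf_div ?tofrac_neq0 // -!(rmorphM, rmorphD) /= !der_frac ?mulf_neq0 //.
rewrite !(mderivD, mderivM) !(rmorphM, rmorphD) /=.
have := tofrac_neq0 b0; have := tofrac_neq0 d0 => *; field.
by apply/andP.
Qed.

Lemma derM k f g : der k (f * g) = der k f * g + f * der k g.
Proof.
have [a [b [b0 ->]]] := fracP f; have [c [d [d0 ->]]] := fracP g.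
rewrite mulf_div -!(rmorphM, rmorphD) /= !der_frac ?mulf_neq0 //.
rewrite !(mderivD, mderivM) !(rmorphM, rmorphD) /=.
have := tofrac_neq0 b0; have := tofrac_neq0 d0 => *; field.
by apply/andP.
Qed.

Definition Der (e : 'rV[F]_r) (f : F) : F := \sum_k e 0 k * der k f.

Lemma DerD e f g : Der e (f + g) = Der e f + Der e g.
Proof. by rewrite -big_split; apply: eq_bigr => k _; rewrite derD mulrDr. Qed.

Lemma DerM e f g : Der e (f * g) = Der e f * g + f * Der e g.
Proof.
rewrite mulr_suml mulr_sumr -big_split; apply: eq_bigr => k _ /=.
by rewrite derM; ring.
Qed.

Lemma DerC e c : Der e (tofrac c%:MP) = 0.
Proof. by rewrite /Der big1 // => k _; rewrite der_poly mderivC rmorph0 mulr0. Qed.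

Lemma DerX e k : Der e (tofrac 'X_k) = e 0 k.
Proof.
rewrite /Der (bigD1 k) //= big1 ?addr0 => [|j jk]; rewrite der_poly mderivX mnmE.
  have -> : (U_(k) - U_(k) = 0)%MM by apply/mnmP => l; rewrite mnmBE mnm0E subnn.
  by rewrite eqxx scale1r mpolyX0 rmorph1 mulr1.
by rewrite eq_sym (negPf jk) scale0r rmorph0 mulr0.
Qed.

Lemma Der_div e f g : g != 0 -> Der e (f / g) = (Der e f - (f / g) * Der e g) / g.
Proof.
move=> g0; have := DerM e (f / g) g; rewrite divfK // => ->.
by rewrite addrK mulfK.
Qed.

Lemma Der_addl e e' f : Der (e + e') f = Der e f + Der e' f.
Proof. by rewrite -big_split; apply: eq_bigr => k _ /=; rewrite mxE mulrDl. Qed.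

Lemma Der_scale (u : F) e f : Der (u *: e) f = u * Der e f.
Proof. by rewrite mulr_sumr; apply: eq_bigr => k _ /=; rewrite mxE mulrA. Qed.

Lemma Der_0l f : Der 0 f = 0.
Proof. by rewrite /Der big1 // => k _; rewrite mxE mul0r. Qed.

End Derivation.

(** * Spaces covered by the charts of a Bott tower *)

Section Atlas.
Variables (r : nat) (nx : rel 'I_r) (R : realType).
Local Notation K := R[i].
Local Notation P := {mpoly K[r]}.

(** The interface between the two halves of the proof: vanishing and rigidity use the space only
    through these properties, and both varieties are shown to have them at the end. *)
Record bott_atlas (X : fspace K) (phi : signs r -> ('I_r -> K) -> X) : Prop := BottAtlas {
  ba_lt : forall k i, nx k i -> (k < i)%N;
  ba_surj : forall x, exists e a, x = phi e a;
  ba_eq : forall e a e' a',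
    phi e a = phi e' a' <-> exists lam, cox_rel nx e a e' a' lam;
  ba_opn : forall U, opn U <-> forall e a, U (phi e a) ->
    exists p : P, p.@[a] != 0 /\ forall b, p.@[b] != 0 -> U (phi e b);
  ba_reg : forall U f, opn U -> (reg U f <-> forall e a, U (phi e a) ->
    exists p q : P, q.@[a] != 0 /\
      forall b, U (phi e b) -> q.@[b] != 0 -> f (phi e b) = p.@[b] / q.@[b]) }.

Variables (X : fspace K) (phi : signs r -> ('I_r -> K) -> X).
Hypothesis atl : bott_atlas phi.
Variables (F : fieldType) (tofrac : {rmorphism P -> F}).
Hypothesis tofrac_inj : injective tofrac.
Hypothesis fracP : forall f : F, exists a b : P, b != 0 /\ f = tofrac a / tofrac b.
Let nx_lt := ba_lt atl.
Local Notation gena := (gena nx_lt tofrac_inj).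
Local Notation iota := (cox_iota nx_lt tofrac_inj).
Local Notation valc := (valc nx_lt tofrac_inj).
Local Notation Der := (Der fracP).
Local Notation plus := (plus r).
Local Notation DerC := (DerC tofrac_inj fracP).
Local Notation DerD := (DerD tofrac_inj fracP).
Local Notation DerM := (DerM tofrac_inj fracP).
Local Notation DerX := (DerX tofrac_inj fracP).
Local Notation Der_div := (Der_div tofrac_inj fracP).

Lemma opnI U V : opn U -> opn V -> opn (U `&` V : set X).
Proof.
move=> /(ba_opn atl) hU /(ba_opn atl) hV; apply/(ba_opn atl) => e a [/hU[p [pa pU]] /hV[q [qa qV]]].
exists (p * q); rewrite mevalM mulf_neq0 //; split=> // b.
by rewrite mevalM mulf_eq0 negb_or => /andP[/pU ? /qV].
Qed.

Definition vat (x : X) (f : F) (v : K) := exists e a, x = phi e a /\ valc e a f v.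

Lemma vatP e a f v : vat (phi e a) f v <-> valc e a f v.
Proof.
split=> [[e' [a' [/(ba_eq atl)[lam h]]]]|h]; last by exists e, a.
exact: valc_trans h.
Qed.

Lemma vat_inj x f v w : vat x f v -> vat x f w -> v = w.
Proof. by have [e [a ->]] := ba_surj atl x; rewrite !vatP; apply: valc_inj. Qed.

Lemma vatC x c : vat x (tofrac c%:MP) c.
Proof. by have [e [a ->]] := ba_surj atl x; rewrite vatP; apply: valcC. Qed.

Lemma vatD x f v g w : vat x f v -> vat x g w -> vat x (f + g) (v + w).
Proof. by have [e [a ->]] := ba_surj atl x; rewrite !vatP; apply: valcD. Qed.

Lemma vatM x f v g w : vat x f v -> vat x g w -> vat x (f * g) (v * w).
Proof. by have [e [a ->]] := ba_surj atl x; rewrite !vatP; apply: valcM. Qed.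

Lemma vat0 x : vat x 0 0.
Proof. by have := vatC x 0; rewrite mpolyC0 rmorph0. Qed.

Lemma vatN x f v : vat x f v -> vat x (- f) (- v).
Proof.
move=> h; have := vatM (vatC x (-1)) h.
by rewrite mpolyCN rmorphN mpolyC1 rmorph1 !mulN1r.
Qed.

Lemma vatB x f v g w : vat x f v -> vat x g w -> vat x (f - g) (v - w).
Proof. by move=> h /vatN; apply: vatD. Qed.

Lemma vatV x f v : v != 0 -> vat x f v -> vat x f^-1 v^-1.
Proof.
move=> v0 h; have f0 : f != 0.
  by apply: contraNneq v0 => f0; rewrite f0 in h; rewrite (vat_inj h (vat0 x)).
by move: h; have [e [a ->]] := ba_surj atl x; rewrite !vatP; apply: valcV.
Qed.

Definition regat x f := exists v, vat x f v.

Definition prin e (q : P) : set X := [set x | exists2 a, x = phi e a & q.@[a] != 0].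

Lemma prinP e q a : prin e q (phi e a) <-> q.@[a] != 0.
Proof.
split=> [[b /(ba_eq atl)[lam h] qb]|qa]; last by exists a.
have v1 := valc_trans h (valc_iota nx_lt tofrac_inj e b q).
by rewrite (valc_inj (valc_iota nx_lt tofrac_inj e a q) v1).
Qed.

(** Seen from another chart, [q] is a fraction A / B near the point; the factors X_i in the equation
    keep nearby points inside the overlap of the two charts. *)
Lemma opn_prin e q : opn (prin e q).
Proof.
apply/(ba_opn atl) => e' a' [a /esym/(ba_eq atl)[lam h] qa].
have [A [B [Ba B0 fAB vAB]]] := valc_trans (cox_relV h)
   (valc_iota nx_lt tofrac_inj e a q).
exists (A * B * \prod_(i | e i != e' i) 'X_i); rewrite !mevalM rmorph_prod /=; split.
  apply: mulf_neq0; first (apply: mulf_neq0; last exact: Ba).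
    by apply: contraNneq qa => A0; rewrite vAB A0 mul0r.
  by apply/prodf_neq0 => i ei; rewrite mevalXU; apply: cox_rel_neq0 h ei.
move=> b; rewrite !mevalM rmorph_prod /= !mulf_eq0 !negb_or => /andP[/andP[Ab Bb]].
move=> /prodf_neq0 hb.
have [|b' [mu hmu]] := @cox_change _ _ nx_lt _ e' b e.
  by move=> i ei; have := hb i; rewrite mevalXU eq_sym; apply.
exists b'; first by apply/(ba_eq atl); exists mu.
have h1 := valc_trans hmu (valc_iota nx_lt tofrac_inj e b' q).
have h2 : valc e' b (iota e q) (A.@[b] / B.@[b]) by exists A, B.
by rewrite (valc_inj h1 h2) mulf_neq0 // invr_eq0.
Qed.

Lemma opn_torus U x : opn U -> U x -> exists D : P, D != 0 /\
  forall t, D.@[t] != 0 -> (forall i, t i != 0) /\ U (phi plus t).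
Proof.
have [e [a ->]] := ba_surj atl x => /(ba_opn atl) oU /oU[p [pa pU]].
have p0 : p != 0 by apply: contraNneq pa => ->; rewrite meval0.
have [D [D0 hD]] := torus_point nx_lt tofrac_inj e p0.
exists D; split=> // t /hD[t0 [b [mu [h /pU]]]]; split=> //.
suff -> : phi plus t = phi e b by [].
by apply/(ba_eq atl); exists mu.
Qed.

Lemma opn_meet (U V : set X) x y : opn U -> opn V -> U x -> V y -> (U `&` V) !=set0.
Proof.
move=> oU oV /(opn_torus oU)[D [D0 hD]] /(opn_torus oV)[D' [D0' hD']].
have [t] := mpoly_nz_pt (mulf_neq0 D0 D0').
rewrite mevalM mulf_eq0 negb_or => /andP[/hD[_ Ut] /hD'[_ Vt]].
by exists (phi plus t).
Qed.

Lemma vat_ext U f g : opn U -> U !=set0 ->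
  (forall y, U y -> exists v, vat y f v /\ vat y g v) -> f = g.
Proof.
move=> oU [x Ux] h; apply/eqP; rewrite -subr_eq0; apply/eqP.
have [A [B [B0 fAB]]] := fracP (f - g).
have [D [D0 hD]] := opn_torus oU Ux; rewrite fAB.
have [->|A0] := eqVneq A 0; first by rewrite rmorph0 mul0r.
have [t] := mpoly_nz_pt (mulf_neq0 (mulf_neq0 A0 B0) D0).
rewrite !mevalM !mulf_eq0 !negb_or => /andP[/andP[At Bt] /hD[_ /h[v [vf vg]]]].
have := vatB vf vg; rewrite fAB subrr => /vatP h0.
have := valc_intro nx_lt tofrac_inj plus A Bt; rewrite !iota_plus => h1.
have := valc_inj h0 h1 => /esym/eqP; rewrite mulf_eq0 invr_eq0.
by rewrite (negPf At) (negPf Bt).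
Qed.

Definition germ (V : set X) (f : X -> K) (g : F) := forall x, V x -> vat x g (f x).

Lemma germ_inj V f g g' : opn V -> V !=set0 -> germ V f g -> germ V f g' -> g = g'.
Proof. by move=> oV V0 h h'; apply: (vat_ext oV V0) => y Vy; exists (f y); split; auto. Qed.

Lemma germ_reg V f g : opn V -> germ V f g -> reg V f.
Proof.
move=> oV h; apply/(ba_reg atl) => // e a /h/vatP[p [q [qa q0 eg ef]]].
exists p, q; split; first exact: qa.
move=> b /h/vatP hb qb; apply: valc_inj hb _.
rewrite eg; exact: valc_intro.
Qed.

(** Local fractions agree where their domains meet, and by irreducibility these always meet; one
    rational function therefore serves on all of [V]. *)
Lemma reg_germ V f : opn V -> V !=set0 -> reg V f -> exists g, germ V f g.
Proof.
move=> oV [x0 Vx0] /(ba_reg atl f oV) h.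
have loc x : V x -> exists g N, [/\ opn N, N x, N `<=` V & germ N f g].
  have [e [a ->]] := ba_surj atl x => Vx.
  have [p [q [qa hf]]] := h _ _ Vx.
  exists (iota e p / iota e q), (V `&` prin e q); split.
  - exact: opnI (opn_prin _ _).
  - by split=> //; apply/prinP.
  - exact: subIsetl.
  - move=> y [Vy [b eb qb]]; rewrite eb vatP hf -?eb //.
    exact: valc_intro.
have [g [N [oN Nx NV hg]]] := loc x0 Vx0.
exists g => x /loc[g' [N' [oN' Nx' NV' hg']]].
suff -> : g = g' by apply: hg'.
apply: (@germ_inj (N `&` N') f) => //; first exact: opnI.
- exact: opn_meet Nx Nx'.
- by move=> y [/hg].
- by move=> y [_ /hg'].
Qed.

Definition ev (f : F) (x : X) : K := xget 0 [set v | vat x f v].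

Lemma evP f x : regat x f -> vat x f (ev f x).
Proof. by case=> v hv; apply: (@xgetPex _ 0 [set v | vat x f v]); exists v. Qed.

Lemma evE f x v : vat x f v -> ev f x = v.
Proof. by move=> h; exact: vat_inj (evP (ex_intro _ v h)) h. Qed.

Lemma opn_regat f : opn [set x | regat x f].
Proof.
apply/(ba_opn atl) => e a [v /vatP[p [q [qa q0 -> _]]]]; exists q; split=> // b qb.
exists (p.@[b] / q.@[b]); rewrite vatP; exact: valc_intro.
Qed.

Lemma germ_ev f V : V `<=` [set x | regat x f] -> germ V (ev f) f.
Proof. by move=> h x /h; apply: evP. Qed.

(** The stalk of the tangent sheaf at [x]: derivations of the function field that preserve the local
    ring of [x]. *)
Definition stalk (x : X) : set 'rV[F]_r :=
  [set e | forall f, regat x f -> regat x (Der e f)].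

Lemma stalk_sub x : subgroup (stalk x).
Proof.
split=> [f _|e e' he he' f hf]; first by rewrite Der_0l; exists 0; apply: vat0.
rewrite -scaleN1r Der_addl Der_scale mulN1r.
have [v hv] := he f hf; have [w hw] := he' f hf; exists (v - w); exact: vatB.
Qed.

Lemma stalk_scale x u e : regat x u -> stalk x e -> stalk x (u *: e).
Proof.
move=> [v hv] he f /he[w hw]; exists (v * w); rewrite Der_scale; exact: vatM.
Qed.

Lemma stalkP e a d : stalk (phi e a) d <-> forall i, regat (phi e a) (Der d (gena e i)).
Proof.
split=> [h i|h].
  apply: h; exists (a i); rewrite vatP -iotaX -(mevalXU a i); exact: valc_iota.
have hp p : regat (phi e a) (Der d (iota e p)).
  have ri q : vat (phi e a) (iota e q) q.@[a] by rewrite vatP; exact: valc_iota.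
  elim/mpoly_gen_ind : p => [c|i|p q [v hv] [w hw]|p q [v hv] [w hw]].
  - by rewrite iotaC DerC; exists 0; exact: vat0.
  - by rewrite iotaX.
  - by rewrite iotaD DerD; exists (v + w); exact: vatD.
  - by rewrite iotaM DerM; eexists; apply: vatD; apply: vatM; eauto.
move=> f [v /vatP[p [q [qa q0 ef ev]]]]; rewrite ef Der_div //.
have [v1 h1] := hp p; have [v2 h2] := hp q.
eexists; apply: vatM; last first.
  by apply: (@vatV _ _ q.@[a]) => //; rewrite vatP; exact: valc_iota.
apply: vatB; first exact: h1.
apply: vatM; last exact: h2.
rewrite vatP; exact: valc_intro.
Qed.

(* The vector field [D] on [U] is the derivation [e] of the function field. *)
Definition rep (U : set X) (D : (X -> K) -> (X -> K)) (e : 'rV[F]_r) :=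
  forall V f g, opn V -> V `<=` U -> germ V f g -> germ V (D f) (Der e g).

Lemma germD V f g f' g' : germ V f g -> germ V f' g' -> germ V (fun x => f x + f' x) (g + g').
Proof. by move=> h h' x Vx; apply: vatD; auto. Qed.

Lemma germM V f g f' g' : germ V f g -> germ V f' g' -> germ V (fun x => f x * f' x) (g * g').
Proof. by move=> h h' x Vx; apply: vatM; auto. Qed.

Lemma germC V c : germ V (fun=> c) (tofrac c%:MP).
Proof. by move=> x _; exact: vatC. Qed.

Lemma germ_sub U V f g : V `<=` U -> germ U f g -> germ V f g.
Proof. by move=> VU h x /VU/h. Qed.

Definition tcoord (k : 'I_r) : X -> K := ev (genx tofrac k).

Lemma tcoord_germ k : germ (prin plus 1) (tcoord k) (genx tofrac k).
Proof.
apply: germ_ev => x [a -> _]; exists (a k).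
by rewrite vatP /genx -(mevalXU a k) -(iota_plus nx_lt tofrac_inj); exact: valc_iota.
Qed.

(** The components of [e] are the images under [D] of the coordinates of the chart [plus]. The
    Leibniz rule extends the description to polynomials in them, and to a fraction A / B by applying
    [D] to the equation B f = A. *)
Lemma rep_exists U D : opn U -> vfield U D -> exists e, rep U D e.
Proof.
move=> oU vD.
have [[x0 Ux0]|nU] := pselect (U !=set0); last first.
  by exists 0 => V f g _ VU _ x /VU Ux; case: nU; exists x.
pose W := U `&` prin plus 1.
have oW : opn W := opnI oU (opn_prin _ _).
have W0 : W !=set0.
  have p1 : prin plus 1 (phi plus (fun=> 0)) by apply/prinP; rewrite meval1 oner_neq0.
  exact: opn_meet (opn_prin _ _) Ux0 p1.
have WU : W `<=` U by apply: subIsetl.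
have tW k : germ W (tcoord k) (genx tofrac k).
  by apply: germ_sub (tcoord_germ k); apply: subIsetr.
have [e he] : exists e : 'rV[F]_r, forall k, germ W (D (tcoord k)) (e 0 k).
  have /choice[e he] k : exists g, germ W (D (tcoord k)) g.
    by apply: reg_germ => //; apply: (vf_reg vD) => //; exact: germ_reg (tW k).
  by exists (\row_k e k) => k; rewrite mxE.
exists e.
have polyD (p : P) : germ W (fun x => p.@[fun k => tcoord k x]) (tofrac p) /\
    germ W (D (fun x => p.@[fun k => tcoord k x])) (Der e (tofrac p)).
  elim/mpoly_gen_ind : p => [c|i|p q [hp hp'] [hq hq']|p q [hp hp'] [hq hq']].
  - have -> : (fun x => c%:MP.@[fun k => tcoord k x]) = (fun=> c).
      by apply/funext => x; rewrite mevalC.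
    split; first exact: germC.
    move=> x Wx; rewrite DerC.
    have xW : x \in W by rewrite inE.
    have r1 d : reg W (fun=> d : K) := germ_reg oW (@germC W d).
    have := vf_leibniz vD oW WU (r1 1) (r1 1) xW; rewrite !mulr1 mul1r.
    move=> /eqP; rewrite -subr_eq0 opprD addrA subrr sub0r oppr_eq0 => /eqP D1.
    have := vf_scale vD c oW WU (r1 1) xW; rewrite D1 mulr0 mulr1.
    by move=> ->; exact: vat0.
  - have -> : (fun x => ('X_i).@[fun k => tcoord k x]) = tcoord i.
      by apply/funext => x; rewrite mevalXU.
    by split; [exact: tW|rewrite DerX; exact: he].
  - have -> : (fun x => (p + q).@[fun k => tcoord k x]) =
      (fun x => p.@[fun k => tcoord k x] + q.@[fun k => tcoord k x]).
      by apply/funext => x; rewrite mevalD.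
    split; first by rewrite rmorphD; exact: germD.
    move=> x Wx; rewrite (vf_add vD oW WU (germ_reg oW hp) (germ_reg oW hq)) ?inE //.
    by rewrite rmorphD DerD; apply: vatD; auto.
  - have -> : (fun x => (p * q).@[fun k => tcoord k x]) =
      (fun x => p.@[fun k => tcoord k x] * q.@[fun k => tcoord k x]).
      by apply/funext => x; rewrite mevalM.
    split; first by rewrite rmorphM; exact: germM.
    move=> x Wx; rewrite (vf_leibniz vD oW WU (germ_reg oW hp) (germ_reg oW hq)) ?inE //.
    by rewrite rmorphM DerM; apply: vatD; apply: vatM; auto.
move=> V f g oV VU hf.
have [V0|nV] := pselect (V !=set0); last by move=> x Vx; case: nV; exists x.
have [h hh] := reg_germ oV V0 (vf_reg vD oV VU (germ_reg oV hf)).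
suff <- : h = Der e g by [].
have [A [B [B0 gAB]]] := fracP g.
have tB0 := tofrac_neq0 tofrac_inj B0.
pose N := V `&` W.
have oN : opn N by apply: opnI.
have NW : N `<=` W by apply: subIsetr.
have NU : N `<=` U by move=> x /NW/WU.
have NV : N `<=` V by apply: subIsetl.
have N0 : N !=set0 by case: V0 => y Vy; case: W0 => z Wz; exact: opn_meet Vy Wz.
have [hA DA] := polyD A; have [hB DB] := polyD B.
rewrite gAB Der_div // -gAB; apply: (mulIf tB0); rewrite divfK //.
apply/esym/eqP; rewrite subr_eq; apply/eqP.
apply: (vat_ext oN N0) => y Ny.
exists (D (fun x => A.@[fun k => tcoord k x]) y); split.
  exact/DA/NW.
have fB : {in N, (fun x => A.@[fun k => tcoord k x]) =1
                (fun x => f x * B.@[fun k => tcoord k x])}.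
  move=> z; rewrite inE => Nz; apply: vat_inj (hA _ (NW _ Nz)) _.
  rewrite -(divfK tB0 (tofrac A)) -gAB; apply: vatM; [exact/hf/NV|exact/hB/NW].
have rA := germ_reg oN (germ_sub NW hA); have rB := germ_reg oN (germ_sub NW hB).
have rf := germ_reg oN (germ_sub NV hf).
have rfB := germ_reg oN (germM (germ_sub NV hf) (germ_sub NW hB)).
rewrite (vf_local vD oN NU rA rfB fB) ?inE //.
rewrite (vf_leibniz vD oN NU rf rB) ?inE //; apply: vatD; apply: vatM.
- exact/hh/NV.
- exact/hB/NW.
- exact/hf/NV.
- exact/DB/NW.
Qed.

Lemma rep_stalk U D e x : opn U -> rep U D e -> U x -> stalk x e.
Proof.
move=> oU h Ux f rf; exists (D (ev f) x).
apply: (h (U `&` [set y | regat y f]) (ev f) f) => //.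
- exact: opnI (opn_regat f).
- by apply: germ_ev; apply: subIsetr.
Qed.

Lemma rep_eq U D D' e : rep U D e -> rep U D' e -> vfield_eq U D D'.
Proof.
move=> h h' V f oV VU rf x; rewrite inE => Vx.
have [g hg] := reg_germ oV (ex_intro _ x Vx) rf.
exact: vat_inj (h V f g oV VU hg x Vx) (h' V f g oV VU hg x Vx).
Qed.

Lemma rep_inj U D D' e e' : opn U -> U !=set0 -> rep U D e -> rep U D' e' ->
  vfield_eq U D D' -> e = e'.
Proof.
move=> oU [x Ux] h h' DD'; apply/rowP => k.
pose W := U `&` prin plus 1.
have oW : opn W := opnI oU (opn_prin _ _).
have WU : W `<=` U by apply: subIsetl.
have W0 : W !=set0.
  have p1 : prin plus 1 (phi plus (fun=> 0)) by apply/prinP; rewrite meval1 oner_neq0.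
  exact: opn_meet (opn_prin _ _) Ux p1.
have tW : germ W (tcoord k) (genx tofrac k).
  by apply: germ_sub (tcoord_germ k); apply: subIsetr.
have := h W _ _ oW WU tW; have := h' W _ _ oW WU tW; rewrite !DerX => h1 h2.
apply: (vat_ext oW W0) => y Wy; exists (D (tcoord k) y); split; first exact: h2.
by rewrite (DD' W) ?inE //; [exact: h1|exact: germ_reg tW].
Qed.

Lemma rep_sub U V D e : V `<=` U -> rep U D e -> rep V D e.
Proof. by move=> VU h W f g oW WV; apply: h => // x /WV/VU. Qed.

(** A right inverse of [rep]. The function is replaced by its germ at each point, which gives an
    operator on all functions whose values matter only where a germ exists. *)
Definition act (e : 'rV[F]_r) (f : X -> K) (x : X) : K :=
  ev (Der e (xget 0 [set g | exists N, [/\ opn N, N x & germ N f g]])) x.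

Lemma rep_act U e : (forall x, U x -> stalk x e) -> rep U (act e) e.
Proof.
move=> he V f g oV VU hf x Vx; rewrite /act.
case: xgetP => [g' eg' [N [oN Nx hg']]|]; last by move=> /(_ g); case; exists V.
have -> : g' = g.
  apply: (@germ_inj (N `&` V) f); [exact: opnI|by exists x| |].
  - by apply: germ_sub hg'; apply: subIsetl.
  - by apply: germ_sub hf; apply: subIsetr.
by apply/evP/(he _ (VU _ Vx)); exists (f x); exact: hf.
Qed.

Lemma rep_vfield U D e : rep U D e -> vfield U D.
Proof.
move=> h; split.
- move=> V f oV VU rf; have [V0|nV] := pselect (V !=set0).
    have [g hg] := reg_germ oV V0 rf; exact: germ_reg (h V f g oV VU hg).
  by apply: (@germ_reg _ _ 0) => // x Vx; case: nV; exists x.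
- move=> V f f' oV VU rf rf' ff' x; rewrite inE => Vx.
  have [g hg] := reg_germ oV (ex_intro _ x Vx) rf.
  have hg' : germ V f' g by move=> y Vy; rewrite -ff' ?inE //; exact: hg.
  exact: vat_inj (h V f g oV VU hg x Vx) (h V f' g oV VU hg' x Vx).
- move=> V c f oV VU rf x; rewrite inE => Vx.
  have [g hg] := reg_germ oV (ex_intro _ x Vx) rf.
  apply: vat_inj (h V _ _ oV VU (germM (@germC V c) hg) x Vx) _.
  rewrite DerM DerC mul0r add0r; apply: vatM; [exact: vatC|exact: h hg x Vx].
- move=> V f f' oV VU rf rf' x; rewrite inE => Vx.
  have [g hg] := reg_germ oV (ex_intro _ x Vx) rf.
  have [g' hg'] := reg_germ oV (ex_intro _ x Vx) rf'.
  apply: vat_inj (h V _ _ oV VU (germD hg hg') x Vx) _.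
  rewrite DerD; apply: vatD; [exact: h hg x Vx|exact: h hg' x Vx].
- move=> V f f' oV VU rf rf' x; rewrite inE => Vx.
  have [g hg] := reg_germ oV (ex_intro _ x Vx) rf.
  have [g' hg'] := reg_germ oV (ex_intro _ x Vx) rf'.
  apply: vat_inj (h V _ _ oV VU (germM hg hg') x Vx) _.
  rewrite DerM; apply: vatD; apply: vatM.
  + exact: h hg x Vx. + exact: hg'. + exact: hg. + exact: h hg' x Vx.
Qed.

Lemma rep_lin U (J : Type) (s : seq J) (b : J -> nat) D e :
  (forall j, rep U (D j) (e j)) ->
  rep U (fun f x => \sum_(j <- s) (-1) ^+ b j * D j f x) (\sum_(j <- s) (-1) ^+ b j *: e j).
Proof.
move=> h V f g oV VU hf x Vx.
elim: s => [|j s IH]; first by rewrite !big_nil Der_0l; exact: vat0.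
rewrite !big_cons Der_addl; apply: vatD => //; rewrite Der_scale.
have hj := h j V f g oV VU hf x Vx.
rewrite -!(signr_odd _ (b j)); case: (odd (b j)); rewrite ?expr1 ?mulN1r ?mul1r //.
exact: vatN.
Qed.

End Atlas.

(** * Vanishing of the cohomology of the tangent sheaf *)

Section DifLinear.
Variables (F : fieldType) (E : lmodType F) (J : eqType).

Lemma dif_scale (u : F) (c : seq J -> E) s : dif (fun t => u *: c t) s = u *: dif c s.
Proof.
elim: s c => [|x s IH] c /=; first by rewrite scaler0.
by rewrite IH scalerBr.
Qed.

Lemma dif_sum (I : Type) (l : seq I) (c : I -> seq J -> E) s :
  dif (fun t => \sum_(i <- l) c i t) s = \sum_(i <- l) dif (c i) s.
Proof.
elim: s c => [|x s IH] c /=; first by rewrite big1.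
by rewrite (IH (fun i t => c i (x :: t))) sumrB.
Qed.

End DifLinear.

(* The rays of the fan of the Bott tower: [ray e i] is e_i^+ or
   e_i^- = - e_i^+ + e_l(i)^+, according to the sign [e i]. *)
Section Rays.
Variables (r : nat) (nx : rel 'I_r).
Hypothesis nx_lt : forall k i, nx k i -> (k < i)%N.
Hypothesis nx_fun : forall i j j', nx i j -> nx i j' -> j = j'.

Definition ray (b : bool) (i : 'I_r) : 'rV[int]_r :=
  \row_k (if b then (k == i)%:R else (nx i k)%:R - (k == i)%:R).

Definition ray_pair (b : bool) (i : 'I_r) (m : 'cV[int]_r) : int := (ray b i *m m) 0 0.

Lemma pair_plus i m : ray_pair true i m = m i 0.
Proof.
rewrite /ray_pair mxE (bigD1 i) //= big1 ?addr0 => [|k ki]; rewrite mxE ?eqxx ?mul1r //.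
by rewrite (negPf ki) mul0r.
Qed.

Lemma pair_minus i m : ray_pair false i m = \sum_(k | nx i k) m k 0 - m i 0.
Proof.
have -> : ray_pair false i m = \sum_k ((nx i k)%:R * m k 0 - (k == i)%:R * m k 0).
  by rewrite /ray_pair mxE; apply: eq_bigr => k _; rewrite mxE mulrBl.
rewrite sumrB; congr (_ - _); last first.
  rewrite (bigD1 i) //= big1 ?addr0 ?eqxx ?mul1r // => k ki.
  by rewrite (negPf ki) mul0r.
rewrite [RHS]big_mkcond; apply: eq_bigr => k _.
by case: (nx i k); rewrite ?mul1r ?mul0r.
Qed.

Definition rays (e : signs r) : 'M[int]_r := \matrix_i ray (e i) i.

Lemma rays_unit e : rays e \in unitmx.
Proof.
rewrite -unitmx_tr unitmxE det_trig; last first.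
  apply/is_trig_mxP => i j ij; rewrite !mxE.
  have -> : (i == j) = false by apply/eqP => h; rewrite h ltnn in ij.
  have -> : nx j i = false by apply/negP => /nx_lt; lia.
  by case: (e j); rewrite ?subrr.
apply: (big_ind (fun x => x \is a GRing.unit)) => //.
  by move=> x y hx hy; rewrite unitrM hx.
move=> i _; rewrite !mxE eqxx; case: (e i) => //.
by have -> : nx i i = false by apply/negP => /nx_lt; rewrite ltnn.
Qed.

Variable K : fieldType.

Definition kray b i : 'rV[K]_r := map_mx intr (ray b i).

(* The weight spaces of the vector fields near the divisor of a ray: a vector field
   may have at most a simple pole, in the direction of the ray. *)
Definition ray_ok (m : 'cV[int]_r) (b : bool) (i : 'I_r) : set 'rV[K]_r :=
  [set v | [\/ 0 <= ray_pair b i m, ray_pair b i m = -1 /\ exists t, v = t *: kray b i | v = 0]].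

Lemma ray_ok_sub m b i : subgroup (ray_ok m b i).
Proof.
split; first by constructor 3.
move=> x y [h|[h [t ->]]|->]; [by constructor 1| |].
  move=> [h'|[h' [t' ->]]|->]; [by constructor 1| |].
    by constructor 2; split=> //; exists (t - t'); rewrite scalerBl.
  by constructor 2; split=> //; exists t; rewrite subr0.
move=> [h'|[h' [t' ->]]|->]; [by constructor 1| |].
  by constructor 2; split=> //; exists (- t'); rewrite scaleNr sub0r.
by constructor 3; rewrite subr0.
Qed.

Definition cst (u : seq (signs r)) (i : 'I_r) (b : bool) := forall e, e \in u -> e i = b.

(** Only the divisors that meet all charts of [u] impose a condition; they belong to the rays common
    to all the cones of [u]. *)
Definition weight_sheaf (m : 'cV[int]_r) (u : seq (signs r)) : set 'rV[K]_r :=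
  [set v | forall i b, cst u i b -> ray_ok m b i v].

Lemma weight_sheaf_sub m u : subgroup (weight_sheaf m u).
Proof.
split=> [i b _|x y hx hy i b hb]; first exact: (ray_ok_sub _ _ _).1.
by apply: (ray_ok_sub _ _ _).2; auto.
Qed.

(* Either every index has a free side, or the constraints of two indices with a
   free side are incompatible. *)
Lemma weight_cases m :
  (exists e : signs r, forall i, 0 <= ray_pair (~~ e i) i m) \/
  exists i0 i1 b0 b1, [/\ 0 <= ray_pair (~~ b0) i0 m, 0 <= ray_pair (~~ b1) i1 m,
    i1 = i0 -> b0 = b1 & forall v, ray_ok m b0 i0 v -> ray_ok m b1 i1 v -> v = 0].
Proof.
have [/existsP[i1 hi1]|/existsPn h] :=
    boolP [exists i, (ray_pair true i m < 0) && (ray_pair false i m < 0)]; last first.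
  left; exists [ffun i => ~~ (0 <= ray_pair true i m)] => i; rewrite ffunE negbK.
  have := h i; case: leP => // h1.
  by rewrite /= -leNgt.
right; have nz : exists i, m i 0 != 0.
  by exists i1; move: hi1; rewrite pair_plus => /andP[/lt_eqF ->].
(* The two pairings at the last nonzero entry of [m] are m_L and - m_L, so exactly one side of L is
   constrained. *)
have [L mL hL] : exists2 L, m L 0 != 0 & forall j : 'I_r, (L < j)%N -> m j 0 = 0.
  case: nz => i mi; pose L := [arg max_(L > i | m L 0 != 0) (L : nat)].
  exists L; rewrite /L; case: arg_maxnP => // j mj hj //.
  by move=> k jk; apply/eqP; apply: contraTT jk => /hj; rewrite -leqNgt.
have pL : ray_pair false L m = - m L 0.
  by rewrite pair_minus big1 ?sub0r // => k /nx_lt /hL.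
have neqL b (i : 'I_r) (v : 'rV[K]_r) t : v = t *: kray b i -> v 0 i = 0 -> v = 0.
  move=> -> ; rewrite !mxE eqxx.
  have -> : nx i i = false by apply/negP => /nx_lt; rewrite ltnn.
  case: b; rewrite ?sub0r ?rmorphN /= ?rmorph1 ?mulrN mulr1.
    by move=> ->; rewrite scale0r.
  by move/eqP; rewrite oppr_eq0 => /eqP ->; rewrite scale0r.
have Lcoord b (i : 'I_r) (v : 'rV[K]_r) : (i < L)%N -> ray_ok m b L v -> ray_pair b L m < 0 -> v 0 i = 0.
  move=> iL [|[_ [t ->]]|->]; [by case: ltP| |by rewrite mxE].
  rewrite !mxE; have -> : (i == L) = false by apply/eqP => h; rewrite h ltnn in iL.
  have -> : nx L i = false by apply/negP => /nx_lt; lia.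
  by case: b; rewrite ?subrr rmorph0 mulr0.
pose bL := m L 0 < 0.
have bLneg : ray_pair bL L m < 0.
  by rewrite /bL; case: (ltP (m L 0)) => h; rewrite ?pair_plus // pL; move: mL h; lia.
have bLpos : 0 <= ray_pair (~~ bL) L m.
  by rewrite /bL; case: (ltP (m L 0)) => h; rewrite /= ?pL ?pair_plus //; move: h; lia.
(* If |m_L| > 1, the pairing on the constrained side is below -1 and the condition at L alone forces
   v = 0. *)
have [small|big] := boolP (`|m L 0| <= 1); last first.
  exists L, L, bL, bL; split=> // v [h|[h _]|//] _; first by move: h; rewrite leNgt bLneg.
  case/negP: big; move: h; rewrite /bL; case: (ltP (m L 0)) => _; rewrite ?pair_plus ?pL; lia.
have ex : exists i : 'I_r, (i < L)%N && ((ray_pair true i m < 0) || (ray_pair false i m < 0)).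
  exists i1; move: hi1 => /andP[h1 h2]; rewrite h1 andbT ltn_neqAle.
  apply/andP; split.
    apply/eqP => /ord_inj e; move: h1 h2; rewrite e pair_plus pL; lia.
  by rewrite leqNgt; apply/negP => /hL e; move: h1; rewrite pair_plus e ltxx.
(* If |m_L| = 1, the second index is the last one before L that has a constrained side. *)
have [i iL [hi him]] : exists2 i : 'I_r, (i < L)%N &
    (ray_pair true i m < 0) || (ray_pair false i m < 0) /\
    forall j : 'I_r, (i < j)%N -> (j < L)%N -> 0 <= ray_pair true j m.
  case: ex => j hj; pose Q (k : 'I_r) := (k < L)%N && ((ray_pair true k m < 0) || (ray_pair false k m < 0)).
  pose i := [arg max_(k > j | Q k) (k : nat)].
  exists i; rewrite /i; case: arg_maxnP => // k /andP[kL hk] hmax //.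
  split=> // l kl lL; rewrite leNgt; apply/negP => h.
  have : Q l by rewrite /Q lL h.
  by move/hmax => /= hlk; move: kl; rewrite ltnNge hlk.
(* Both pairings negative would give m_j < m_i < 0 for the j with [nx i j], hence m_j < -1. This
   contradicts the choice of [i] if j < L, the bound on m_L if j = L, and the choice of L if j >
   L. *)
have not_both : ~ (ray_pair true i m < 0 /\ ray_pair false i m < 0).
  rewrite pair_plus pair_minus => -[h1 h2].
  have [j nij] : exists j, nx i j.
    apply: contrapT => /forallNP hn; move: h2; rewrite big1; first lia.
    by move=> k /hn.
  move: h2; rewrite (big_pred1 j) => [h2|k]; last first.
    by apply/idP/eqP => [/nx_fun|->//]; apply.
  have mj : m j 0 < -1 by lia.
  have [jL|Lj] := ltnP j L.
    by have := him j (nx_lt nij) jL; rewrite pair_plus; lia.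
  move: Lj; rewrite leq_eqVlt => /orP[/eqP/ord_inj e|/hL e]; last by lia.
  by move: small; rewrite e; lia.
pose bi := ray_pair true i m < 0.
have bineg : ray_pair bi i m < 0 by move: hi; rewrite /bi; case E: (ray_pair true i m < 0) => //= _.
have bipos : 0 <= ray_pair (~~ bi) i m.
  rewrite leNgt; apply/negP => h; apply: not_both.
  by move: h bineg; rewrite /bi; case E: (ray_pair true i m < 0) => //= h h'; rewrite h in E.
exists i, L, bi, bL; split=> // [e|v]; first by rewrite e ltnn in iL.
(* The condition at L kills the i-th coordinate of v, and the condition at [i] makes v a multiple of
   a ray whose i-th coordinate is 1 or -1. *)
move=> [|[_ [t ht]]|//]; first by rewrite leNgt bineg.
by move=> hv; apply: neqL ht _; apply: Lcoord hv bLneg.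
Qed.

(** In the first case of [weight_cases], adding [e] to the index only drops conditions on rays
    opposite to [e], which are void, so [e] is a cone point. In the second, the prism is taken for
    the map that imposes b0 at i0 and b1 at i1: the conditions it drops are void and those it
    imposes force v = 0. *)
Lemma weight_exact m k : exact_at (weight_sheaf m) k.
Proof.
have [[e he]|[i0 [i1 [b0 [b1 [h0 h1 h01 hv]]]]]] := weight_cases m.
  apply: (@cone_exact _ _ _ _ e) => s v hv i b hb.
  have [eb|/negP eb] := boolP (e i == b).
    by apply: hv => e'; rewrite inE => /orP[/eqP ->|/hb //]; apply/eqP.
  constructor 1; have := he i; suff -> : ~~ e i = b by [].
  by move: eb; case: (e i); case: (b).
pose f (e : signs r) : signs r := [ffun i => if i == i0 then b0 else if i == i1 then b1 else e i].
apply: (@prism_exact _ _ f).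
- by move=> s _; exact: weight_sheaf_sub.
- move=> s1 x s2 v hv' i b hb.
  have free j c : 0 <= ray_pair (~~ c) j m -> (forall e, f e j = c) -> j = i -> ray_ok m b i v.
    move=> hj hc ji; have [bc|/negP bc] := boolP (b == c); last first.
      constructor 1; rewrite -ji; suff -> : b = ~~ c by [].
      by move: bc; case: (b); case: (c).
    apply: hv' => e; rewrite mem_cat inE => /or3P[es|/eqP ->|].
    + by apply: hb; rewrite mem_cat es.
    + by apply: hb; rewrite mem_cat inE eqxx orbT.
    + by case/mapP => e' _ ->; rewrite -ji hc; apply/esym/eqP.
  have [e0|n0] := eqVneq i i0.
    by apply: (free i0 b0) => // e; rewrite ffunE eqxx.
  have [e1|n1] := eqVneq i i1.
    apply: (free i1 b1) => // e; rewrite ffunE eqxx.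
    by rewrite -e1 (negPf n0).
  apply: hv' => e; rewrite mem_cat inE => /or3P[es|/eqP ->|].
  + by apply: hb; rewrite mem_cat es.
  + by apply: hb; rewrite mem_cat inE eqxx orbT.
  + case/mapP => e' es ->; rewrite ffunE (negPf n0) (negPf n1).
    by apply: hb; rewrite mem_cat; apply/orP; right.
- move=> [|x s] v // _ hv'; apply: hv; apply: hv' => e /mapP[e' _ ->].
    by rewrite ffunE eqxx.
  rewrite ffunE eqxx; case: eqP => // /h01 ->.
Qed.

End Rays.

(** * Acyclicity of affine charts for the tangent sheaf *)

Section Serre.
Variables (r : nat) (nx : rel 'I_r) (R : realType).
Local Notation K := R[i].
Local Notation P := {mpoly K[r]}.
Variables (X : fspace K) (phi : signs r -> ('I_r -> K) -> X).
Hypothesis atl : bott_atlas nx phi.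
Variables (F : fieldType) (tofrac : {rmorphism P -> F}).
Hypothesis tofrac_inj : injective tofrac.
Hypothesis fracP : forall f : F, exists a b : P, b != 0 /\ f = tofrac a / tofrac b.
Let nx_lt := ba_lt atl.
Local Notation gena := (gena nx_lt tofrac_inj).
Local Notation iota := (cox_iota nx_lt tofrac_inj).
Local Notation Der := (Der fracP).
Local Notation plus := (plus r).
Local Notation vat := (vat atl tofrac_inj).
Local Notation regat := (regat atl tofrac_inj).
Local Notation stalk := (stalk atl tofrac_inj fracP).
Local Notation prin := (prin phi).
Local Notation prinP := (prinP atl tofrac_inj).
Local Notation vatP := (vatP atl tofrac_inj).

Lemma iota_neq0 e p : p != 0 -> iota e p != 0.
Proof. by apply: contraNneq => /iota_inj ->. Qed.

Lemma neq0_pt (p : P) a : p.@[a] != 0 -> p != 0.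
Proof. by apply: contraNneq => ->; rewrite meval0. Qed.

Lemma iota_val e a p : vat (phi e a) (iota e p) p.@[a].
Proof. by rewrite vatP; exact: valc_iota. Qed.

Lemma regat_frac e a p q : q.@[a] != 0 -> regat (phi e a) (iota e p / iota e q).
Proof. by move=> qa; exists (p.@[a] / q.@[a]); rewrite vatP; exact: valc_intro. Qed.

(** The denominators of [f] form an ideal all of whose zeros lie on g = 0, so the Nullstellensatz
    finds a power of [g] among them. *)
Lemma loc_frac e (g : P) f : g != 0 ->
  (forall a, g.@[a] != 0 -> regat (phi e a) f) ->
  exists k p, f = iota e p / iota e (g ^+ k).
Proof.
move=> g0 h; pose I : set P := [set q | exists p, iota e q * f = iota e p].
have iI : ideal I.
  split.
  - by exists 0; rewrite /cox_iota !rmorph0 mul0r.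
  - by move=> p q [a ha] [b hb]; exists (a + b); rewrite !iotaD mulrDl ha hb.
  - by move=> p q [b hb]; exists (p * b); rewrite !iotaM -mulrA hb.
have [|k [p hp]] := @nullstellensatz R r I g iI.
  move=> x hx; apply/eqP; apply: contrapT => /negP /h[v /vatP[p [q [qx q0 ef _]]]].
  by case/negP: qx; apply/eqP/hx; exists p; rewrite ef mulrC divfK.
exists k, p; apply: (mulIf (iota_neq0 e (expf_neq0 k g0))).
by rewrite divfK ?iota_neq0 ?expf_neq0 // mulrC.
Qed.

(** The components of [d] have a power of g h as denominator, and a high power of [h] leaves only
    [g]. The claim is made for all large M so that one exponent can serve for finitely many
    derivations. *)
Lemma stalk_clear e (g h : P) d : g != 0 -> h != 0 ->
  (forall a, (g * h).@[a] != 0 -> stalk (phi e a) d) ->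
  exists N, forall M, (N <= M)%N -> forall a, g.@[a] != 0 ->
    stalk (phi e a) (iota e (h ^+ M) *: d).
Proof.
move=> g0 h0 hd.
have /choice[N hN] i : exists N, forall M, (N <= M)%N -> forall a, g.@[a] != 0 ->
    regat (phi e a) (iota e (h ^+ M) * Der d (gena e i)).
  have [||k [p ef]] := @loc_frac e (g * h) (Der d (gena e i)).
  - exact: mulf_neq0.
  - by move=> a /hd /stalkP.
  exists k => M kM a ga.
  have -> : iota e (h ^+ M) * Der d (gena e i) = iota e (h ^+ (M - k) * p) / iota e (g ^+ k).
    rewrite ef -{1}(subnK kM) exprD exprMn !iotaM invfM.
    have := iota_neq0 e (expf_neq0 k h0); have := iota_neq0 e (expf_neq0 k g0).
    move: (iota e (h ^+ (M - k))) (iota e (h ^+ k)) (iota e p) (iota e (g ^+ k)).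
    by move=> A B C D D0 B0; field; apply/andP.
  by apply: regat_frac; rewrite rmorphXn expf_neq0.
exists (\max_i N i) => M NM a ga; apply/stalkP => i.
by rewrite Der_scale; apply: hN => //; exact: leq_trans (leq_bigmax i) NM.
Qed.

(** On the overlap of the two charts [q] is a fraction p / m^k, where m is the product of the
    coordinates at which the signs differ. *)
Lemma prin_chart e e' q : exists h : P, forall a, prin e' q (phi e a) <-> h.@[a] != 0.
Proof.
pose m : P := \prod_(i | e i != e' i) 'X_i.
have mP a : m.@[a] != 0 <-> prin e' 1 (phi e a).
  rewrite rmorph_prod /=; split=> [/prodf_neq0 h|[b /(ba_eq atl)[lam hl] _]].
    have [|b [lam hl]] := @cox_change _ _ nx_lt _ e a e'.
      by move=> i /h; rewrite mevalXU.
    by exists b; [apply/(ba_eq atl); exists lam|rewrite meval1 oner_neq0].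
  apply/prodf_neq0 => i ei; rewrite mevalXU.
  by apply: (cox_rel_neq0 (cox_relV hl)); rewrite eq_sym.
have m0 : m != 0.
  by apply/prodf_neq0 => i _; rewrite -(embed_eq0 tofrac_inj) genx_neq0.
have [|k [p ef]] := @loc_frac e m (iota e' q) m0.
  by move=> a /mP[b -> _]; exists q.@[b]; exact: iota_val.
exists (m * p) => a; rewrite mevalM mulf_eq0 negb_or; split.
  move=> [b eb qb]; have ma : m.@[a] != 0.
    by apply/mP; exists b => //; rewrite meval1 oner_neq0.
  apply/andP; split=> //; apply: contraNneq qb => pa.
  have mk : (m ^+ k).@[a] != 0 by rewrite rmorphXn expf_neq0.
  have h1 := iota_val e' b q; rewrite -eb ef in h1.
  have h2 : vat (phi e a) (iota e p / iota e (m ^+ k)) (p.@[a] / (m ^+ k).@[a]).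
    by rewrite vatP; exact: valc_intro.
  by rewrite (vat_inj h1 h2) pa mul0r.
move=> /andP[ma pa]; have /mP[b eb _] := ma; exists b => //.
have mk : (m ^+ k).@[a] != 0 by rewrite rmorphXn expf_neq0.
have h1 := iota_val e' b q; rewrite -eb ef in h1.
have h2 : vat (phi e a) (iota e p / iota e (m ^+ k)) (p.@[a] / (m ^+ k).@[a]).
  by rewrite vatP; exact: valc_intro.
by rewrite (vat_inj h1 h2) mulf_neq0 // invr_eq0.
Qed.

(** A partition of unity on the affine open set where [g] does not vanish. *)
Lemma unity (J : finType) (g : P) (h : J -> P) N :
  (forall a, g.@[a] != 0 -> exists j, (h j).@[a] != 0) ->
  exists M (c : J -> P), g ^+ M = \sum_j c j * h j ^+ N.
Proof.
move=> hc; pose I : set P := [set q | exists c : J -> P, q = \sum_j c j * h j ^+ N].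
have iI : ideal I.
  split.
  - by exists (fun=> 0); rewrite big1 // => j _; rewrite mul0r.
  - move=> p q [c ->] [c' ->]; exists (fun j => c j + c' j).
    by rewrite -big_split; apply: eq_bigr => j _; rewrite mulrDl.
  - move=> p q [c ->]; exists (fun j => p * c j).
    by rewrite mulr_sumr; apply: eq_bigr => j _; rewrite mulrA.
have [|M [c hM]] := @nullstellensatz R r I g iI; last by exists M, c.
move=> x hx; apply/eqP; apply: contrapT => /negP /hc[j hj].
have : (h j ^+ N).@[x] = 0.
  apply: hx; exists (fun j' => (j' == j)%:R); rewrite (bigD1 j) //= eqxx mul1r big1 ?addr0 //.
  by move=> j' /negPf ->; rewrite mul0r.
by move/eqP; rewrite rmorphXn /= expf_eq0 (negPf hj) andbF.
Qed.

Section Cover.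
Variables (J : finType) (tau : J -> signs r) (q : J -> P).
Local Notation W j := (prin (tau j) (q j)).
Hypothesis Wcov : forall x, exists j, W j x.
Hypothesis q0 : forall j, q j != 0.

Definition double (u : seq (signs r)) (s : seq J) : set 'rV[F]_r :=
  [set d | forall x, (forall e, e \in u -> prin e 1 x) -> (forall j, j \in s -> W j x) ->
     stalk x d].

Lemma double_sub u s : subgroup (double u s).
Proof.
split; first by move=> x _ _; exact: (stalk_sub _ _ _ _).1.
by move=> d d' h h' x hu hs; apply: (stalk_sub _ _ _ _).2; [exact: h|exact: h'].
Qed.

Lemma double_mono u u' s s' : {subset u <= u'} -> {subset s <= s'} ->
  double u s `<=` double u' s'.
Proof. by move=> uu ss d h x hu hs; apply: h => [e /uu/hu|j /ss/hs]. Qed.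

Lemma prin1 e a : prin e 1 (phi e a).
Proof. by apply/prinP; rewrite meval1 oner_neq0. Qed.

Lemma double_glue s d : (forall e, double [:: e] s d) -> double [::] s d.
Proof.
move=> h x _ hs; have [e [a ex]] := ba_surj atl x.
by apply: (h e) => // e'; rewrite inE => /eqP ->; rewrite ex; exact: prin1.
Qed.

Lemma charts_prin e (u : seq (signs r)) : exists g : P, g != 0 /\
  forall a, (forall e', e' \in u -> prin e' 1 (phi e a)) <-> g.@[a] != 0.
Proof.
suff [g hg] : exists g : P, forall a,
    (forall e', e' \in u -> prin e' 1 (phi e a)) <-> g.@[a] != 0.
  exists g; split=> //.
  have pt : all_vars r R != 0 := all_vars_neq0 tofrac_inj.
  have [a /all_varsP a0] := mpoly_nz_pt pt; apply: (@neq0_pt _ a); apply/hg => e' _.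
  have [|b [lam hl]] := @cox_change _ _ nx_lt _ e a e'; first by [].
  by exists b; [apply/(ba_eq atl); exists lam|rewrite meval1 oner_neq0].
elim: u => [|e' u [g hg]]; first by exists 1 => a; rewrite meval1 oner_neq0.
have [h hh] := prin_chart e e' 1; exists (h * g) => a.
rewrite mevalM mulf_eq0 negb_or; split=> [hu|/andP[/hh h1 /hg h2] e''].
  apply/andP; split; first by apply/hh/hu; rewrite inE eqxx.
  by apply/hg => e'' e''u; apply: hu; rewrite inE e''u orbT.
by rewrite inE => /orP[/eqP ->|/h2].
Qed.

(** The usual argument for quasi-coherent sheaves on affine schemes: with g^M = sum of c_j h_j^N,
    the sum over j of (c_j / g^M) h_j^N c(j :: s) is a primitive. The factor h_j^N removes the poles
    of c(j :: s) along h_j = 0. *)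
Lemma serre u k : (0 < size u)%N -> exact_at (double u) k.
Proof.
case: u => [//|e u] _ c [cF c0].
have [g [g0 hg]] := charts_prin e (e :: u).
have /choice[h hh] j := prin_chart e (tau j) (q j).
have hn0 j : h j != 0.
  have [a qa] := mpoly_nz_pt (q0 j).
  have o1 : opn (W j) := opn_prin atl tofrac_inj _ _.
  have o2 := opn_prin atl tofrac_inj e 1.
  have w1 : W j (phi (tau j) a) by exists a.
  have [x [Wx [b eb _]]] := opn_meet atl tofrac_inj o1 o2 w1 (prin1 e (fun=> 0)).
  by apply: (@neq0_pt _ b); apply/hh; rewrite -eb.
pose H (s : seq J) := \prod_(j <- s) h j.
have Hn0 s : H s != 0 by rewrite /H prodf_seq_neq0; apply/allP => j _; rewrite hn0.
have HP s a : (H s).@[a] != 0 <-> forall j, j \in s -> W j (phi e a).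
  rewrite rmorph_prod /= prodf_seq_neq0; split=> [/allP hs j /hs /=/hh //|hs].
  by apply/allP => j /hs /hh.
have dP s d : double (e :: u) s d <->
    forall a, (g * H s).@[a] != 0 -> stalk (phi e a) d.
  split=> hd => [a|x hu hs].
    by rewrite mevalM mulf_eq0 negb_or => /andP[/hg ga /HP Ha]; apply: hd.
  have [a ex _] := hu e (mem_head _ _); rewrite ex in hu hs *; apply: hd.
  by rewrite mevalM mulf_neq0 //; [apply/hg|apply/HP].
(* There are finitely many tuples of length k and indices j, so one exponent suffices. *)
have [N hN] : exists N, forall s j, size s = k -> forall a, (g * H s).@[a] != 0 ->
    stalk (phi e a) (iota e (h j ^+ N) *: c (j :: s)).
  have /choice[N hN] (sj : k.-tuple J * J) : exists N, forall M, (N <= M)%N ->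
      forall a, (g * H sj.1).@[a] != 0 ->
      stalk (phi e a) (iota e (h sj.2 ^+ M) *: c (sj.2 :: sj.1)).
    apply: stalk_clear => //; first exact: mulf_neq0.
    move=> a ga; apply: (dP (sj.2 :: sj.1) _).1.
      by apply: cF; rewrite /= size_tuple.
    by move: ga; rewrite /H big_cons -mulrA [h _ * _]mulrC.
  exists (\max_sj N sj) => s j ks.
  have e1 : s = tval (Tuple (introT eqP ks)) by [].
  by have := hN (Tuple (introT eqP ks), j) _ (leq_bigmax _).
have [|M [cc hM]] := @unity J g h N.
  by move=> a ga; have [j Wj] := Wcov (phi e a); exists j; apply/hh.
have gM0 : iota e (g ^+ M) != 0 by rewrite iota_neq0 // expf_neq0.
exists (fun s => \sum_j (iota e (cc j) / iota e (g ^+ M) * iota e (h j ^+ N)) *: c (j :: s)).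
split=> s ks.
  apply/dP => a ga; apply: (big_ind (fun d => stalk (phi e a) d)).
  - exact: (stalk_sub _ _ _ _).1.
  - by move=> d d'; apply: subgroupD; exact: stalk_sub.
  - move=> j _; rewrite -scalerA; apply: stalk_scale; last exact: hN.
    apply: regat_frac; rewrite rmorphXn expf_neq0 //.
    by move: ga; rewrite mevalM mulf_eq0 negb_or => /andP[].
rewrite (dif_sum (index_enum J) (fun j t =>
   (iota e (cc j) / iota e (g ^+ M) * iota e (h j ^+ N)) *: c (j :: t))).
have cj j : dif (fun t => c (j :: t)) s = c s.
  have := c0 (j :: s); rewrite /= ks => /(_ erefl)/eqP.
  by rewrite subr_eq0 => /eqP.
under eq_bigr => j _ do rewrite dif_scale cj.
rewrite -scaler_suml -[RHS]scale1r; congr (_ *: _).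
under eq_bigr => j _ do rewrite mulrAC -iotaM.
rewrite -mulr_suml -(mulfV gM0) {2}hM; congr (_ / _).
by rewrite /cox_iota raddf_sum.
Qed.

Lemma exact_cover k : (0 < k)%N ->
  (forall k, (0 < k)%N -> exact_at (double^~ [::]) k) -> exact_at (double [::]) k.
Proof.
move=> k0 hV; have [j0 _] := Wcov (phi plus (fun=> 0)).
apply: (exact_of_double plus j0) k0.
- exact: double_sub.
- exact: double_mono.
- exact: double_glue.
- exact: serre.
(* For nonempty [s] the intersection lies in the chart [tau j], which is then a cone point for the
   standard cover. *)
- move=> [|j s] k' k0'; first exact: hV.
  apply: (@cone_exact _ _ _ _ (tau j)) => u d hd x hu hs.
  apply: hd => // e; rewrite inE => /orP[/eqP ->|/hu //].
  have [a -> _] := hs j (mem_head _ _); exact: prin1.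
Qed.

End Cover.
End Serre.

Lemma dif_additive (E E' : zmodType) (J : eqType) (f : E -> E') (c : seq J -> E) s :
  f 0 = 0 -> (forall x y, f (x - y) = f x - f y) -> dif (f \o c) s = f (dif c s).
Proof.
move=> f0 fB; elim: s c => [|x s IH] c /=; first by rewrite f0.
by rewrite fB; congr (_ - _); exact: IH.
Qed.

(** * Weight decomposition over the standard cover *)

Section Toric.
Variables (r : nat) (nx : rel 'I_r) (R : realType).
Local Notation K := R[i].
Local Notation P := {mpoly K[r]}.
Variables (X : fspace K) (phi : signs r -> ('I_r -> K) -> X).
Hypothesis atl : bott_atlas nx phi.
Hypothesis nx_fun : forall i j j', nx i j -> nx i j' -> j = j'.
Variables (F : fieldType) (tofrac : {rmorphism P -> F}).
Hypothesis tofrac_inj : injective tofrac.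
Hypothesis fracP : forall f : F, exists a b : P, b != 0 /\ f = tofrac a / tofrac b.
Let nx_lt := ba_lt atl.
Local Notation gena := (gena nx_lt tofrac_inj).
Local Notation iota := (cox_iota nx_lt tofrac_inj).
Local Notation Der := (Der fracP).
Local Notation DerC := (DerC tofrac_inj fracP).
Local Notation DerM := (DerM tofrac_inj fracP).
Local Notation DerX := (DerX tofrac_inj fracP).
Local Notation plus := (plus r).
Local Notation genx := (genx tofrac).
Local Notation vat := (vat atl tofrac_inj).
Local Notation regat := (regat atl tofrac_inj).
Local Notation stalk := (stalk atl tofrac_inj fracP).
Local Notation prin := (prin phi).
Local Notation rays := (rays nx).
Local Notation pair := (ray_pair nx).
Local Notation kray := (kray nx K).
Local Notation weight_sheaf := (@weight_sheaf r nx K).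
Local Notation charts_sheaf u :=
  [set d | forall x, (forall e, e \in u -> prin e 1 x) -> stalk x d].

Definition kf (c : K) : F := tofrac c%:MP.

Lemma kfD c d : kf (c + d) = kf c + kf d. Proof. by rewrite /kf mpolyCD rmorphD. Qed.
Lemma kfM c d : kf (c * d) = kf c * kf d. Proof. by rewrite /kf mpolyCM rmorphM. Qed.
Lemma kf0 : kf 0 = 0. Proof. by rewrite /kf mpolyC0 rmorph0. Qed.
Lemma kf1 : kf 1 = 1. Proof. by rewrite /kf mpolyC1 rmorph1. Qed.
Lemma kfN c : kf (- c) = - kf c. Proof. by rewrite /kf mpolyCN rmorphN. Qed.
Lemma kf_int (z : int) : kf z%:~R = z%:~R.
Proof. by rewrite -[RHS](rmorph_int (tofrac \o (@mpolyC r K))). Qed.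

Definition mon (m : 'cV[int]_r) : F := \prod_k genx k ^ m k 0.
Definition cm e (n : 'cV[int]_r) : F := \prod_i gena e i ^ n i 0.

Lemma prod_expz (I : Type) (s : seq I) (f : F) (z : I -> int) : f != 0 ->
  \prod_(i <- s) f ^ z i = f ^ \sum_(i <- s) z i.
Proof.
move=> f0; elim: s => [|i s IH]; first by rewrite !big_nil.
by rewrite !big_cons IH expfzDr.
Qed.

Lemma prod_delta (f : 'I_r -> F) k : \prod_i f i ^ ((k == i)%:R : int) = f k.
Proof.
rewrite (bigD1 k) //= eqxx big1 ?mulr1 // => i ik.
by rewrite eq_sym (negPf ik).
Qed.

Lemma genx_cm e k : genx k = \prod_i gena e i ^ rays e i k.
Proof.
have h := genP nx_lt tofrac_inj e; have [m0 hz hy] := h k.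
have mu i : genmu nx_lt tofrac_inj e i = zcox e (gena e) i.
  by have [_ -> _] := h i; rewrite /zcox ffunE mulr1.
have z0 i : zcox e (gena e) i != 0 by rewrite -mu; case: (h i).
transitivity (\prod_i (ycox e (gena e) i ^ ((k == i)%:R : int) *
    zcox e (gena e) i ^ ((nx i k)%:R : int) * (zcox e (gena e) i)^-1 ^ ((k == i)%:R : int))).
  rewrite !big_split /= (prod_delta (ycox e (gena e))).
  rewrite (prod_delta (fun i => (zcox e (gena e) i)^-1)).
  have -> : \prod_i zcox e (gena e) i ^ ((nx i k)%:R : int) =
      \prod_(i | nx i k) genmu nx_lt tofrac_inj e i.
    rewrite [RHS]big_mkcond; apply: eq_bigr => i _.
    by case: (nx i k); rewrite ?expr1z ?mu.
  by rewrite hy -mu {1}/ycox ffunE mulrAC mulfV // mul1r.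
apply: eq_bigr => i _; rewrite !mxE /ycox /zcox; case: ifP => _.
  by rewrite invr1 !exp1rz !mulr1.
by rewrite exp1rz mul1r exprz_inv -expfzDr // gena_neq0.
Qed.

Lemma genx_n0 k : genx k != 0. Proof. exact: genx_neq0. Qed.

(** The order of the character x^m along the divisor of a ray is the pairing of m with that ray. *)
Lemma mon_cm e m : mon m = cm e (rays e *m m).
Proof.
rewrite /mon /cm; under eq_bigr => k _ do rewrite (genx_cm e k).
have -> : \prod_k (\prod_i gena e i ^ rays e i k) ^ m k 0 =
    \prod_k \prod_i gena e i ^ (rays e i k * m k 0).
  apply: eq_bigr => k _; rewrite (big_morph (fun x : F => x ^ m k 0)
    (id1 := 1) (op1 := *%R)); last by rewrite exp1rz.
    by apply: eq_bigr => i _; rewrite exprz_exp.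
  by move=> x y; rewrite expfzMl.
rewrite exchange_big; apply: eq_bigr => i _ /=.
by rewrite prod_expz ?gena_neq0 // mxE.
Qed.

Lemma cm_mon e n : cm e n = mon (invmx (rays e) *m n).
Proof. by rewrite (mon_cm e) mulKVmx // rays_unit. Qed.

Lemma cmD e n n' : cm e (n + n') = cm e n * cm e n'.
Proof.
rewrite -big_split; apply: eq_bigr => i _ /=.
by rewrite mxE expfzDr // gena_neq0.
Qed.

Lemma cm_neq0 e n : cm e n != 0.
Proof. by apply/prodf_neq0 => i _; rewrite expfz_neq0 // gena_neq0. Qed.

Lemma mon_neq0 m : mon m != 0.
Proof. by rewrite (mon_cm plus) cm_neq0. Qed.

Definition delta i : 'cV[int]_r := delta_mx i 0.

Lemma gena_cm e i : gena e i = cm e (delta i).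
Proof.
rewrite -[LHS](prod_delta (gena e)); apply: eq_bigr => j _.
by rewrite mxE eqxx andbT eq_sym.
Qed.

Definition dl d f : F := Der d f / f.

Lemma dlM d f g : f != 0 -> g != 0 -> dl d (f * g) = dl d f + dl d g.
Proof. by move=> f0 g0; rewrite /dl DerM; field; apply/andP. Qed.

Lemma dl1 d : dl d 1 = 0.
Proof. by rewrite /dl -kf1 DerC mul0r. Qed.

Lemma dlV d f : f != 0 -> dl d f^-1 = - dl d f.
Proof.
move=> f0; apply/eqP; rewrite -addr_eq0 addrC -dlM ?invr_eq0 //.
by rewrite mulfV // dl1.
Qed.

Lemma dlXz d f (z : int) : f != 0 -> dl d (f ^ z) = dl d f *~ z.
Proof.
move=> f0; have pos n : dl d (f ^+ n) = dl d f *+ n.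
  elim: n => [|n IH]; first by rewrite expr0 dl1 mulr0n.
  by rewrite exprS dlM ?expf_neq0 // IH mulrS.
case: z => n; first exact: pos.
by rewrite NegzE mulrNz -exprz_inv exprz_inv -invr_expz dlV ?expf_neq0 // pos.
Qed.

Lemma dl_prod d (f : 'I_r -> F) (z : 'I_r -> int) : (forall i, f i != 0) ->
  dl d (\prod_i f i ^ z i) = \sum_i dl d (f i) *~ z i.
Proof.
move=> f0; suff [] : \prod_i f i ^ z i != 0 /\
  dl d (\prod_i f i ^ z i) = \sum_i dl d (f i) *~ z i by [].
apply: (big_ind2 (fun x y => x != 0 /\ dl d x = y)) => [|x y x' y' [x0 <-] [x0' <-]|i _].
- by rewrite oner_neq0 dl1.
- by rewrite mulf_neq0 // dlM.
- by rewrite expfz_neq0 // dlXz.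
Qed.

Lemma der_ext e d d' : (forall i, Der d (gena e i) = Der d' (gena e i)) -> d = d'.
Proof.
move=> h; apply/rowP => k; rewrite -!DerX -/(genx k).
suff : dl d (genx k) = dl d' (genx k).
  by move/(mulIf _); apply; rewrite invr_eq0 genx_n0.
rewrite (genx_cm e k) !dl_prod; try exact: gena_neq0.
by apply: eq_bigr => i _; rewrite /dl h.
Qed.

(** The vector field x^m times the sum of v_k x_k d/dx_k, of weight m. *)
Definition tv (m : 'cV[int]_r) (v : 'rV[K]_r) : 'rV[F]_r :=
  \row_k (kf (v 0 k) * mon m * genx k).

Lemma tvB m v w : tv m (v - w) = tv m v - tv m w.
Proof. by apply/rowP => k; rewrite !mxE kfD kfN !mulrBl. Qed.

Lemma tv0 m : tv m 0 = 0.
Proof. by apply/rowP => k; rewrite !mxE kf0 !mul0r. Qed.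

Lemma tvD m v w : tv m (v + w) = tv m v + tv m w.
Proof. by apply/rowP => k; rewrite !mxE kfD !mulrDl. Qed.

Definition dot (v : 'rV[K]_r) (n : 'cV[int]_r) : K := \sum_k v 0 k * (n k 0)%:~R.

Lemma Der_tv m v n : Der (tv m v) (mon n) = kf (dot v n) * mon m * mon n.
Proof.
suff : dl (tv m v) (mon n) = kf (dot v n) * mon m.
  by move=> <-; rewrite divfK // mon_neq0.
rewrite {1}/mon dl_prod; last exact: genx_n0.
rewrite (big_morph kf kfD kf0) mulr_suml; apply: eq_bigr => k _ /=.
rewrite /dl DerX mxE mulfK ?genx_n0 // -mulrzr kfM kf_int; ring.
Qed.

Lemma dot_kray t b i n : dot (t *: kray b i) n = t * (pair b i n)%:~R.
Proof.
rewrite /dot /ray_pair mxE rmorph_sum mulr_sumr; apply: eq_bigr => k _ /=.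
by rewrite !mxE rmorphM mulrA.
Qed.

Lemma pair_rays (e : signs r) j n : pair (e j) j n = (rays e *m n) j 0.
Proof.
by rewrite /ray_pair !mxE; apply: eq_bigr => k _; rewrite !mxE.
Qed.

Lemma Der_tv_gena e m v i : Der (tv m v) (gena e i) =
  kf (dot v (invmx (rays e) *m delta i)) * cm e (rays e *m m + delta i).
Proof. by rewrite gena_cm cm_mon Der_tv -cm_mon (mon_cm e) cmD mulrA. Qed.

Lemma pair_dual (e : signs r) j i : pair (e j) j (invmx (rays e) *m delta i) = (j == i)%:R.
Proof. by rewrite pair_rays mulKVmx ?rays_unit // mxE eqxx andbT. Qed.

Lemma cm_regat e a (n : 'cV[int]_r) : (forall j, a j = 0 -> 0 <= n j 0) -> regat (phi e a) (cm e n).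
Proof.
move=> h; apply: (big_ind (fun f => regat (phi e a) f)).
- by exists 1; have := vatC atl tofrac_inj (phi e a) 1; rewrite -/(kf 1) kf1.
- by move=> f g [v hv] [w hw]; exists (v * w); exact: vatM.
move=> i _; have hi : vat (phi e a) (gena e i) (a i).
  by have := iota_val atl tofrac_inj e a 'X_i; rewrite iotaX mevalXU.
have pos f v k : vat (phi e a) f v -> vat (phi e a) (f ^+ k) (v ^+ k).
  move=> hf; elim: k => [|k IH]; last by rewrite !exprS; exact: vatM.
  by have := vatC atl tofrac_inj (phi e a) 1; rewrite -/(kf 1) kf1.
have := h i; case: (n i 0) => k hk; first by exists (a i ^+ k); exact: pos.
have ai : a i != 0 by apply/eqP => /hk.
exists (a i ^+ k.+1)^-1; apply: vatV; first by rewrite expf_neq0.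
exact: pos.
Qed.

(** If a coordinate a_j vanishes at the point, the ray of j is common to all charts of [u]. The
    condition on [v] then either keeps the exponent of a_j nonnegative or makes the coefficient
    zero. *)
Lemma stalk_weight u m v : (0 < size u)%N -> weight_sheaf m u v -> charts_sheaf u (tv m v).
Proof.
case: u => // e u _ hv x hx; have [a ex _] := hx e (mem_head _ _).
rewrite ex in hx *; apply/stalkP => i; rewrite Der_tv_gena.
have [-> | c0] := eqVneq (dot v (invmx (rays e) *m delta i)) 0.
  by rewrite kf0 mul0r; exists 0; exact: vat0.
have [w hw] : regat (phi e a) (cm e (rays e *m m + delta i)); last first.
  by eexists; apply: vatM hw; exact: vatC.
apply: cm_regat => j aj; rewrite mxE -pair_rays.
have cj : cst (e :: u) j (e j).
  move=> e' /hx[b /(ba_eq atl)[lam hl] _]; apply/eqP; apply: contraT => ne.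
  by have := cox_rel_neq0 (cox_relV hl) ne; rewrite aj eqxx.
have dj : 0 <= delta i j 0 by rewrite mxE; case: (_ && _).
case: (hv j _ cj) => [h|[-> [t et]]|v0]; first exact: addr_ge0.
  move: c0; rewrite et dot_kray pair_dual mxE eqxx andbT.
  by case: (j == i) => //; rewrite mulr0 eqxx.
by move: c0; rewrite v0 /dot big1 ?eqxx // => k _; rewrite mxE mul0r.
Qed.

Definition mvec (n : 'X_{1..r}) : 'cV[int]_r := \col_i (n i : int).

Lemma iota_cm e p : iota e p = \sum_(n <- msupp p) kf p@_n * cm e (mvec n).
Proof.
rewrite /cox_iota /mmap; apply: eq_bigr => n _; congr (_ * _).
by rewrite /mmap1; apply: eq_bigr => i _; rewrite mxE.
Qed.

(** In the coordinates of one chart of [u], the components of [d] are Laurent polynomials with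
    denominators only in the coordinates whose sign varies over [u]. A monomial times d/da_j is a
    [tv] in the direction of the j-th ray, and the shift by [delta j] in its weight comes from
    d/da_j. *)
Lemma decomp u d : (0 < size u)%N -> charts_sheaf u d ->
  exists T : seq ('cV[int]_r * 'rV[K]_r),
    d = \sum_(t <- T) tv t.1 t.2 /\ forall t, t \in T -> weight_sheaf t.1 u t.2.
Proof.
case: u => // e u _ hd; pose nc i := has (fun e' : signs r => e' i != e i) u.
pose g : P := \prod_(i | nc i) 'X_i.
pose gv : 'cV[int]_r := \col_i (nc i)%:R.
have g0 : g != 0.
  by apply/prodf_neq0 => i _; rewrite -(embed_eq0 tofrac_inj) genx_n0.
have ig k : iota e (g ^+ k) = cm e (gv *+ k).
  elim: k => [|k IH].
    by rewrite expr0 /cox_iota rmorph1 /cm big1 // => i _; rewrite mulr0n mxE.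
  rewrite exprS iotaM IH mulrS cmD; congr (_ * _).
  rewrite /cox_iota rmorph_prod /= big_mkcond; apply: eq_bigr => i _ /=.
  by rewrite mxE -/(iota e _) iotaX; case: (nc i).
have /choice[kp hkp] j : exists kp : nat * P,
    Der d (gena e j) = iota e kp.2 / iota e (g ^+ kp.1).
  have [|k [p hp]] := @loc_frac _ _ _ _ _ atl _ _ tofrac_inj e g (Der d (gena e j)) g0.
    move=> a; rewrite rmorph_prod /= => /prodf_neq0 ha.
    suff /(stalkP atl tofrac_inj fracP) : stalk (phi e a) d by apply.
    apply: hd => e' e'u.
    have [|b [lam hl]] := @cox_change _ _ nx_lt _ e a e'; last first.
      by exists b; [apply/(ba_eq atl); exists lam|rewrite meval1 oner_neq0].
    move=> i ei; have := ha i; rewrite mevalXU; apply.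
    move: e'u; rewrite inE => /orP[/eqP ee|e'u]; first by rewrite ee eqxx in ei.
    by apply/hasP; exists e' => //; rewrite eq_sym.
  by exists (k, p).
pose tm j n := invmx (rays e) *m (mvec n - delta j - gv *+ (kp j).1).
pose T := [seq (tm j n, (kp j).2@_n *: kray (e j) j) | j <- enum 'I_r, n <- msupp (kp j).2].
exists T; split.
  apply: (@der_ext e) => i; rewrite (big_morph (fun d => Der d (gena e i))
    (id1 := 0) (op1 := +%R)); first last.
  - exact: Der_0l.
  - by move=> x y; exact: Der_addl.
  rewrite /T big_allpairs_dep /= big_enum /= (bigD1 i) //= [X in _ + X]big1 ?addr0.
    rewrite hkp ig iota_cm mulr_suml; apply: eq_bigr => n _.
    rewrite Der_tv_gena dot_kray pair_dual eqxx mulr1; rewrite -mulrA; congr (_ * _).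
    rewrite /tm mulKVmx ?rays_unit // addrAC subrK.
    apply: (mulIf (cm_neq0 e (gv *+ (kp i).1))).
    by rewrite divfK ?cm_neq0 // -cmD subrK.
  move=> j ji; rewrite big1 // => n _.
  by rewrite Der_tv_gena dot_kray pair_dual (negPf ji) mulr0 kf0 mul0r.
move=> t /allpairsPdep[j [n [_ _ ->]]] i b cb /=.
have -> : b = e i by rewrite (cb e) // mem_head.
have nci : nc i = false.
  apply/hasP => -[e' e'u]; rewrite (cb e') ?inE ?e'u ?orbT //.
  by rewrite (cb e) ?mem_head // eqxx.
have pe : pair (e i) i (tm j n) = (n i : int) - (i == j)%:R.
  rewrite pair_rays /tm mulKVmx ?rays_unit // !mxE eqxx andbT.
  have -> : (gv *+ (kp j).1) i 0 = 0.
    by elim: (kp j).1 => [|k IH]; rewrite ?mulr0n ?mulrS !mxE ?IH ?nci.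
  by rewrite subr0.
have [ij|nij] := eqVneq i j; last first.
  by constructor 1; rewrite pe (negPf nij) subr0.
case ni : (n i) => [|k]; last by constructor 1; rewrite pe ni ij eqxx; lia.
constructor 2; split; first by rewrite pe ni ij eqxx.
by exists (kp j).2@_n; rewrite ij.
Qed.

(** Multiplication by a high power of all coordinates turns the Laurent monomials into distinct
    ordinary ones. *)
Lemma mon_indep (S : seq 'cV[int]_r) (w : 'cV[int]_r -> 'rV[K]_r) : uniq S ->
  \sum_(m <- S) tv m (w m) = 0 -> forall m, m \in S -> w m = 0.
Proof.
move=> uS hS m0 m0S; apply/rowP => k; rewrite mxE.
pose N := (\sum_(m <- S) \sum_i `|m i 0%R|)%N.
have bN m i : m \in S -> 0 <= m i 0 + N%:Z.
  move=> mS; have : (`|m i 0%R| <= N)%N.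
    rewrite /N (big_rem m) //= (bigD1 i) //= -!addnA; exact: leq_addr.
  lia.
pose q (m : 'cV[int]_r) : 'X_{1..r} := [multinom `|(m i 0 + N%:Z)%R|%N | i < r].
have qinj m m' : m \in S -> m' \in S -> q m = q m' -> m = m'.
  move=> mS mS' /mnmP h; apply/colP => i; have := h i; rewrite !mnmE.
  have := bN m i mS; have := bN m' i mS'; move: (m i 0) (m' i 0) => x y; lia.
have qm m : m \in S -> mon m * mon (const_mx N%:Z) = tofrac 'X_[q m].
  move=> mS; rewrite mpolyXE_id rmorph_prod /mon -big_split; apply: eq_bigr => i _ /=.
  rewrite -expfzDr ?genx_n0 // rmorphXn mnmE !mxE /=.
  by have := bN m i mS; case: (m i 0 + N%:Z).
have : \sum_(m <- S) (w m 0 k) *: 'X_[q m] = 0 :> P.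
  apply: tofrac_inj; rewrite rmorph0 rmorph_sum.
  have := congr1 (fun v : 'rV[F]_r => v 0 k / genx k * mon (const_mx N%:Z)) hS.
  rewrite mxE mul0r mul0r summxE !mulr_suml => {2}<-; rewrite !big_seq.
  apply: eq_bigr => m mS; rewrite !mxE mulfK ?genx_n0 // -mulrA qm //.
  by rewrite -mul_mpolyC rmorphM.
move/(congr1 (fun p : P => p@_(q m0))); rewrite raddf_sum mcoeff0 (big_rem m0) //=.
rewrite mcoeffZ mcoeffX eqxx mulr1 big_seq big1 ?addr0 // => m mS.
rewrite mcoeffZ mcoeffX; case: eqP => [e|_]; last by rewrite mulr0.
have mS' : m \in S := mem_rem mS.
by move: mS; rewrite (qinj _ _ mS' m0S e) mem_rem_uniq // inE eqxx.
Qed.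

(** Only finitely many weights occur in [c], as there are finitely many tuples of charts. By
    independence of the weights each component is a cocycle, to which [weight_exact] applies. *)
Theorem toric_exact k : (0 < k)%N -> exact_at (fun u => charts_sheaf u) k.
Proof.
move=> k0 c [cF c0].
have /choice[T hT] (u : seq (signs r)) : exists T : seq ('cV[int]_r * 'rV[K]_r),
    size u = k.+1 -> c u = \sum_(t <- T) tv t.1 t.2 /\
      forall t, t \in T -> weight_sheaf t.1 u t.2.
  have [su|nu] := eqVneq (size u) k.+1; last by exists [::] => /eqP; rewrite (negPf nu).
  by have [|T hT] := @decomp u (c u) _ (cF u su); [rewrite su|exists T].
pose S := undup (flatten [seq [seq t.1 | t <- T (tval u)] | u <- enum {: k.+1.-tuple (signs r)}]).
have uS : uniq S := undup_uniq _.
pose v u m := \sum_(t <- T u | t.1 == m) t.2.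
have cE u : size u = k.+1 -> c u = \sum_(m <- S) tv m (v u m).
  move=> su; have [-> _] := hT u su.
  transitivity (\sum_(t <- T u) \sum_(m <- S | t.1 == m) tv t.1 t.2).
    rewrite [LHS]big_seq [RHS]big_seq; apply: eq_bigr => t tT.
    rewrite -big_filter; have -> : [seq m <- S | t.1 == m] = [:: t.1].
      have t1S : t.1 \in S.
        rewrite mem_undup; apply/flattenP; exists [seq t.1 | t <- T u]; last first.
          exact: map_f.
        by apply/mapP; exists (Tuple (introT eqP su)); rewrite ?mem_enum.
      apply: perm_small_eq => //; apply: uniq_perm => //; first exact: filter_uniq.
      move=> m; rewrite mem_filter inE eq_sym.
      by case: eqP => // ->.
    by rewrite big_seq1.
  rewrite (exchange_big_dep xpredT) //=; apply: eq_bigr => m _.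
  rewrite (big_morph (tv m) (tvD m) (tv0 m)); apply: eq_bigr => t /eqP -> //.
have vF u m : size u = k.+1 -> weight_sheaf m u (v u m).
  move=> su; have [_ hw] := hT u su.
  rewrite /v big_seq_cond; apply: (big_ind (fun x => weight_sheaf m u x)).
  - exact: (weight_sheaf_sub _ _ _ _).1.
  - by move=> x y; apply: subgroupD; exact: weight_sheaf_sub.
  - by move=> t /andP[/hw + /eqP <-].
have v0 m u : m \in S -> size u = k.+2 -> dif (v^~ m) u = 0.
  move=> mS su; apply: (@mon_indep S (fun m => dif (v^~ m) u)) mS => //.
  rewrite -[RHS](c0 u su).
  rewrite (@dif_eq _ _ k.+1 c (fun t => \sum_(m <- S) tv m (v t m)) u su); last first.
    by move=> t st _; rewrite cE.
  rewrite (dif_sum S (fun m t => tv m (v t m))); apply: eq_bigr => m' _.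
  by rewrite -(dif_additive _ _ (tv0 m') (tvB m')).
have /choice[b hb] m : exists b : seq (signs r) -> 'rV[K]_r, m \in S ->
    (forall u, size u = k -> weight_sheaf m u (b u)) /\
    forall u, size u = k.+1 -> dif b u = v u m.
  have [mS|_] := boolP (m \in S); last by exists (fun=> 0).
  have [|b [bF bE]] := @weight_exact r nx nx_lt nx_fun K m k (v^~ m); last by exists b.
  by split=> u su; [exact: vF|exact: v0].
exists (fun u => \sum_(m <- S) tv m (b m u)); split=> u su.
  rewrite big_seq => x hx; apply: (big_ind (fun d => stalk x d)).
  - exact: (stalk_sub _ _ _ _).1.
  - by move=> y z; apply: subgroupD; exact: stalk_sub.
  - by move=> m mS; apply: stalk_weight hx; [rewrite su|exact: (hb m mS).1].
rewrite cE // (dif_sum S (fun m t => tv m (b m t))) !big_seq; apply: eq_bigr => m mS.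
by rewrite (dif_additive (b m) _ (tv0 m) (tvB m)) (hb m mS).2.
Qed.

End Toric.

(** * Passage to arbitrary finite covers *)

Section Vanishing.
Variables (r : nat) (nx : rel 'I_r) (R : realType).
Local Notation K := R[i].
Local Notation P := {mpoly K[r]}.
Variables (X : fspace K) (phi : signs r -> ('I_r -> K) -> X).
Hypothesis atl : bott_atlas nx phi.
Local Notation prin := (prin phi).

(** Quasi-compactness of an affine chart: the ideal generated by [A] has no zero, hence contains 1,
    which is a combination of finitely many elements of [A]. *)
Lemma finite_subideal (A : P -> Prop) : (forall a, exists2 p, A p & p.@[a] != 0) ->
  exists s : seq P, (forall p, p \in s -> A p) /\ forall a, exists2 p, p \in s & p.@[a] != 0.
Proof.
move=> hA; pose I : set P := [set q | exists2 s : seq P, (forall p, p \in s -> A p) &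
  exists c : P -> P, q = \sum_(p <- s) c p * p].
have hI : ideal I.
  split.
  - by exists [::] => //; exists (fun=> 0); rewrite big_nil.
  - move=> q q' [s sA [c ->]] [s' sA' [c' ->]].
    pose S := undup (s ++ s').
    have cA (t : seq P) (d : P -> P) : {subset t <= S} ->
        exists d', \sum_(p <- t) d p * p = \sum_(p <- S) d' p * p.
      move=> tS; exists (fun p => \sum_(p' <- t | p' == p) d p').
      transitivity (\sum_(p' <- t) \sum_(p <- S | p' == p) d p' * p'); last first.
        rewrite (exchange_big_dep xpredT) //=; apply: eq_bigr => p _.
        by rewrite mulr_suml; apply: eq_bigr => p' /eqP ->.
      rewrite [LHS]big_seq [RHS]big_seq; apply: eq_bigr => p' p't.
      rewrite -big_filter; have -> : [seq p <- S | p' == p] = [:: p'].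
        apply: perm_small_eq => //; apply: uniq_perm => //.
          by rewrite filter_uniq // undup_uniq.
        move=> x; rewrite mem_filter inE eq_sym.
        by case: eqP => // ->; rewrite tS.
      by rewrite big_seq1.
    exists S; first by move=> p; rewrite mem_undup mem_cat => /orP[/sA|/sA'].
    have [|d ->] := cA s c; first by move=> p ps; rewrite mem_undup mem_cat ps.
    have [|d' ->] := cA s' c'; first by move=> p ps; rewrite mem_undup mem_cat ps orbT.
    exists (fun p => d p + d' p); rewrite -big_split; apply: eq_bigr => p _.
    by rewrite mulrDl.
  - move=> p q [s sA [c ->]]; exists s => //; exists (fun x => p * c x).
    by rewrite mulr_sumr; apply: eq_bigr => x _; rewrite mulrA.
have [|k [s sA [c hs]]] := @nullstellensatz R r I 1 hI.
  move=> x hx; have [p Ap] := hA x; rewrite (hx p) ?eqxx //.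
  exists [:: p]; first by move=> p'; rewrite inE => /eqP ->.
  by exists (fun=> 1); rewrite big_seq1 mul1r.
exists s; split=> // a; apply: contrapT => h.
have : (1 ^+ k : P).@[a] == 0.
  rewrite hs raddf_sum big_seq big1 //= => p ps; rewrite mevalM.
  suff -> : p.@[a] = 0 by rewrite mulr0.
  by apply/eqP; apply: contrapT => /negP pa; apply: h; exists p.
by rewrite expr1n meval1 oner_eq0.
Qed.

(** Zero polynomials are discarded, so that all members of the refinement, and by irreducibility all
    their finite intersections, are nonempty. *)
Lemma refine (I : Type) (U : I -> set X) : (forall i, opn (U i)) ->
  (forall x, exists i, U i x) ->
  exists (J : finType) (tau : J -> signs r) (q : J -> P) (t : J -> I),
  [/\ forall x, exists j, prin (tau j) (q j) x, forall j, q j != 0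
    & forall j, prin (tau j) (q j) `<=` U (t j)].
Proof.
move=> oU cU.
have /choice[s hs] e : exists s : seq P,
    (forall p, p \in s -> exists i, prin e p `<=` U i) /\
    forall a, exists2 p, p \in s & p.@[a] != 0.
  apply: finite_subideal => a; have [i Ui] := cU (phi e a).
  have /(ba_opn atl) oUi := oU i; have [p [pa hp]] := oUi e a Ui.
  by exists p => //; exists i => x [b -> /hp].
have hp (ep : {e : signs r & seq_sub (s e)}) : ssval (tagged ep) \in s (tag ep).
  exact: ssvalP.
pose J0 := {e : signs r & seq_sub (s e)}.
pose J : finType := {j : J0 | ssval (tagged j) != 0}.
pose jv (j : J) : J0 := sval j.
have /choice[t ht] (j : J) : exists i, prin (tag (jv j)) (ssval (tagged (jv j))) `<=` U i.
  by apply: (hs _).1; exact: hp.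
exists J, (fun j => tag (jv j)), (fun j => ssval (tagged (jv j))), t; split=> //.
  move=> x; have [e [a ->]] := ba_surj atl x.
  have [p ps pa] := (hs e).2 a.
  have p0 : p != 0 by apply: contraNneq pa => ->; rewrite meval0.
  by exists (exist _ (Tagged (fun e => seq_sub (s e)) (SeqSub ps)) p0 : J); exists a.
by move=> j; exact: (valP j).
Qed.

Variables (F : fieldType) (tofrac : {rmorphism P -> F}).
Hypothesis tofrac_inj : injective tofrac.
Hypothesis fracP : forall f : F, exists a b : P, b != 0 /\ f = tofrac a / tofrac b.
Hypothesis nx_fun : forall i j j', nx i j -> nx i j' -> j = j'.
Local Notation rep := (rep atl tofrac_inj fracP).
Local Notation act := (act atl tofrac_inj fracP).
Local Notation double := (double atl tofrac_inj fracP).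

Lemma codom_ord (J : Type) k (s : 'I_k.+1 -> J) :
  codom s = s ord0 :: codom (s \o lift ord0).
Proof. by rewrite !codomE enum_ordSl /= -map_comp. Qed.

(** The bridge from cochains on functions of ordinals, with explicit signs, to cochains on lists. *)
Lemma dif_codom (J : eqType) (E : lmodType F) p (s : 'I_p.+1 -> J) (c : seq J -> E) :
  dif c (codom s) = \sum_(j < p.+1) (-1) ^+ j *: c (codom (s \o lift j)).
Proof.
elim: p s c => [|p IH] s c.
  rewrite big_ord_recl big_ord0 addr0 expr0 scale1r codom_ord /=.
  have -> : codom (s \o lift ord0) = [::] by apply: size0nil; rewrite size_codom card_ord.
  by rewrite /= subr0.
rewrite codom_ord [RHS]big_ord_recl expr0 scale1r /=; congr (_ + _).
rewrite IH -sumrN; apply: eq_bigr => i _.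
rewrite /bump leq0n exprS mulN1r scaleNr; congr (- (_ *: c _)).
rewrite [RHS]codom_ord; congr (_ :: _).
  by congr s; apply: val_inj.
rewrite !codomE; apply: eq_map => j /=; congr s; apply: val_inj => /=.
by rewrite /bump /= !add1n ltnS; case: (i <= j)%N.
Qed.

Lemma meet_opn (J : Type) (W : J -> set X) k (s : 'I_k.+1 -> J) :
  (forall j, opn (W j)) -> opn (meet W s).
Proof.
move=> oW; elim: k s => [|k IH] s.
  have -> : meet W s = W (s ord0); last exact: oW.
  by apply/seteqP; split=> x h => [|j]; [exact: h|rewrite (ord1 j)].
have -> : meet W s = W (s ord0) `&` meet W (s \o lift ord0).
  apply/seteqP; split=> x h; first by split=> [|j]; exact: h.
  by move=> j; case: (unliftP ord0 j) => [i ->|->]; [exact: h.2|exact: h.1].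
exact: (opnI atl).
Qed.

(** On a refinement by principal open sets the cocycle becomes a cochain of derivations of the
    function field; [exact_cover] gives a primitive, and [act] turns it back into vector fields. *)
Theorem atlas_vanishing p : (0 < p)%N -> tangent_cohomology_vanishes X p.
Proof.
case: p => // p _ I U c [oU cU] cC cZ.
have [J [tau [q [t [Wcov q0 Wt]]]]] := refine oU cU.
pose W j := prin (tau j) (q j).
have oW j : opn (W j) := opn_prin atl tofrac_inj _ _.
have oM k (s : 'I_k.+1 -> J) := meet_opn s oW.
have WU k (s : 'I_k -> J) : meet W s `<=` meet U (t \o s).
  by move=> x h j; apply/Wt/h.
have M0 k (s : 'I_k.+1 -> J) : meet W s !=set0.
  elim: k s => [|k IH] s.
    have [a qa] := mpoly_nz_pt (q0 (s ord0)).
    by exists (phi (tau (s ord0)) a) => j; rewrite (ord1 j); exists a.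
  have [x hx] := IH (s \o lift ord0); have [a qa] := mpoly_nz_pt (q0 (s ord0)).
  have w1 : W (s ord0) (phi (tau (s ord0)) a) by exists a.
  have [y [h1 h2]] := opn_meet atl tofrac_inj (oW _) (oM _ _) w1 hx.
  by exists y => j; case: (unliftP ord0 j) => [i ->|->] //; exact: h2.
have [j00 _] := Wcov (phi (plus r) (fun=> 0)).
pose fn k (s : seq J) : 'I_k -> J := fun j => nth j00 s j.
have fnK k (f : 'I_k -> J) : fn k (codom f) = f.
  by apply/funext => j; rewrite /fn codomE (nth_map j) ?size_enum_ord // nth_ord_enum.
have codom_fn k (s : seq J) : size s = k -> codom (fn k s) = s.
  move=> ks; apply: (@eq_from_nth _ j00); first by rewrite size_codom card_ord.
  move=> j; rewrite size_codom card_ord => jk.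
  by rewrite -[j]/(nat_of_ord (Ordinal jk)) -/(fn k _ (Ordinal jk)) fnK.
have /choice[ef hef] (s : 'I_p.+2 -> J) : exists e, rep (meet W s) (c (t \o s)) e.
  apply: rep_exists => //; split.
  - by move=> V f oV VW; apply: vf_reg (cC (t \o s)) _ _ oV _ => x /VW/WU.
  - by move=> V f g oV VW; apply: vf_local (cC (t \o s)) _ _ _ oV _ => x /VW/WU.
  - by move=> V a f oV VW; apply: vf_scale (cC (t \o s)) _ _ _ oV _ => x /VW/WU.
  - by move=> V f g oV VW; apply: vf_add (cC (t \o s)) _ _ _ oV _ => x /VW/WU.
  - by move=> V f g oV VW; apply: vf_leibniz (cC (t \o s)) _ _ _ oV _ => x /VW/WU.
pose e s := ef (fn p.+2 s).
have lin k (s : 'I_k.+2 -> J) (D : ('I_k.+1 -> J) -> (X -> K) -> (X -> K)) d :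
    (forall s, rep (meet W s) (D s) (d s)) ->
    rep (meet W s) (fun f x => \sum_(j < k.+2) (-1) ^+ j * D (s \o lift j) f x)
     (\sum_(j < k.+2) (-1) ^+ j *: d (s \o lift j)).
  move=> hd; apply: (rep_lin (index_enum 'I_k.+2) (fun j => j : nat)
    (D := fun j => D (s \o lift j)) (e := fun j => d (s \o lift j))) => j.
  by apply: rep_sub (hd _) => x hx i; exact: hx.
have eF s : size s = p.+2 -> double tau q [::] s (e s).
  move=> ks x _ hx; apply: (rep_stalk (oM _ _) (hef (fn p.+2 s))) => j.
  by apply: hx; rewrite mem_nth ?ks.
have eZ s : size s = p.+3 -> dif e s = 0.
  move=> ks; rewrite -(codom_fn _ _ ks); move: (fn _ s) => f.
  rewrite dif_codom; under eq_bigr do rewrite /e fnK.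
  have h1 := lin _ f (fun s => c (t \o s)) ef hef.
  have h2 : rep (meet W f) (fun _ _ => 0) 0.
    by move=> V g h oV VW _ x _; rewrite Der_0l; exact: vat0.
  apply: (rep_inj (oM _ _) (M0 _ _) h1 h2) => V g oV VW rg x Vx.
  by apply: (cZ (t \o f) V) => // y /VW/WU.
have [] := @exact_cover _ _ _ _ _ atl _ _ tofrac_inj fracP J tau q Wcov q0 p.+1 isT _ e.
- move=> k k0 b [bF b0].
  have [|b' [h1 h2]] := @toric_exact _ _ _ _ _ atl nx_fun _ _ tofrac_inj fracP k k0 b.
    split=> [u su x hx|//]; apply: (bF u su) => //.
  exists b'; split=> // u su x hx _; exact: (h1 u su).
- by split.
move=> b [bF hb].
have hb' (s : 'I_p.+1 -> J) : rep (meet W s) (act (b (codom s))) (b (codom s)).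
  apply: rep_act => x hx; apply: (bF (codom s)) => //.
    by rewrite size_codom card_ord.
  by move=> j /codomP[i ->]; exact: hx.
exists J, W, t, (fun s => act (b (codom s))); split.
- by split.
- exact: Wt.
- move=> s; exact: rep_vfield (hb' s).
- move=> s; have := lin _ s _ _ hb'; rewrite -dif_codom hb; last first.
    by rewrite size_codom card_ord.
  rewrite /e fnK => h; exact: rep_eq (hef s) h.
Qed.

End Vanishing.

Lemma fraction_ratio (D : idomainType) (f : {fraction D}) :
  exists a b : D, b != 0 /\ f = tofrac a / tofrac b.
Proof.
elim/quotW : f => -[[a b] /= b0]; exists a, b; split=> //.
have tb0 : tofrac b != 0 by rewrite tofrac_eq0.
apply: (mulIf tb0); rewrite divfK //.
unlock tofrac; rewrite !piE /= /FracField.mulf.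
apply/eqP; rewrite piE /FracField.equivf /= !numden_Ratio ?mulf_neq0 ?oner_eq0 //=.
by rewrite !mulr1 mulrC.
Qed.

Theorem bott_vanishing (R : realType) (r : nat) (nx : rel 'I_r) (X : fspace R[i])
    (phi : signs r -> ('I_r -> R[i]) -> X) (p : nat) :
  bott_atlas nx phi -> (forall i j j', nx i j -> nx i j' -> j = j') -> (0 < p)%N ->
  tangent_cohomology_vanishes X p.
Proof.
move=> atl nx_fun p0.
have tinj : injective (@tofrac {mpoly R[i][r]}).
  by move=> x y /eqP; rewrite tofrac_eq => /eqP.
exact: (atlas_vanishing atl tinj (@fraction_ratio {mpoly R[i][r]})).
Qed.

(** * Deformations *)

Section Flag.
Variables (K : fieldType) (A : comAlgType K) (aug : {rmorphism A -> K}).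
Hypothesis art : artin_local aug.

Fixpoint lspan (l : seq A) (y : A) : Prop :=
  if l is x :: l' then exists c : K, lspan l' (y - c *: x) else y = 0.

Lemma lspan0 l : lspan l 0.
Proof. by elim: l => //= x l IH; exists 0; rewrite scale0r subr0. Qed.

Lemma lspan_lin l (c : K) y z : lspan l y -> lspan l z -> lspan l (c *: y + z).
Proof.
elim: l y z => [|x l IH] y z /=; first by move=> -> ->; rewrite scaler0 addr0.
move=> [a ha] [b hb]; exists (c * a + b).
have -> : c *: y + z - (c * a + b) *: x = c *: (y - a *: x) + (z - b *: x).
  by rewrite scalerBr scalerDl scalerA opprD addrACA.
exact: IH.
Qed.

Lemma lspanD l y z : lspan l y -> lspan l z -> lspan l (y + z).
Proof. by move=> hy hz; rewrite -[y]scale1r; apply: lspan_lin. Qed.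

Lemma lspanZ l (c : K) y : lspan l y -> lspan l (c *: y).
Proof. by move=> hy; rewrite -[_ *: _]addr0; apply: lspan_lin => //; exact: lspan0. Qed.

Lemma lspan_cons x l y : lspan l y -> lspan (x :: l) y.
Proof. by exists 0; rewrite scale0r subr0. Qed.

Lemma lspan_mem x l : x \in l -> lspan l x.
Proof.
elim: l => // y l IH; rewrite inE => /orP[/eqP ->|/IH]; last exact: lspan_cons.
by exists 1; rewrite scale1r subrr; exact: lspan0.
Qed.

Lemma lspan_catr l l' y : lspan l' y -> lspan (l ++ l') y.
Proof. by elim: l => //= x l IH /IH; exact: lspan_cons. Qed.

Lemma lspan_sub l l' y : (forall x, x \in l -> lspan l' x) -> lspan l y -> lspan l' y.
Proof.
elim: l y => [|x l IH] y h /=; first by move=> ->; exact: lspan0.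
case=> c /(IH _ _) hy; rewrite -[y](subrK (c *: x)) addrC.
apply: lspanD; first by apply/lspanZ/h; rewrite mem_head.
by apply: hy => z zl; apply: h; rewrite inE zl orbT.
Qed.

(** Makes the span of every tail an ideal, with the maximal ideal acting by zero on the successive
    quotients. *)
Fixpoint flagged (l : seq A) : Prop :=
  if l is x :: l' then (forall z, aug z = 0 -> lspan l' (z * x)) /\ flagged l' else True.

Fixpoint lfree (l : seq A) : Prop :=
  if l is x :: l' then ~ lspan l' x /\ lfree l' else True.

Lemma prune l : flagged l -> exists l', [/\ flagged l', lfree l' & forall y, lspan l' y <-> lspan l y].
Proof.
elim: l => [|x l IH] /=; first by exists [::].
move=> [hx /IH[l' [fl' fr' sp']]].
have [xl|nxl] := pselect (lspan l' x).
  exists l'; split=> // y; rewrite sp'; split; first exact: lspan_cons.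
  case=> c hy; rewrite -[y](subrK (c *: x)); apply: lspanD => //.
  by apply/lspanZ/sp'.
exists (x :: l'); split=> //=.
  by split=> // z /hx; rewrite sp'.
by move=> y; split=> -[c hc]; exists c; apply/sp'.
Qed.

Lemma flagged_cat l l' : flagged l' ->
  (forall x z, x \in l -> aug z = 0 -> lspan l' (z * x)) -> flagged (l ++ l').
Proof.
move=> fl'; elim: l => //= x l IH h; split.
  by move=> z az; apply: lspan_catr; apply: h; rewrite ?mem_head.
by apply: IH => y z yl; apply: h; rewrite inE yl orbT.
Qed.

Lemma lspanP l y : lspan l y <-> exists c : nat -> K, y = \sum_(i < size l) c i *: l`_i.
Proof.
elim: l y => [|x l IH] y /=.
  by split=> [->|[c ->]]; rewrite ?big_ord0 //; exists (fun=> 0); rewrite big_ord0.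
split=> [[c /IH[c' hc']]|[c ->]].
  exists (fun i => if i is j.+1 then c' j else c); rewrite big_ord_recl /= -hc'.
  by rewrite addrC subrK.
exists (c 0%N); rewrite big_ord_recl /= addrC addKr; apply/IH.
by exists (fun i => c i.+1).
Qed.

Lemma lfreeP l (c : nat -> K) : lfree l -> \sum_(i < size l) c i *: l`_i = 0 ->
  forall i, (i < size l)%N -> c i = 0.
Proof.
elim: l c => //= x l IH c [nx fl]; rewrite big_ord_recl /= => h.
have c0 : c 0%N = 0.
  apply/eqP; apply: contrapT => /negP c0; apply: nx; apply/lspanP.
  exists (fun i => - (c 0%N)^-1 * c i.+1).
  apply: (scalerI c0); rewrite scaler_sumr; move/eqP: h; rewrite addr_eq0 => /eqP ->.
  rewrite -sumrN; apply: eq_bigr => i _.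
  by rewrite scalerA mulrA mulrN mulfV // mulN1r scaleNr.
move: h; rewrite c0 scale0r add0r => h [//|i]; rewrite ltnS.
exact: (IH (fun i => c i.+1)).
Qed.

Lemma flaggedP l z i : flagged l -> aug z = 0 -> (i < size l)%N ->
  exists c : nat -> K, z * l`_i = \sum_(j < size l | (i < j)%N) c j *: l`_j.
Proof.
elim: l i => //= x l IH [|i] [hx fl] az; last rewrite ltnS.
  move=> _; have /lspanP[c ->] := hx z az; exists (fun j => c j.-1).
  by rewrite [RHS]big_mkcond big_ord_recl /= add0r; apply: eq_bigr.
move=> il; have [c ->] := IH i fl az il; exists (fun j => c j.-1).
rewrite [RHS]big_mkcond big_ord_recl /= add0r [LHS]big_mkcond.
by apply: eq_bigr => j _; rewrite /bump /= add1n ltnS.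
Qed.

Lemma prod_count (I : finType) (w : I -> A) (t : seq I) :
  \prod_(j <- t) w j = \prod_j w j ^+ count_mem j t.
Proof.
elim: t => [|j t IH]; first by rewrite big_nil big1.
rewrite big_cons IH [RHS](bigD1 j) //= [X in _ * X](bigD1 j) //= eqxx exprS -mulrA.
congr (_ * (_ * _)); apply: eq_bigr => i ij.
by rewrite eq_sym (negPf ij).
Qed.

(** Products of n generators of the maximal ideal, listed by increasing n, form a flagged list,
    because multiplication by the ideal raises n. Pruning redundant elements and prepending 1 gives
    the basis. *)
Theorem flag : exists (L : nat) (b : 'I_L.+1 -> A),
  [/\ b ord0 = 1 /\ (forall i, i != ord0 -> aug (b i) = 0),
      forall c : 'I_L.+1 -> K, \sum_i c i *: b i = 0 -> forall i, c i = 0,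
      forall x, exists c : 'I_L.+1 -> K, x = \sum_i c i *: b i
    & forall x i, aug x = 0 -> exists c : 'I_L.+1 -> K, x * b i = \sum_(j : 'I_L.+1 | (i < j)%N) c j *: b j].
Proof.
have [d [v hv]] := al_fin art.
have augA c : aug (c%:A) = c := al_aug art c.
have augZ c x : aug (c *: x) = c * aug x by rewrite -mulr_algl rmorphM augA.
pose w j := v j - (aug (v j))%:A.
have aw j : aug (w j) = 0 by rewrite rmorphB /= augA subrr.
have hw x : aug x = 0 -> exists c : 'I_d -> K, x = \sum_j c j *: w j.
  move=> ax; have [c hc] := hv x; exists c.
  have : x = \sum_j c j *: w j + (\sum_j c j * aug (v j))%:A.
    rewrite hc scaler_suml -big_split; apply: eq_bigr => j _ /=.
    by rewrite -scalerA -scalerDr subrK.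
  move=> hx; have := ax; rewrite hx rmorphD rmorph_sum /= big1 ?add0r.
    by rewrite augA => ->; rewrite scale0r addr0.
  by move=> j _; rewrite augZ aw mulr0.
have /choice[k hk] j : exists k, w j ^+ k = 0 := al_nil art (aw j).
(* A product of this many of the [w j] contains some [w j] at least [k j] times. *)
pose N := (\sum_j k j).+1.
have nilw (t : seq 'I_d) : size t = N -> \prod_(j <- t) w j = 0.
  move=> st; rewrite prod_count.
  have [j hj] : exists j, (k j <= count_mem j t)%N.
    apply: contrapT => /forallNP h.
    have : (\sum_j count_mem j t <= \sum_j k j)%N.
      by apply: leq_sum => j _; apply: ltnW; rewrite ltnNge; apply/negP/h.
    suff -> : (\sum_j count_mem j t)%N = size t by rewrite st ltnn.
    elim: t {st h} => [|i t IH]; first by rewrite big1.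
    rewrite /= big_split /= IH (bigD1 i) //= eqxx big1 // => j ji.
    by rewrite eq_sym (negPf ji).
  by rewrite (bigD1 j) //= -(subnK hj) exprD hk mulr0 mul0r.
pose lev n : seq A := [seq \prod_(j <- val t) w j | t <- enum {: n.-tuple 'I_d}].
have levS n z y : aug z = 0 -> y \in lev n -> lspan (lev n.+1) (z * y).
  move=> az /mapP[t _ ->]; have [c ->] := hw z az; rewrite mulr_suml.
  apply: (big_ind (fun y => lspan (lev n.+1) y)); [exact: lspan0|by move=> *; exact: lspanD|].
  move=> j _; rewrite -scalerAl; apply/lspanZ/lspan_mem/mapP.
  by exists [tuple of j :: t]; rewrite ?mem_enum //= big_cons.
have [l [fl ml al]] : exists l, [/\ flagged l, {subset lev 1 <= l}
    & forall x, x \in l -> aug x = 0].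
  have augl n y : (0 < n)%N -> y \in lev n -> aug y = 0.
    move=> n0 /mapP[[[|j t] /= st] _ -> /=]; first by rewrite -(eqP st) in n0.
    by rewrite big_cons rmorphM aw mul0r.
  suff H m : (m < N)%N -> exists l, [/\ flagged l, {subset lev (N - m)%N <= l}
      & forall x, x \in l -> aug x = 0].
    by have := H N.-1 (ltnSn _); rewrite /N /= subSnn.
  elim: m => [|m IH] mN.
    exists (lev N); split=> [|x|x]; rewrite ?subn0 //; last exact: augl.
    have : {in lev N, forall x, x = 0} by move=> x /mapP[t _ ->]; rewrite nilw ?size_tuple.
    elim: (lev N) => //= x s IHs hs; split; last first.
      by apply: IHs => y ys; apply: hs; rewrite inE ys orbT.
    by move=> z _; rewrite (hs x (mem_head _ _)) mulr0; exact: lspan0.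
  have [l [fl sl al]] := IH (ltnW mN); exists (lev (N - m.+1)%N ++ l); split.
  - apply: flagged_cat => // x z xl az; apply: lspan_sub (levS _ _ _ az xl) => y yl.
    by apply/lspan_mem/sl; rewrite -(subnSK (ltnW mN)).
  - by move=> x xl; rewrite mem_cat xl.
  - by move=> x; rewrite mem_cat => /orP[/augl|/al //]; apply; rewrite subn_gt0.
have [l' [fl' fr' sp']] := prune fl.
have augs y : lspan l y -> aug y = 0.
  elim: (l) al y => [|x s IHs] hs y /=; first by move=> ->; rewrite rmorph0.
  have hs' u : u \in s -> aug u = 0 by move=> us; apply: hs; rewrite inE us orbT.
  by case=> c hc; have := IHs hs' _ hc; rewrite rmorphB /= augZ hs ?mem_head // mulr0 subr0.
have ml' z : aug z = 0 -> lspan l' z.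
  move=> /hw[c ->]; apply: (big_ind (fun y => lspan l' y)); [exact: lspan0| |].
    by move=> *; exact: lspanD.
  move=> j _; apply/lspanZ/sp'/lspan_mem/ml/mapP.
  by exists [tuple j]; rewrite ?mem_enum //= big_seq1.
have fl1 : flagged (1 :: l') by split=> // z az; rewrite mulr1; exact: ml'.
have fr1 : lfree (1 :: l').
  split=> // /sp'/augs; rewrite rmorph1 => /eqP; by rewrite oner_eq0.
exists (size l'), (fun i => (1 :: l')`_i); split.
- split=> // i i0; apply/augs/sp'; case: i i0 => -[//|i] /= il _.
  by apply/lspan_mem/mem_nth.
- move=> c hc i; pose c' j := c (inord j).
  have := @lfreeP (1 :: l') c' fr1 _ i (ltn_ord i); rewrite /c' inord_val; apply.
  by rewrite -[RHS]hc; apply: eq_bigr => j _; rewrite inord_val.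
- move=> x; have : lspan (1 :: l') x.
    exists (aug x); apply: ml'; rewrite rmorphB /= augA subrr //.
  by move=> /lspanP[c ->]; exists (fun i => c i).
- move=> x i ax; have [c ->] := flaggedP fl1 ax (ltn_ord i).
  by exists (fun j => c j).
Qed.
End Flag.

(** * Filtration of a deformation by the flag *)

Section Deformation.
Variables (r : nat) (nx : rel 'I_r) (R : realType).
Local Notation K := R[i].
Local Notation P := {mpoly K[r]}.
Variables (X : fspace K) (phi : signs r -> ('I_r -> K) -> X).
Hypothesis atl : bott_atlas nx phi.
Implicit Types (U V : opens X) (f : X -> K).

Lemma reg_local (V : set X) f : opn V ->
  (forall x, V x -> exists V' : set X, [/\ opn V', V' x & reg V' f]) -> reg V f.
Proof.
move=> oV h; apply/(ba_reg atl) => // e a /h[V' [oV' V'x /(ba_reg atl f oV') hf]].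
have /(ba_opn atl) hV' := oV'; have [p [pa pV']] := hV' _ _ V'x.
have [A [B [Ba hAB]]] := hf _ _ V'x.
exists (A * p), (B * p); rewrite mevalM mulf_neq0 //; split=> // b Vb.
rewrite !mevalM mulf_eq0 negb_or => /andP[Bb pb].
by rewrite (hAB b (pV' b pb) Bb) -mulf_div divff // mulr1.
Qed.

Lemma reg_sub (V V' : set X) f : opn V -> opn V' -> V' `<=` V -> reg V f -> reg V' f.
Proof. by move=> oV oV' VV rf; apply: reg_local => // x /VV Vx; exists V. Qed.

Lemma reg_ext (V : set X) f (g : X -> K) : opn V -> {in V, f =1 g} -> reg V f -> reg V g.
Proof.
move=> oV fg /(ba_reg atl f oV) h; apply/(ba_reg atl) => // e a /h[p [q [qa hpq]]].
by exists p, q; split=> // b Vb qb; rewrite -fg ?inE //; exact: hpq.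
Qed.

Lemma reg_cst (V : set X) (c : K) : opn V -> reg V (fun=> c).
Proof.
move=> oV; apply/(ba_reg atl) => // e a _; exists c%:MP, 1.
by rewrite meval1 oner_neq0; split=> // b _ _; rewrite mevalC meval1 divr1.
Qed.

Lemma reg_add (V : set X) f (g : X -> K) : opn V -> reg V f -> reg V g -> reg V (fun x => f x + g x).
Proof.
move=> oV /(ba_reg atl f oV) hf /(ba_reg atl g oV) hg; apply/(ba_reg atl) => // e a Va.
have [p [q [qa h]]] := hf _ _ Va; have [p' [q' [qa' h']]] := hg _ _ Va.
exists (p * q' + p' * q), (q * q'); rewrite mevalM mulf_neq0 //; split=> // b Vb.
rewrite mevalM mulf_eq0 negb_or => /andP[qb qb'].
by rewrite h // h' // addf_div // mevalD !mevalM.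
Qed.

Lemma reg_mul (V : set X) f (g : X -> K) : opn V -> reg V f -> reg V g -> reg V (fun x => f x * g x).
Proof.
move=> oV /(ba_reg atl f oV) hf /(ba_reg atl g oV) hg; apply/(ba_reg atl) => // e a Va.
have [p [q [qa h]]] := hf _ _ Va; have [p' [q' [qa' h']]] := hg _ _ Va.
exists (p * p'), (q * q'); rewrite mevalM mulf_neq0 //; split=> // b Vb.
rewrite mevalM mulf_eq0 negb_or => /andP[qb qb'].
by rewrite h // h' // mulf_div !mevalM.
Qed.

Lemma tinj : injective (@tofrac P).
Proof. by move=> x y /eqP; rewrite tofrac_eq => /eqP. Qed.

Definition oI U V : opens X := exist _ (oset U `&` oset V) (opnI atl (svalP U) (svalP V)).

Lemma oIl U V : oset (oI U V) `<=` oset U. Proof. exact: subIsetl. Qed.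
Lemma oIr U V : oset (oI U V) `<=` oset V. Proof. exact: subIsetr. Qed.

Variables (A : comAlgType K) (aug : {rmorphism A -> K}) (d : deformation X aug).
Hypothesis augA : forall c : K, aug (c%:A) = c.
Variables (L : nat) (b : 'I_L.+1 -> A).
Implicit Types g : 'I_L.+1 -> X -> K.
Hypothesis b0 : b ord0 = 1.
Hypothesis aug_b : forall i, i != ord0 -> aug (b i) = 0.
Hypothesis b_free : forall c : 'I_L.+1 -> K, \sum_i c i *: b i = 0 -> forall i, c i = 0.
Hypothesis b_span : forall x, exists c : 'I_L.+1 -> K, x = \sum_i c i *: b i.
Hypothesis b_flag : forall x i, aug x = 0 ->
  exists c : 'I_L.+1 -> K, x * b i = \sum_(j : 'I_L.+1 | (i < j)%N) c j *: b j.
Local Notation st a := (dstr d _ a).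
Local Notation res := (@dres _ _ _ _ d _ _).

Definition spang (k : nat) : set A :=
  [set y | exists c : 'I_L.+1 -> K, y = \sum_(j : 'I_L.+1 | (k <= j)%N) c j *: b j].

Lemma spangD k y z : spang k y -> spang k z -> spang k (y + z).
Proof.
move=> [c ->] [c' ->]; exists (fun j => c j + c' j).
by rewrite -big_split; apply: eq_bigr => j _; rewrite scalerDl.
Qed.

Lemma spang0 k : spang k 0.
Proof. by exists (fun=> 0); rewrite big1 // => j _; rewrite scale0r. Qed.

Lemma spang_le k k' y : (k <= k')%N -> spang k' y -> spang k y.
Proof.
move=> kk [c ->]; exists (fun j : 'I_L.+1 => if (k' <= j)%N then c j else 0).
rewrite [RHS]big_mkcond [LHS]big_mkcond; apply: eq_bigr => j _.
by case: ifP => h; rewrite ?(leq_trans kk h) // scale0r if_same.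
Qed.

Lemma spangZ k (c : K) y : spang k y -> spang k (c *: y).
Proof.
by move=> [c' ->]; exists (fun j => c * c' j); rewrite scaler_sumr; apply: eq_bigr => j _; rewrite scalerA.
Qed.

Lemma spang_b (i : 'I_L.+1) : spang i (b i).
Proof.
exists (fun j => (j == i)%:R); rewrite (bigD1 i) //= eqxx scale1r big1 ?addr0 //.
by move=> j /andP[_ /negPf ->]; rewrite scale0r.
Qed.

Lemma spang_m k x y : aug x = 0 -> spang k y -> spang k.+1 (x * y).
Proof.
move=> ax [c ->]; rewrite mulr_sumr; apply: (big_ind (fun y => spang k.+1 y)).
- exact: spang0.
- by move=> *; exact: spangD.
- move=> j kj; rewrite -scalerAr; apply: spangZ; apply: (@spang_le _ j.+1) => //.
  exact: b_flag.
Qed.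

Lemma spangM k x y : spang k y -> spang k (x * y).
Proof.
move=> hy; rewrite -[x](subrK ((aug x)%:A)) mulrDl; apply: spangD; last first.
  by rewrite mulr_algl; exact: spangZ.
by apply: (@spang_le _ k.+1) => //; apply: spang_m; rewrite // rmorphB /= augA subrr.
Qed.

(** Modulo the next ideal of the flag, only the multiple [aug (be i)] of [b i] remains of the
    sum. *)
Lemma flag_top (i : 'I_L.+1) (be : 'I_L.+1 -> A) :
  \sum_(j : 'I_L.+1 | (i <= j)%N) b j * be j = 0 -> aug (be i) = 0.
Proof.
rewrite (bigD1 i) //= => h.
have [c hc] : spang i.+1 (\sum_(j : 'I_L.+1 | (i <= j)%N && (j != i)) b j * be j).
  apply: (big_ind (fun y => spang i.+1 y)); [exact: spang0|by move=> *; exact: spangD|].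
  move=> j /andP[ij ji]; rewrite mulrC; apply/spangM/(@spang_le _ j); last exact: spang_b.
  by rewrite ltn_neqAle ij andbT; apply: contraNneq ji => e; apply/eqP/ord_inj.
have [c' hc'] : spang i.+1 (b i * (be i - (aug (be i))%:A)).
  by rewrite mulrC; apply: spang_m (spang_b i); rewrite rmorphB /= augA subrr.
have := @b_free (fun j => if j == i then aug (be i) else
   if (i < j)%N then c j + c' j else 0) _ i; rewrite eqxx; apply.
rewrite (bigD1 i) //= eqxx -[RHS]h hc -[be i in RHS](subrK ((aug (be i))%:A)).
rewrite mulrDr hc' [b i * _]mulrC mulr_algl [_ + _ *: _]addrC -addrA; congr (_ + _).
rewrite [in RHS]addrC -big_split /= big_mkcond [RHS]big_mkcond.
apply: eq_bigr => j _; have [->|ji] := eqVneq j i; first by rewrite ltnn.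
by case: ifP => _; rewrite ?scale0r // scalerDl.
Qed.

Definition mem k V (s : dO d V) :=
  exists t : 'I_L.+1 -> dO d V, s = \sum_(i : 'I_L.+1 | (k <= i)%N) st (b i) * t i.

Lemma mem0 k V : mem k (0 : dO d V).
Proof. by exists (fun=> 0); rewrite big1 // => i _; rewrite mulr0. Qed.

Lemma memD k V (s t : dO d V) : mem k s -> mem k t -> mem k (s + t).
Proof.
move=> [u ->] [v ->]; exists (fun i => u i + v i).
by rewrite -big_split; apply: eq_bigr => i _; rewrite mulrDr.
Qed.

Lemma memM k V (s t : dO d V) : mem k t -> mem k (s * t).
Proof.
move=> [u ->]; exists (fun i => s * u i).
by rewrite mulr_sumr; apply: eq_bigr => i _; rewrite mulrCA.
Qed.

Lemma memN k V (s : dO d V) : mem k s -> mem k (- s).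
Proof. by move=> h; rewrite -mulN1r; exact: memM. Qed.

Lemma memB k V (s t : dO d V) : mem k s -> mem k t -> mem k (s - t).
Proof. by move=> hs /memN; exact: memD. Qed.

Lemma mem_sum k V (I : Type) (l : seq I) (Q : pred I) (F : I -> dO d V) :
  (forall i, Q i -> mem k (F i)) -> mem k (\sum_(i <- l | Q i) F i).
Proof. by move=> h; apply: (big_ind (fun s => mem k s)) => //; [exact: mem0|move=> *; exact: memD]. Qed.

Lemma mem_st (i : 'I_L.+1) V k (s : dO d V) : (k <= i)%N -> mem k (st (b i) * s).
Proof.
move=> ki; exists (fun j => if j == i then s else 0); rewrite (bigD1 i) //= eqxx big1 ?addr0 //.
by move=> j /andP[_ /negPf ->]; rewrite mulr0.
Qed.

Lemma st_scale V (c : K) a : dstr d V (c *: a) = st (c%:A) * st a.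
Proof. by rewrite -[c *: a]mulr_algl rmorphM. Qed.

Lemma mem_spang k V a (s : dO d V) : spang k a -> mem k (st a * s).
Proof.
move=> [c ->]; rewrite rmorph_sum mulr_suml; apply: mem_sum => j kj.
by rewrite st_scale -mulrA; apply/memM/mem_st.
Qed.

Lemma mem_le k k' V (s : dO d V) : (k <= k')%N -> mem k' s -> mem k s.
Proof. by move=> kk [t ->]; apply: mem_sum => i ki; apply: mem_st; exact: leq_trans ki. Qed.

Lemma mem_m k V a (s : dO d V) : aug a = 0 -> mem k s -> mem k.+1 (st a * s).
Proof.
move=> ha [t ->]; rewrite mulr_sumr; apply: mem_sum => i ki; rewrite mulrA -rmorphM.
by apply: mem_spang; apply: spang_m => //; apply: (spang_le ki); exact: spang_b.
Qed.

Lemma mem1M k V (z s : dO d V) : mem 1 z -> mem k s -> mem k.+1 (z * s).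
Proof.
move=> [w ->] hs; rewrite mulr_suml; apply: mem_sum => i i1; rewrite -mulrA.
by apply: mem_m; [apply: aug_b; apply: contraTneq i1 => ->|exact: memM].
Qed.

Lemma mem_all V (s : dO d V) : mem 0 s.
Proof. by rewrite -[s]mul1r -(rmorph1 (dstr d V)) -b0; exact: mem_st. Qed.

Lemma mem_top V (s : dO d V) : mem L.+1 s -> s = 0.
Proof. by case=> t ->; rewrite big1 // => i; rewrite leqNgt ltn_ord. Qed.

Lemma mem_res k U V (h : oset V `<=` oset U) (s : dO d U) : mem k s -> mem k (res h s).
Proof.
move=> [t ->]; exists (fun i => res h (t i)); rewrite rmorph_sum; apply: eq_bigr => i _.
by rewrite rmorphM dres_str.
Qed.

Lemma spang1_m a : aug a = 0 -> spang 1 a.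
Proof. by move=> /(@spang_m 0 _ 1); rewrite mulr1; apply; rewrite -b0; exact: spang_b. Qed.

Lemma dredD V (s t : dO d V) x : oset V x -> dred (s + t) x = dred s x + dred t x.
Proof. by move=> Vx; rewrite dred_add // inE. Qed.

Lemma dredM V (s t : dO d V) x : oset V x -> dred (s * t) x = dred s x * dred t x.
Proof. by move=> Vx; rewrite dred_mul // inE. Qed.

Lemma dred_st V a x : oset V x -> dred (dstr d V a) x = aug a.
Proof. by move=> Vx; rewrite dred_str // inE. Qed.

Lemma dred0 V x : oset V x -> dred (0 : dO d V) x = 0.
Proof. by move=> Vx; rewrite -(rmorph0 (dstr d V)) dred_st // rmorph0. Qed.

Lemma dredN V (s : dO d V) x : oset V x -> dred (- s) x = - dred s x.
Proof.
move=> Vx; apply/eqP; rewrite -addr_eq0 addrC -dredD //.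
by rewrite subrr dred0.
Qed.

Lemma dredR U V (h : oset V `<=` oset U) (s : dO d U) x : oset V x -> dred (res h s) x = dred s x.
Proof. by move=> Vx; rewrite dred_res // inE. Qed.

Lemma dred_sum V (I : Type) (l : seq I) (Q : pred I) (F : I -> dO d V) x : oset V x ->
  dred (\sum_(i <- l | Q i) F i) x = \sum_(i <- l | Q i) dred (F i) x.
Proof.
move=> Vx; apply: (big_morph (fun s => dred s x)); last exact: dred0.
by move=> *; exact: dredD.
Qed.

Lemma mem1_local V (s : dO d V) x : (forall y, oset V y -> dred s y = 0) -> oset V x ->
  exists V' (h : oset V' `<=` oset V), oset V' x /\ mem 1 (res h s).
Proof.
move=> hs Vx; have [|V' [h [k [a [t [V'x ha hr]]]]]] := @dred_ker _ _ _ _ d V s x _ Vx.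
  by move=> y; rewrite inE => /hs.
by exists V', h; split=> //; rewrite hr; apply: mem_sum => i _; exact/mem_spang/spang1_m.
Qed.

Definition section : Type := forall V : opens X, (X -> K) -> dO d V.

(* A section over W of the reduction map, multiplicative and K-linear. *)
Record lsec (W : set X) (sg : section) : Prop := LSec {
  ls_dred : forall V f x, oset V `<=` W -> reg (oset V) f -> oset V x -> dred (sg V f) x = f x;
  ls_ext : forall V f (g : X -> K), oset V `<=` W -> reg (oset V) f -> {in oset V, f =1 g} -> sg V f = sg V g;
  ls_add : forall V f (g : X -> K), oset V `<=` W -> reg (oset V) f -> reg (oset V) g ->
    sg V (fun x => f x + g x) = sg V f + sg V g;
  ls_mul : forall V f (g : X -> K), oset V `<=` W -> reg (oset V) f -> reg (oset V) g ->
    sg V (fun x => f x * g x) = sg V f * sg V g;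
  ls_cst : forall V c, oset V `<=` W -> sg V (fun=> c) = st (c%:A);
  ls_res : forall U V (h : oset V `<=` oset U) f, oset U `<=` W -> reg (oset U) f ->
    res h (sg U f) = sg V f }.

Lemma lsec_sub W W' sg : W' `<=` W -> lsec W sg -> lsec W' sg.
Proof.
move=> WW [h1 h2 h3 h4 h5 h6]; split.
- by move=> V f x VW; apply: h1 => y /VW/WW.
- by move=> V f g VW; apply: h2 => y /VW/WW.
- by move=> V f g VW; apply: h3 => y /VW/WW.
- by move=> V f g VW; apply: h4 => y /VW/WW.
- by move=> V c VW; apply: h5 => y /VW/WW.
- by move=> U V h f VW; apply: h6 => y /VW/WW.
Qed.

(** * Coordinates of the sections of a deformation *)

Section LocalSection.
Variables (W : set X) (sg : section).
Hypothesis ls : lsec W sg.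

Let rc V (c : K) : reg (oset V) (fun=> c) := reg_cst c (svalP V).

Lemma ls0 V : oset V `<=` W -> sg V (fun=> 0) = 0.
Proof. by move=> VW; rewrite (ls_cst ls) // scale0r rmorph0. Qed.

Lemma ls_zero V f : oset V `<=` W -> (forall x, oset V x -> f x = 0) -> sg V f = 0.
Proof.
move=> VW h; rewrite -(ls0 VW); symmetry; apply: (ls_ext ls) => // x.
by rewrite inE => /h.
Qed.

Lemma ls_opp V f : oset V `<=` W -> reg (oset V) f -> sg V (fun x => - f x) = - sg V f.
Proof.
move=> VW rf; have := ls_mul ls VW (rc V (-1)) rf; rewrite (ls_cst ls) // scaleN1r rmorphN.
rewrite rmorph1 mulN1r => <-; apply: (ls_ext ls) => //.
  apply: reg_ext (reg_mul (svalP V) (rc V (-1)) rf) => //; first exact: svalP.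
  by move=> x _; rewrite mulN1r.
by move=> x _; rewrite mulN1r.
Qed.

Definition comb V (g : 'I_L.+1 -> X -> K) : dO d V := \sum_i st (b i) * sg V (g i).

Lemma comb_res U V (h : oset V `<=` oset U) g : oset U `<=` W ->
  (forall i, reg (oset U) (g i)) -> res h (comb U g) = comb V g.
Proof.
move=> UW rg; rewrite rmorph_sum; apply: eq_bigr => i _.
by rewrite rmorphM dres_str (ls_res ls).
Qed.

Lemma comb_ext V g g' : oset V `<=` W -> (forall i, reg (oset V) (g i)) ->
  (forall i x, oset V x -> g i x = g' i x) -> comb V g = comb V g'.
Proof.
move=> VW rg gg; apply: eq_bigr => i _; congr (_ * _); apply: (ls_ext ls) => // x.
by rewrite inE => /gg.
Qed.

Lemma combB V g g' : oset V `<=` W -> (forall i, reg (oset V) (g i)) ->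
  (forall i, reg (oset V) (g' i)) ->
  comb V (fun i x => g i x - g' i x) = comb V g - comb V g'.
Proof.
move=> VW rg rg'; rewrite -sumrB; apply: eq_bigr => i _; rewrite -mulrBr; congr (_ * _).
rewrite (ls_add ls) ?ls_opp //.
by have := reg_mul (svalP V) (rc V (-1)) (rg' i); apply: reg_ext;
  [exact: svalP|move=> x _; rewrite mulN1r].
Qed.

(** By strong induction the earlier coefficients vanish. Flatness then writes the lift of the i-th
    one as a combination with factors in A that lie, by [flag_top], in the maximal ideal; its
    reduction is therefore zero. *)
Lemma comb_uniq V g : oset V `<=` W -> (forall i, reg (oset V) (g i)) -> comb V g = 0 ->
  forall i x, oset V x -> g i x = 0.
Proof.
move=> VW rg hg i; elim: {i}(i : nat).+1 {-2}i (ltnSn i) => // m IH i im x Vx.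
have hz (j : 'I_L.+1) : (j < i)%N -> sg V (g j) = 0.
  by move=> ji; apply: ls_zero => // y; apply: IH; exact: leq_trans ji im.
have [|V' [h [l [be [t [V'x ht hb]]]]]] := @dflat _ _ _ _ d V L.+1
   (fun j => if (i <= j)%N then b j else 0) (fun j => sg V (g j)) x _ Vx.
  rewrite -[RHS]hg; apply: eq_bigr => j _; case: leqP => // /hz ->.
  by rewrite !mulr0.
rewrite -(ls_dred ls VW (rg i) Vx) -(dredR h) // ht dred_sum // big1 // => q _.
rewrite dredM // dred_st // (@flag_top i (be^~ q)) ?mul0r //.
rewrite -[RHS](hb q) [LHS]big_mkcond; apply: eq_bigr => j _.
by case: ifP => // _; rewrite mul0r.
Qed.

(** Subtracting [b k] times the lift of the reduction of the leading coefficient leaves, after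
    shrinking, a section one step deeper in the flag; the flag has finite length. *)
Lemma struct_local k V (s : dO d V) x : oset V `<=` W -> mem k s -> oset V x ->
  exists V' (h : oset V' `<=` oset V) g, [/\ oset V' x, forall i, reg (oset V') (g i),
    forall i : 'I_L.+1, (i < k)%N -> forall y, g i y = 0 & res h s = comb V' g].
Proof.
move En: (L.+1 - k)%N => n; elim: n k En V s => [|n IH] k kn V s VW ms Vx.
  move: ms => /(@mem_le L.+1)-/(_ _)/mem_top ->; last lia.
  exists V, (fun _ => id), (fun _ _ => 0); split; [exact: Vx|by move=> i; exact: rc|by []|].
  by rewrite rmorph0 /comb big1 // => i _; rewrite ls0 ?mulr0.
have kL : (k < L.+1)%N by lia.
move: ms => [t ht]; pose K0 : 'I_L.+1 := Ordinal kL.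
have rk : reg (oset V) (dred (t K0)) by exact: dred_reg.
have dk y : oset V y -> dred (t K0 - sg V (dred (t K0))) y = 0.
  by move=> Vy; rewrite dredD // dredN // (ls_dred ls) // subrr.
have [V' [h [V'x hm]]] := mem1_local dk Vx.
have V'W : oset V' `<=` W by move=> y /h/VW.
have rk' : reg (oset V') (dred (t K0)) by exact: reg_sub (svalP V) (svalP V') h rk.
have hs : mem k.+1 (res h s - st (b K0) * sg V' (dred (t K0))).
  rewrite ht (bigD1 K0) //= rmorphD rmorphM dres_str addrAC -(ls_res ls h VW rk) -mulrBr.
  rewrite -rmorphB; apply: memD.
    case: hm => u ->; rewrite mulr_sumr; apply: mem_sum => i i1.
    rewrite mulrA -rmorphM mulrC; apply/memM.
    rewrite -[st _]mulr1; apply: mem_spang; rewrite mulrC.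
    by apply: spang_m (spang_b K0); apply: aug_b; apply: contraTneq i1 => ->.
  apply: mem_res; apply: mem_sum => i /andP[ki ni]; apply: mem_st.
  by rewrite ltn_neqAle ki andbT; apply: contraNneq ni => e; apply/eqP/ord_inj.
have [|V'' [h' [g [V''x rg gk hg]]]] := IH k.+1 _ V' _ V'W hs V'x; first lia.
have hh : oset V'' `<=` oset V by move=> y /h'/h.
exists V'', hh, (fun i => if i == K0 then dred (t K0) else g i); split=> //.
- by move=> i; case: eqP => // _; exact: reg_sub (svalP V') (svalP V'') h' rk'.
- move=> i ik y; case: eqP => [e|_]; first by rewrite e ltnn in ik.
  by apply: gk; exact: ltnW.
- move: hg; rewrite rmorphB rmorphM dres_str (dres_comp _ _ hh) (ls_res ls) //.
  move/eqP; rewrite subr_eq => /eqP ->; rewrite /comb [in RHS](bigD1 K0) //= eqxx addrC.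
  congr (_ + _); rewrite (bigD1 K0) //= [sg V'' (g K0)]ls_zero ?mulr0 ?add0r.
  + by apply: eq_bigr => i /negPf ->.
  + by move=> y /h'/V'W.
  + by move=> y _; apply: gk.
Qed.

(** The local expansions agree on overlaps because the coefficients are unique, so the coefficient
    functions glue. *)
Lemma struct k V (s : dO d V) : oset V `<=` W -> mem k s ->
  exists g, [/\ forall i, reg (oset V) (g i),
    forall i : 'I_L.+1, (i < k)%N -> forall y, oset V y -> g i y = 0 & s = comb V g].
Proof.
move=> VW hs.
have /choice[G hG] x : exists Vg : opens X * ('I_L.+1 -> X -> K), oset V x ->
    exists h : oset Vg.1 `<=` oset V, [/\ oset Vg.1 x, forall i, reg (oset Vg.1) (Vg.2 i),
      forall i : 'I_L.+1, (i < k)%N -> forall y, Vg.2 i y = 0 & res h s = comb Vg.1 Vg.2].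
  have [Vx|nVx] := pselect (oset V x); last by exists (V, fun _ _ => 0).
  by have [V' [h [g [V'x rg gk hg]]]] := struct_local VW hs Vx; exists (V', g) => _; exists h.
pose g i x := (G x).2 i x.
have gE x y : oset V x -> oset (G x).1 y -> forall i, g i y = (G x).2 i y.
  move=> Vx Gy i; have [h [Gx rg gk hg]] := hG x Vx.
  have Vy := h _ Gy.
  have [h' [Gy' rg' gk' hg']] := hG y Vy.
  pose N := oI (G x).1 (G y).1.
  have NW : oset N `<=` W by move=> z [/h/VW].
  have rN (g' : X -> K) : reg (oset (G x).1) g' -> reg (oset N) g'.
    exact: reg_sub (svalP _) (svalP N) (@oIl _ _).
  have rN' (g' : X -> K) : reg (oset (G y).1) g' -> reg (oset N) g'.
    exact: reg_sub (svalP _) (svalP N) (@oIr _ _).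
  have e1 := congr1 (res (@oIl (G x).1 (G y).1)) hg.
  have e2 := congr1 (res (@oIr (G x).1 (G y).1)) hg'.
  have NV : oset N `<=` oset V by move=> z [/h].
  rewrite (dres_comp _ _ NV) comb_res // in e1; last by move=> z /h/VW.
  rewrite (dres_comp _ _ NV) comb_res // in e2; last by move=> z /h'/VW.
  have := @comb_uniq N (fun i z => (G y).2 i z - (G x).2 i z) NW _ _ i y (conj Gy Gy').
  rewrite combB // -?e1 -?e2 ?subrr; try by move=> j; auto.
  move=> H; apply/eqP; rewrite -subr_eq0; apply/eqP/H => // j.
  apply: reg_add; first exact: svalP; first by auto.
  have := reg_mul (svalP N) (rc N (-1)) (rN _ (rg j)); apply: reg_ext; first exact: svalP.
  by move=> z _; rewrite mulN1r.
have rg i : reg (oset V) (g i).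
  apply: reg_local; first exact: svalP.
  move=> x Vx; have [h [Gx rgx gk hg]] := hG x Vx; exists (oset (G x).1); split=> //.
    exact: svalP.
  apply: reg_ext (rgx i); first exact: svalP.
  by move=> y; rewrite inE => Gy; rewrite (gE x y).
exists g; split=> //.
- by move=> i ik x Vx; have [h [_ _ gk _]] := hG x Vx; apply: gk.
- apply: (@dsep _ _ _ _ d V) => x Vx; have [h [Gx rgx gk hg]] := hG x Vx.
  exists (G x).1, h; split=> //; rewrite hg comb_res //; apply: comb_ext => //.
    by move=> y /h/VW.
  by move=> j y Gy; rewrite (gE x y).
Qed.

Lemma comb_mem k V g : oset V `<=` W -> (forall i, reg (oset V) (g i)) -> mem k (comb V g) ->
  forall i : 'I_L.+1, (i < k)%N -> forall x, oset V x -> g i x = 0.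
Proof.
move=> VW rg /(struct VW)[g' [rg' gk e]] i ik x Vx.
have := @comb_uniq V (fun i x => g i x - g' i x) VW _ _ i x Vx; rewrite gk // subr0; apply.
  move=> j; apply: reg_add; [exact: svalP|exact: rg|].
  have := reg_mul (svalP V) (rc V (-1)) (rg' j); apply: reg_ext; first exact: svalP.
  by move=> z _; rewrite mulN1r.
by rewrite combB // e subrr.
Qed.

(** Membership amounts to the vanishing of the first k coefficients, which is a local condition. *)
Lemma mem_local k V (s : dO d V) : oset V `<=` W ->
  (forall x, oset V x -> exists V' (h : oset V' `<=` oset V), oset V' x /\ mem k (res h s)) ->
  mem k s.
Proof.
move=> VW hs; have [g [rg _ e]] := struct VW (mem_all s).
have gz (i : 'I_L.+1) : (i < k)%N -> forall x, oset V x -> g i x = 0.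
  move=> ik x Vx; have [V' [h [V'x hm]]] := hs x Vx.
  have V'W : oset V' `<=` W by move=> y /h/VW.
  rewrite e comb_res // in hm; apply: (comb_mem V'W _ hm ik V'x) => j.
  exact: reg_sub (svalP V) (svalP V') h (rg j).
rewrite e; apply: mem_sum => i _; have [ik|ki] := ltnP i k; last exact: mem_st.
by rewrite ls_zero ?mulr0; [exact: mem0| |exact: gz].
Qed.

Lemma mem1_dred V (s : dO d V) : oset V `<=` W -> (forall x, oset V x -> dred s x = 0) -> mem 1 s.
Proof. by move=> VW hs; apply: mem_local => // x Vx; exact: mem1_local. Qed.

Lemma mem_coef (k : 'I_L.+1) V f : oset V `<=` W -> reg (oset V) f ->
  mem k.+1 (st (b k) * sg V f) -> forall x, oset V x -> f x = 0.
Proof.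
move=> VW rf hm x Vx; pose g i := if i == k then f else fun=> 0.
have rg i : reg (oset V) (g i) by rewrite /g; case: eqP => // _; exact: rc.
have -> : f x = g k x by rewrite /g eqxx.
apply: (comb_mem VW rg _ (ltnSn k) Vx); rewrite /comb (bigD1 k) //= /g eqxx big1 ?addr0 //.
by move=> i /negPf ->; rewrite ls0 ?mulr0.
Qed.

Lemma mem_lead (k : 'I_L.+1) V (s : dO d V) : oset V `<=` W -> mem k s ->
  exists f, reg (oset V) f /\ mem k.+1 (s - st (b k) * sg V f).
Proof.
move=> VW /(struct VW)[g [rg gk ->]]; exists (g k); split=> //.
rewrite /comb (bigD1 k) //= [_ * _ + _]addrC addrK; apply: mem_sum => i ik.
have [ki|] := leqP k.+1 i; first exact: mem_st.
rewrite ltnS leq_eqVlt => /orP[/eqP/ord_inj e|/gk gi]; first by rewrite e eqxx in ik.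
by rewrite ls_zero ?mulr0 //; exact: mem0.
Qed.

End LocalSection.

(** * The exponential of a vector field with nilpotent coefficient *)

Section Twist.
Variables (W : set X) (sg : section) (D : (X -> K) -> X -> K) (a : A) (N : nat).
Hypothesis ls : lsec W sg.
Hypothesis oW : opn W.
Hypothesis vD : vfield W D.
Hypothesis aN : a ^+ N.+1 = 0.
Hypothesis aug_a : aug a = 0.

(** The n-th divided power D^n f / n! of the derivation. *)
Fixpoint Exp n f : X -> K := if n is m.+1 then fun x => (m.+1%:R)^-1 * D (Exp m f) x else f.

Lemma Exp_reg n V f : oset V `<=` W -> reg (oset V) f -> reg (oset V) (Exp n f).
Proof.
move=> VW rf; elim: n => //= n IH; apply: reg_mul; first exact: svalP.
  by apply: reg_cst; exact: svalP.
by apply: (vf_reg vD) => //; exact: svalP.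
Qed.

Lemma Exp_ext n V f (g : X -> K) : oset V `<=` W -> reg (oset V) f -> reg (oset V) g ->
  {in oset V, f =1 g} -> {in oset V, Exp n f =1 Exp n g}.
Proof.
move=> VW rf rg fg; elim: n => //= n IH x Vx; congr (_ * _).
by apply: (vf_local vD) Vx; rewrite ?VW //; try exact: svalP; exact: Exp_reg.
Qed.

Lemma Exp_add n V f (g : X -> K) : oset V `<=` W -> reg (oset V) f -> reg (oset V) g ->
  {in oset V, forall x, Exp n (fun x => f x + g x) x = Exp n f x + Exp n g x}.
Proof.
move=> VW rf rg; elim: n => //= n IH x Vx; rewrite -mulrDr; congr (_ * _).
rewrite -(vf_add vD (svalP V) VW) //; first last.
- exact: Exp_reg.
- exact: Exp_reg.
apply: (vf_local vD) IH x Vx => //; first exact: svalP.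
- by apply: Exp_reg => //; apply: reg_add => //; exact: svalP.
- by apply: reg_add; [exact: svalP|exact: Exp_reg|exact: Exp_reg].
Qed.

Lemma D_cst V c : oset V `<=` W -> {in oset V, D (fun=> c) =1 (fun=> 0)}.
Proof.
move=> VW x Vx; have r1 := reg_cst (1 : K) (svalP V).
have D1 : D (fun=> 1) x = 0.
  have := vf_leibniz vD (svalP V) VW r1 r1 Vx.
  rewrite (_ : (fun _ => 1 * 1) = (fun=> 1)); last by rewrite mul1r.
  by rewrite mulr1 mul1r => /eqP; rewrite -subr_eq0 opprD addNKr oppr_eq0 => /eqP.
have := vf_scale vD c (svalP V) VW r1 Vx.
by rewrite D1 mulr0 mulr1.
Qed.

Lemma Exp_cst n V c : oset V `<=` W -> {in oset V, Exp n.+1 (fun=> c) =1 (fun=> 0)}.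
Proof.
move=> VW; elim: n => [|n IH] x Vx /=; first by rewrite (D_cst c VW) ?mulr0.
rewrite (vf_local vD (svalP V) VW _ _ IH Vx) ?(D_cst 0 VW) ?mulr0 //.
- by apply: (@Exp_reg n.+1) => //; apply: reg_cst; exact: svalP.
- by apply: reg_cst; exact: svalP.
Qed.

Lemma D_sum V (I : Type) (l : seq I) (F : I -> X -> K) : oset V `<=` W ->
  (forall i, reg (oset V) (F i)) ->
  reg (oset V) (fun x => \sum_(i <- l) F i x) /\
  {in oset V, forall x, D (fun x => \sum_(i <- l) F i x) x = \sum_(i <- l) D (F i) x}.
Proof.
move=> VW rF; have oV := svalP V; elim: l => [|i l [IHr IH]].
  rewrite (_ : (fun x => _) = (fun=> 0)); last by apply/funext => x; rewrite big_nil.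
  by split=> [|x Vx]; [exact: reg_cst|rewrite (D_cst 0 VW) // big_nil].
rewrite (_ : (fun x => _) = (fun x => F i x + \sum_(j <- l) F j x)); last first.
  by apply/funext => x; rewrite big_cons.
by split=> [|x Vx]; [exact: reg_add|rewrite (vf_add vD oV VW) // IH // big_cons].
Qed.

Lemma Exp_mul n V f (g : X -> K) : oset V `<=` W -> reg (oset V) f -> reg (oset V) g ->
  {in oset V, forall x, Exp n (fun x => f x * g x) x = \sum_(j < n.+1) Exp j f x * Exp (n - j)%N g x}.
Proof.
move=> VW rf rg; have oV := svalP V; elim: n => [|n IH] x Vx.
  by rewrite big_ord_recl big_ord0 addr0.
have rm j : reg (oset V) (fun x => Exp j f x * Exp (n - j)%N g x).
  by apply: reg_mul => //; exact: Exp_reg.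
have [rs ds] := D_sum (index_enum 'I_n.+1) VW (fun j : 'I_n.+1 => rm j).
rewrite [LHS]/= (vf_local vD oV VW _ _ IH Vx) //; last first.
  by apply: Exp_reg => //; exact: reg_mul.
have n0 : n.+1%:R != 0 :> K by rewrite pnatr_eq0.
apply: (mulfI n0); rewrite mulVKf // ds //.
have Dn m h : D (Exp m h) x = m.+1%:R * Exp m.+1 h x by rewrite /= mulVKf // pnatr_eq0.
transitivity (\sum_(j < n.+1) (j.+1%:R * Exp j.+1 f x * Exp (n - j)%N g x) +
    \sum_(j < n.+1) ((n - j).+1%:R * (Exp j f x * Exp (n - j).+1 g x))).
  rewrite -big_split; apply: eq_bigr => j _ /=.
  rewrite (vf_leibniz vD oV VW) //; try exact: Exp_reg.
  by rewrite -!/(Exp _.+1 _ _) !Dn /=; ring.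
have -> : \sum_(j < n.+1) (j.+1%:R * Exp j.+1 f x * Exp (n - j)%N g x) =
   \sum_(j < n.+2) j%:R * (Exp j f x * Exp (n.+1 - j)%N g x).
  by rewrite [RHS]big_ord_recl mul0r add0r; apply: eq_bigr => j _; rewrite mulrA.
have -> : \sum_(j < n.+1) ((n - j).+1%:R * (Exp j f x * Exp (n - j).+1 g x)) =
   \sum_(j < n.+2) (n.+1 - j)%:R * (Exp j f x * Exp (n.+1 - j)%N g x).
  rewrite [RHS]big_ord_recr /= subnn mul0r addr0; apply: eq_bigr => j _.
  by rewrite subSn // -ltnS.
rewrite -big_split mulr_sumr; apply: eq_bigr => j _ /=.
by rewrite -mulrDl -natrD subnKC // -ltnS.
Qed.

Lemma cauchy_sum (S : pzRingType) (x y : nat -> S) :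
  (forall i j, (N.+1 <= i + j)%N -> x i * y j = 0) ->
  (\sum_(i < N.+1) x i) * (\sum_(i < N.+1) y i) =
   \sum_(n < N.+1) \sum_(j < n.+1) x j * y (n - j)%N.
Proof.
move=> h; transitivity (\sum_(n < N.+1) \sum_(j < N.+1 | (j <= n)%N) x j * y (n - j)%N).
  rewrite (exchange_big_dep xpredT) //= mulr_suml; apply: eq_bigr => i _; rewrite mulr_sumr.
  rewrite -(big_mkord xpredT (fun j => x i * y j)).
  rewrite -(big_mkord (fun n => (i <= n)%N) (fun n => x i * y (n - i)%N)).
  have iN : (i <= N.+1)%N by exact: ltnW.
  rewrite (big_cat_nat _ (leq_subr i N.+1)) //= [X in _ + X]big_nat_cond [X in _ + X]big1.
    rewrite addr0 [RHS]big_mkcond (big_cat_nat _ iN) //= [X in _ = X + _]big_nat_cond.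
    rewrite [X in _ = X + _]big1 ?add0r => [|n /andP[/andP[_ ni] _]]; last by rewrite leqNgt ni.
    rewrite -{3}[i : nat]add0n big_addn; apply: eq_big_nat => n _.
    by rewrite leq_addl addnK.
  by move=> n /andP[/andP[ni _] _]; apply: h; rewrite -leq_subLR.
apply: eq_bigr => n _; rewrite (big_ord_widen N.+1 (fun j => x j * y (n - j)%N) (ltn_ord n)).
by apply: eq_bigl => j; rewrite ltnS.
Qed.

(** The section composed with exp(a D), a finite sum since [a] is nilpotent. It is again
    multiplicative because D is a derivation. *)
Definition twist : section := fun V f => \sum_(n < N.+1) st (a ^+ n) * sg V (Exp n f).

Lemma twist_lsec : lsec W twist.
Proof.
split.
- move=> V f x VW rf Vx; rewrite dred_sum // big_ord_recl big1 ?addr0.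
    by rewrite dredM // dred_st // rmorph1 mul1r (ls_dred ls).
  by move=> i _; rewrite dredM // dred_st // exprS rmorphM aug_a !mul0r.
- move=> V f g VW rf fg; apply: eq_bigr => i _; congr (_ * _).
  have rg : reg (oset V) g by apply: reg_ext rf; first exact: svalP.
  by apply: (ls_ext ls) => //; [exact: Exp_reg|exact: Exp_ext].
- move=> V f g VW rf rg; rewrite -big_split; apply: eq_bigr => i _ /=; rewrite -mulrDr.
  congr (_ * _); rewrite -(ls_add ls) //; try exact: Exp_reg.
  apply: (ls_ext ls) => //; last exact: Exp_add.
  by apply: Exp_reg => //; apply: reg_add => //; exact: svalP.
- move=> V f g VW rf rg; rewrite /twist (cauchy_sum (x := fun i => st (a ^+ i) * sg V (Exp i f))
      (y := fun i => st (a ^+ i) * sg V (Exp i g))); last first.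
    move=> i j ij; rewrite mulrACA -rmorphM -exprD -(subnK ij) addnC.
    by rewrite exprD aN mul0r rmorph0 mul0r.
  apply: eq_bigr => n _.
  have rm j : reg (oset V) (fun x => Exp j f x * Exp (n - j)%N g x).
    by apply: reg_mul; [exact: svalP|exact: Exp_reg|exact: Exp_reg].
  rewrite (ls_ext ls VW _ (Exp_mul n VW rf rg)); last first.
    by apply: Exp_reg => //; apply: reg_mul => //; exact: svalP.
  have -> : sg V (fun x => \sum_(j < n.+1) Exp j f x * Exp (n - j)%N g x) =
      \sum_(j < n.+1) sg V (Exp j f) * sg V (Exp (n - j)%N g).
    pose F (j : 'I_n.+1) x := Exp j f x * Exp (n - j)%N g x.
    transitivity (\sum_(j < n.+1) sg V (F j)); last first.
      by apply: eq_bigr => j _; rewrite (ls_mul ls) //; exact: Exp_reg.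
    elim: (index_enum _) => [|j l IH].
      by rewrite big_nil -(ls0 ls VW); apply: (ls_ext ls) => //;
        [have [] := D_sum [::] VW (fun j : 'I_n.+1 => rm j) | move=> x _; rewrite big_nil].
    have rF i : reg (oset V) (F i) := rm i.
    rewrite big_cons -IH -(ls_add ls VW (rF j) (D_sum l VW rF).1).
    apply: (ls_ext ls VW (D_sum (j :: l) VW rF).1) => x _; by rewrite big_cons.
  rewrite mulr_sumr; apply: eq_bigr => j _; rewrite mulrACA -rmorphM -exprD subnKC //.
  by rewrite -ltnS.
- move=> V c VW; rewrite /twist big_ord_recl big1 ?addr0 => [|i _].
    by rewrite rmorph1 mul1r (ls_cst ls).
  rewrite (ls_ext ls VW _ (Exp_cst i c VW)) ?(ls0 ls) ?mulr0 //.
  by apply: Exp_reg => //; apply: reg_cst; exact: svalP.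
- move=> U V h f UW rf; rewrite rmorph_sum; apply: eq_bigr => i _.
  by rewrite rmorphM dres_str (ls_res ls) //; exact: Exp_reg.
Qed.

(** Terms of order two and more contain the product of [a] with an element of the maximal ideal and
    so lie one step deeper. *)
Lemma twist_mem k V f : (0 < k)%N -> spang k a -> oset V `<=` W -> reg (oset V) f ->
  mem k.+1 (twist V f - sg V f - st a * sg V (D f)).
Proof.
move=> k0 ka VW rf; rewrite /twist; case: N aN => [|M] aM.
  have a0 : a = 0 by rewrite -[a]expr1.
  rewrite a0 rmorph0 mul0r subr0 big_ord_recl big_ord0 addr0 rmorph1 mul1r subrr.
  exact: mem0.
rewrite 2!big_ord_recl rmorph1 mul1r [Exp (lift _ _) f](_ : _ = D f); last first.
  by apply/funext => x; rewrite /= invr1 mul1r.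
rewrite expr1 [sg V f + _]addrC addrK [_ + \sum_(_ < _) _]addrC addrK.
apply: mem_sum => i _; apply: mem_spang; rewrite exprSr; apply: spang_m => //.
by rewrite exprS rmorphM aug_a mul0r.
Qed.

End Twist.
(** Sections over the empty set form the zero ring, whereas [mmap] evaluates in nonzero rings; hence
    the case distinction. *)
Lemma mpoly_eval_exists (S : comPzRingType) (c : {rmorphism K -> S}) (t : 'I_r -> S) :
  exists h : P -> S, [/\ forall p q, h (p + q) = h p + h q, forall p q, h (p * q) = h p * h q,
    forall a, h a%:MP = c a & forall i, h 'X_i = t i].
Proof.
have [S0|S1] := eqVneq (1 : S) 0.
  have S_0 (x y : S) : x = y by rewrite -[x]mul1r -[y]mul1r S0 !mul0r.
  by exists (fun=> 0); split=> *; exact: S_0.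
pose S' : comNzRingType := HB.pack (GRing.ComPzRing.sort S) (GRing.PzSemiRing_isNonZero.Build S S1).
pose c' : {rmorphism K -> S'} := c.
exists (mmap c' (t : 'I_r -> S')); split=> [p q|p q|a|i]; rewrite ?rmorphD ?rmorphM //.
  by rewrite mmapC.
by rewrite mmapX mmap1U.
Qed.

(** * A local section obtained by lifting chart coordinates *)

Section Initial.
Variables (e : signs r) (W : opens X) (t : 'I_r -> dO d W).
Hypothesis W_e : oset W `<=` prin phi e 1.
Hypothesis tE : forall i a, oset W (phi e a) -> dred (t i) (phi e a) = a i.

Definition scal V : {rmorphism K -> dO d V} := dstr d V \o in_alg A.

Definition pe V : P -> dO d V := if pselect (oset V `<=` oset W) is left h then
  sval (cid (mpoly_eval_exists (scal V) (fun i => res h (t i)))) else fun=> 0.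

Lemma peP V (h : oset V `<=` oset W) : [/\ forall p q, pe V (p + q) = pe V p + pe V q,
  forall p q, pe V (p * q) = pe V p * pe V q, forall c, pe V c%:MP = st (c%:A)
  & forall i, pe V 'X_i = res h (t i)].
Proof.
rewrite /pe; case: pselect => // h'; have -> : h' = h by exact: Prop_irrelevance.
by case: (cid _).
Qed.

Lemma pe_res U V (h : oset V `<=` oset U) p : oset U `<=` oset W -> res h (pe U p) = pe V p.
Proof.
move=> UW; have VW : oset V `<=` oset W by move=> x /h/UW.
have [hD hM hC hX] := peP UW; have [hD' hM' hC' hX'] := peP VW.
elim/mpoly_gen_ind: p => [c|i|p q hp hq|p q hp hq].
- by rewrite hC hC' dres_str.
- by rewrite hX hX' (dres_comp _ _ VW).
- by rewrite hD hD' rmorphD hp hq.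
- by rewrite hM hM' rmorphM hp hq.
Qed.

Lemma pe_dred V p a : oset V `<=` oset W -> oset V (phi e a) -> dred (pe V p) (phi e a) = p.@[a].
Proof.
move=> VW Va; have [hD hM hC hX] := peP VW.
elim/mpoly_gen_ind: p => [c|i|p q hp hq|p q hp hq].
- by rewrite hC dred_st // augA mevalC.
- by rewrite hX dredR // tE ?mevalXU //; apply: (VW).
- by rewrite hD dredD // hp hq mevalD.
- by rewrite hM dredM // hp hq mevalM.
Qed.

Definition isfrac (V : set X) f (p q : P) :=
  forall a, V (phi e a) -> q.@[a] != 0 /\ f (phi e a) = p.@[a] / q.@[a].

Lemma pt V x : oset V `<=` oset W -> oset V x -> exists2 a, x = phi e a & oset V (phi e a).
Proof. by move=> VW Vx; have /VW/W_e[a xa _] := Vx; exists a; rewrite -?xa. Qed.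

Lemma dO_empty V (s s' : dO d V) : (forall x, ~ oset V x) -> s = s'.
Proof. by move=> h; apply: (@dsep _ _ _ _ d V) => x /h. Qed.

Lemma isfrac_eq V f p q p' q' : oset V `<=` oset W -> isfrac (oset V) f p q ->
  isfrac (oset V) f p' q' -> pe V (p * q') = pe V (p' * q).
Proof.
move=> VW h h'; have [[x Vx]|/forallNP V0] := pselect (exists x, oset V x); last exact: dO_empty.
congr (pe V _); apply: contrapT => /eqP; rewrite -subr_eq0 => n0.
have [a xa Va] := pt VW Vx.
have /(ba_opn atl) oV := svalP V; have [D [Da DV]] := oV e a Va.
have D0 : D != 0 by apply: contraNneq Da => ->; rewrite meval0.
have /mpoly_nz_pt[c] : (p * q' - p' * q) * D != 0 by rewrite mulf_neq0.
rewrite mevalM mulf_eq0 negb_or => /andP[nz /DV Vc].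
have [qc e1] := h c Vc; have [qc' e2] := h' c Vc.
move: nz; rewrite mevalB !mevalM subr_eq0 => /eqP; apply; apply/eqP.
by rewrite -eqr_div // -e1 -e2.
Qed.

(** Lift the inverse of the reduction to u. Then 1 - s u reduces to zero, hence is nilpotent, and a
    geometric series corrects u. *)
Lemma unit_local V (s : dO d V) x : oset V x -> dred s x != 0 ->
  (forall y, oset V y -> dred s y != 0) ->
  exists V' (h : oset V' `<=` oset V) u, oset V' x /\ res h s * u = 1.
Proof.
move=> Vx sx s0; have ri : reg (oset V) (fun y => (dred s y)^-1).
  have /(ba_reg atl _ (svalP V)) hs := dred_reg s.
  apply/(ba_reg atl) => [|e' a Va]; first exact: svalP.
  have [p [q [qa h]]] := hs e' a Va.
  have pa : p.@[a] != 0.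
    by have := s0 _ Va; rewrite h // mulf_eq0 negb_or => /andP[].
  exists (q ^+ 2), (p * q); rewrite mevalM mulf_neq0 //; split=> // c Vc.
  rewrite mevalM mulf_eq0 negb_or => /andP[pc qc].
  by rewrite h // invf_div rmorphXn /= expr2 -mulf_div divff // mulr1.
have [V1 [u [V1x V1V hu]]] := dred_surj d ri Vx.
pose z := 1 - res V1V s * u.
have zd y : oset V1 y -> dred z y = 0.
  move=> V1y; rewrite dredD // dredN // dredM // dredR // hu ?inE //.
  rewrite -(rmorph1 (dstr d V1)) dred_st // rmorph1 divff ?subrr //.
  exact/s0/V1V.
have [V2 [h2 [V2x hz]]] := mem1_local zd V1x.
have zk k : mem k (res h2 z ^+ k).
  by elim: k => [|k IH]; [exact: mem_all|rewrite exprS; exact: mem1M].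
have z0 : res h2 z ^+ L.+1 = 0 by apply: mem_top.
have h : oset V2 `<=` oset V by move=> y /h2/V1V.
exists V2, h, (res h2 u * \sum_(i < L.+1) res h2 z ^+ i); split=> //.
have -> : res h s * (res h2 u * \sum_(i < L.+1) res h2 z ^+ i) =
   (1 - res h2 z) * \sum_(i < L.+1) res h2 z ^+ i.
  rewrite mulrA; congr (_ * _); rewrite rmorphB rmorph1 rmorphM (dres_comp _ _ h) opprB.
  by rewrite addrC subrK.
by rewrite -opprB mulNr -subrX1 z0 sub0r opprK.
Qed.

Lemma inv_uniq (S : comPzRingType) (s u v : S) : s * u = 1 -> s * v = 1 -> u = v.
Proof. by move=> su sv; rewrite -[u]mulr1 -sv mulrA [u * s]mulrC su mul1r. Qed.

(** Local inverses are unique, so they glue. *)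
Lemma unit_global V (s : dO d V) : (forall y, oset V y -> dred s y != 0) ->
  exists u, s * u = 1.
Proof.
move=> s0.
pose C : set (opens X) := [set V' | exists (h : oset V' `<=` oset V) u, res h s * u = 1].
have hex V' : exists u : dO d V', C V' -> forall h : oset V' `<=` oset V, res h s * u = 1.
  have [[h [u hu]]|n] := pselect (C V'); last by exists 0.
  by exists u => _ h'; rewrite (Prop_irrelevance h' h).
have [w hw] : exists w : forall V', dO d V', forall V', C V' -> forall h : oset V' `<=` oset V, res h s * w V' = 1.
  by exists (fun V' => sval (cid (hex V'))) => V'; case: (cid _).
have [||u hu] := @dglue _ _ _ _ d V C w.
- apply/seteqP; split=> [x Vx|x [V' [h _] /h //]].
  have [V' [h [u [V'x hu]]]] := unit_local Vx (s0 x Vx) s0.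
  by exists V' => //; exists h, u.
- move=> V1 V2 U h1 h2 C1 C2; have [k1 _] := C1; have [k2 _] := C2.
  have k : oset U `<=` oset V by move=> x /h1/k1.
  apply: (@inv_uniq _ (res k s)).
    by rewrite -(dres_comp k1 h1 k) -rmorphM hw // rmorph1.
  by rewrite -(dres_comp k2 h2 k) -rmorphM hw // rmorph1.
exists u; apply: (@dsep _ _ _ _ d V) => x Vx.
have [V' [h [v [V'x hv]]]] := unit_local Vx (s0 x Vx) s0.
have CV : C V' by exists h, v.
by exists V', h; split=> //; rewrite rmorphM hu // hw // rmorph1.
Qed.

Lemma pe_unit V f p q : oset V `<=` oset W -> isfrac (oset V) f p q -> exists u, pe V q * u = 1.
Proof.
move=> VW h; apply: unit_global => y Vy; have [a -> Va] := pt VW Vy.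
by rewrite pe_dred //; have [] := h a Va.
Qed.

(** The lift of f = p / q is characterised by the equation s q = p instead of by a division; this
    makes uniqueness and compatibility with restriction direct. *)
Definition frac V f (s : dO d V) := forall x, oset V x ->
  exists V' (h : oset V' `<=` oset V) p q, [/\ oset V' x, isfrac (oset V') f p q
    & res h s * pe V' q = pe V' p].

Lemma isfrac_sub (V V' : set X) f p q : V' `<=` V -> isfrac V f p q -> isfrac V' f p q.
Proof. by move=> VV h a /VV; exact: h. Qed.

Lemma frac_uniq V f s s' : oset V `<=` oset W -> @frac V f s -> @frac V f s' -> s = s'.
Proof.
move=> VW hs hs'; apply: (@dsep _ _ _ _ d V) => x Vx.
have [V1 [h1 [p [q [V1x f1 e1]]]]] := hs x Vx.
have [V2 [h2 [p' [q' [V2x f2 e2]]]]] := hs' x Vx.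
have h : oset (oI V1 V2) `<=` oset V by move=> y [/h1].
exists (oI V1 V2), h; split; first by split.
have N1 := isfrac_sub (@oIl V1 V2) f1; have N2 := isfrac_sub (@oIr V1 V2) f2.
have NW : oset (oI V1 V2) `<=` oset W by move=> y /h/VW.
have V1W : oset V1 `<=` oset W by move=> y /h1/VW.
have V2W : oset V2 `<=` oset W by move=> y /h2/VW.
have [_ hM _ _] := peP NW.
have := congr1 (res (@oIl V1 V2)) e1; have := congr1 (res (@oIr V1 V2)) e2.
rewrite !rmorphM !pe_res // !(dres_comp _ _ h) => {}e2 {}e1.
have [u hu] := pe_unit NW N1; have [u' hu'] := pe_unit NW N2.
have := isfrac_eq NW N1 N2; rewrite !hM -e1 -e2 => e3.
have k (S : comPzRingType) (y z z' v v' : S) : z * v = 1 -> z' * v' = 1 -> y = y * z * z' * (v * v').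
  by move=> hv hv'; rewrite mulrACA hv' mulr1 -mulrA hv mulr1.
by rewrite (k _ (res h s) _ _ _ _ hu hu') e3 mulrC [u * _]mulrC mulrC -(k _ _ _ _ _ _ hu' hu).
Qed.

Lemma frac_res U V (h : oset V `<=` oset U) f s : oset U `<=` oset W -> @frac U f s -> @frac V f (res h s).
Proof.
move=> UW hs x Vx; have [V1 [h1 [p [q [V1x f1 e1]]]]] := hs x (h _ Vx).
exists (oI V1 V), (@oIr V1 V), p, q; split; first by split.
  by apply: isfrac_sub f1; exact: oIl.
have k : oset (oI V1 V) `<=` oset U by move=> y [/h1].
have V1W : oset V1 `<=` oset W by move=> y /h1/UW.
have := congr1 (res (@oIl V1 V)) e1.
by rewrite rmorphM !pe_res // (dres_comp _ _ k) (dres_comp _ _ k).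
Qed.

Lemma frac_exists V f : oset V `<=` oset W -> reg (oset V) f -> exists s, @frac V f s.
Proof.
move=> VW rf.
pose C : set (opens X) := [set V' | exists (h : oset V' `<=` oset V) p q, isfrac (oset V') f p q].
have hex V' : exists u : dO d V', C V' -> @frac V' f u.
  have [[h [p [q hf]]]|n] := pselect (C V'); last by exists 0.
  have V'W : oset V' `<=` oset W by move=> y /h/VW.
  have [u hu] := pe_unit V'W hf.
  exists (u * pe V' p) => _ x V'x; exists V', (fun _ => id), p, q; split=> //.
  by rewrite dres_id mulrAC [u * _]mulrC hu mul1r.
have [w hw] : exists w : forall V', dO d V', forall V', C V' -> @frac V' f (w V').
  by exists (fun V' => sval (cid (hex V'))) => V'; case: (cid _).
have Cx x : oset V x -> exists V', C V' /\ oset V' x.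
  move=> Vx; have [a xa Va] := pt VW Vx.
  have /(ba_reg atl _ (svalP V)) hf := rf; have [p [q [qa h]]] := hf e a Va.
  pose V' := oI V (exist _ (prin phi e q) (opn_prin atl tinj e q)).
  have V'x : oset V' x by split=> //; rewrite xa; exists a.
  exists V'; split=> //; exists (@oIl _ _), p, q => c [Vc /(prinP atl tinj) qc].
  by rewrite h.
have CV V' : C V' -> oset V' `<=` oset V by case.
have [||u hu] := @dglue _ _ _ _ d V C w.
- by apply/seteqP; split=> [x /Cx[V' []]|x [V' [h _] /h //]]; exists V'.
- move=> V1 V2 U h1 h2 C1 C2.
  have UW : oset U `<=` oset W by move=> x /h1/(CV _ C1)/VW.
  by apply: (frac_uniq UW (f := f)); apply: frac_res; try exact: hw; move=> x /CV; auto.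
exists u => x Vx; have [V' [CV' V'x]] := Cx x Vx.
have [V1 [h1 [p [q [V1x f1 e1]]]]] := hw V' CV' x V'x.
have h := CV _ CV'; have k : oset V1 `<=` oset V by move=> y /h1/h.
by exists V1, k, p, q; split=> //; rewrite -(dres_comp h h1 k) hu.
Qed.

Definition inisec : section := fun V f => xget 0 [set s | @frac V f s].

Lemma inisecP V f : oset V `<=` oset W -> reg (oset V) f -> @frac V f (inisec V f).
Proof. by move=> VW /(frac_exists VW)[s hs]; rewrite /inisec; case: xgetP => [|/(_ s)/(_ hs)]. Qed.

Lemma inisecE V f s : oset V `<=` oset W -> reg (oset V) f -> @frac V f s -> inisec V f = s.
Proof. by move=> VW rf hs; apply: (frac_uniq VW _ hs); exact: inisecP. Qed.

Lemma frac2 V f (g : X -> K) (s s' : dO d V) x : oset V `<=` oset W -> @frac V f s -> @frac V g s' -> oset V x ->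
  exists V' (h : oset V' `<=` oset V) p q p' q', [/\ oset V' x,
   isfrac (oset V') f p q /\ isfrac (oset V') g p' q'
    & res h s * pe V' q = pe V' p /\ res h s' * pe V' q' = pe V' p'].
Proof.
move=> VW hs hs' Vx.
have [V1 [h1 [p [q [V1x f1 e1]]]]] := hs x Vx.
have [V2 [h2 [p' [q' [V2x f2 e2]]]]] := hs' x Vx.
have h : oset (oI V1 V2) `<=` oset V by move=> y [/h1].
have V1W : oset V1 `<=` oset W by move=> y /h1/VW.
have V2W : oset V2 `<=` oset W by move=> y /h2/VW.
exists (oI V1 V2), h, p, q, p', q'; split; first by split.
  by split; [exact: isfrac_sub (@oIl V1 V2) f1|exact: isfrac_sub (@oIr V1 V2) f2].
have := congr1 (res (@oIl V1 V2)) e1; have := congr1 (res (@oIr V1 V2)) e2.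
by rewrite !rmorphM !pe_res // !(dres_comp _ _ h).
Qed.

Lemma inisec_lsec : lsec (oset W) inisec.
Proof.
split.
- move=> V f x VW rf Vx; have [V' [h [p [q [V'x hf hE]]]]] := inisecP VW rf Vx.
  have V'W : oset V' `<=` oset W by move=> y /h/VW.
  have [a xa V'a] := pt V'W V'x; have [qa fa] := hf a V'a.
  have := congr1 (fun s => dred s x) hE; rewrite dredM // dredR // xa !pe_dred // fa => <-.
  by rewrite mulfK.
- move=> V f g VW rf fg; symmetry; have rg : reg (oset V) g by apply: reg_ext rf; first exact: svalP.
  apply: inisecE => // x Vx; have [V' [h [p [q [V'x hf hE]]]]] := inisecP VW rf Vx.
  exists V', h, p, q; split=> // a V'a; have [qa fa] := hf a V'a; split=> //.
  by rewrite -fg // inE; apply: (h).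
- move=> V f g VW rf rg; apply: inisecE => //; first by apply: reg_add => //; exact: svalP.
  move=> x Vx.
  have [V' [h [p [q [p' [q' [V'x [hf hg] [e1 e2]]]]]]]] := frac2 VW (inisecP VW rf) (inisecP VW rg) Vx.
  have V'W : oset V' `<=` oset W by move=> y /h/VW.
  have [hD hM _ _] := peP V'W.
  exists V', h, (p * q' + p' * q), (q * q'); split=> //.
    move=> a V'a; have [qa fa] := hf a V'a; have [qa' ga] := hg a V'a.
    by rewrite mevalM mulf_neq0 // fa ga addf_div // mevalD !mevalM.
  by rewrite rmorphD hD !hM -e1 -e2 mulrDl mulrA; congr (_ + _); rewrite -!mulrA; congr (_ * _); rewrite mulrC.
- move=> V f g VW rf rg; apply: inisecE => //; first by apply: reg_mul => //; exact: svalP.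
  move=> x Vx.
  have [V' [h [p [q [p' [q' [V'x [hf hg] [e1 e2]]]]]]]] := frac2 VW (inisecP VW rf) (inisecP VW rg) Vx.
  have V'W : oset V' `<=` oset W by move=> y /h/VW.
  have [hD hM _ _] := peP V'W.
  exists V', h, (p * p'), (q * q'); split=> //.
    move=> a V'a; have [qa fa] := hf a V'a; have [qa' ga] := hg a V'a.
    by rewrite mevalM mulf_neq0 // fa ga mulf_div // !mevalM.
  by rewrite rmorphM !hM -e1 -e2 mulrACA.
- move=> V c VW; apply: inisecE => //; first by apply: reg_cst; exact: svalP.
  move=> x Vx; have [hD hM hC _] := peP VW.
  exists V, (fun _ => id), c%:MP, 1; split=> //.
    by move=> a _; rewrite meval1 oner_eq0 mevalC divr1.
  by rewrite dres_id -mpolyC1 !hC scale1r rmorph1 mulr1.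
- move=> U V h f UW rf; symmetry; apply: inisecE.
  + by move=> x /h/UW.
  + by apply: reg_sub rf; try exact: svalP.
  + by apply: frac_res => //; exact: inisecP.
Qed.

End Initial.

Lemma initial_section x : exists (W : opens X) (sg : section), oset W x /\ lsec (oset W) sg.
Proof.
have [e [a xa]] := ba_surj atl x.
pose gen i := cox_iota (ba_lt atl) tinj e 'X_i.
have cv u i : vat atl tinj (phi e u) (gen i) (u i).
  by apply/vatP; have := valc_iota (ba_lt atl) tinj e u 'X_i; rewrite mevalXU.
pose c i := ev atl tinj (gen i).
have cE u i : c i (phi e u) = u i by exact: evE (cv u i).
pose U : opens X := exist _ (prin phi e 1) (opn_prin atl tinj e 1).
have Ux : oset U x by exists a; rewrite ?meval1 ?oner_neq0.
have cr i : reg (oset U) (c i).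
  have g0 : germ atl tinj (oset U) (c i) (gen i) by move=> y [u -> _]; rewrite cE.
  exact: (germ_reg (svalP U) g0).
have /choice[Vs hVs] i : exists Vs : {V : opens X & dO d V},
    [/\ oset (projT1 Vs) x, oset (projT1 Vs) `<=` oset U & {in oset (projT1 Vs), dred (projT2 Vs) =1 c i}].
  by have [V [s hs]] := dred_surj d (cr i) Ux; exists (existT _ V s).
pose V j := if unlift ord0 j is Some i then oset (projT1 (Vs i)) else oset U.
have oV : opn (meet V (fun j : 'I_r.+1 => j)).
  by apply: (meet_opn atl) => j; rewrite /V; case: unlift => [i|]; exact: svalP.
pose W : opens X := exist _ _ oV.
have WV i : oset W `<=` oset (projT1 (Vs i)).
  by move=> y /(_ (lift ord0 i)); rewrite /V liftK.
have WU : oset W `<=` prin phi e 1.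
  by move=> y /(_ ord0); rewrite /V unlift_none.
exists W, (@inisec e W (fun i => res (WV i) (projT2 (Vs i)))); split.
  by move=> j; rewrite /V; case: unlift => [i|] //; have [] := hVs i.
apply: inisec_lsec => // i u Wu; have [_ _ hd] := hVs i.
by rewrite dredR // hd ?cE // inE; exact: WV.
Qed.

Definition agree (J : Type) (W : J -> opens X) (sg : J -> section) k := 
  [/\ forall x, exists j, oset (W j) x, forall j, lsec (oset (W j)) (sg j)
    & forall i j V f, oset V `<=` oset (W i) -> oset V `<=` oset (W j) -> reg (oset V) f ->
        mem k (sg i V f - sg j V f)].

Lemma agree_start : exists (J : finType) (W : J -> opens X) (sg : J -> section), agree W sg 1.
Proof.
have /choice[G hG] x : exists Ws : opens X * section, oset Ws.1 x /\ lsec (oset Ws.1) Ws.2.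
  by have [W [sg h]] := initial_section x; exists (W, sg).
have [||J [tau [q [t [cov _ sub]]]]] := refine atl (U := fun x => oset (G x).1).
- by move=> x; exact: svalP.
- by move=> x; exists x; have [] := hG x.
have lsj j : lsec (prin phi (tau j) (q j)) (G (t j)).2.
  by apply: lsec_sub (sub j) _; have [] := hG (t j).
exists J, (fun j => exist _ _ (opn_prin atl tinj (tau j) (q j))), (fun j => (G (t j)).2).
split=> // i j V f Vi Vj rf; apply: (mem1_dred (lsj i)) => // x Vx.
by rewrite dredD // dredN // (ls_dred (lsj i)) // (ls_dred (lsj j)) // subrr.
Qed.

(** * Correction of the local sections, one step of the flag at a time *)

Section Step.
Variables (J : finType) (W : J -> opens X) (sg : J -> section) (k : 'I_L.+1).
Hypothesis k0 : (0 < k)%N.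
Hypothesis ag : agree W sg k.

Let ls j : lsec (oset (W j)) (sg j). Proof. by case: ag. Qed.

Definition coef i j V f h := reg (oset V) h /\
  mem k.+1 (sg j V f - sg i V f - st (b k) * sg i V h).

Definition inter i j V := oset V `<=` oset (W i) /\ oset V `<=` oset (W j).

Lemma aug_bk : aug (b k) = 0.
Proof. by apply: aug_b; apply: contraTneq k0 => ->. Qed.

Lemma coef_exists i j V f : inter i j V -> reg (oset V) f -> exists h, coef i j V f h.
Proof.
move=> [Vi Vj] rf; have [_ _ hk] := ag.
have [h [rh hm]] := mem_lead (ls i) Vi (hk j i V f Vj Vi rf).
by exists h.
Qed.

Lemma coef_uniq i j V f h h' : inter i j V -> coef i j V f h -> coef i j V f h' ->
  forall x, oset V x -> h x = h' x.
Proof.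
move=> [Vi Vj] [rh hm] [rh' hm'] x Vx; apply/eqP; rewrite -subr_eq0; apply/eqP.
have rn : reg (oset V) (fun x => - h' x).
  have := reg_mul (svalP V) (reg_cst (-1) (svalP V)) rh'; apply: reg_ext; first exact: svalP.
  by move=> z _; rewrite mulN1r.
apply: (mem_coef (ls i) (f := fun x => h x - h' x) (k := k) Vi) => //.
  by apply: reg_add => //; exact: svalP.
rewrite (ls_add (ls i)) // (ls_opp (ls i)) // mulrBr.
by have := memB hm' hm; rewrite opprB addrC subrKA.
Qed.

Lemma coef_res i j U V (h : oset V `<=` oset U) f (g : X -> K) : inter i j U -> reg (oset U) f ->
  coef i j U f g -> coef i j V f g.
Proof.
move=> [Ui Uj] rf [rg hm]; split; first by apply: reg_sub rg; try exact: svalP.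
have := mem_res h hm; rewrite !rmorphB rmorphM dres_str.
by rewrite !(ls_res (ls i) h Ui) // (ls_res (ls j) h Uj).
Qed.

(** The function [h] of [coef], made independent of the open set: any neighbourhood of x on which
    [f] is regular gives the same value at x. *)
Definition cdiff i j f x : K := xget 0 [set v | exists V h,
  [/\ oset V x, inter i j V, reg (oset V) f, coef i j V f h & v = h x]].

Lemma cdiffE i j V f h x : inter i j V -> reg (oset V) f -> coef i j V f h -> oset V x ->
  cdiff i j f x = h x.
Proof.
move=> Vij rf ch Vx; rewrite /cdiff; case: xgetP => [v _|/(_ (h x))/=]; last first.
  by case; exists V, h.
move=> [V' [h' [V'x Vij' rf' ch' ->]]].
have N : inter i j (oI V V') by case: Vij => Vi Vj; split=> y [Vy _]; [exact: Vi|exact: Vj].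
apply: (coef_uniq N (f := f)); last by split.
- exact: (coef_res (@oIr V V') Vij' rf' ch').
- exact: (coef_res (@oIl V V') Vij rf ch).
Qed.

Lemma cdiffP i j V f : inter i j V -> reg (oset V) f -> coef i j V f (cdiff i j f).
Proof.
move=> Vij rf; have [h ch] := coef_exists Vij rf; have [rh hm] := ch.
have e : {in oset V, h =1 cdiff i j f} by move=> x; rewrite inE => Vx; rewrite (cdiffE Vij rf ch).
split; first by apply: reg_ext e rh; exact: svalP.
by rewrite -(ls_ext (ls i) _ rh e) //; case: Vij.
Qed.

(** Two algebra maps that agree modulo the k-th ideal differ by a derivation modulo the next one:
    the error term is [b k], an element of the maximal ideal, times a section in the k-th ideal. *)
Lemma coef_mul i j V f (g h h' : X -> K) : inter i j V -> reg (oset V) f -> reg (oset V) g ->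
  coef i j V f h -> coef i j V g h' -> coef i j V (fun x => f x * g x) (fun x => h x * g x + f x * h' x).
Proof.
move=> [Vi Vj] rf rg [rh hm] [rh' hm']; have oV := svalP V.
have r1 := reg_mul oV rh rg; have r2 := reg_mul oV rf rh'.
split; first exact: reg_add.
rewrite !(ls_mul (ls _)) // (ls_add (ls _)) // !(ls_mul (ls _)) //.
have [_ _ hk] := ag; have gk := hk j i V g Vj Vi rg.
set A1 := sg j V f in hm *; set A2 := sg i V f in hm *; set B1 := sg j V g in hm' gk *.
set B2 := sg i V g in hm' gk *; set H := sg i V h in hm *; set H' := sg i V h' in hm' *.
set z := st (b k) in hm hm' *.
have -> : A1 * B1 - A2 * B2 - z * (H * B2 + A2 * H') =
   B1 * (A1 - A2 - z * H) + A2 * (B1 - B2 - z * H') + z * (H * (B1 - B2)) by ring.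
apply: memD; first by apply: memD; exact: memM.
by apply: mem_m; [exact: aug_bk|exact: memM].
Qed.

Lemma cdiff_vfield i j : vfield (oset (W i) `&` oset (W j)) (cdiff i j).
Proof.
have I0 (V : set X) : V `<=` oset (W i) `&` oset (W j) -> forall oV : opn V, inter i j (exist _ V oV).
  by move=> h oV; split=> x /h[].
split.
- by move=> V f oV /I0/(_ oV) Vij rf; have [] := cdiffP Vij rf.
- move=> V f g oV /I0/(_ oV) Vij rf rg fg x; rewrite inE => Vx.
  apply: (cdiffE Vij rf _ Vx); have [rh hm] := cdiffP Vij rg; split=> //.
  case: Vij => Vi Vj; pose V' : opens X := exist _ V oV.
  by rewrite (ls_ext (ls i) (V := V') Vi rf fg) (ls_ext (ls j) (V := V') Vj rf fg).
- move=> V c f oV /I0/(_ oV) Vij rf x; rewrite inE => Vx.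
  have rc : reg V (fun=> c) by exact: reg_cst.
  have c0 : coef i j (exist _ V oV) (fun=> c) (fun=> 0).
    case: Vij => Vi Vj; split; first exact: reg_cst.
    by rewrite !(ls_cst (ls _)) // scale0r rmorph0 subrr mulr0 subr0; exact: mem0.
  rewrite (cdiffE Vij _ (coef_mul Vij rc rf c0 (cdiffP Vij rf)) Vx) ?mul0r ?add0r //.
  exact: reg_mul.
- move=> V f g oV /I0/(_ oV) Vij rf rg x; rewrite inE => Vx.
  have [r1 m1] := cdiffP Vij rf; have [r2 m2] := cdiffP Vij rg.
  rewrite (cdiffE Vij (h := fun x => cdiff i j f x + cdiff i j g x) _ _ Vx) //; first exact: reg_add.
  split; first exact: reg_add.
  case: Vij => Vi Vj; rewrite !(ls_add (ls _)) //.
  have := memD m1 m2; congr mem; ring.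
- move=> V f g oV /I0/(_ oV) Vij rf rg x; rewrite inE => Vx.
  rewrite (cdiffE Vij _ (coef_mul Vij rf rg (cdiffP Vij rf) (cdiffP Vij rg)) Vx) //.
  exact: reg_mul.
Qed.

Lemma cdiff_cocycle i j l V f x : oset V `<=` oset (W i) -> oset V `<=` oset (W j) ->
  oset V `<=` oset (W l) -> reg (oset V) f -> oset V x ->
  cdiff i l f x = cdiff i j f x + cdiff j l f x.
Proof.
move=> Vi Vj Vl rf Vx.
have [r1 m1] := cdiffP (conj Vi Vj) rf; have [r2 m2] := cdiffP (conj Vj Vl) rf.
have [_ _ hk] := ag; have gk := hk j i V _ Vj Vi r2.
rewrite (cdiffE (conj Vi Vl) rf (h := fun x => cdiff i j f x + cdiff j l f x) _ Vx) //.
split; first by apply: reg_add => //; exact: svalP.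
rewrite (ls_add (ls _)) //.
have := memD (memD m1 m2) (mem_m aug_bk gk); congr mem; ring.
Qed.

Lemma spang_exp a n : aug a = 0 -> spang n (a ^+ n).
Proof.
move=> ha; elim: n => [|n IH]; last by rewrite exprS; exact: spang_m.
by rewrite expr0 -b0; exact: spang_b.
Qed.

Lemma spang_top a : spang L.+1 a -> a = 0.
Proof. by case=> c ->; rewrite big1 // => i; rewrite leqNgt ltn_ord. Qed.

(** The vector fields [cdiff] form a cocycle. If it is the coboundary of [bb] on a refinement,
    twisting the j-th section by the exponential of - b_k bb_j cancels the discrepancies modulo the
    next ideal. *)
Lemma agree_step : tangent_cohomology_vanishes X 1 ->
  exists (J' : finType) (W' : J' -> opens X) (sg' : J' -> section), agree W' sg' k.+1.
Proof.
move=> hX; pose c : cochain X J 2 := fun s => cdiff (s ord0) (s ord_max).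
pose WJ j := oset (W j).
have m2 (s : 'I_2 -> J) x : meet WJ s x -> oset (W (s ord0)) x /\ oset (W (s ord_max)) x.
  by move=> h; split; exact: h.
have [cov lsj hk] := ag.
have [|||J' [V [t [bb [[oV cV] Vt vb hb]]]]] := hX J WJ c.
- by split=> [j|x]; [exact: svalP|exact: cov].
- move=> s; have := cdiff_vfield (s ord0) (s ord_max); congr vfield.
  apply/seteqP; split=> [x [h0 h1] j|x /m2 [] //].
  case: j => -[|[|//]] h; [have -> : Ordinal h = ord0 by exact: val_inj|
    have -> : Ordinal h = ord_max by exact: val_inj]; done.
- move=> s V f oV Vs rf x; rewrite inE => Vx.
  pose j0 : 'I_3 := ord0; pose j1 : 'I_3 := lift ord0 ord0; pose j2 : 'I_3 := ord_max.
  have l00 : lift (ord0 : 'I_3) ord0 = j1 by [].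
  have l0m : lift (ord0 : 'I_3) ord_max = j2 by exact: val_inj.
  have l10 : lift j1 ord0 = j0 by exact: val_inj.
  have l1m : lift j1 ord_max = j2 by exact: val_inj.
  have l2 : lift ord0 (lift ord0 ord0) = j2 by exact: val_inj.
  have l20 : lift j2 ord0 = j0 by exact: val_inj.
  have l2m : lift j2 ord_max = j1 by exact: val_inj.
  rewrite /cobound !big_ord_recl big_ord0 /c /= l2 l00 l0m l10 l1m l20 l2m.
  pose VO : opens X := exist _ V oV.
  have Vj l : oset VO `<=` oset (W (s l)) by move=> y /Vs/(_ l).
  rewrite (cdiff_cocycle (Vj j0) (Vj j1) (Vj j2) rf Vx) expr0 expr1 sqrrN expr1n.
  ring.
pose W' j : opens X := exist _ (V j) (oV j).
have vf j : vfield (oset (W' j)) (bb (fun=> j)).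
  by have := vb (fun=> j); congr vfield; apply/seteqP; split=> [x /(_ ord0)|x Vx i].
have aa : aug (- b k) = 0 by rewrite rmorphN aug_bk oppr0.
have ls' j : lsec (oset (W' j)) (sg (t j)) by apply: lsec_sub (lsj (t j)); exact: Vt.
have aN : (- b k) ^+ L.+1 = 0 by apply/spang_top/spang_exp.
exists J', W', (fun j => twist (sg (t j)) (bb (fun=> j)) (- b k) L); split=> //.
  by move=> j; apply: twist_lsec => //; exact: oV.
have sk : spang k (- b k) by rewrite -scaleN1r; apply/spangZ/spang_b.
move=> i j U f Ui Uj rf.
have mi := twist_mem (sg (t i)) (bb (fun=> i)) aN aa k0 sk Ui rf.
have mj := twist_mem (sg (t j)) (bb (fun=> j)) aN aa k0 sk Uj rf.
have Uti : oset U `<=` oset (W (t i)) by move=> x /Ui/Vt.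
have Utj : oset U `<=` oset (W (t j)) by move=> x /Uj/Vt.
have [rd md] := cdiffP (conj Utj Uti) rf.
have ri : reg (oset U) (bb (fun=> i) f) by apply: (vf_reg (vf i)) => //; exact: svalP.
have rj : reg (oset U) (bb (fun=> j) f) by apply: (vf_reg (vf j)) => //; exact: svalP.
have ed : {in oset U, forall x, cdiff (t j) (t i) f x + bb (fun=> j) f x = bb (fun=> i) f x}.
  move=> x Ux; pose s (l : 'I_2) := if l == ord0 then j else i.
  have := hb s (oset U) f (svalP U) _ rf x Ux; rewrite /cobound !big_ord_recl big_ord0 /=.
  have -> : s \o lift ord0 = (fun=> i) by apply/funext => l; rewrite /= /s ord1.
  have -> : s \o lift (lift ord0 ord0) = (fun=> j).
    apply/funext => l; have l0 : lift (lift ord0 ord0 : 'I_2) l = ord0.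
      by case: l => -[|//] h; exact: val_inj.
    by rewrite /= /s l0.
  rewrite /c /= /s /= expr0 mul1r expr1 mulN1r addr0 => ->.
    by rewrite subrK.
  by move=> y Uy l; rewrite /s; case: ifP => _; [exact: Uj|exact: Ui].
have gk := hk (t i) (t j) U _ Uti Utj ri.
have e1 : sg (t j) U (cdiff (t j) (t i) f) + sg (t j) U (bb (fun=> j) f) = sg (t j) U (bb (fun=> i) f).
  by rewrite -(ls_add (lsj _)) //; apply: (ls_ext (lsj _)) => //; apply: reg_add => //; exact: svalP.
have := memD (memB mi mj) (memB md (mem_m aug_bk gk)); congr mem; rewrite !rmorphN -e1.
ring.
Qed.

End Step.

Lemma agree_all k : tangent_cohomology_vanishes X 1 -> (k <= L)%N ->
  exists (J : finType) (W : J -> opens X) (sg : J -> section), agree W sg k.+1.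
Proof.
move=> hX; elim: k => [|k IH] kL; first exact: agree_start.
have [J [W [sg ag]]] := IH (ltnW kL).
exact: (@agree_step J W sg (Ordinal (kL : k.+1 < L.+1)%N)).
Qed.

(** At level L + 1 the ideal of the flag is zero, so the local sections coincide on overlaps and
    glue. *)
Lemma global_section : tangent_cohomology_vanishes X 1 -> exists sg, lsec setT sg.
Proof.
move=> /(@agree_all L)-/(_ (leqnn L))[J [W [sg [cov ls ag]]]].
have ag0 i j V f : oset V `<=` oset (W i) -> oset V `<=` oset (W j) -> reg (oset V) f ->
    sg i V f = sg j V f.
  by move=> Vi Vj rf; apply/eqP; rewrite -subr_eq0; apply/eqP/mem_top/ag.
pose glob V f (s : dO d V) := forall j V' (h : oset V' `<=` oset V), oset V' `<=` oset (W j) ->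
  res h s = sg j V' f.
have gex V f : reg (oset V) f -> exists s, @glob V f s.
  move=> rf; pose C : set (opens X) := [set V' | oset V' `<=` oset V /\ exists j, oset V' `<=` oset (W j)].
  have hex V' : exists u : dO d V', C V' -> forall j, oset V' `<=` oset (W j) -> u = sg j V' f.
    have [[h [j hj]]|n] := pselect (C V'); last by exists 0.
    exists (sg j V' f) => _ i hi; apply: ag0 => //; exact: reg_sub (svalP V) (svalP V') h rf.
  have [w hw] : exists w : forall V', dO d V', forall V', C V' -> forall j, oset V' `<=` oset (W j) -> w V' = sg j V' f.
    by exists (fun V' => sval (cid (hex V'))) => V'; case: (cid _).
  have [||u hu] := @dglue _ _ _ _ d V C w.
  - apply/seteqP; split=> [x Vx|x [V' [h _] /h //]]; have [j Wx] := cov x.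
    by exists (oI V (W j)) => //; split; [exact: oIl|exists j; exact: oIr].
  - move=> V1 V2 U h1 h2 C1 C2; have [s1 [j1 q1]] := C1; have [s2 [j2 q2]] := C2.
    rewrite (hw _ C1 _ q1) (hw _ C2 _ q2) (ls_res (ls j1)) // ?(ls_res (ls j2)) //.
    + apply: ag0; [by move=> x /h1/q1|by move=> x /h2/q2|].
      by apply: reg_sub rf; [exact: svalP|exact: svalP|move=> x /h1/s1].
    + exact: reg_sub (svalP V) (svalP V2) s2 rf.
    + exact: reg_sub (svalP V) (svalP V1) s1 rf.
  exists u => j V' h hj; have CV' : C V' by split=> //; exists j.
  by rewrite (hu _ h CV') (hw _ CV' j hj).
pose sG : section := fun V f => xget 0 [set s | @glob V f s].
have sGP V f : reg (oset V) f -> @glob V f (sG V f).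
  by move=> /gex[s hs]; rewrite /sG; case: xgetP => [|/(_ s)/(_ hs)].
have sGE V f s : reg (oset V) f -> (forall x, oset V x -> exists j V' (h : oset V' `<=` oset V),
    [/\ oset V' x, oset V' `<=` oset (W j) & res h s = sg j V' f]) -> sG V f = s.
  move=> rf hs; apply: (@dsep _ _ _ _ d V) => x Vx.
  have [j [V' [h [V'x hj e]]]] := hs x Vx; exists V', h; split=> //.
  by rewrite e; exact: sGP.
have loc V x : oset V x -> exists j V' (h : oset V' `<=` oset V), oset V' x /\ oset V' `<=` oset (W j).
  by move=> Vx; have [j Wx] := cov x; exists j, (oI V (W j)), (@oIl _ _); split; [split|exact: oIr].
exists sG; split.
- move=> V f x _ rf Vx; have [j [V' [h [V'x hj]]]] := loc V x Vx.
  rewrite -(dredR h) // (sGP V f rf j V' h hj) (ls_dred (ls j)) //.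
  exact: reg_sub (svalP V) (svalP V') h rf.
- move=> V f g _ rf fg; have rg : reg (oset V) g by apply: reg_ext rf; first exact: svalP.
  apply: sGE => // x Vx; have [j [V' [h [V'x hj]]]] := loc V x Vx; exists j, V', h; split=> //.
  rewrite (sGP V g rg j V' h hj); apply: (ls_ext (ls j)) => //.
    exact: reg_sub (svalP V) (svalP V') h rg.
  by move=> y; rewrite inE => V'y; rewrite fg // inE; apply: (h).
- move=> V f g _ rf rg; apply: sGE => [|x Vx]; first by apply: reg_add => //; exact: svalP.
  have [j [V' [h [V'x hj]]]] := loc V x Vx; exists j, V', h; split=> //.
  rewrite rmorphD !(sGP V _ _ j V' h hj) // (ls_add (ls j)) //.
    exact: reg_sub (svalP V) (svalP V') h rf.
  exact: reg_sub (svalP V) (svalP V') h rg.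
- move=> V f g _ rf rg; apply: sGE => [|x Vx]; first by apply: reg_mul => //; exact: svalP.
  have [j [V' [h [V'x hj]]]] := loc V x Vx; exists j, V', h; split=> //.
  rewrite rmorphM !(sGP V _ _ j V' h hj) // (ls_mul (ls j)) //.
    exact: reg_sub (svalP V) (svalP V') h rf.
  exact: reg_sub (svalP V) (svalP V') h rg.
- move=> V c _; apply: sGE => [|x Vx]; first by apply: reg_cst; exact: svalP.
  have [j [V' [h [V'x hj]]]] := loc V x Vx; exists j, V', h; split=> //.
  by rewrite dres_str (ls_cst (ls j)).
- move=> U V h f _ rf; symmetry; have rV : reg (oset V) f by apply: reg_sub rf; try exact: svalP.
  apply: sGE => // x Vx; have [j [V' [h' [V'x hj]]]] := loc V x Vx; exists j, V', h'; split=> //.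
  have k : oset V' `<=` oset U by move=> y /h'/h.
  by rewrite (dres_comp h h' k) (sGP U f rf j V' k hj).
Qed.

(** * The trivialisation given by a global section *)

Section Trivial.
Variable sg : section.
Hypothesis ls : lsec setT sg.

(* [s] is the image of the A-valued function [Fx], written in some finite family
   of elements of A. *)
Definition isval U (s : dO d U) (Fx : X -> A) := exists (I : finType) (v : I -> A) (f : I -> X -> K),
  [/\ forall i, reg (oset U) (f i), s = \sum_i st (v i) * sg U (f i)
    & forall x, oset U x -> Fx x = \sum_i f i x *: v i].

Let sT U : oset U `<=` [set: X] := fun _ _ => I.

Lemma reg_sum U (I : Type) (l : seq I) (c : I -> K) (f : I -> X -> K) :
  (forall i, reg (oset U) (f i)) -> 
  reg (oset U) (fun x => \sum_(i <- l) c i * f i x) /\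
  sg U (fun x => \sum_(i <- l) c i * f i x) = \sum_(i <- l) st ((c i)%:A) * sg U (f i).
Proof.
move=> rf; have oU := svalP U; elim: l => [|i l [IHr IH]].
  rewrite (_ : (fun x => _) = (fun=> 0)); last by apply/funext => x; rewrite big_nil.
  by rewrite big_nil (ls0 ls) //; split=> //; exact: reg_cst.
rewrite (_ : (fun x => _) = (fun x => c i * f i x + \sum_(j <- l) c j * f j x)); last first.
  by apply/funext => x; rewrite big_cons.
have r1 : reg (oset U) (fun=> c i) by exact: reg_cst.
have r2 := reg_mul oU r1 (rf i).
split; first exact: reg_add.
by rewrite (ls_add ls) // (ls_mul ls) // (ls_cst ls) // IH big_cons.
Qed.

Lemma isval_comb U (s : dO d U) Fx : isval s Fx -> exists g,
  [/\ forall i, reg (oset U) (g i), s = comb sg U g & forall x, oset U x -> Fx x = \sum_i g i x *: b i].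
Proof.
move=> [I [v [f [rf es eF]]]]; have /choice[c hc] i := b_span (v i).
exists (fun l x => \sum_i c i l * f i x); split.
- by move=> l; have [] := reg_sum (index_enum I) (c^~ l) rf.
- rewrite es /comb; under [RHS]eq_bigr => l _ do
    rewrite (reg_sum (index_enum I) (c^~ l) rf).2 mulr_sumr.
  rewrite exchange_big; apply: eq_bigr => i _.
  rewrite {1}hc rmorph_sum mulr_suml; apply: eq_bigr => l _.
  by rewrite st_scale mulrA [st (b l) * _]mulrC.
- move=> x Ux; rewrite eF //; under [RHS]eq_bigr => l _ do rewrite scaler_suml.
  rewrite exchange_big; apply: eq_bigr => i _.
  by rewrite {1}hc scaler_sumr; apply: eq_bigr => l _; rewrite scalerA mulrC.
Qed.

Lemma isval_exists U (s : dO d U) : exists Fx, isval s Fx.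
Proof.
have [g [rg _ e]] := struct ls (sT (U := U)) (mem_all s).
by exists (fun x => \sum_i g i x *: b i), 'I_L.+1, b, g.
Qed.

Lemma isval_uniq U (s : dO d U) Fx Gx : isval s Fx -> isval s Gx ->
  forall x, oset U x -> Fx x = Gx x.
Proof.
move=> /isval_comb[g [rg es eF]] /isval_comb[h [rh es' eG]] x Ux; rewrite eF // eG //.
apply: eq_bigr => i _; congr (_ *: _); apply/eqP; rewrite -subr_eq0; apply/eqP.
apply: (comb_uniq ls (V := U) (g := fun i x => g i x - h i x)) Ux => //.
  move=> j; apply: reg_add; [exact: svalP|exact: rg|].
  have := reg_mul (svalP U) (reg_cst (-1) (svalP U)) (rh j); apply: reg_ext; first exact: svalP.
  by move=> z _; rewrite mulN1r.
by rewrite (combB ls) // -es -es' subrr.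
Qed.

Lemma isval_inj U (s s' : dO d U) Fx : isval s Fx -> isval s' Fx -> s = s'.
Proof.
move=> /isval_comb[g [rg -> eF]] /isval_comb[h [rh -> eG]].
apply: (comb_ext ls) => // i x Ux.
have := @b_free (fun i => g i x - h i x) _ i => /(_ _)/eqP; rewrite subr_eq0 => H; apply/eqP/H.
by under eq_bigr => j _ do rewrite scalerBl; rewrite sumrB -eF // -eG // subrr.
Qed.

Lemma trivial : trivial_deformation d.
Proof.
have /choice[ph hph] (Us : {U : opens X & dO d U}) := isval_exists (projT2 Us).
pose phi' U s := ph (existT _ U s); have pP U s : isval s (phi' U s) := hph (existT _ U s).
have pE U s Fx : isval s Fx -> {in oset U, phi' U s =1 Fx}.
  by move=> h x; rewrite inE => Ux; apply: (isval_uniq (pP U s) h Ux).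
exists phi'; split=> [U s|].
  have [g [rg es eF]] := isval_comb (pP U s); exists L.+1, b, g; split=> // x.
  by rewrite inE; exact: eF.
split=> [U Fx [n [v [f [rf eF]]]]|].
  exists (\sum_i st (v i) * sg U (f i)); apply: pE; exists 'I_n, v, f; split=> // x Ux.
  by apply: eF; rewrite inE.
split=> [U s t e|].
  apply: (isval_inj (pP U s)); have [I [v [f [rf es eF]]]] := pP U t.
  by exists I, v, f; split=> // x Ux; rewrite e ?inE // eF.
split=> [U s t|].
  apply: pE; have [I [v [f [rf es eF]]]] := pP U s; have [I' [v' [f' [rf' es' eF']]]] := pP U t.
  exists (I + I')%type, (fun i => match i with inl i => v i | inr i => v' i end),
     (fun i => match i with inl i => f i | inr i => f' i end); split=> [[]//||x Ux].
    by rewrite big_sumType /= es es'.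
  by rewrite big_sumType /= eF // eF'.
split=> [U s t|].
  apply: pE; have [I [v [f [rf es eF]]]] := pP U s; have [I' [v' [f' [rf' es' eF']]]] := pP U t.
  exists (I * I')%type, (fun i => v i.1 * v' i.2), (fun i x => f i.1 x * f' i.2 x).
  split=> [i||x Ux]; first by apply: reg_mul => //; exact: svalP.
    rewrite es es' mulr_suml -(pair_bigA _ (fun i j => st (v i * v' j) * sg U (fun x => f i x * f' j x))) /=.
    apply: eq_bigr => i _; rewrite mulr_sumr; apply: eq_bigr => j _.
    by rewrite (ls_mul ls) // rmorphM mulrACA.
  rewrite eF // eF' // mulr_suml -(pair_bigA _ (fun i j => (f i x * f' j x) *: (v i * v' j))) /=.
  apply: eq_bigr => i _; rewrite mulr_sumr; apply: eq_bigr => j _.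
  by rewrite -scalerAl -scalerAr scalerA.
split=> [U a|].
  apply: pE; exists unit, (fun=> a), (fun _ _ => 1); split=> [_||x Ux].
  - by apply: reg_cst; exact: svalP.
  - by rewrite big_const card_unit /= addr0 (ls_cst ls) // scale1r rmorph1 mulr1.
  - by rewrite big_const card_unit /= addr0 scale1r.
split=> [U V h s|U s x].
  apply: pE; have [I [v [f [rf es eF]]]] := pP U s; exists I, v, f; split=> [i||x /h Ux].
  - by apply: reg_sub (rf i); try exact: svalP.
  - rewrite es rmorph_sum; apply: eq_bigr => i _; by rewrite rmorphM dres_str (ls_res ls).
  - exact: eF.
rewrite inE => Ux; have [I [v [f [rf es eF]]]] := pP U s.
rewrite eF // es rmorph_sum dred_sum //; apply: eq_bigr => i _.
by rewrite dredM // dred_st // (ls_dred ls) // -mulr_algl rmorphM augA mulrC.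
Qed.

End Trivial.
End Deformation.

Theorem bott_rigid (R : realType) (r : nat) (nx : rel 'I_r) (X : fspace R[i])
    (phi : signs r -> ('I_r -> R[i]) -> X) :
  bott_atlas nx phi -> tangent_cohomology_vanishes X 1 -> locally_rigid X.
Proof.
move=> atl hX A aug art d; have [L [b [[b0 aug_b] b_free b_span b_flag]]] := flag art.
have augA := al_aug art.
have [sg ls] := global_section atl d augA b0 aug_b b_free b_flag hX.
exact: (trivial atl augA b0 aug_b b_free b_span b_flag ls).
Qed.

(** * Induction from the Borel to a minimal parabolic subalgebra *)

Section TensorProduct.
Variable K : comPzRingType.

Lemma tensmxDl m n p q (A B : 'M[K]_(m, n)) (C : 'M_(p, q)) : (A + B) *t C = A *t C + B *t C.
Proof. by apply/matrixP=> i j; rewrite !mxE mulrDl. Qed.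

Lemma tensmxDr m n p q (A : 'M[K]_(m, n)) (B C : 'M_(p, q)) : A *t (B + C) = A *t B + A *t C.
Proof. by apply/matrixP=> i j; rewrite !mxE mulrDr. Qed.

Lemma tensmxZl m n p q c (A : 'M[K]_(m, n)) (C : 'M_(p, q)) : (c *: A) *t C = c *: (A *t C).
Proof. by apply/matrixP=> i j; rewrite !mxE mulrA. Qed.

Lemma tensmxZr m n p q c (A : 'M[K]_(m, n)) (C : 'M_(p, q)) : A *t (c *: C) = c *: (A *t C).
Proof. by apply/matrixP=> i j; rewrite !mxE mulrCA. Qed.

Lemma tensmxNl m n p q (A : 'M[K]_(m, n)) (C : 'M_(p, q)) : (- A) *t C = - (A *t C).
Proof. by apply/matrixP=> i j; rewrite !mxE mulNr. Qed.

Lemma tensmxNr m n p q (A : 'M[K]_(m, n)) (C : 'M_(p, q)) : A *t (- C) = - (A *t C).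
Proof. by apply/matrixP=> i j; rewrite !mxE mulrN. Qed.

Lemma tensmx11 m n : (1%:M : 'M[K]_m) *t (1%:M : 'M_n) = 1%:M.
Proof.
apply/matrixP=> i j; case: (mxtens_indexP i) => i0 i1; case: (mxtens_indexP j) => j0 j1.
rewrite tensmxE !mxE (can_eq (@mxtens_indexK _ _)) xpair_eqE -natrM mulnb.
by [].
Qed.

End TensorProduct.

Section TensorModules.
Variables (K : numFieldType) (n m : nat) (G : km_datum n m).

Lemma tens_action_bracket d e (x x' : 'M[K]_d) (y y' : 'M[K]_e) :
  bracket (tens_action x y) (tens_action x' y') = tens_action (bracket x x') (bracket y y').
Proof.
rewrite /bracket /tens_action !mulmxDl !mulmxDr !tensmx_mul !mul1mx !mulmx1.
rewrite tensmxDl tensmxDr tensmxNl tensmxNr !opprD !addrA.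
by rewrite [LHS](ACl (1*5*4*8*(2*7)*(3*6))) /= !subrr !addr0.
Qed.

Lemma tens_action_iter d e k (x x' : 'M[K]_d) (y y' : 'M[K]_e) :
  iter k (bracket (tens_action x y)) (tens_action x' y') =
  tens_action (iter k (bracket x) x') (iter k (bracket y) y').
Proof. by elim: k => //= k ->; rewrite tens_action_bracket. Qed.

Lemma tens_action00 d e : tens_action (0 : 'M[K]_d) (0 : 'M[K]_e) = 0.
Proof. by rewrite /tens_action tens0mx tensmx0 addr0. Qed.

Lemma tens_actionZ d e c (x : 'M[K]_d) (y : 'M[K]_e) :
  tens_action (c *: x) (c *: y) = c *: tens_action x y.
Proof. by rewrite /tens_action tensmxZl tensmxZr -scalerDr. Qed.

Lemma tens_actionD d e (x x' : 'M[K]_d) (y y' : 'M[K]_e) :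
  tens_action (x + x') (y + y') = tens_action x y + tens_action x' y'.
Proof. by rewrite /tens_action tensmxDl tensmxDr addrACA. Qed.

Lemma tens_action_sum d e (I : Type) (l : seq I) (x : I -> 'M[K]_d) (y : I -> 'M[K]_e) :
  tens_action (\sum_(i <- l) x i) (\sum_(i <- l) y i) = \sum_(i <- l) tens_action (x i) (y i).
Proof.
by elim: l => [|i l IH]; rewrite ?big_nil ?tens_action00 // !big_cons tens_actionD IH.
Qed.

Definition wt_tens d e (u : 'I_d -> 'rV[int]_m) (v : 'I_e -> 'rV[int]_m) (p : 'I_(d * e)) :=
  u (mxtens_unindex p).1 + v (mxtens_unindex p).2.

Lemma hmat_tens d e (u : 'I_d -> 'rV[int]_m) (v : 'I_e -> 'rV[int]_m) k :
  hmat K (wt_tens u v) k = tens_action (hmat K u k) (hmat K v k).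
Proof.
apply/matrixP=> i j; case: (mxtens_indexP i) => i0 i1; case: (mxtens_indexP j) => j0 j1.
rewrite /tens_action [RHS]mxE !tensmxE mxE (can_eq (@mxtens_indexK _ _)) xpair_eqE.
rewrite !mxE /wt_tens mxtens_indexK /= ?mxE; case: eqP => [->|_] /=; case: eqP => [->|_] /=;
  by rewrite ?mulr1n ?mulr0n ?mulr0 ?mul0r ?mulr1 ?mul1r ?addr0 ?add0r ?rmorphD.
Qed.

Lemma bmod_tens_exists d e (r : bmod K G d) (s : bmod K G e) : exists t, bmod_tens r s t.
Proof.
have he k i : bracket (hmat K (wt_tens (wt r) (wt s)) k) (tens_action (emat r i) (emat s i)) =
    (Defs.root G i k)%:~R *: tens_action (emat r i) (emat s i).
  by rewrite hmat_tens tens_action_bracket !bmod_he tens_actionZ.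
have hs i j : i != j -> iter `|1 - gcm G i j|%N (bracket (tens_action (emat r i) (emat s i)))
    (tens_action (emat r j) (emat s j)) = 0.
  by move=> ij; rewrite tens_action_iter !bmod_serre // tens_action00.
by exists (BMod he hs); split=> //= k; exact: hmat_tens.
Qed.

Lemma pmod_tens_exists a d e (r : pmod K G a d) (s : pmod K G a e) : exists t, pmod_tens r s t.
Proof.
have [t [ht et]] := bmod_tens_exists r s; pose f := tens_action (fmat r) (fmat s).
have hf k : bracket (hmat K (wt t) k) f = - (Defs.root G a k)%:~R *: f.
  by rewrite ht tens_action_bracket !pmod_hf tens_actionZ.
have ef i : bracket (emat t i) f =
    if i == a then \sum_k (coroot G a k)%:~R *: hmat K (wt t) k else 0.
  rewrite et tens_action_bracket !pmod_ef; case: eqP => _; last exact: tens_action00.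
  by rewrite tens_action_sum; apply: eq_bigr => k _; rewrite tens_actionZ ht.
by exists (PMod hf ef).
Qed.

End TensorModules.

(** * Exponentials of nilpotent matrices *)

Section Exponential.
Variable K : numFieldType.

Lemma mulE d (A B : 'M[K]_d) : A * B = A *m B. Proof. by []. Qed.

Lemma mulZl d c (A B : 'M[K]_d) : (c *: A) * B = c *: (A * B).
Proof. by rewrite !mulE scalemxAl. Qed.

Lemma mulZr d c (A B : 'M[K]_d) : A * (c *: B) = c *: (A * B).
Proof. by rewrite !mulE scalemxAr. Qed.

Lemma expZ d c (A : 'M[K]_d) k : (c *: A) ^+ k = c ^+ k *: A ^+ k.
Proof.
elim: k => [|k IH]; first by rewrite !expr0 scale1r.
by rewrite !exprS IH mulZl mulZr scalerA.
Qed.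

Definition nilmx d (X : 'M[K]_d) := exists k, X ^+ k = 0.

(** The exponential series cut at some exponent annihilating X; [nexpE] shows that the choice is
    immaterial. For X not nilpotent the sum is empty. *)
Definition nexp d (X : 'M[K]_d) : 'M[K]_d :=
  \sum_(n < xget 0%N [set k | X ^+ k = 0]) n`!%:R^-1 *: X ^+ n.

Lemma nexp_tail d (X : 'M[K]_d) k l : X ^+ k = 0 -> (k <= l)%N ->
  \sum_(n < l) n`!%:R^-1 *: X ^+ n = \sum_(n < k) n`!%:R^-1 *: X ^+ n.
Proof.
move=> Xk /subnKC <-; rewrite big_split_ord /= [X in _ + X]big1 ?addr0 // => i _.
by rewrite exprD Xk mul0r scaler0.
Qed.

Lemma nexpE d (X : 'M[K]_d) k : X ^+ k = 0 -> nexp X = \sum_(n < k) n`!%:R^-1 *: X ^+ n.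
Proof.
move=> Xk; rewrite /nexp; case: xgetP => [l _ Xl|/(_ k)//].
by rewrite -(nexp_tail Xk (leq_maxl k l)) -(nexp_tail Xl (leq_maxr k l)).
Qed.

Lemma nexp0 d : nexp (0 : 'M[K]_d) = 1.
Proof. by rewrite (@nexpE _ _ 1) ?expr1 // big_ord1 expr0 fact0 invr1 scale1r. Qed.

Lemma nilmxZ d (X : 'M[K]_d) c : nilmx X -> nilmx (c *: X).
Proof. by case=> k Xk; exists k; rewrite expZ Xk scaler0. Qed.

Lemma nilmx_intertw d e (X : 'M[K]_d) (Y : 'M[K]_e) (F : 'M_(e, d)) k :
  F *m X = Y *m F -> F *m X ^+ k = Y ^+ k *m F.
Proof.
move=> FX; elim: k => [|k IH]; first by rewrite !expr0 mulmx1 mul1mx.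
by rewrite exprSr exprS !mulE mulmxA IH -mulmxA FX mulmxA -mulE -exprSr exprS.
Qed.

Lemma nexp_intertw d e (X : 'M[K]_d) (Y : 'M[K]_e) (F : 'M_(e, d)) :
  nilmx X -> nilmx Y -> F *m X = Y *m F -> F *m nexp X = nexp Y *m F.
Proof.
move=> [k Xk] [l Yl] FX; rewrite (nexpE Xk) (nexpE Yl).
rewrite -(nexp_tail Xk (leq_maxl k l)) -(nexp_tail Yl (leq_maxr k l)).
rewrite mulmx_sumr mulmx_suml; apply: eq_bigr => i _.
by rewrite -scalemxAr -scalemxAl (nilmx_intertw _ FX).
Qed.

Lemma exprD_comm0 d (X Y : 'M[K]_d) k l : GRing.comm X Y -> X ^+ k = 0 -> Y ^+ l = 0 ->
  (X + Y) ^+ (k + l) = 0.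
Proof.
move=> c Xk Yl; rewrite exprDn_comm // big1 // => i _.
have [li|il] := leqP l i; first by rewrite -(subnKC li) [Y ^+ _]exprD Yl mul0r mulr0 mul0rn.
have ki : (k <= k + l - i)%N by lia.
by rewrite -(subnKC ki) exprD Xk !mul0r mul0rn.
Qed.

Lemma nexpD d (X Y : 'M[K]_d) : GRing.comm X Y -> nilmx X -> nilmx Y ->
  nexp (X + Y) = nexp X * nexp Y.
Proof.
move=> c [k Xk] [l Yl]; pose N := (k + l)%N.
have XN : X ^+ N.+1 = 0 by rewrite exprS exprD Xk mul0r mulr0.
have YN : Y ^+ N.+1 = 0 by rewrite exprS exprD Yl !mulr0.
have XYN : (X + Y) ^+ N.+1 = 0 by rewrite exprS exprD_comm0 // mulr0.
rewrite (nexpE XYN) (nexpE XN) (nexpE YN).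
rewrite (cauchy_sum (N := N) (x := fun i => i`!%:R^-1 *: X ^+ i) (y := fun i => i`!%:R^-1 *: Y ^+ i)).
  apply: eq_bigr => i _; rewrite addrC exprDn_comm; last by apply: commr_sym.
  rewrite scaler_sumr; apply: eq_bigr => j _.
  rewrite mulZl mulZr scalerA -scaler_nat scalerA.
  have -> : Y ^+ (i - j) * X ^+ j = X ^+ j * Y ^+ (i - j) by exact/commrX/commr_sym/commrX.
  congr (_ *: _); have ji : (j <= i)%N by rewrite -ltnS.
  have f0 q : q`!%:R != 0 :> K by rewrite pnatr_eq0 -lt0n fact_gt0.
  rewrite -(bin_fact ji) !natrM; field.
  by rewrite !f0 pnatr_eq0 -lt0n bin_gt0 ji.
move=> i j ij; rewrite mulZl mulZr.
have [ki|ik] := leqP k i; first by rewrite -(subnKC ki) exprD Xk !mul0r !scaler0.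
have lj : (l <= j)%N by rewrite /N in ij; lia.
by rewrite -(subnKC lj) [Y ^+ _]exprD Yl !mul0r mulr0 !scaler0.
Qed.

Lemma nexpN d (X : 'M[K]_d) : nilmx X -> nexp X * nexp (- X) = 1.
Proof.
move=> nX; rewrite -nexpD ?subrr ?nexp0 //; first exact/commrN/commr_refl.
by rewrite -scaleN1r; exact: nilmxZ.
Qed.

Lemma tensmx_expl d e (X : 'M[K]_d) k : (X *t (1%:M : 'M_e)) ^+ k = X ^+ k *t 1%:M.
Proof.
elim: k => [|k IH]; first by rewrite !expr0 tensmx11.
by rewrite !exprS IH !mulE tensmx_mul mul1mx.
Qed.

Lemma tensmx_expr d e (X : 'M[K]_e) k : ((1%:M : 'M_d) *t X) ^+ k = 1%:M *t X ^+ k.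
Proof.
elim: k => [|k IH]; first by rewrite !expr0 tensmx11.
by rewrite !exprS IH !mulE tensmx_mul mul1mx.
Qed.

Lemma nexp_tens d e (X : 'M[K]_d) (Y : 'M[K]_e) : nilmx X -> nilmx Y ->
  nexp (tens_action X Y) = nexp X *t nexp Y.
Proof.
move=> [k Xk] [l Yl].
have Xk' : (X *t (1%:M : 'M_e)) ^+ k = 0 by rewrite tensmx_expl Xk tens0mx.
have Yl' : ((1%:M : 'M_d) *t Y) ^+ l = 0 by rewrite tensmx_expr Yl tensmx0.
rewrite nexpD; [|by rewrite /GRing.comm !mulE !tensmx_mul !mulmx1 !mul1mx|by exists k|by exists l].
rewrite (nexpE Xk) (nexpE Yl) (nexpE Xk') (nexpE Yl') [RHS]tensmx_decr mulE; congr (_ *m _).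
  by elim/big_ind2: _ => [|A B C D -> ->|i _]; rewrite ?tens0mx ?tensmxDl // tensmx_expl tensmxZl.
by elim/big_ind2: _ => [|A B C D -> ->|i _]; rewrite ?tensmx0 ?tensmxDr // tensmx_expr tensmxZr.
Qed.

Lemma nexp_poly d (X : 'M[K]_d) i j : nilmx X -> exists p : {poly K}, forall x, nexp (x *: X) i j = p.[x].
Proof.
move=> [k Xk]; exists (\sum_(n < k) (n`!%:R^-1 * (X ^+ n) i j) *: 'X^n) => x.
rewrite (@nexpE _ _ k) ?expZ ?Xk ?scaler0 // summxE horner_sum; apply: eq_bigr => l _.
by rewrite expZ 2!mxE hornerZ hornerXn mulrCA [RHS]mulrC.
Qed.

(** X shifts the k-th component of weights by c, so X^q shifts it by c q, while only finitely many
    weights occur. *)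
Lemma nilmx_weight m d (w : 'I_d -> 'rV[int]_m) (X : 'M[K]_d) (k : 'I_m) (c : int) : c != 0 ->
  bracket (hmat K w k) X = c%:~R *: X -> nilmx X.
Proof.
move=> c0 hX.
have XE i j : X i j != 0 -> w i 0 k - w j 0 k = c.
  move=> Xij; have := congr1 (fun M : 'M_d => M i j) hX.
  rewrite /bracket mul_diag_mx mul_mx_diag !mxE mulrC -mulrBr [RHS]mulrC => /(mulfI Xij).
  by rewrite -rmorphB => /intr_inj.
have XnE q i j : (X ^+ q) i j != 0 -> w i 0 k - w j 0 k = c * q%:Z.
  elim: q i => [|q IH] i.
    by rewrite expr0 mulr0 mxE; have [->|_] := eqVneq i j; rewrite ?subrr ?eqxx.
  rewrite exprS mulE mxE => h.
  have [l hl] : exists l, X i l * (X ^+ q) l j != 0.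
    apply: contrapT => /forallNP hn; case/eqP: h; apply: big1 => l _; apply/eqP.
    by apply: contrapT => /negP; exact: hn.
  move: hl; rewrite mulf_eq0 negb_or => /andP[/XE h1 /IH h2].
  by rewrite -(subrKA (w l 0 k)) h1 h2 intS mulrDr mulr1.
pose B := (\sum_i absz (w i 0%R k))%N; exists (B + B).+1; apply/matrixP => i j; rewrite mxE.
apply/eqP; apply: contrapT => /negP /XnE h.
have bd l : (absz (w l 0%R k) <= B)%N by rewrite /B (bigD1 l) //= leq_addr.
have := bd i; have := bd j; move: h; move: (w i 0 k) (w j 0 k) => u v.
move=> /(congr1 absz); rewrite abszM absz_nat => h hv hu.
have c1 : (0 < `|c|)%N by rewrite absz_gt0.
have h1 : ((B + B).+1 <= `|c| * (B + B).+1)%N by rewrite leq_pmull.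
by rewrite -h in h1; lia.
Qed.

End Exponential.

Notation PM := (map_mx polyC).

Ltac mxring := apply/matrixP => ? ?; rewrite !mxE; ring.

(** * Matrices of polynomials and a nilpotency identity *)

Section PolyMatrix.
Variable K : numFieldType.

Definition Dx p q (f : 'M[{poly K}]_(p, q)) : 'M_(p, q) := map_mx (@deriv K) f.

Lemma DxD p q (f g : 'M[{poly K}]_(p, q)) : Dx (f + g) = Dx f + Dx g.
Proof. by apply/matrixP => i j; rewrite !mxE derivD. Qed.

Lemma DxN p q (f : 'M[{poly K}]_(p, q)) : Dx (- f) = - Dx f.
Proof. by apply/matrixP => i j; rewrite !mxE derivN. Qed.

Lemma DxZ p q (c : {poly K}) (f : 'M[{poly K}]_(p, q)) : Dx (c *: f) = c^`() *: f + c *: Dx f.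
Proof. by apply/matrixP => i j; rewrite !mxE derivM. Qed.

Lemma DxM p q s (f : 'M[{poly K}]_(p, q)) (g : 'M[{poly K}]_(q, s)) :
  Dx (f *m g) = Dx f *m g + f *m Dx g.
Proof.
apply/matrixP => i j; rewrite !mxE linear_sum -big_split; apply: eq_bigr => k _.
by rewrite !mxE; exact: derivM.
Qed.

Lemma DxC p q (z : 'M[K]_(p, q)) : Dx (PM z) = 0.
Proof. by apply/matrixP => i j; rewrite !mxE derivC. Qed.

Lemma Dx0 p q : Dx (0 : 'M[{poly K}]_(p, q)) = 0.
Proof. by apply/matrixP => i j; rewrite !mxE linear0. Qed.

Lemma Dx_tens p q s t (f : 'M[{poly K}]_(p, q)) (g : 'M[{poly K}]_(s, t)) :
  Dx (f *t g) = Dx f *t g + f *t Dx g.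
Proof. by apply/matrixP => i j; rewrite !mxE derivM. Qed.

Lemma PMZ p q (c : K) (z : 'M[K]_(p, q)) : PM (c *: z) = c%:P *: PM z.
Proof. by apply/matrixP => i j; rewrite !mxE polyCM. Qed.

(** The coefficients in the expansion of E^s v below. For s = n + 1 and l <= n the falling factorial
    is zero, which is the nilpotency sought. *)
Definition gam (n s l : nat) : nat := ('C(s, l) * (n - l) ^_ (s - l))%N.

Lemma gam_rec0 n s : (s <= n)%N -> (gam n s 0)%:R * (n%:R - s%:R) = (gam n s.+1 0)%:R :> K.
Proof. by move=> sn; rewrite /gam !bin0 !mul1n !subn0 ffactnSr natrM natrB. Qed.

Lemma gam_recS n s l : (s <= n)%N -> (l < n)%N ->
  (gam n s l)%:R + (gam n s l.+1)%:R * (n%:R - l.+1%:R - s%:R) = (gam n s.+1 l.+1)%:R :> K.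
Proof.
move=> sn ln; rewrite /gam; have [sl|ls|<-] := ltngtP s l.
- by rewrite !bin_small ?mul0n ?mul0r ?addr0 //; lia.
- have e1 : (s - l)%N = (s - l.+1).+1 by lia.
  have e2 : (n - l)%N = (n - l.+1).+1 by lia.
  rewrite subSS e1 e2 ffactSS ffactnSr; set F := (_ ^_ (s - l.+1))%N.
  have h := mul_bin_left s l; rewrite binS.
  have hK : (l.+1%:R : K) * 'C(s, l.+1)%:R = (s%:R - l%:R) * 'C(s, l)%:R.
    by rewrite -natrM h natrM natrB // ltnW.
  have e3 : (n - l.+1 - (s - l.+1))%N = (n - s)%N by lia.
  rewrite e3 -e2 !natrM natrD !natrB ?(ltnW ln) //.
  apply/eqP; rewrite -subr_eq0; apply/eqP.
  transitivity (F%:R * ((s%:R - l%:R) * 'C(s, l)%:R - l.+1%:R * 'C(s, l.+1)%:R) : K); first by ring.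
  by rewrite hK subrr mulr0.
- by rewrite (bin_small (ltnSn s)) mul0n mul0r addr0 !binn !subnn !ffactn0.
Qed.

(* On the string y_l = e^l v, E^s v = \sum_l C(s, l) (n - l)^_(s - l) X^(s - l) y_l. *)
Lemma const_nil (V : lmodType {poly K}) (ea ha dx E : V -> V) (v : V) (c : K) (n : nat) :
  (forall u w, ea (u + w) = ea u + ea w) -> (forall p u, ea (p *: u) = p *: ea u) ->
  (forall u w, ha (u + w) = ha u + ha w) -> (forall p u, ha (p *: u) = p *: ha u) ->
  (forall u w, dx (u + w) = dx u + dx w) -> (forall p u, dx (p *: u) = p^`() *: u + p *: dx u) ->
  (forall u, E u = ea u - 'X *: ha u + ((c + n%:R)%:P * 'X) *: u - 'X^2 *: dx u) ->
  (forall l, ha (iter l ea v) = (c + 2 * l%:R)%:P *: iter l ea v) ->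
  (forall l, dx (iter l ea v) = 0) -> iter n.+1 ea v = 0 -> iter n.+1 E v = 0.
Proof.
move=> eaD eaZ haD haZ dxD dxZ EE hv dv yn.
pose y l := iter l ea v.
have ED u w : E (u + w) = E u + E w.
  by rewrite !EE eaD haD dxD !scalerDr !opprD !addrA [LHS](ACl (1*3*5*7*2*4*6*8)).
have E0 : E 0 = 0 by have /eqP := ED 0 0; rewrite addr0 -subr_eq0 opprD addNKr oppr_eq0 => /eqP.
(* The scalar is n - 2l - j: the operator h contributes its eigenvalue c + 2l, the derivative
   contributes j, and the linear term of E contributes c + n. *)
have Et (j l : nat) : E (('X ^+ j : {poly K}) *: y l) =
   ('X ^+ j : {poly K}) *: y l.+1 + ((n%:R - l%:R - l%:R - j%:R)%:P * 'X ^+ j.+1 : {poly K}) *: y l.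
  rewrite EE eaZ haZ dxZ dv scaler0 addr0 hv !scalerA -!addrA; congr (_ + _).
  rewrite -!scaleNr -!scalerDl; congr (_ *: _).
  rewrite derivXn -scaler_nat -!mul_polyC.
  case: j => [|j]; first by rewrite !mulr0n ?polyC0 !expr0 /=; ring.
  rewrite /= !exprS; ring.
have Ec a0 u : E (a0%:P *: u) = a0%:P *: E u.
  rewrite !EE eaZ haZ dxZ derivC scale0r add0r !(scalerDr, scalerN, scalerA).
  by rewrite ![_ * a0%:P]mulrC.
have Es : forall s, (s <= n.+1)%N ->
    iter s E v = \sum_(l < n.+1) (gam n s l)%:R%:P *: (('X ^+ (s - l) : {poly K}) *: y l).
  elim=> [|s IH] sn.
    rewrite big_ord_recl big1 ?addr0 => [|i _]; first by rewrite /gam /= mul1n ffactn0 expr0 !scale1r.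
    by rewrite /gam bin_small // mul0n scale0r.
  rewrite [LHS]/= IH; last exact: ltnW.
  have -> : E (\sum_(l < n.+1) (gam n s l)%:R%:P *: (('X ^+ (s - l) : {poly K}) *: y l)) =
     \sum_(l < n.+1) (gam n s l)%:R%:P *: (('X ^+ (s - l) : {poly K}) *: y l.+1) +
     \sum_(l < n.+1) ((gam n s l)%:R * (n%:R - l%:R - s%:R))%:P *: (('X ^+ (s.+1 - l) : {poly K}) *: y l).
    rewrite -big_split (big_morph E ED E0); apply: eq_bigr => l _ /=.
    rewrite Ec Et scalerDr; congr (_ + _); rewrite !scalerA.
    have [sl|ls] := ltnP s l; first by rewrite /gam bin_small // !mul0n !mul0r.
    rewrite subSn // natrB // polyCM mulrA; congr ((_ * _%:P * _) *: _); ring.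
  rewrite [X in X + _](_ : _ = \sum_(l < n.+1) (if l : nat is l'.+1 then (gam n s l')%:R else 0)%:P
      *: (('X ^+ (s.+1 - l) : {poly K}) *: y l)); last first.
    rewrite big_ord_recr [RHS]big_ord_recl; have -> : y (ord_max : 'I_n.+1).+1 = 0 by [].
    rewrite !scaler0 /= addr0 scale0r add0r.
    by apply: eq_bigr => l _; rewrite /bump /= add1n subSS.
  rewrite -big_split; apply: eq_bigr => l _ /=; rewrite -scalerDl -polyCD; congr (_%:P *: _).
  case: l => -[|l] ln /=; first by rewrite add0r subr0 gam_rec0.
  by rewrite gam_recS.
rewrite Es // big1 // => l _; rewrite /gam [(_ ^_ _)%N]ffact_small ?muln0 ?scale0r //.
by rewrite ltn_sub2r.
Qed.

End PolyMatrix.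

Lemma root_neq0 n m (G : km_datum n m) a : exists k, Defs.root G a k != 0.
Proof.
apply: contrapT => /forallNP h; have /row_free_inj inj := kmd_root_free G.
have /inj/matrixP/(_ 0 a)/eqP : (delta_mx 0 a : 'rV_n) *m map_mx intr (Defs.root G) =
    0 *m map_mx intr (Defs.root G) :> 'rV[rat]_m.
  rewrite -rowE mul0mx; apply/rowP => k; rewrite !mxE.
  by have /negP := h k; rewrite negbK => /eqP ->.
by rewrite !mxE !eqxx oner_eq0.
Qed.

(** Used to choose a basis made of weight vectors in the space of sections. *)
Lemma max_free (F : fieldType) s (P : 'rV[F]_s -> Prop) : exists q (A : 'M_(q, s)),
  [/\ row_free A, forall i, P (row i A) & forall v, P v -> (v <= A)%MS].
Proof.
pose Q q := `[< exists A : 'M[F]_(q, s), row_free A /\ forall i, P (row i A) >].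
have Q0 : exists q, Q q.
  exists 0%N; apply/asboolP; exists 0; split=> [|[]//].
  by rewrite /row_free mxrank0.
have Qb q : Q q -> (q <= s)%N.
  by move=> /asboolP[A [/eqP rA _]]; rewrite -[q]rA; exact: rank_leq_col.
case: (ex_maxnP Q0 Qb) => q /asboolP[A [fA PA]] qmax; exists q, A; split=> // v Pv.
apply: contrapT => /negP nv; suff /qmax : Q q.+1 by rewrite ltnn.
apply/asboolP; rewrite -addn1; exists (col_mx A v); split; last first.
  move=> i; case: (split_ordP i) => j ->; first by rewrite rowKu.
  by rewrite rowKd row_id.
apply/row_freeP; apply/row_freeP; rewrite -kermx_eq0.
apply/eqP/row_matrixP => i; rewrite row0; set u := row i _.
have : u *m col_mx A v = 0 by apply/sub_kermxP; exact: row_sub.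
rewrite -[u]hsubmxK mul_row_col; set u1 := lsubmx u; set u2 := rsubmx u => h.
have u20 : u2 = 0.
  apply/eqP; apply: contraNT nv => n0; have c0 : u2 0 0 != 0.
    by apply: contra n0 => /eqP z; apply/eqP/rowP => j; rewrite !ord1 z mxE.
  have -> : v = (- (u2 0 0)^-1 *: u1) *m A.
    apply: (scalerI c0); rewrite -scalemxAl scalerA mulrN divff // scaleN1r.
    apply/eqP; rewrite -addr_eq0 addrC -[X in _ + X]mul_scalar_mx -[(u2 0 0)%:M]mx11_scalar.
    by rewrite h.
  exact: submxMl.
move: h; rewrite u20 mul0mx addr0 => h.
have /row_free_inj inj := fA; have -> : u1 = 0 by apply: inj; rewrite /= h mul0mx.
by rewrite row_mx0.
Qed.

(** * Sections over the big cell of P_a / B *)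

Section Coinduction.
Variables (K : numFieldType) (n m : nat) (G : km_datum n m) (a : 'I_n).

Section Ops.
Variables (d : nat) (M : bmod K G d).
Local Notation e := (emat M).

Definition hC : 'M[K]_d := \sum_k (coroot G a k)%:~R *: hmat K (wt M) k.

(* e, f, h of the sl_2 attached to [a] act on the sections over the big cell of the
   vector bundle on P_a / B = P^1 with fibre M, twisted by N. *)
Definition Ek (N : nat) q (f : 'M[{poly K}]_(d, q)) : 'M_(d, q) :=
  PM (e a) *m f - 'X *: (PM hC *m f) + (N%:R%:P * 'X) *: f - 'X^2 *: Dx f.

(** The coordinate x has the simple root as weight, and the twist by 2k shifts all weights by -k
    times that root. *)
Definition Hk (k : nat) l q (f : 'M[{poly K}]_(d, q)) : 'M_(d, q) :=
  PM (hmat K (wt M) l) *m f + ((Defs.root G a l)%:~R)%:P *: ('X *: Dx f - k%:R%:P *: f).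

Lemma EkD N q (f g : 'M[{poly K}]_(d, q)) : Ek N (f + g) = Ek N f + Ek N g.
Proof. by rewrite /Ek DxD !mulmxDr; mxring. Qed.

Lemma EkM N q s (f : 'M[{poly K}]_(d, q)) (z : 'M[K]_(q, s)) :
  Ek N (f *m PM z) = Ek N f *m PM z.
Proof.
rewrite /Ek DxM DxC mulmx0 addr0 !mulmxDl !mulNmx -!scalemxAl !mulmxA.
by [].
Qed.

Lemma HkM k l q s (f : 'M[{poly K}]_(d, q)) (z : 'M[K]_(q, s)) :
  Hk k l (f *m PM z) = Hk k l f *m PM z.
Proof.
by rewrite /Hk DxM DxC mulmx0 addr0 !mulmxDl mulmxA -!scalemxAl !mulmxBl -!scalemxAl.
Qed.

Lemma DxMc q s (f : 'M[{poly K}]_(d, q)) (z : 'M[K]_(q, s)) : Dx (f *m PM z) = Dx f *m PM z.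
Proof. by rewrite DxM DxC mulmx0 addr0. Qed.

Lemma gcm_pair i : (gcm G a i) = \sum_l coroot G a l * Defs.root G i l.
Proof. by rewrite -(kmd_pairing G) mxE; apply: eq_bigr => l _; rewrite mxE. Qed.

Lemma bracket_suml (I : Type) (s : seq I) (x : I -> 'M[K]_d) (c : I -> K) (y : 'M[K]_d) :
  bracket (\sum_(i <- s) c i *: x i) y = \sum_(i <- s) c i *: bracket (x i) y.
Proof.
rewrite /bracket mulmx_suml mulmx_sumr -sumrB; apply: eq_bigr => i _.
by rewrite scalerBr -scalemxAl -scalemxAr.
Qed.

Lemma hC_e i : bracket hC (e i) = (gcm G a i)%:~R *: e i.
Proof.
rewrite /hC bracket_suml gcm_pair rmorph_sum scaler_suml; apply: eq_bigr => l _.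
by rewrite bmod_he scalerA rmorphM.
Qed.

Lemma hmatC k l : bracket (hmat K (wt M) k) (hmat K (wt M) l) = 0.
Proof. by rewrite /bracket /hmat !mulmx_diag; apply/eqP; rewrite subr_eq0; apply/eqP; congr diag_mx; apply/rowP => j; rewrite !mxE mulrC. Qed.

Lemma hC_hmat k : hC *m hmat K (wt M) k = hmat K (wt M) k *m hC.
Proof.
have : bracket hC (hmat K (wt M) k) = 0.
  by rewrite bracket_suml big1 // => l _; rewrite hmatC scaler0.
by move/eqP; rewrite subr_eq0 => /eqP.
Qed.

Lemma he_mul k i : hmat K (wt M) k *m e i = e i *m hmat K (wt M) k + (Defs.root G i k)%:~R *: e i.
Proof. by rewrite -(bmod_he M) /bracket addrC subrK. Qed.

Lemma hCe_mul i : hC *m e i = e i *m hC + (gcm G a i)%:~R *: e i.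
Proof. by rewrite -hC_e /bracket addrC subrK. Qed.

Lemma Hk_Dx k l q (f : 'M[{poly K}]_(d, q)) :
  Hk k l (Dx f) = Dx (Hk k l f) - ((Defs.root G a l)%:~R)%:P *: Dx f.
Proof.
rewrite /Hk DxD DxM DxC mul0mx add0r DxZ derivC scale0r add0r !DxD DxN !DxZ derivX derivC scale1r scale0r add0r.
mxring.
Qed.

Lemma Hk_Lm k l i q (f : 'M[{poly K}]_(d, q)) :
  Hk k l (PM (e i) *m f) = PM (e i) *m Hk k l f + ((Defs.root G i l)%:~R)%:P *: (PM (e i) *m f).
Proof.
rewrite /Hk DxM DxC mul0mx add0r mulmxA -map_mxM he_mul map_mxD PMZ mulmxDl map_mxM.
rewrite mulmxDr mulmxA -!scalemxAl -!scalemxAr mulmxBr -!scalemxAr.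
by rewrite addrAC.
Qed.

Lemma Hk_Z k l (c : {poly K}) q (f : 'M[{poly K}]_(d, q)) :
  Hk k l (c *: f) = c *: Hk k l f + (((Defs.root G a l)%:~R)%:P * ('X * c^`())) *: f.
Proof. by rewrite /Hk DxZ -scalemxAr; mxring. Qed.

Lemma HkD k l q (f g : 'M[{poly K}]_(d, q)) : Hk k l (f + g) = Hk k l f + Hk k l g.
Proof. by rewrite /Hk DxD mulmxDr; mxring. Qed.

Lemma HkN k l q (f : 'M[{poly K}]_(d, q)) : Hk k l (- f) = - Hk k l f.
Proof. by rewrite /Hk DxN mulmxN; mxring. Qed.

Lemma Hk_hC k l q (f : 'M[{poly K}]_(d, q)) :
  Hk k l (PM hC *m f) = PM hC *m Hk k l f.
Proof.
rewrite /Hk DxM DxC mul0mx add0r mulmxA -map_mxM -hC_hmat map_mxM -mulmxA mulmxDr.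
by rewrite -scalemxAr mulmxBr -!scalemxAr.
Qed.

Lemma Hk_Ek k l q (f : 'M[{poly K}]_(d, q)) :
  Hk k l (Ek k.*2 f) = Ek k.*2 (Hk k l f) + ((Defs.root G a l)%:~R)%:P *: Ek k.*2 f.
Proof.
rewrite /Ek !HkD !HkN !Hk_Z Hk_Lm Hk_hC Hk_Dx derivXn derivX derivM derivC derivX.
by rewrite /Hk DxD !DxZ DxM DxC; mxring.
Qed.

(** The relation [e, f] = h, with d/dx in the role of f. *)
Lemma EkDx k q (f : 'M[{poly K}]_(d, q)) :
  Ek k.*2 (Dx f) = Dx (Ek k.*2 f) + \sum_l (coroot G a l)%:~R%:P *: Hk k l f.
Proof.
have -> : \sum_l ((coroot G a l)%:~R)%:P *: Hk k l f =
    PM hC *m f + 2%:R *: ('X *: Dx f - k%:R%:P *: f).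
  rewrite /hC raddf_sum mulmx_suml.
  have -> : (2%:R : {poly K}) = (\sum_l coroot G a l * Defs.root G a l)%:~R%:P.
    by rewrite -gcm_pair (gcm_diag (kmd_gcm G)) -polyC_natr.
  rewrite rmorph_sum raddf_sum scaler_suml -big_split; apply: eq_bigr => l _ /=.
  by rewrite /Hk PMZ -scalemxAl rmorphM polyCM scalerDr scalerA.
rewrite /Ek !DxD !DxN !DxZ !DxM !DxC derivXn derivX derivM derivC derivX -muln2 natrM.
rewrite !mul0mx; mxring.
Qed.

Lemma Dx_Lm i q (f : 'M[{poly K}]_(d, q)) : Dx (PM (e i) *m f) = PM (e i) *m Dx f.
Proof. by rewrite DxM DxC mul0mx add0r. Qed.

(** The commutator of [Ek N] with multiplication by Z, as [Ek_mul] shows; the twist N drops out. *)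
Definition Ead (Z : 'M[{poly K}]_d) : 'M[{poly K}]_d :=
  (PM (e a) *m Z - Z *m PM (e a)) - 'X *: (PM hC *m Z - Z *m PM hC) - 'X^2 *: Dx Z.

Lemma Ek_mul N (Z : 'M[{poly K}]_d) q (f : 'M[{poly K}]_(d, q)) :
  Ek N (Z *m f) = Ead Z *m f + Z *m Ek N f.
Proof.
rewrite /Ek /Ead DxM !mulmxDr !mulmxDl !mulNmx !mulmxN -!scalemxAl -!scalemxAr !mulmxDl !mulNmx !mulmxA.
mxring.
Qed.

Lemma iter_br_h i l : bracket hC (iter l (bracket (e a)) (e i)) =
  ((gcm G a i)%:~R + 2 * l%:R) *: iter l (bracket (e a)) (e i).
Proof.
elim: l => [|l IH]; first by rewrite mulr0 addr0 hC_e.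
rewrite [iter _ _ _]/=; set y := iter l _ _ in IH *.
have he : bracket hC (e a) = 2%:R *: e a.
  by rewrite hC_e (gcm_diag (kmd_gcm G)).
have jac (x u v : 'M[K]_d) : bracket x (bracket u v) = bracket (bracket x u) v + bracket u (bracket x v).
  rewrite /bracket !mulmxBl !mulmxBr !mulmxA !opprB !addrA.
  mxring.
rewrite jac he IH /bracket -scalemxAl -!scalemxAr -!scalemxAl -!scalerBr -scalerDl.
by congr (_ *: _); rewrite -natr1; ring.
Qed.

(** This is [const_nil] with n = - gcm G a i, for which the linear term c + n is zero. The Serre
    relation of M supplies the nilpotency on constants. *)
Lemma Ead_nil i : i != a -> iter `|1 - gcm G a i|%N Ead (PM (e i)) = 0.
Proof.
move=> ia; have off : gcm G a i <= 0 by apply: (gcm_off (kmd_gcm G)); rewrite eq_sym.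
have [s gs] : exists s : nat, gcm G a i = - s%:Z.
  by exists `|gcm G a i|%N; rewrite -[LHS]opprK; congr (- _); rewrite ler0_def in off; lia.
have -> : `|1 - gcm G a i|%N = s.+1 by rewrite gs; lia.
have sz := bmod_serre M (i := a) (j := i); rewrite eq_sym ia in sz; have {sz} := sz isT.
have -> : `|1 - gcm G a i|%N = s.+1 by rewrite gs; lia.
have itE l : iter l (fun Z => PM (e a) *m Z - Z *m PM (e a)) (PM (e i)) = PM (iter l (bracket (e a)) (e i)).
  by elim: l => //= l ->; rewrite /bracket map_mxB !map_mxM.
move=> sz; apply: (@const_nil K _ (fun Z => PM (e a) *m Z - Z *m PM (e a))
   (fun Z => PM hC *m Z - Z *m PM hC) (@Dx K d d) _ _ (gcm G a i)%:~R).
- by move=> u w; rewrite mulmxDr mulmxDl; mxring.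
- by move=> p u; rewrite -scalemxAr -scalemxAl scalerBr.
- by move=> u w; rewrite mulmxDr mulmxDl; mxring.
- by move=> p u; rewrite -scalemxAr -scalemxAl scalerBr.
- exact: DxD.
- exact: DxZ.
- by move=> u; rewrite gs rmorphN /= addNr mul0r scale0r addr0.
- by move=> l; rewrite itE -PMZ -iter_br_h /bracket map_mxB !map_mxM.
- by move=> l; rewrite itE DxC.
- by rewrite itE sz map_mx0.
Qed.

Lemma PM_bracket (x y : 'M[K]_d) : bracket (PM x) (PM y) = PM (bracket x y).
Proof. by rewrite /bracket map_mxB !map_mxM. Qed.

(** The correction is a multiple of e_i, so one more bracket with e_i kills it. *)
Lemma br_iterE i (c : K) l : iter l.+1 (bracket (PM (e i)))
    (bracket (PM (e i)) (PM (e a)) + (c%:P * 'X) *: PM (e i)) =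
  PM (iter l.+2 (bracket (e i)) (e a)).
Proof.
elim: l => [|l IH]; last by rewrite [LHS]iterS IH PM_bracket.
rewrite /= -!PM_bracket {1}/bracket mulmxDr mulmxDl -scalemxAr -scalemxAl.
by rewrite opprD addrACA subrr addr0.
Qed.

(* Sections killed by a power of e: the sections that extend over the other chart. *)
Definition nilE N q (f : 'M[{poly K}]_(d, q)) := exists s, iter s (@Ek N q) f = 0.

Lemma Ek0 N q : Ek N (0 : 'M[{poly K}]_(d, q)) = 0.
Proof. by rewrite /Ek !mulmx0 Dx0 !scaler0; mxring. Qed.

Lemma iterEk0 N q s : iter s (@Ek N q) 0 = 0.
Proof. by elim: s => //= s ->; rewrite Ek0. Qed.

Lemma iterEkD N q s (f g : 'M[{poly K}]_(d, q)) :
  iter s (@Ek N q) (f + g) = iter s (@Ek N q) f + iter s (@Ek N q) g.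
Proof. by elim: s => //= s ->; rewrite EkD. Qed.

Lemma iterEkM N q s t (f : 'M[{poly K}]_(d, q)) (z : 'M[K]_(q, t)) :
  iter s (@Ek N t) (f *m PM z) = iter s (@Ek N q) f *m PM z.
Proof. by elim: s => //= s ->; rewrite EkM. Qed.

Lemma nilE0 N q : nilE N (0 : 'M[{poly K}]_(d, q)).
Proof. by exists 0%N. Qed.

Lemma nilED N q (f g : 'M[{poly K}]_(d, q)) : nilE N f -> nilE N g -> nilE N (f + g).
Proof.
move=> [s fs] [t gt]; exists (s + t)%N; rewrite iterEkD {1}addnC !iterD fs gt !iterEk0.
by rewrite addr0.
Qed.

Lemma nilEM N q t (f : 'M[{poly K}]_(d, q)) (z : 'M[K]_(q, t)) : nilE N f -> nilE N (f *m PM z).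
Proof. by move=> [s fs]; exists s; rewrite iterEkM fs mul0mx. Qed.

Lemma nilE_Ek N q (f : 'M[{poly K}]_(d, q)) : nilE N (Ek N f) -> nilE N f.
Proof. by move=> [s fs]; exists s.+1; rewrite iterSr. Qed.

Lemma nilE_Ek' N q (f : 'M[{poly K}]_(d, q)) : nilE N f -> nilE N (Ek N f).
Proof. by move=> [s fs]; exists s; rewrite -iterSr iterS fs Ek0. Qed.

(** The Leibniz rule of [Ek_mul] and induction on the sum of the two nilpotency orders. *)
Lemma nilE_mul N i q (f : 'M[{poly K}]_(d, q)) : i != a -> nilE N f -> nilE N (PM (e i) *m f).
Proof.
move=> ia [t ft]; have := Ead_nil ia; move: (PM (e i)) => Z; move: `|_|%N => s.
elim: {s t}(s + t)%N {-2}s {-2}t (erefl (s + t)%N) Z f ft => [|w IH] s t st Z f ft Zs.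
  have [s0 _] : s = 0%N /\ t = 0%N by lia.
  by move: Zs; rewrite s0 /= => ->; rewrite mul0mx; exact: nilE0.
case: s st Zs => [|s] st Zs; first by move: Zs => /= ->; rewrite mul0mx; exact: nilE0.
case: t st ft => [|t] st ft; first by move: ft => /= ->; rewrite mulmx0; exact: nilE0.
apply: nilE_Ek; rewrite Ek_mul; apply: nilED.
  by apply: (IH s t.+1) => //; [lia|rewrite -iterSr].
by apply: (IH s.+1 t) => //; [lia|rewrite -iterSr].
Qed.

Definition wtv k (mu : 'rV[int]_m) q (f : 'M[{poly K}]_(d, q)) :=
  forall l, Hk k l f = ((mu 0 l)%:~R)%:P *: f.

Local Notation al := (row a (Defs.root G)).

Lemma wtD (mu nu : 'rV[int]_m) l : ((mu + nu) 0 l)%:~R = (mu 0 l)%:~R + (nu 0 l)%:~R :> K.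
Proof. by rewrite mxE rmorphD. Qed.

Lemma rootE i l : (row i (Defs.root G)) 0 l = Defs.root G i l. Proof. by rewrite mxE. Qed.

Lemma wtv_Ek k mu q (f : 'M[{poly K}]_(d, q)) : wtv k mu f -> wtv k (mu + al) (Ek k.*2 f).
Proof.
move=> wf l; rewrite Hk_Ek wf.
have -> (c : K) : Ek k.*2 (c%:P *: f) = c%:P *: Ek k.*2 f.
  have := EkM k.*2 f (c%:M : 'M_q); rewrite map_scalar_mx !mul_mx_scalar.
  by [].
by rewrite -scalerDl -polyCD wtD rootE.
Qed.

(** Commuting e past f only adds a scalar multiple of the section, because the section is a weight
    vector. *)
Lemma nilE_Dx k mu q (f : 'M[{poly K}]_(d, q)) : wtv k mu f -> nilE k.*2 f -> nilE k.*2 (Dx f).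
Proof.
move=> wf [s]; elim: s mu f wf => [|s IH] mu f wf fs.
  by move: fs => /= ->; rewrite Dx0; exact: nilE0.
apply: nilE_Ek; rewrite EkDx; apply: nilED; first by apply: IH (wtv_Ek wf) _; rewrite -iterSr.
apply: (big_ind (fun g => nilE k.*2 g)); [exact: nilE0|by move=> *; exact: nilED|].
move=> l _; rewrite wf scalerA -polyCM -mul_mx_scalar -map_scalar_mx; apply: nilEM.
by exists s.+1.
Qed.

Lemma hC_diag i j : hC i j = (\sum_l coroot G a l * wt M i 0 l)%:~R *+ (i == j).
Proof.
rewrite /hC summxE; case: eqP => [<-|/eqP/negPf ij].
  by rewrite rmorph_sum; apply: eq_bigr => l _; rewrite !mxE eqxx mulr1n rmorphM.
by rewrite big1 // => l _; rewrite !mxE ij mulr0n mulr0.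
Qed.

Definition nu i : int := \sum_l coroot G a l * wt M i 0 l.

Lemma hC_coef (f : 'cV[{poly K}]_d) i : (PM hC *m f) i 0 = (nu i)%:~R%:P * f i 0.
Proof.
rewrite mxE (bigD1 i) //= big1 ?addr0 => [|j ji]; first by rewrite mxE hC_diag eqxx.
by rewrite mxE hC_diag eq_sym (negPf ji) mulr0n polyC0 mul0r.
Qed.

Lemma Ek_coef N (f : 'cV[{poly K}]_d) i l : (Ek N f i 0)`_l.+1 =
  \sum_j e a i j * (f j 0)`_l.+1 - ((nu i)%:~R - N%:R + l%:R) * (f i 0)`_l.
Proof.
have hA : ((PM (e a) *m f) i 0)`_l.+1 = \sum_j e a i j * (f j 0)`_l.+1.
  by rewrite mxE coef_sum; apply: eq_bigr => j _; rewrite mxE coefCM.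
have hB := hC_coef f i; rewrite /Ek; move: hA hB; move: (PM _ *m f) (PM _ *m f) => A B hA hB.
rewrite !mxE hB !coefB !coefD coefN hA coefXM /= coefCM -mulrA coefCM coefXM /= coefXnM.
case: l {hA} => [|l] /=; first by ring.
by rewrite subn2 /= coef_deriv -mulr_natr; ring.
Qed.

(** In degrees beyond N and all the [nu i], the operator raises the degree by one and multiplies top
    coefficients by nonzero scalars, so a section of such degree is never killed. Hence the space of
    sections is finite-dimensional. *)
Lemma nilE_bound N : exists D, forall f : 'cV[{poly K}]_d, nilE N f ->
  forall i l, (D <= l)%N -> (f i 0)`_l = 0.
Proof.
pose D := (N + \sum_i absz (nu i)).+1; exists D => f [s fs] i l Dl.
pose B (g : 'cV[{poly K}]_d) := exists2 j, (D <= j)%N & (exists i, (g i 0)`_j != 0) /\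
  (forall i' j', (j < j')%N -> (g i' 0)`_j' = 0).
have BE g : B g -> B (Ek N g).
  move=> [j Dj [[i0 gj] gz]]; exists j.+1; first by rewrite ltnW.
  split=> [|i' [//|j'] jj]; last first.
    rewrite Ek_coef gz // mulr0 subr0 big1 // => p _.
    by rewrite gz ?mulr0 //; lia.
  exists i0; rewrite Ek_coef big1 ?sub0r ?oppr_eq0 ?mulf_neq0 // => [|p _]; last first.
    by rewrite gz ?mulr0.
  rewrite !pmulrn -rmorphB -rmorphD intr_eq0.
  have : (absz (nu i0) <= \sum_i absz (nu i))%N by rewrite (bigD1 i0) //= leq_addr.
  by move: Dj; rewrite /D; move: (\sum_i _)%N => S; lia.
apply/eqP; apply: contrapT => /negP fil.
have [j [Dj [hj jmax]]] : exists j, (D <= j)%N /\ ((exists i, (f i 0)`_j != 0) /\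
    (forall i' j', (j < j')%N -> (f i' 0)`_j' = 0)).
  pose Q j := `[< exists i, (f i 0)`_j != 0 >].
  have Ql : exists j, Q j by exists l; apply/asboolP; exists i.
  have Qb j : Q j -> (j <= \sum_i size (f i 0%R))%N.
    move=> /asboolP[p hp]; apply: leq_trans (_ : size (f p 0%R) <= _)%N.
      by rewrite ltnW // ltnNge; apply: contra hp => /(nth_default 0) ->.
    by rewrite (bigD1 p) //= leq_addr.
  case: (ex_maxnP Ql Qb) => j /asboolP hj jm; exists j; split.
    by apply: leq_trans Dl (jm _ _); apply/asboolP; exists i.
  split=> // i' j' jj; apply/eqP; apply: contraTT jj => h; rewrite -leqNgt; apply: jm.
  by apply/asboolP; exists i'.
have Bs t : B (iter t (@Ek N 1) f) by elim: t => [|t IH]; [exists j|exact: BE].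
by have [j' _ [[i']]] := Bs s; rewrite fs mxE coef0 eqxx.
Qed.

(** For large N every N - nu_i is at least the nilpotency order of e_a on M, and [const_nil] applies
    to the i-th basis vector with n = N - nu_i. *)
Lemma const_nilE : exists N0, forall N, (N0 <= N)%N -> forall v : 'cV[K]_d, nilE N (PM v).
Proof.
have [s es] : nilmx (e a).
  have [k ak] := root_neq0 G a.
  exact: (nilmx_weight ak (bmod_he M k a)).
exists (s + \sum_i absz (nu i))%N => N hN v.
have -> : v = \sum_i v i 0 *: delta_mx i 0.
  by rewrite [LHS]matrix_sum_delta; apply: eq_bigr => i _; rewrite big_ord1.
rewrite raddf_sum; apply: (big_ind (fun g => nilE N g)); [exact: nilE0|by move=> *; exact: nilED|].
move=> i _; rewrite /= PMZ -mul_mx_scalar -map_scalar_mx; apply: nilEM.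
have [w hw] : exists w : nat, N%:Z - nu i = w%:Z /\ (s <= w)%N.
  have : (absz (nu i) <= \sum_i absz (nu i))%N by rewrite (bigD1 i) //= leq_addr.
  move: hN; move: (\sum_i _)%N => S h1 h2; exists `|N%:Z - nu i|%N; lia.
case: hw => hw sw.
have itE l : iter l (fun f : 'cV_d => PM (e a) *m f) (PM (delta_mx i 0)) = PM (e a ^+ l *m delta_mx i 0).
  elim: l => [|l IH]; first by rewrite expr0 mul1mx.
  by rewrite iterS IH -map_mxM exprS mulmxA.
exists w.+1; apply: (@const_nil K _ (fun f => PM (e a) *m f) (fun f => PM hC *m f)
   (@Dx K d 1) _ _ (nu i)%:~R w).
- by move=> *; rewrite mulmxDr.
- by move=> *; rewrite scalemxAr.
- by move=> *; rewrite mulmxDr.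
- by move=> *; rewrite scalemxAr.
- exact: DxD.
- exact: DxZ.
- move=> u; rewrite /Ek; congr (_ + (_%:P * _) *: _ - _).
  by rewrite -[N%:R]/(N%:Z%:~R) -[w%:R]/(w%:Z%:~R) -hw rmorphB addrC subrK.
- move=> l; rewrite itE -map_mxM -PMZ; congr (PM _).
  elim: l => [|l IH].
    rewrite expr0 mul1mx mulr0 addr0; apply/colP => j; rewrite !mxE (bigD1 i) //= big1 ?addr0.
      by rewrite hC_diag !mxE eqxx mulr1 eq_sym; case: eqP => [->|_]; rewrite ?mulr1n ?mulr0n ?mulr1 ?mulr0.
    by move=> j' ji; rewrite mxE (negPf ji) mulr0.
  rewrite exprS mulE -[_ *m _ *m delta_mx i 0]mulmxA [LHS]mulmxA hCe_mul mulmxDl -[e a *m hC *m _]mulmxA IH -scalemxAl -scalemxAr -scalerDl.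
  by rewrite (gcm_diag (kmd_gcm G)); congr (_ *: _); rewrite -natr1; ring.
- by move=> l; rewrite itE DxC.
- by rewrite itE -(subnK (leqW sw)) exprD es mulr0 mul0mx map_mx0.
Qed.

(** The weight of x^l times the i-th basis vector in the twist by 2k. *)
Definition wtat k i (l : nat) : 'rV[int]_m := wt M i + (l%:Z - k%:Z) *: al.

Lemma Hk_coef k l (f : 'cV[{poly K}]_d) i j : (Hk k l f i 0)`_j =
  ((wtat k i j) 0 l)%:~R * (f i 0)`_j.
Proof.
have hA : ((PM (hmat K (wt M) l) *m f) i 0)`_j = (wt M i 0 l)%:~R * (f i 0)`_j.
  rewrite mxE coef_sum (bigD1 i) //= big1 ?addr0 => [|p pi]; last first.
    by rewrite !mxE eq_sym (negPf pi) mulr0n polyC0 mul0r coef0.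
  by rewrite !mxE eqxx mulr1n coefCM.
rewrite /Hk; move: hA; move: (PM _ *m f) => A hA.
have hD : (('X * (f i 0)^`())`_j) = j%:R * (f i 0)`_j.
  by rewrite coefXM; case: j {hA} => [|j] /=; rewrite ?mul0r // coef_deriv mulr_natl.
rewrite !mxE coefD hA coefCM coefB coefCM hD rmorphD rmorphM rmorphB /= -!pmulrn.
move: (wt M i 0 l)%:~R (Defs.root G a l)%:~R (f i 0)`_j => x y z.
by rewrite -mulrBl mulrA [y * _]mulrC -mulrDl.
Qed.

Lemma scale_coef (c : K) (f : 'cV[{poly K}]_d) i j : ((c%:P *: f) i 0)`_j = c * (f i 0)`_j.
Proof. by rewrite mxE coefCM. Qed.

Lemma wtvP k mu (f : 'cV[{poly K}]_d) :
  wtv k mu f <-> forall i j, (f i 0)`_j != 0 -> wtat k i j = mu.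
Proof.
split=> [h i j fij|h l].
  apply/rowP => l; have /matrixP/(_ i 0)/(congr1 (fun p : {poly K} => p`_j)) := h l.
  by rewrite Hk_coef scale_coef => /(mulIf fij)/intr_inj.
apply/matrixP => i o; rewrite (ord1 o) {o}; apply/polyP => j; rewrite Hk_coef scale_coef.
by have [->|/h ->] := eqVneq (f i 0)`_j 0; rewrite ?mulr0.
Qed.

Definition comp k (f : 'cV[{poly K}]_d) (mu : 'rV[int]_m) : 'cV[{poly K}]_d :=
  \col_i \poly_(j < size (f i 0)) (if wtat k i j == mu then (f i 0)`_j else 0).

Lemma comp_coef k f mu i j : (comp k f mu i 0)`_j = if wtat k i j == mu then (f i 0)`_j else 0.
Proof.
rewrite mxE coef_poly; case: ltnP => // h; rewrite nth_default //; by case: ifP.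
Qed.

Lemma comp_wtv k f mu : wtv k mu (comp k f mu).
Proof. by apply/wtvP => i j; rewrite comp_coef; have [-> //|_ /eqP] := eqVneq (wtat k i j) mu. Qed.

Lemma comp_sum k (f : 'cV[{poly K}]_d) : exists s : seq 'rV[int]_m, uniq s /\ f = \sum_(mu <- s) comp k f mu.
Proof.
exists (undup [seq wtat k i j | i <- enum 'I_d, j <- iota 0 (\max_i size (f i 0%R))]).
split; first exact: undup_uniq.
apply/matrixP => i o; rewrite (ord1 o) {o}; apply/polyP => j; rewrite summxE coef_sum.
have [z|nz] := eqVneq (f i 0)`_j 0.
  by rewrite z big1 // => mu _; rewrite comp_coef z if_same.
rewrite (bigD1_seq (wtat k i j)) ?undup_uniq //=; last first.
  rewrite mem_undup; apply/allpairsP; exists (i, j); rewrite mem_enum mem_iota /=; split=> //.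
  rewrite add0n; apply: leq_trans (leq_bigmax i); rewrite ltnNge.
  by apply: contra nz => /(nth_default 0) ->.
by rewrite comp_coef eqxx big1 ?addr0 // => mu /negPf h; rewrite comp_coef eq_sym h.
Qed.

Lemma wtv_indep k (s : seq 'rV[int]_m) (g : 'rV[int]_m -> 'cV[{poly K}]_d) c : uniq s ->
  (forall mu, wtv k (mu + c) (g mu)) -> \sum_(mu <- s) g mu = 0 -> forall mu, mu \in s -> g mu = 0.
Proof.
move=> us wg sg mu ms; apply/matrixP => i o; rewrite (ord1 o) {o}; apply/polyP => j.
rewrite mxE coef0; apply/eqP; apply: contrapT => /negP nz.
have := congr1 (fun f : 'cV[{poly K}]_d => (f i 0)`_j) sg; rewrite /= mxE coef0 summxE coef_sum.
rewrite (bigD1_seq mu) //= big1 ?addr0 => [|nu' nm]; first by move/eqP; rewrite (negPf nz).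
apply/eqP; apply: contraTT nm => h; rewrite negbK.
have e1 := (wtvP _ _ _).1 (wg nu') i j h; have e2 := (wtvP _ _ _).1 (wg mu) i j nz.
by rewrite e1 in e2; move/addIr: e2 => ->.
Qed.

Lemma iterEk_wtv k mu s (f : 'cV[{poly K}]_d) : wtv k mu f ->
  wtv k (mu + s%:Z *: al) (iter s (@Ek k.*2 1) f).
Proof.
move=> wf; elim: s => [|s IH]; first by rewrite scale0r addr0.
by have := wtv_Ek IH; rewrite -addrA intS scalerDl scale1r [X in _ + X]addrC.
Qed.

(** All weights are shifted by the same amount, so in a vanishing sum of images of weight components
    every term vanishes. *)
Lemma comp_nil k f mu : nilE k.*2 f -> nilE k.*2 (comp k f mu).
Proof.
move=> [t ft]; have [s [us fs]] := comp_sum k f.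
have [ms|ns] := boolP (mu \in s); last first.
  have -> : comp k f mu = 0; last exact: nilE0.
  apply/matrixP => i o; rewrite (ord1 o) {o}; apply/polyP => j; rewrite comp_coef mxE coef0.
  case: eqP => // e; rewrite fs summxE coef_sum big1_seq // => mu' /andP[_ ms'].
  by rewrite comp_coef e; case: eqP => // e'; rewrite e' ms' in ns.
exists t; apply: (@wtv_indep k s (fun mu => iter t (@Ek k.*2 1) (comp k f mu)) (t%:Z *: al)) ms => //.
  by move=> mu'; exact/iterEk_wtv/comp_wtv.
rewrite -[RHS]ft [in RHS]fs; elim: (s) => [|x s' IH]; first by rewrite !big_nil iterEk0.
by rewrite !big_cons iterEkD IH.
Qed.

Lemma PM_coef q (T : 'M[{poly K}]_(d, q)) (c : 'cV[K]_q) i l :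
  ((T *m PM c) i 0)`_l = \sum_j c j 0 * (T i j)`_l.
Proof. by rewrite mxE coef_sum; apply: eq_bigr => j _; rewrite mxE coefMC mulrC. Qed.

Lemma PM_sum q (T : 'M[{poly K}]_(d, q)) (c : 'cV[K]_q) : T *m PM c = \sum_j (c j 0)%:P *: col j T.
Proof.
apply/matrixP => i o; rewrite (ord1 o) summxE mxE; apply: eq_bigr => j _; rewrite !mxE mulrC.
by [].
Qed.

(** The degree bound encodes sections as vectors of coefficients. Weight vectors suffice, since the
    weight components of a section are sections. *)
Lemma section_basis k : exists q (T : 'M[{poly K}]_(d, q)),
  [/\ forall j, nilE k.*2 (col j T) /\ exists mu, wtv k mu (col j T),
      forall c : 'cV[K]_q, T *m PM c = 0 -> c = 0
    & forall f : 'cV_d, nilE k.*2 f -> exists c, f = T *m PM c].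
Proof.
have [D hD] := nilE_bound k.*2.
pose enc (f : 'cV[{poly K}]_d) : 'rV[K]_(d * D) := mxvec (\matrix_(i, j) (f i 0)`_j).
pose P v := exists f, [/\ nilE k.*2 f, exists mu, wtv k mu f & v = enc f].
have [q [A [fA PA sA]]] := max_free P.
have /choice[g hg] := PA; pose T := \matrix_(i, j) g j i 0.
have colT j : col j T = g j by apply/matrixP => i o; rewrite !mxE (ord1 o).
have encE (f : 'cV[{poly K}]_d) i (j : 'I_D) : enc f 0 (mxvec_index i j) = (f i 0)`_j.
  by rewrite mxvecE mxE.
have encT c : enc (T *m PM c) = c^T *m A.
  apply/rowP => w; case/mxvec_indexP: w => i j; rewrite encE PM_coef mxE; apply: eq_bigr => p _.
  rewrite !mxE; have [_ _ e] := hg p; congr (_ * _).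
  by have := congr1 (fun v : 'rV_(d * D) => v 0 (mxvec_index i j)) e; rewrite encE mxE => ->.
have nT (c : 'cV[K]_q) : nilE k.*2 (T *m PM c).
  rewrite PM_sum; apply: (big_ind (fun g => nilE k.*2 g)); [exact: nilE0|by move=> *; exact: nilED|].
  move=> j _; rewrite -mul_mx_scalar -map_scalar_mx; apply: nilEM.
  by rewrite colT; have [] := hg j.
have sp (f : 'cV_d) mu : nilE k.*2 f -> wtv k mu f -> exists c, f = T *m PM c.
  move=> nf wf; have /sA/submxP[u hu] : P (enc f) by exists f; split=> //; exists mu.
  exists u^T; apply/matrixP => i o; rewrite (ord1 o) {o}; apply/polyP => l.
  have [Dl|lD] := leqP D l; first by rewrite !hD.
  by rewrite -(encE f i (Ordinal lD)) -(encE _ i (Ordinal lD)) encT trmxK hu.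
exists q, T; split.
- by move=> j; rewrite colT; have [] := hg j.
- move=> c Tc; have := encT c; rewrite Tc.
  have -> : enc 0 = 0 by apply/rowP => w; case/mxvec_indexP: w => i j; rewrite encE !mxE coef0.
  move/esym => h; apply: trmx_inj; rewrite trmx0; apply: (row_free_inj fA); rewrite /= h mul0mx.
  by [].
- move=> f nf; have [s [_ ->]] := comp_sum k f.
  elim: s => [|mu s [c IH]]; first by exists 0; rewrite big_nil map_mx0 mulmx0.
  have [c' hc'] := sp _ mu (comp_nil mu nf) (comp_wtv k f mu).
  by exists (c' + c); rewrite big_cons IH {1}hc' map_mxD mulmxDr.
Qed.

End Ops.
End Coinduction.

(** * The induced module and its universal property *)

Section CoinducedModule.
Variables (K : numFieldType) (n m : nat) (G : km_datum n m) (a : 'I_n).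

(* The columns of T are sections of the bundle attached to M, twisted by 2k, and span
   a submodule isomorphic to a quotient of r. *)
Definition coind_pair d (M : bmod K G d) (k : nat) q (r : pmod K G a q)
    (T : 'M[{poly K}]_(d, q)) : Prop :=
  [/\ Dx T = T *m PM (fmat r), (forall i, i != a -> PM (emat M i) *m T = T *m PM (emat r i)),
      Ek a M k.*2 T = T *m PM (emat r a) & forall l, Hk a M k l T = T *m PM (hmat K (wt r) l)].

Definition universal_pair d (M : bmod K G d) (k : nat) q (T : 'M[{poly K}]_(d, q)) : Prop :=
  (forall c : 'cV[K]_q, T *m PM c = 0 -> c = 0) /\
  (forall f : 'cV_d, nilE a M k.*2 f -> exists c, f = T *m PM c).

Lemma PM_colP p q (A B : 'M[{poly K}]_(p, q)) :
  (forall j, A *m PM (delta_mx j 0 : 'cV_q) = B *m PM (delta_mx j 0 : 'cV_q)) -> A = B.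
Proof.
move=> h; apply/matrixP => i j; have /matrixP/(_ i 0) := h j.
by rewrite !map_delta_mx -!colE !mxE.
Qed.

Lemma universal_inj d (M : bmod K G d) k q (T : 'M[{poly K}]_(d, q)) s (x y : 'M[K]_(q, s)) :
  universal_pair M k T -> T *m PM x = T *m PM y -> x = y.
Proof.
move=> [inj _] h; apply/eqP; rewrite -subr_eq0; apply/eqP/matrixP => i j.
have : (x - y) *m delta_mx j 0 = 0 :> 'cV_q.
  by apply: inj; rewrite map_mxM mulmxA map_mxB mulmxBr h subrr mul0mx.
by rewrite -colE => /matrixP/(_ i 0); rewrite !mxE.
Qed.

Section Existence.
Variables (d : nat) (M : bmod K G d) (k : nat).
Local Notation e := (emat M).

Lemma ops_exist q (T : 'M[{poly K}]_(d, q)) (X : forall s, 'M[{poly K}]_(d, s) -> 'M[{poly K}]_(d, s)) :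
  universal_pair M k T -> (forall s t f (z : 'M_(s, t)), X t (f *m PM z) = X s f *m PM z) ->
  (forall j, nilE a M k.*2 (X 1 (col j T))) -> exists x, X q T = T *m PM x.
Proof.
move=> [_ sp] XM Xn; have /choice[c hc] j := sp _ (Xn j).
exists (\matrix_(i, j) c j i 0); apply: PM_colP => j; rewrite -XM -mulmxA -map_mxM.
rewrite [T *m PM (delta_mx _ _)](_ : _ = col j T); last by rewrite map_delta_mx -colE.
rewrite hc; congr (_ *m PM _); apply/matrixP => i o; rewrite (ord1 o) -colE !mxE.
by [].
Qed.

Lemma lm_bracket q (T : 'M[{poly K}]_(d, q)) (A B : 'M[{poly K}]_d) (x y : 'M[K]_q) :
  A *m T = T *m PM x -> B *m T = T *m PM y -> bracket A B *m T = T *m PM (bracket x y).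
Proof.
move=> hA hB; rewrite /bracket mulmxBl -!mulmxA hB hA !mulmxA hA hB -!mulmxA -!map_mxM.
by rewrite -mulmxBr -map_mxB.
Qed.

Lemma lm_iter q (T : 'M[{poly K}]_(d, q)) (A B : 'M[{poly K}]_d) (x y : 'M[K]_q) s :
  A *m T = T *m PM x -> B *m T = T *m PM y ->
  iter s (bracket A) B *m T = T *m PM (iter s (bracket x) y).
Proof. by move=> hA hB; elim: s => //= s IH; exact: lm_bracket. Qed.

Lemma Ead_bracket q (T : 'M[{poly K}]_(d, q)) N (Z : 'M[{poly K}]_d) (x z : 'M[K]_q) :
  Ek a M N T = T *m PM x -> Z *m T = T *m PM z -> Ead a M Z *m T = T *m PM (bracket x z).
Proof.
move=> hE hZ; have := Ek_mul a M N Z T; rewrite hZ hE EkM hE => h.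
rewrite -[LHS](addrK (Z *m (T *m PM x))) -h mulmxA hZ -!mulmxA -!map_mxM -mulmxBr -map_mxB.
by [].
Qed.

Lemma Ead_iter q (T : 'M[{poly K}]_(d, q)) N (Z : 'M[{poly K}]_d) (x z : 'M[K]_q) s :
  Ek a M N T = T *m PM x -> Z *m T = T *m PM z ->
  iter s (Ead a M) Z *m T = T *m PM (iter s (bracket x) z).
Proof. by move=> hE hZ; elim: s => //= s IH; exact: Ead_bracket hE IH. Qed.

Lemma EadE i : Ead a M (PM (e i)) =
  - (bracket (PM (e i)) (PM (e a)) + ((gcm G a i)%:~R%:P * 'X) *: PM (e i)).
Proof.
have hb : hC a M *m e i - e i *m hC a M = _ := hC_e a M i.
rewrite /Ead DxC scaler0 subr0 -!map_mxM -!map_mxB hb PMZ /bracket !map_mxB !map_mxM.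
by rewrite scalerA opprD opprB mulrC.
Qed.

(** The operators of the parabolic subalgebra preserve the space of sections, so they have matrices
    in the basis T; as T is injective on constants, relations between operators pass to the
    matrices. *)
Lemma coind_exists : exists q (r : pmod K G a q) T, [/\ coind_pair M k r T, universal_pair M k T
  & forall l, l != a -> emat M l = 0 -> emat r l = 0].
Proof.
have [q [T [wT iT sT]]] := section_basis a M k.
have uT : universal_pair M k T by [].
have injT := @universal_inj d M k q T _ _ _ uT.
have nT j : nilE a M k.*2 (col j T) by have [] := wT j.
have /choice[mu hmu] j := (wT j).2.
have [f hf] := ops_exist uT (X := fun s => @Dx K d s) (@DxMc _ _) (fun j => nilE_Dx (hmu j) (nT j)).
have [ea hea] := ops_exist uT (X := fun s => @Ek K n m G a d M k.*2 s)
   (@EkM _ _ _ _ _ _ _ _) (fun j => nilE_Ek' (nT j)).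
have /choice[e0 he0] i : exists x, i != a -> PM (e i) *m T = T *m PM x.
  have [ia|] := boolP (i != a); last by exists 0.
  have [x hx] := ops_exist uT (X := fun s f => PM (e i) *m f) (fun s t f z => mulmxA _ _ _)
     (fun j => nilE_mul ia (nT j)).
  by exists x.
pose em i := if i == a then ea else e0 i.
have ema : em a = ea by rewrite /em eqxx.
have emi i : i != a -> PM (e i) *m T = T *m PM (em i).
  by move=> ia; rewrite /em (negPf ia); exact: he0.
have hH l : Hk a M k l T = T *m PM (hmat K mu l).
  apply: PM_colP => j; rewrite -HkM -mulmxA -map_mxM.
  rewrite [T *m PM (delta_mx _ _)](_ : _ = col j T); last by rewrite map_delta_mx -colE.
  rewrite hmu; have -> : hmat K mu l *m delta_mx j 0 = (mu j 0 l)%:~R *: delta_mx j 0 :> 'cV_q.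
    apply/matrixP => i o; rewrite mul_diag_mx !mxE.
    by case: eqP => [->|_] //=; rewrite !mulr0.
  by rewrite PMZ -scalemxAr map_delta_mx -colE.
have he l i : bracket (hmat K mu l) (em i) = (Defs.root G i l)%:~R *: em i.
  apply: injT; rewrite PMZ -scalemxAr /bracket map_mxB !map_mxM mulmxBr !mulmxA -hH.
  have [->|ia] := eqVneq i a.
    rewrite ema -hea -EkM -hH -HkM -hea.
    by rewrite Hk_Ek addrAC subrr add0r.
  by rewrite -(emi _ ia) -mulmxA -hH -HkM -(emi _ ia) Hk_Lm addrAC subrr add0r.
have hs i j : i != j -> iter `|1 - gcm G i j|%N (bracket (em i)) (em j) = 0.
  move=> ij; apply: injT; rewrite map_mx0 mulmx0.
  have [ja|ja] := eqVneq j a.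
    rewrite ja in ij *; rewrite ema.
    (* Bracketing e_i with [Ek] gives the bracket with e_a plus a multiple of e_i, which a second
       bracket kills. If the Serre relation has a single bracket, then gcm G i a = 0, hence gcm G a
       i = 0 and the multiple is zero. *)
    have b1 : (bracket (PM (e i)) (PM (e a)) + ((gcm G a i)%:~R%:P * 'X) *: PM (e i)) *m T =
        T *m PM (bracket (em i) ea).
      rewrite -[X in X *m T]opprK -EadE mulNmx (Ead_bracket hea (emi _ ij)) -mulmxN -raddfN.
      by rewrite /bracket opprB.
    have off : gcm G i a <= 0 by apply: (gcm_off (kmd_gcm G)).
    have sz := bmod_serre M ij.
    have [s hs] : exists s, `|1 - gcm G i a|%N = s.+1 by exists `|gcm G i a|%N; lia.
    rewrite hs in sz *; case: s hs sz => [|s] hs sz.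
      have g0 : gcm G i a = 0 by lia.
      have g1 := gcm_zero (kmd_gcm G) g0.
      rewrite [iter _ _ _]/= -b1 g1 polyC0 mul0r scale0r addr0.
      by rewrite PM_bracket [bracket _ _]sz map_mx0 mul0mx.
    by rewrite iterSr -(lm_iter s.+1 (emi _ ij) b1) br_iterE sz map_mx0 mul0mx.
  have [ia|ia] := eqVneq i a.
    rewrite ia ema -(Ead_iter _ hea (emi _ ja)) Ead_nil // mul0mx.
    by [].
  rewrite -(lm_iter _ (emi _ ia) (emi _ ja)).
  have -> : iter `|1 - gcm G i j|%N (bracket (PM (e i))) (PM (e j)) = PM (iter `|1 - gcm G i j|%N (bracket (e i)) (e j)).
    by elim: `|_|%N => //= s ->; rewrite PM_bracket.
  by rewrite bmod_serre // map_mx0 mul0mx.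
pose B := BMod he hs.
have hhf l : bracket (hmat K (wt B) l) f = - (Defs.root G a l)%:~R *: f.
  apply: injT; rewrite PMZ -scalemxAr /bracket map_mxB !map_mxM mulmxBr !mulmxA -hH -hf.
  by rewrite -DxMc -hH -HkM -hf Hk_Dx addrAC subrr add0r polyCN scaleNr.
have hef i : bracket (emat B i) f =
    if i == a then \sum_l (coroot G a l)%:~R *: hmat K (wt B) l else 0.
  apply: injT; rewrite /bracket map_mxB !map_mxM mulmxBr !mulmxA -hf -DxMc /=.
  have [->|ia] := eqVneq i a.
    rewrite ema -hea -EkM -hf EkDx addrAC subrr add0r raddf_sum mulmx_sumr.
    by apply: eq_bigr => l _ /=; rewrite PMZ -scalemxAr hH.
  by rewrite -(emi _ ia) -mulmxA -hf -Dx_Lm subrr map_mx0 mulmx0.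
exists q, (PMod hhf hef), T; split=> //.
- by split=> //=; rewrite ?ema.
- move=> l la el0 /=; apply: injT; rewrite -(emi _ la) el0.
  by rewrite !map_mx0 mul0mx mulmx0.
Qed.

End Existence.
(** The value of a section at the base point x = 0 of P_a / B. *)
Definition ev0 p q (f : 'M[{poly K}]_(p, q)) : 'M[K]_(p, q) := map_mx (fun c : {poly K} => c`_0) f.

Lemma ev0D p q (f g : 'M[{poly K}]_(p, q)) : ev0 (f + g) = ev0 f + ev0 g.
Proof. by apply/matrixP => i j; rewrite !mxE coefD. Qed.

Lemma ev0N p q (f : 'M[{poly K}]_(p, q)) : ev0 (- f) = - ev0 f.
Proof. by apply/matrixP => i j; rewrite !mxE coefN. Qed.

Lemma ev0M p q s (f : 'M[{poly K}]_(p, q)) (g : 'M[{poly K}]_(q, s)) :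
  ev0 (f *m g) = ev0 f *m ev0 g.
Proof. by apply/matrixP => i j; rewrite !mxE coef_sum; apply: eq_bigr => l _; rewrite !mxE coef0M. Qed.

Lemma ev0_PM p q (z : 'M[K]_(p, q)) : ev0 (PM z) = z.
Proof. by apply/matrixP => i j; rewrite !mxE coefC. Qed.

Lemma ev0Z p q (c : {poly K}) (f : 'M[{poly K}]_(p, q)) : ev0 (c *: f) = c`_0 *: ev0 f.
Proof. by apply/matrixP => i j; rewrite !mxE coef0M. Qed.

Lemma ev0_tens p q s t (f : 'M[{poly K}]_(p, q)) (g : 'M[{poly K}]_(s, t)) :
  ev0 (f *t g) = ev0 f *t ev0 g.
Proof. by apply/matrixP => i j; rewrite !mxE coef0M. Qed.

Section Pairs.
Variables (d : nat) (M : bmod K G d) (k q : nat) (r : pmod K G a q) (T : 'M[{poly K}]_(d, q)).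
Hypothesis hT : coind_pair M k r T.

(** With [pair_h], evaluation at the base point is linear over the Borel subalgebra, up to a shift
    of weights by k times the root. *)
Lemma pair_e i : emat M i *m ev0 T = ev0 T *m emat r i.
Proof.
case: hT => _ he hE _; have [->|ia] := eqVneq i a.
  have := congr1 (@ev0 _ _) hE; rewrite ev0M ev0_PM => <-.
  rewrite /Ek !(ev0D, ev0N, ev0Z) ev0M ev0_PM coefX coefXn coef0M coefX.
  by rewrite !(mulr0, scale0r) !subr0 addr0.
by have := congr1 (@ev0 _ _) (he i ia); rewrite !ev0M !ev0_PM.
Qed.

Lemma pair_h l : hmat K (wt M) l *m ev0 T - ((Defs.root G a l)%:~R * k%:R) *: ev0 T =
  ev0 T *m hmat K (wt r) l.
Proof.
case: hT => _ _ _ /(_ l)/(congr1 (@ev0 _ _)); rewrite ev0M ev0_PM => <-.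
rewrite /Hk !(ev0D, ev0N, ev0Z) ev0M ev0_PM coefX !coefC /= scale0r add0r.
by rewrite scalerN scalerA.
Qed.

Lemma pair_hom e (N : bmod K G e) F : bmod_hom M N F -> coind_pair N k r (PM F *m T).
Proof.
case: hT => hD he hE hH [Fh Fe]; split.
- by rewrite DxM DxC mul0mx add0r hD mulmxA.
- by move=> i ia; rewrite mulmxA -map_mxM -Fe map_mxM -!mulmxA he.
- have hCF : F *m hC a M = hC a N *m F.
    rewrite /hC mulmx_suml mulmx_sumr; apply: eq_bigr => l _.
    by rewrite -scalemxAl -scalemxAr Fh.
  rewrite -mulmxA -hE /Ek DxM DxC mul0mx add0r !mulmxDr !mulmxN -!scalemxAr !mulmxA -!map_mxM.
  by rewrite Fe hCF.
- move=> l; rewrite -mulmxA -hH /Hk DxM DxC mul0mx add0r mulmxDr !mulmxA -!map_mxM Fh.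
  by rewrite -!scalemxAr mulmxBr -!scalemxAr.
Qed.

Lemma pair_nil (c : 'cV[K]_q) : nilE a M k.*2 (T *m PM c).
Proof.
case: hT => _ _ hE _; have [l al0] := root_neq0 G a.
have [s es] := nilmx_weight al0 (bmod_he r l a).
have it t : iter t (@Ek K n m G a d M k.*2 q) T = T *m PM (emat r a ^+ t).
  elim: t => [|t IH]; first by rewrite expr0 map_mx1 mulmx1.
  by rewrite iterS IH EkM hE -mulmxA -map_mxM exprS.
by exists s; rewrite iterEkM it es map_mx0 mulmx0 mul0mx.
Qed.

End Pairs.

(** The columns of U are sections by [pair_nil], hence combinations of those of T; the coefficient
    matrix commutes with the actions because T is injective. *)
Lemma pair_factor d (M : bmod K G d) k q (r : pmod K G a q) T s (r' : pmod K G a s) U :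
  coind_pair M k r T -> universal_pair M k T -> coind_pair M k r' U ->
  exists Q, U = T *m PM Q /\ pmod_hom r' r Q.
Proof.
move=> hT uT hU; have [hD he hE hH] := hT; have [hD' he' hE' hH'] := hU.
have [_ sp] := uT.
have /choice[c hc] j := sp _ (pair_nil hU (delta_mx j 0)).
pose Q := \matrix_(i, j) c j i 0.
have UQ : U = T *m PM Q.
  apply: PM_colP => j; rewrite hc -mulmxA -map_mxM; congr (_ *m PM _).
  by apply/matrixP => i o; rewrite (ord1 o) -colE !mxE.
have inj := universal_inj uT.
exists Q; split=> //; split; first split.
- move=> l; apply: inj; rewrite !map_mxM !mulmxA -UQ -hH' -hH UQ -HkM.
  by [].
- move=> i; apply: inj; rewrite !map_mxM !mulmxA -UQ.
  have [->|ia] := eqVneq i a; first by rewrite -hE' -hE UQ -EkM.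
  by rewrite -he' // -he // UQ mulmxA.
- by apply: inj; rewrite !map_mxM !mulmxA -UQ -hD' -hD UQ DxMc.
Qed.

Lemma Ek_tens d e (M : bmod K G d) (M' : bmod K G e) (N : bmod K G (d * e)) k k' q s
    (f : 'M[{poly K}]_(d, q)) (g : 'M[{poly K}]_(e, s)) : bmod_tens M M' N ->
  Ek a N (k + k') (f *t g) = Ek a M k f *t g + f *t Ek a M' k' g.
Proof.
move=> [hh he].
have PMt (x : 'M[K]_d) (y : 'M[K]_e) : PM (tens_action x y) *m (f *t g) = (PM x *m f) *t g + f *t (PM y *m g).
  by rewrite /tens_action map_mxD !map_mxT !map_mx1 mulmxDl !tensmx_mul !mul1mx.
have hC_t : hC a N = tens_action (hC a M) (hC a M').
  by rewrite /hC tens_action_sum; apply: eq_bigr => l _; rewrite hh tens_actionZ.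
rewrite /Ek he hC_t !PMt Dx_tens natrD polyCD.
rewrite !tensmxDl !tensmxDr !tensmxNl !tensmxNr !tensmxZl !tensmxZr.
move: (PM _ *m f *t g) (PM (hC a M) *m f *t g) (f *t (PM _ *m g)) (f *t (PM (hC a M') *m g)).
move: (Dx f *t g) (f *t Dx g) (f *t g) => A1 A2 A3 A4 A5 A6 A7; mxring.
Qed.

Lemma Hk_tens d e (M : bmod K G d) (M' : bmod K G e) (N : bmod K G (d * e)) k k' l q s
    (f : 'M[{poly K}]_(d, q)) (g : 'M[{poly K}]_(e, s)) : bmod_tens M M' N ->
  Hk a N (k + k') l (f *t g) = Hk a M k l f *t g + f *t Hk a M' k' l g.
Proof.
move=> [hh he].
have PMt (x : 'M[K]_d) (y : 'M[K]_e) : PM (tens_action x y) *m (f *t g) = (PM x *m f) *t g + f *t (PM y *m g).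
  by rewrite /tens_action map_mxD !map_mxT !map_mx1 mulmxDl !tensmx_mul !mul1mx.
rewrite /Hk hh PMt Dx_tens natrD polyCD.
rewrite !tensmxDl !tensmxDr !tensmxZl !tensmxZr !tensmxDl !tensmxDr !tensmxNl !tensmxNr !tensmxZl !tensmxZr.
move: (PM _ *m f *t g) (f *t (PM _ *m g)).
move: (Dx f *t g) (f *t Dx g) (f *t g) => A1 A2 A3 A4 A5; mxring.
Qed.

Lemma pair_tens d e (M : bmod K G d) (M' : bmod K G e) (N : bmod K G (d * e)) k k' q s
    (r : pmod K G a q) (r' : pmod K G a s) (t : pmod K G a (q * s)) T T' :
  bmod_tens M M' N -> pmod_tens r r' t -> coind_pair M k r T -> coind_pair M' k' r' T' ->
  coind_pair N (k + k') t (T *t T').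
Proof.
move=> hN [[th te] tf] [hD he hE hH] [hD' he' hE' hH']; have [Nh Ne] := hN.
have TT (x : 'M[K]_q) (y : 'M[K]_s) : (T *m PM x) *t T' + T *t (T' *m PM y) = (T *t T') *m PM (tens_action x y).
  by rewrite /tens_action map_mxD !map_mxT !map_mx1 mulmxDr !tensmx_mul !mulmx1.
split.
- by rewrite Dx_tens hD hD' TT tf.
- move=> i ia; rewrite Ne te -TT /tens_action map_mxD !map_mxT !map_mx1 mulmxDl !tensmx_mul !mul1mx.
  by rewrite he // he'.
- by rewrite doubleD (Ek_tens _ _ _ _ hN) hE hE' TT te.
- by move=> l; rewrite (Hk_tens _ _ _ _ _ hN) hH hH' TT th.
Qed.

Section BmodUtils.

(** Since E_(N+1)(x g) = x E_N(g), division by x stays within sections and lowers the twist by one.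
    It is done twice, with the constant term removed in between. *)
Lemma ker_ev0 d (M : bmod K G d) N (f : 'cV[{poly K}]_d) :
  (forall v : 'cV[K]_d, nilE a M N (PM v) /\ nilE a M N.+1 (PM v)) ->
  nilE a M N.+2 f -> ev0 f = 0 -> exists (v : 'cV[K]_d) (g : 'cV[{poly K}]_d),
  f = 'X *: PM v + 'X^2 *: g /\ nilE a M N g.
Proof.
move=> cn; have EX N' q (g : 'M[{poly K}]_(d, q)) : Ek a M N'.+1 ('X *: g) = 'X *: Ek a M N' g.
  rewrite /Ek DxZ derivX scale1r -!scalemxAr -natr1 polyCD.
  move: (PM _ *m g) (PM _ *m g) (Dx g) => A B C; mxring.
have nX N' (g : 'cV[{poly K}]_d) : nilE a M N'.+1 ('X *: g) -> nilE a M N' g.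
  move=> [s gs]; exists s; have itX t : iter t (@Ek _ _ _ _ a _ M N'.+1 1) ('X *: g) = 'X *: iter t (@Ek _ _ _ _ a _ M N' 1) g.
    by elim: t => //= t ->; rewrite EX.
  rewrite itX in gs; apply/matrixP => i j; have /matrixP/(_ i j) := gs.
  rewrite !mxE => /eqP; rewrite mulf_eq0 polyX_eq0 /= => /eqP ->.
  by [].
have dv (g : 'cV[{poly K}]_d) : ev0 g = 0 -> exists h, g = 'X *: h.
  move=> g0; exists (\col_i \poly_(j < (size (g i 0)).-1) (g i 0)`_j.+1).
  apply/matrixP => i j; rewrite (ord1 j) !mxE; apply/polyP => l; rewrite coefXM.
  case: l => [|l] /=; first by have /matrixP/(_ i 0) := g0; rewrite !mxE.
  rewrite coef_poly; case: ltnP => // h; rewrite nth_default //.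
  by move: h; case: (size _).
move=> nf /dv[f1 ef]; rewrite ef in nf; have n1 := nX _ _ nf.
pose v := ev0 f1; have [_ nv] := cn v.
have [|g eg] := dv (f1 - PM v); first by rewrite ev0D ev0N ev0_PM subrr.
exists v, g; split.
  rewrite ef -[f1](subrK (PM v)) eg scalerDr addrC scalerA -expr2.
  by [].
apply: nX; rewrite -eg; apply: nilED => //.
have -> : - PM v = PM v *m PM ((-1)%:M).
  by rewrite map_scalar_mx mul_mx_scalar rmorphN rmorph1 scaleN1r.
exact: nilEM.
Qed.

(* u |-> exp(x f) u embeds a representation of P_a in the sections of its restriction
   to B. *)
Lemma pair_self q (V : pmod K G a q) : exists U, coind_pair V 0 V U /\ ev0 U = 1%:M.
Proof.
have [l al0] := root_neq0 G a.
have [s fs] : nilmx (fmat V).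
  apply: (@nilmx_weight _ m q (wt V) (fmat V) l (- Defs.root G a l)).
    by rewrite oppr_eq0.
  by rewrite pmod_hf rmorphN.
set f := fmat V in fs *; set h := hC a V.
pose c t : {poly K} := t`!%:R^-1 *: 'X^t.
pose U := \sum_(t < s) c t *: PM (f ^+ t).
have f0 t : t.+1%:R != 0 :> K by rewrite pnatr_eq0.
have ct t : (t.+1)`!%:R^-1 * t.+1%:R = t`!%:R^-1 :> K.
  by rewrite factS natrM invfM mulrAC mulVf // mul1r.
have cD t : (c t.+1)^`() = c t by rewrite /c derivZ derivXn -scaler_nat scalerA ct.
have cX t : 'X * c t = t.+1%:R *: c t.+1 by rewrite /c -scalerAr -exprS scalerA mulrC ct.
have cD0 : (c 0%N)^`() = 0 by rewrite /c derivZ derivXn mulr0n scaler0.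
have fl t : f ^+ t *m f = f ^+ t.+1 by rewrite exprSr.
have hff : h *m f = f *m h - 2%:R *: f.
  have : bracket h f = - 2%:R *: f.
    rewrite /h /hC bracket_suml.
    under eq_bigr => t _ do rewrite pmod_hf scalerA.
    rewrite -scaler_suml; congr (_ *: _).
    have -> : (2%:R : K) = (\sum_t coroot G a t * Defs.root G a t)%:~R.
      by rewrite -gcm_pair (gcm_diag (kmd_gcm G)).
    by rewrite rmorph_sum -sumrN; apply: eq_bigr => t _; rewrite rmorphM mulrN.
  by rewrite /bracket => /eqP; rewrite subr_eq => /eqP ->; rewrite addrC scaleNr.
have hf t : h *m f ^+ t = f ^+ t *m h - (2 * t%:R) *: f ^+ t.
  elim: t => [|t IH]; first by rewrite expr0 mul1mx mulmx1 mulr0 scale0r subr0.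
  rewrite exprSr mulE mulmxA IH mulmxBl -[f ^+ t *m h *m f]mulmxA hff mulmxBr mulmxA -scalemxAl -scalemxAr.
  by rewrite -addrA -opprD -scalerDl; congr (_ - _ *: _); rewrite -natr1; ring.
have ef t : emat V a *m f ^+ t.+1 = f ^+ t.+1 *m emat V a + t.+1%:R *: (f ^+ t *m h) - (t.+1%:R * t%:R) *: f ^+ t.
  have e1 : emat V a *m f = f *m emat V a + h.
    by have := pmod_ef V a; rewrite eqxx /bracket -/(hC a V) => /eqP; rewrite subr_eq addrC => /eqP.
  elim: t => [|t IH]; first by rewrite expr1 expr0 e1 mulr0 scale0r subr0 scale1r mul1mx.
  rewrite exprSr mulE mulmxA IH mulmxBl mulmxDl -!scalemxAl -!mulmxA e1 hff fl mulmxDr mulmxBr.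
  rewrite !mulmxA !fl -scalemxAr fl.
  move: (f ^+ t.+2 *m emat V a) (f ^+ t.+1 *m h) (f ^+ t.+1) => A B C; rewrite -!natr1; mxring.
have DU : Dx U = U *m PM f.
  rewrite /U mulmx_suml (big_morph (@Dx K q q) (@DxD K q q) (@Dx0 K q q)).
  case: (s) fs => [|s'] fs; first by rewrite !big_ord0.
  rewrite big_ord_recl [RHS]big_ord_recr /= -scalemxAl -map_mxM fl fs map_mx0 scaler0 addr0.
  rewrite DxZ DxC cD0 scale0r scaler0 !add0r; apply: eq_bigr => t _.
  by rewrite DxZ DxC scaler0 addr0 cD -scalemxAl -map_mxM fl.
have U0 : ev0 U = 1%:M.
  rewrite /U (big_morph (@ev0 q q) (@ev0D q q) (_ : ev0 0 = 0)); last first.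
    by apply/matrixP => i j; rewrite !mxE coef0.
  case: (s) fs => [|s'] fs.
    by rewrite big_ord0; rewrite expr0 in fs.
  rewrite big_ord_recl big1 => [|t _].
    by rewrite addr0 ev0Z ev0_PM /c fact0 invr1 expr0 scale1r coef1 expr0 scale1r.
  by rewrite ev0Z ev0_PM /c coefZ coefXn mulr0 scale0r.
have U1 : U = \sum_(t < s.+1) c t *: PM (f ^+ t).
  by rewrite big_ord_recr /= fs map_mx0 scaler0 addr0.
have fU : 'X *: (U *m PM f) = \sum_(t < s) (t%:R%:P * c t) *: PM (f ^+ t).
  transitivity (\sum_(t < s.+1) (t%:R%:P * c t) *: PM (f ^+ t)); last first.
    by rewrite big_ord_recr /= fs map_mx0 scaler0 addr0.
  rewrite big_ord_recl polyC0 mul0r scale0r add0r /U mulmx_suml scaler_sumr; apply: eq_bigr => t _.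
  by rewrite -scalemxAl -map_mxM fl scalerA cX mul_polyC.
have hmf l' t : hmat K (wt V) l' *m f ^+ t = f ^+ t *m hmat K (wt V) l' - ((Defs.root G a l')%:~R * t%:R) *: f ^+ t.
  have hm1 : hmat K (wt V) l' *m f = f *m hmat K (wt V) l' - (Defs.root G a l')%:~R *: f.
    have := pmod_hf V l'; rewrite /bracket => /eqP; rewrite subr_eq => /eqP ->.
    by rewrite addrC scaleNr.
  elim: t => [|t IH]; first by rewrite expr0 mul1mx mulmx1 mulr0 scale0r subr0.
  rewrite exprSr mulE mulmxA IH mulmxBl -[f ^+ t *m _ *m f]mulmxA hm1 mulmxBr mulmxA -scalemxAl -scalemxAr.
  by rewrite -addrA -opprD -scalerDl; congr (_ - _ *: _); rewrite -natr1; ring.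
exists U; split=> //; split=> //.
- move=> i ia; rewrite /U mulmx_sumr mulmx_suml; apply: eq_bigr => t _.
  rewrite -scalemxAr -scalemxAl -!map_mxM; congr (_ *: PM _).
  rewrite (@nilmx_intertw _ _ _ f f (emat V i)) //.
  by have := pmod_ef V i; rewrite (negPf ia) => /eqP; rewrite subr_eq0 => /eqP.
- rewrite /Ek mul0r scale0r addr0 DU -/h.
  have -> : PM (emat V a) *m U = U *m PM (emat V a) +
      \sum_(t < s) ('X * c t) *: (PM (f ^+ t) *m PM h - t%:R%:P *: PM (f ^+ t)).
    rewrite U1 mulmx_sumr mulmx_suml !big_ord_recl !expr0 -!scalemxAr -!scalemxAl map_mx1 mulmx1 mul1mx.
    rewrite -addrA; congr (_ + _); rewrite -big_split; apply: eq_bigr => t _ /=.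
    rewrite -scalemxAr -scalemxAl -!map_mxM ef cX !(map_mxB, map_mxD) !PMZ polyCM.
    rewrite -mul_polyC; move: (PM _) (PM _) (PM _) (c _) => A B C D; mxring.
  have -> : PM h *m U = \sum_(t < s) c t *: (PM (f ^+ t) *m PM h - (2 * t%:R)%:P *: PM (f ^+ t)).
    by rewrite /U mulmx_sumr; apply: eq_bigr => t _; rewrite -scalemxAr -!map_mxM hf map_mxB PMZ.
  rewrite expr2 -scalerA fU !scaler_sumr -[RHS]addr0 -!addrA; congr (_ + _).
  rewrite -sumrN -sumrN -!big_split big1 //= => t _.
  rewrite polyCM; move: (PM (f ^+ t) *m PM h) (PM (f ^+ t)) (c t) => A B C; mxring.
- move=> l'; rewrite /Hk scale0r subr0 DU fU /U mulmx_sumr mulmx_suml scaler_sumr -big_split.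
  apply: eq_bigr => t _ /=; rewrite -scalemxAr -scalemxAl -!map_mxM hmf map_mxB PMZ polyCM.
  by move: (PM (f ^+ t *m hmat K (wt V) l')) (PM (f ^+ t)) (c t) => A B C; mxring.
Qed.

End BmodUtils.
End CoinducedModule.

(** * The stabiliser of the base point of P_a / B *)

Lemma invmx_tens (K : fieldType) d e (A : 'M[K]_d) (B : 'M[K]_e) : A \in unitmx -> B \in unitmx ->
  A *t B \in unitmx /\ invmx (A *t B) = invmx A *t invmx B.
Proof.
move=> uA uB; have h : (A *t B) *m (invmx A *t invmx B) = 1%:M.
  by rewrite tensmx_mul !mulmxV // tensmx11.
have [uAB _] := mulmx1_unit h; split=> //.
by rewrite -[LHS]mulmx1 -h mulmxA mulVmx // mul1mx.
Qed.

Section TensorAut.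
Variables (K : numFieldType) (M : nat -> Type).
Variables (hom : forall d e, M d -> M e -> 'M[K]_(e, d) -> Prop).
Variables (tens : forall d e, M d -> M e -> M (d * e)%N -> Prop) (one : M 1 -> Prop).
Implicit Types g : forall d, M d -> 'M[K]_d.
Local Notation taut := (tensor_aut hom tens one).

Lemma taut1 : taut (fun d _ => 1%:M).
Proof. by split=> *; rewrite ?unitmx1 ?mul1mx ?mulmx1 ?tensmx11. Qed.

Lemma tautM g g' : taut g -> taut g' -> taut (fun d r => g d r *m g' d r).
Proof.
move=> [u n t o] [u' n' t' o']; split.
- by move=> d r; rewrite unitmx_mul u u'.
- by move=> d e r s F h; rewrite mulmxA (n _ _ _ _ _ h) -!mulmxA (n' _ _ _ _ _ h).
- by move=> d e r s w h; rewrite (t _ _ _ _ _ h) (t' _ _ _ _ _ h) tensmx_mul.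
- by move=> w h; rewrite o // o' // mul1mx.
Qed.

Lemma tautV g : taut g -> taut (fun d r => invmx (g d r)).
Proof.
move=> [u n t o]; split.
- by move=> d r; rewrite unitmx_inv.
- move=> d e r s F h.
  by rewrite -[LHS]mul1mx -(mulVmx (u _ s)) -!mulmxA [g e s *m _]mulmxA -(n _ _ _ _ _ h)
    -[F *m _ *m _]mulmxA mulmxV // mulmx1.
- by move=> d e r s w h; rewrite (t _ _ _ _ _ h); have [] := invmx_tens (u _ r) (u _ s).
- by move=> w h; rewrite o // invmx1.
Qed.

End TensorAut.

(** * Elements of P_a and their action in degree 2 *)

Section Groups.
Variables (K : numFieldType) (n m : nat) (G : km_datum n m).
Local Notation btaut := (tensor_aut (@bmod_hom K n m G) (@bmod_tens K n m G) (@bmod_unit K n m G)).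
Local Notation ptaut a := (tensor_aut (@pmod_hom K n m G a) (@pmod_tens K n m G a) (@pmod_unit K n m G a)).

Lemma taut_restrict a (g : bfam K G) : btaut g -> ptaut a (fun d r => g d r).
Proof.
move=> [u nt t o]; split.
- by move=> d r; exact: u.
- by move=> d e r s F [h _]; exact: nt.
- by move=> d e r s w [h _]; exact: t.
- by move=> w [h _]; exact: o.
Qed.

Definition bmul (b b' : borel K G) : borel K G := exist _ _ (tautM (svalP b) (svalP b')).
Definition binv (b : borel K G) : borel K G := exist _ _ (tautV (svalP b)).
Definition bone : borel K G := exist _ _ (taut1 (@bmod_hom K n m G) (@bmod_tens K n m G) (@bmod_unit K n m G)).

Section Parabolic.
Variable a : 'I_n.
Local Notation al := (row a (Defs.root G)).
Local Notation par := (parab K G a).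

Definition pmulp (p q : par) : par := exist _ _ (tautM (svalP p) (svalP q)).
Definition pinvp (p : par) : par := exist _ _ (tautV (svalP p)).
Definition brestr (b : borel K G) : par := exist _ _ (taut_restrict a (svalP b)).

Lemma nil_e d (r : bmod K G d) : nilmx (emat r a).
Proof. by have [l al0] := root_neq0 G a; exact: nilmx_weight al0 (bmod_he r l a). Qed.

Lemma nil_f d (r : pmod K G a d) : nilmx (fmat r).
Proof.
have [l al0] := root_neq0 G a.
apply: (@nilmx_weight _ m d (wt r) (fmat r) l (- Defs.root G a l)).
  by rewrite oppr_eq0.
by rewrite pmod_hf rmorphN.
Qed.

Lemma exp_taut (X : forall d, pmod K G a d -> 'M[K]_d) : (forall d r, nilmx (X d r)) ->
  (forall d e (r : pmod K G a d) (s : pmod K G a e) F, pmod_hom r s F -> F *m X d r = X e s *m F) ->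
  (forall d e (r : pmod K G a d) (s : pmod K G a e) t, pmod_tens r s t ->
     X _ t = tens_action (X _ r) (X _ s)) ->
  (forall t, pmod_unit t -> X 1%N t = 0) -> ptaut a (fun d r => nexp (X d r)).
Proof.
move=> nX hX tX oX; split.
- move=> d r; have := nexpN (nX d r); rewrite mulE.
  by case/mulmx1_unit.
- by move=> d e r s F h; apply: nexp_intertw; [exact: nX|exact: nX|exact: hX].
- by move=> d e r s t h; rewrite (tX _ _ _ _ _ h) nexp_tens.
- by move=> t h; rewrite oX // nexp0.
Qed.

Lemma fexp_taut x : ptaut a (fun d r => nexp (x *: fmat r)).
Proof.
apply: exp_taut => [d r|d e r s F [_ h]|d e r s t [_ ->]|t [_ ->]]; last by rewrite scaler0.
- exact/nilmxZ/nil_f.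
- by rewrite -scalemxAr -scalemxAl h.
- by rewrite tens_actionZ.
Qed.

Lemma eexp_taut x : ptaut a (fun d r => nexp (x *: emat r a)).
Proof.
apply: exp_taut => [d r|d e r s F [[_ h] _]|d e r s t [[_ h] _]|t [[_ h] _]].
- exact/nilmxZ/nil_e.
- by rewrite -scalemxAr -scalemxAl h.
- by rewrite h tens_actionZ.
- by rewrite h scaler0.
Qed.

Definition fexp x : par := exist _ _ (fexp_taut x).
Definition eexp x : par := exist _ _ (eexp_taut x).

(* The representatives of the two affine charts of P_a / B. *)
Definition sig (e : bool) x : par := if e then fexp x else pmulp (eexp (x - 1)) (fexp 1).

Lemma par_unit (p : par) d (r : pmod K G a d) : sval p d r \in unitmx.
Proof. by case: p => g h /=; exact: ta_unit h _ _. Qed.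

Lemma par_nat (p : par) d e (r : pmod K G a d) (s : pmod K G a e) F : pmod_hom r s F ->
  F *m sval p d r = sval p e s *m F.
Proof. by case: p => g h /=; exact: ta_nat h _ _ _ _ _. Qed.

Lemma par_tens (p : par) d e (r : pmod K G a d) (s : pmod K G a e) t : pmod_tens r s t ->
  sval p _ t = sval p d r *t sval p e s.
Proof. by case: p => g h /=; exact: ta_tens h _ _ _ _ _. Qed.

Lemma par_one (p : par) t : pmod_unit t -> sval p 1%N t = 1%:M.
Proof. by case: p => g h /=; exact: ta_one h _. Qed.

Lemma bor_unit (b : borel K G) d (r : bmod K G d) : sval b d r \in unitmx.
Proof. by case: b => g h /=; exact: ta_unit h _ _. Qed.

Lemma bor_nat (b : borel K G) d e (r : bmod K G d) (s : bmod K G e) F : bmod_hom r s F ->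
  F *m sval b d r = sval b e s *m F.
Proof. by case: b => g h /=; exact: ta_nat h _ _ _ _ _. Qed.

Lemma bor_tens (b : borel K G) d e (r : bmod K G d) (s : bmod K G e) t : bmod_tens r s t ->
  sval b _ t = sval b d r *t sval b e s.
Proof. by case: b => g h /=; exact: ta_tens h _ _ _ _ _. Qed.

Lemma bor_one (b : borel K G) t : bmod_unit t -> sval b 1%N t = 1%:M.
Proof. by case: b => g h /=; exact: ta_one h _. Qed.

Lemma bracket0l d (y : 'M[K]_d) : bracket 0 y = 0.
Proof. by rewrite /bracket mul0mx mulmx0 subrr. Qed.

Lemma bracket0r d (y : 'M[K]_d) : bracket y 0 = 0.
Proof. by rewrite /bracket mul0mx mulmx0 subrr. Qed.

(** Every Serre relation contains at least one bracket and two distinct generators, one of which is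
    zero. *)
Lemma serre_single d (em : 'I_n -> 'M[K]_d) (j0 : 'I_n) :
  (forall i, i != j0 -> em i = 0) ->
  forall i j, i != j -> iter `|1 - gcm G i j|%N (bracket (em i)) (em j) = 0.
Proof.
move=> h i j ij; have [jj|jj] := eqVneq j j0; last first.
  by rewrite (h _ jj); elim: `|_|%N => //= s ->; rewrite bracket0r.
have -> : em i = 0 by apply: h; rewrite -jj.
have : gcm G i j <= 0 by exact: (gcm_off (kmd_gcm G)).
by case e0 : `|1 - gcm G i j|%N => [|s] hle /=; [lia|rewrite bracket0l].
Qed.

(* The sections 1, x, x^2 of the twist by 2 of the trivial bundle. *)
Definition wt2 (i : 'I_3) : 'rV[int]_m :=
  match (i : nat) with 0%N => - al | 1%N => 0 | _ => al end.
Definition e2 : 'M[K]_3 := \matrix_(i, j)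
  match (i : nat), (j : nat) with 1%N, 0%N => 2 | 2%N, 1%N => 1 | _, _ => 0 end.
Definition f2 : 'M[K]_3 := \matrix_(i, j)
  match (i : nat), (j : nat) with 0%N, 1%N => 1 | 1%N, 2%N => 2 | _, _ => 0 end.

Lemma sum3 (V : nmodType) (F : 'I_3 -> V) : \sum_i F i = F ord0 + F (lift ord0 ord0) + F ord_max.
Proof.
rewrite !big_ord_recl big_ord0 addr0 addrA; congr (_ + F _); exact: val_inj.
Qed.

Let bump00 : bump 0 0 = 1%N. Proof. by []. Qed.

Lemma ord3P (P : 'I_3 -> Prop) : P ord0 -> P (lift ord0 ord0) -> P ord_max -> forall i, P i.
Proof.
move=> h0 h1 h2 [[|[|[|//]]] hi].
- by have -> : Ordinal hi = ord0 by exact: val_inj.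
- by have -> : Ordinal hi = lift ord0 ord0 by exact: val_inj.
- by have -> : Ordinal hi = ord_max by exact: val_inj.
Qed.

Ltac case33 i j := elim/ord3P: i; elim/ord3P: j; rewrite ?eqE /= ?mxE ?mulr0n ?mulr1n
  ?rmorphN ?rmorph0 /=; ring.

Lemma he2 k i : bracket (hmat K wt2 k) (if i == a then e2 else 0) =
  (Defs.root G i k)%:~R *: (if i == a then e2 else 0).
Proof.
case: eqP => [->|_]; last by rewrite bracket0r scaler0.
apply/matrixP => i1 j1; rewrite /bracket mul_diag_mx mul_mx_diag !mxE /wt2.
by case33 i1 j1.
Qed.

Lemma hf2 k : bracket (hmat K wt2 k) f2 = - (Defs.root G a k)%:~R *: f2.
Proof.
apply/matrixP => i1 j1; rewrite /bracket mul_diag_mx mul_mx_diag !mxE /wt2.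
by case33 i1 j1.
Qed.

Lemma ef2 i : bracket (if i == a then e2 else 0) f2 =
  if i == a then \sum_k (coroot G a k)%:~R *: hmat K wt2 k else 0.
Proof.
case: eqP => _; last exact: bracket0l.
have -> : \sum_k (coroot G a k)%:~R *: hmat K wt2 k =
    diag_mx (\row_j (2 * ((j : nat)%:R - 1))) :> 'M[K]_3.
  apply/matrixP => i1 j1; rewrite summxE [RHS]mxE.
  have e2E : (2 : K) = (\sum_l coroot G a l * Defs.root G a l)%:~R.
    by rewrite -gcm_pair (gcm_diag (kmd_gcm G)).
  case: eqP => [->|/eqP/negPf h]; last first.
    by rewrite big1 // => l _; rewrite !mxE h mulr0n mulr0.
  rewrite mxE mulr1n [2 in RHS]e2E rmorph_sum mulr_suml; apply: eq_bigr => l _.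
  rewrite !mxE eqxx mulr1n !rmorphM /= -mulrA; congr (_ * _).
  by elim/ord3P: j1; rewrite /wt2 /= !mxE ?rmorphN ?rmorph0 /= ?bump00; ring.
apply/matrixP => i1 j1; rewrite /bracket !mxE !sum3 !mxE.
by case33 i1 j1.
Qed.

Definition L2b : bmod K G 3 := BMod he2 (serre_single (j0 := a) (fun i (h : i != a) =>
  ifN _ _ h : (if i == a then e2 else 0) = 0)).
Definition L2 : pmod K G a 3 := @PMod K n m G a 3 L2b f2 hf2 ef2.

Lemma unit_he k i : bracket (hmat K (fun _ : 'I_1 => 0) k) 0 = (Defs.root G i k)%:~R *: (0 : 'M[K]_1).
Proof. by rewrite bracket0r scaler0. Qed.

Lemma unit_serre (i j : 'I_n) : i != j -> iter `|1 - gcm G i j|%N (bracket (0 : 'M[K]_1)) 0 = 0.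
Proof. by move=> _; elim: `|_|%N => //= s ->; rewrite bracket0r. Qed.

Definition U1 : bmod K G 1 := @BMod K n m G 1 (fun=> 0) (fun=> 0) unit_he unit_serre.

Lemma hmat0 k : hmat K (fun _ : 'I_1 => 0 : 'rV[int]_m) k = 0.
Proof. by apply/matrixP => i j; rewrite !mxE mul0rn. Qed.

Lemma U1_unit : bmod_unit U1. Proof. by split=> // k; exact: hmat0. Qed.

Lemma unit_hf k : bracket (hmat K (wt U1) k) 0 = - (Defs.root G a k)%:~R *: (0 : 'M[K]_1).
Proof. by rewrite bracket0r scaler0. Qed.

Lemma unit_ef i : bracket (emat U1 i) 0 =
  if i == a then \sum_k (coroot G a k)%:~R *: hmat K (wt U1) k else 0.
Proof.
rewrite bracket0r; case: eqP => // _; rewrite big1 // => k _.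
by rewrite [hmat _ _ _]hmat0 scaler0.
Qed.

Definition U1p : pmod K G a 1 := @PMod K n m G a 1 U1 0 unit_hf unit_ef.

Lemma U1p_unit : pmod_unit U1p. Proof. by split=> //; exact: U1_unit. Qed.

Definition T2 : 'M[{poly K}]_(1, 3) := \matrix_(i, j) 'X^j.

Lemma T2_pair : coind_pair U1 1 L2 T2.
Proof.
split.
- apply/matrixP => i; elim/ord3P; rewrite !mxE sum3 !mxE /= derivXn /=;
    rewrite ?mulr0n ?mulr1n ?polyC0 ?expr0 ?expr1 ?(mulr0, mul0r, addr0, add0r, mulr1, mul1r) //.
  by rewrite polyC_natr mulr_natr.
- move=> i ia; rewrite map_mx0 mul0mx /= (negPf ia) map_mx0 mulmx0.
  by [].
- have hC0 : hC a U1 = 0 by rewrite /hC big1 // => l _; rewrite [hmat _ _ _]hmat0 scaler0.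
  rewrite /Ek hC0 !map_mx0 !mul0mx scaler0 subr0 add0r /= eqxx; have -> : 1.*2 = 2%N by [].
  apply/matrixP => i j; rewrite !mxE sum3 !mxE; elim/ord3P: j; rewrite /= derivXn /= ?polyC_natr ?polyC0 ?mulr0n ?mulr1n.
  ring. ring. ring.
- move=> l; rewrite /Hk [hmat _ _ _]hmat0 map_mx0 mul0mx add0r /=.
  apply/matrixP => i j; rewrite !mxE sum3 !mxE /wt2; elim/ord3P: j;
    rewrite ?eqE /= ?mxE ?mulr0n ?mulr1n ?polyC0 derivXn /= ?rmorphN /= ?rmorph0 ?polyCN ?polyC1 ?polyC0 ?mxE ?bump00; ring.
Qed.

(** The invariant symmetric form of [L2]; its null cone is the conic y^2 = 4 x z. *)
Definition bform : 'M[K]_3 := \matrix_(i, j)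
  match (i : nat), (j : nat) with 0%N, 2%N => 2 | 1%N, 1%N => -1 | 2%N, 0%N => 2 | _, _ => 0 end.

(** The form is a morphism of P_a-modules from the tensor square of [L2] to the trivial module, so p
    commutes with it. *)
Lemma form_inv (p : par) : (sval p 3 L2)^T *m bform *m sval p 3 L2 = bform.
Proof.
have [t ht] := pmod_tens_exists L2 L2.
pose F : 'M[K]_(1, 3 * 3) := \matrix_(i, w) bform (mxtens_unindex w).1 (mxtens_unindex w).2.
have sumt (g : 'I_(3 * 3) -> K) : \sum_w g w = \sum_i \sum_j g (mxtens_index (i, j)).
  rewrite pair_bigA /= (reindex (@mxtens_index 3 3)); first by apply: eq_bigr => -[].
  by exists (@mxtens_unindex 3 3) => w _; [exact: mxtens_indexK|exact: mxtens_unindexK].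
have E (x y : 'M[K]_3) i j : (F *m (x *t y)) 0 (mxtens_index (i, j)) = (x^T *m bform *m y) i j.
  rewrite mxE sumt mxE exchange_big; apply: eq_bigr => l _; rewrite mxE mulr_suml.
  by apply: eq_bigr => l' _; rewrite tensmxE !mxE mxtens_indexK /= mulrA [_ * x _ _]mulrC.
have E1 (x y : 'M[K]_3) : x^T *m bform + bform *m y = 0 -> F *m tens_action x y = 0.
  move=> h; apply/matrixP => o w; rewrite (ord1 o) [RHS]mxE; case: (mxtens_indexP w) => i j.
  rewrite /tens_action mulmxDr mxE !E trmx1 mul1mx mulmx1.
  by have /matrixP/(_ i j) := h; rewrite !mxE.
have hF : pmod_hom t U1p F.
  have [[th te] tf] := ht; split; first split.
  - move=> k; rewrite [hmat K (wt U1p) k]hmat0 mul0mx th; apply: E1.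
    apply/matrixP => i j; rewrite !mxE !sum3 !mxE.
    rewrite /wt2; by case33 i j.
  - move=> i; rewrite mul0mx te; apply: E1 => /=; case: eqP => _; last by rewrite trmx0 mul0mx mulmx0 addr0.
    apply/matrixP => i1 j1; rewrite !mxE !sum3 !mxE.
    by case33 i1 j1.
  - rewrite mul0mx tf; apply: E1.
    apply/matrixP => i1 j1; rewrite !mxE !sum3 !mxE.
    by case33 i1 j1.
have := par_nat p hF; rewrite (par_one p U1p_unit) mul1mx (par_tens p ht) => h.
by apply/matrixP => i j; rewrite -E h mxE mxtens_indexK.
Qed.

(** The matrix of p preserves the highest weight line of [L2], spanned by x^2; that is, p fixes the
    base point of P_a / B. *)
Definition lower (p : par) := sval p 3 L2 ord0 ord_max = 0 /\ sval p 3 L2 (lift ord0 ord0) ord_max = 0.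
Local Notation p_ p i j := (sval p 3 L2 i j).

Lemma conic (p : par) : p_ p (lift ord0 ord0) ord_max ^+ 2 = 4 * p_ p ord0 ord_max * p_ p ord_max ord_max.
Proof.
have /matrixP/(_ ord_max ord_max) := form_inv p; rewrite !mxE !sum3 !mxE !sum3 !mxE /=.
move: (p_ p (lift ord0 ord0) _) (p_ p ord0 _) (p_ p ord_max _) => x y z h; apply/eqP; rewrite -subr_eq0; apply/eqP.
by rewrite -[RHS]oppr0 -[in RHS]h; ring.
Qed.

Lemma lowerP (p : par) : lower p ->
  [/\ p_ p ord0 ord0 * p_ p ord_max ord_max = 1, p_ p ord0 (lift ord0 ord0) = 0 & p_ p ord0 ord_max = 0].
Proof.
move=> [h0 h1]; have inv := form_inv p; have n2 : (2 : K) != 0 by rewrite pnatr_eq0.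
have e0 : p_ p ord0 ord0 * p_ p ord_max ord_max = 1.
  have /matrixP/(_ ord0 ord_max) := inv; rewrite !mxE !sum3 !mxE !sum3 !mxE /= h0 h1 => h.
  apply: (mulfI n2); rewrite mulr1 -[RHS]h; ring.
split=> //; have z0 : p_ p ord_max ord_max != 0.
  by apply: contra_eq_neq e0 => ->; rewrite mulr0 eq_sym oner_eq0.
have /matrixP/(_ (lift ord0 ord0) ord_max) := inv.
rewrite !mxE !sum3 !mxE !sum3 !mxE /= h0 h1 => h.
apply: (mulIf z0); apply: (mulfI n2); rewrite mul0r mulr0 -[RHS]h; ring.
Qed.

End Parabolic.
End Groups.

Section UnitIso.
Variable R : comNzRingType.

(* The isomorphism of V (x) R with V. *)
Definition runit d : 'M[R]_(d, d * 1) := \matrix_(i, w) (i == (mxtens_unindex w).1)%:R.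

Lemma runitE d q (X : 'M[R]_(d * 1, q)) i j : (runit d *m X) i j = X (mxtens_index (i, 0)) j.
Proof.
rewrite mxE (bigD1 (mxtens_index (i, 0))) //= mxE mxtens_indexK eqxx mul1r big1 ?addr0 // => w.
case: (mxtens_indexP w) => i' k; rewrite (ord1 k) => h; rewrite mxE mxtens_indexK /=.
by move: h; have [->|_ _] := eqVneq i i'; [rewrite eqxx|rewrite mul0r].
Qed.

Lemma mul_runit d q (Y : 'M[R]_(d, q)) i j k : (Y *m runit q) i (mxtens_index (j, k)) = Y i j.
Proof.
rewrite mxE (bigD1 j) //= mxE mxtens_indexK eqxx mulr1 big1 ?addr0 // => l /negPf lj.
by rewrite mxE mxtens_indexK lj mulr0.
Qed.

Lemma runit_tens d q (Y : 'M[R]_(d, q)) : runit d *m (Y *t (1%:M : 'M_1)) = Y *m runit q.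
Proof.
apply/matrixP => i w; case: (mxtens_indexP w) => j k; rewrite (ord1 k) runitE tensmxE mul_runit.
by rewrite mxE eqxx mulr1.
Qed.

Lemma runit_inj d q (X Y : 'M[R]_(q, d)) : X *m runit d = Y *m runit d -> X = Y.
Proof.
by move=> /matrixP h; apply/matrixP => i j; rewrite -(mul_runit X i j 0%R) h mul_runit.
Qed.

Lemma tr_runit_tens d q (Y : 'M[R]_(d, q)) : (Y *t (1%:M : 'M_1)) *m (runit q)^T = (runit d)^T *m Y.
Proof. have := congr1 trmx (runit_tens Y^T).
by rewrite !trmx_mul trmx_tens !trmxK trmx1. Qed.

Lemma tr_runit_inj d q (X Y : 'M[R]_(d, q)) : (runit d)^T *m X = (runit d)^T *m Y -> X = Y.
Proof.
move=> h; apply: trmx_inj; apply: runit_inj; apply: trmx_inj.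
by rewrite !trmx_mul !trmxK.
Qed.

End UnitIso.

(** * The element of B defined by a stabiliser of the base point *)

Section Induction.
Variables (K : numFieldType) (n m : nat) (G : km_datum n m) (a : 'I_n).
Local Notation par := (parab K G a).
Local Notation L2 := (L2 K G a).
Local Notation i1 := (lift ord0 ord0 : 'I_3).
Local Notation p_ p i j := (sval p 3 L2 i j).

Lemma tens_unit_hom d (M : bmod K G d) t : bmod_tens M (U1 K G) t -> bmod_hom t M (runit K d).
Proof.
move=> [th te]; split=> [k|i].
  by rewrite th [hmat K (wt (U1 _ _)) k]hmat0 /tens_action tensmx0 addr0 runit_tens.
by rewrite te /tens_action tensmx0 addr0 runit_tens.
Qed.

Lemma lower00 (p : par) : lower p -> p_ p ord0 ord0 != 0 /\ p_ p ord_max ord_max = (p_ p ord0 ord0)^-1.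
Proof.
move=> /lowerP[h _ _]; have z0 : p_ p ord0 ord0 != 0.
  by apply: contra_eq_neq h => ->; rewrite mul0r eq_sym oner_eq0.
by split=> //; apply: (mulfI z0); rewrite h mulfV.
Qed.

Lemma lower_row (p : par) : lower p ->
  ev0 (T2 K) *m sval p 3 L2 = p_ p ord0 ord0 *: ev0 (T2 K).
Proof.
move=> /lowerP[_ h1 h2]; apply/matrixP => i; elim/ord3P; rewrite !mxE !sum3 !mxE /= !coefXn /=;
  by rewrite ?h1 ?h2 ?mul0r ?mul1r ?addr0 ?mulr0 ?mulr1.
Qed.

(** Multiplying sections by the polynomials 1, x and x^2 of [L2] raises the twist by 2. *)
Lemma pair_lift d (M : bmod K G d) k q (r : pmod K G a q) T t : coind_pair M k r T ->
  pmod_tens r L2 t -> coind_pair M k.+1 t (PM (runit K d) *m (T *t T2 K)).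
Proof.
move=> hT ht; have [N hN] := bmod_tens_exists M (U1 K G).
apply: pair_hom (tens_unit_hom hN); have -> : k.+1 = (k + 1)%N by rewrite addn1.
exact: (pair_tens hN ht hT (@T2_pair K n m G a)).
Qed.

(* [p] acts by [C] on the values at the base point of the sections of M twisted by 2k. *)
Definition acts_at d (M : bmod K G d) (p : par) (k : nat) (C : 'M[K]_d) : Prop :=
  forall q (r : pmod K G a q) U, coind_pair M k r U -> ev0 U *m sval p q r = C *m ev0 U.

(* Multiply the sections by the section 1 of L2, an eigenvector of [p] modulo x and x^2. *)
Lemma acts_at_down d (M : bmod K G d) p k C : lower p -> acts_at M p k.+1 C ->
  acts_at M p k (p_ p ord_max ord_max *: C).
Proof.
move=> lp hC q r U hU; have [t ht] := pmod_tens_exists r L2.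
have := hC _ _ _ (pair_lift hU ht); rewrite ev0M ev0_PM ev0_tens (par_tens p ht).
set l0 := ev0 (T2 K); rewrite -mulmxA tensmx_mul lower_row // => h.
have l0E : l0 *m l0^T = 1%:M.
  apply/matrixP => i j; rewrite !mxE sum3 !mxE /= !coefXn !mulr0 !addr0 mulr1 (ord1 i) (ord1 j).
  by rewrite eqxx.
have /runit_inj {}h : p_ p ord0 ord0 *: (ev0 U *m sval p q r) *m runit K q = C *m ev0 U *m runit K q.
  have E (X : 'M[K]_(d, q)) c : runit K d *m (X *t (c *: l0)) *m ((1%:M : 'M_q) *t l0^T) = c *: X *m runit K q.
    by rewrite -mulmxA tensmx_mul mulmx1 -!scalemxAl l0E tensmxZr -scalemxAr runit_tens.
  have := congr1 (mulmx^~ ((1%:M : 'M_q) *t l0^T)) h.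
  by rewrite E -[in X in X -> _]mulmxA -[X in _ *t X]scale1r E scale1r mulmxA.
have [z0 ->] := lower00 lp.
by rewrite -scalemxAl -h scalerA mulVf // scale1r.
Qed.

Lemma acts_at_downs d (M : bmod K G d) p s k C : lower p -> acts_at M p (s + k) C ->
  acts_at M p k (p_ p ord_max ord_max ^+ s *: C).
Proof.
move=> lp; elim: s k C => [|s IH] k C; first by rewrite scale1r.
by rewrite addSnnS => /IH/(acts_at_down lp); rewrite scalerA -exprS.
Qed.

(** As p preserves the kernel of evaluation, it acts on the quotient M. Any other pair factors
    through the universal one by a morphism of P_a-modules, and p commutes with it. *)
Lemma univ_acts d (M : bmod K G d) p k q (r : pmod K G a q) T B :
  coind_pair M k r T -> universal_pair a M k T -> ev0 T *m B = 1%:M ->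
  (forall c : 'cV_q, ev0 T *m c = 0 -> ev0 T *m (sval p q r *m c) = 0) ->
  acts_at M p k (ev0 T *m sval p q r *m B).
Proof.
move=> hT uT TB pk q' r' U /(pair_factor hT uT)[Q [-> hQ]]; rewrite ev0M ev0_PM.
have kz : ev0 T *m sval p q r *m (1%:M - B *m ev0 T) = 0.
  apply/matrixP => i j; have := pk (col j (1%:M - B *m ev0 T)).
  rewrite colE !mulmxA mulmxBr mulmx1 mulmxA TB mul1mx subrr mul0mx => /(_ erefl)/matrixP/(_ i 0).
  by rewrite -!mulmxA !mulmxA -colE !mxE.
rewrite -mulmxA (par_nat p hQ) !mulmxA; congr (_ *m Q); apply/eqP.
by rewrite -subr_eq0 -[X in X - _]mulmx1 -!mulmxA -!mulmxBr !mulmxA kz.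
Qed.

(* A section of the twist by 2k + 2 that vanishes at the base point is x v + x^2 g with v and
   g sections of the twist by 2k, so it comes from r (x) L2, where [p] preserves the span of
   x and x^2. *)
Lemma lower_kernel d (M : bmod K G d) p k q (r : pmod K G a q) T q1 (r1 : pmod K G a q1) T1 : lower p ->
  (forall v : 'cV[K]_d, nilE a M k.*2 (PM v) /\ nilE a M k.*2.+1 (PM v)) ->
  coind_pair M k r T -> universal_pair a M k T -> coind_pair M k.+1 r1 T1 -> universal_pair a M k.+1 T1 ->
  forall c : 'cV_q1, ev0 T1 *m c = 0 -> ev0 T1 *m (sval p q1 r1 *m c) = 0.
Proof.
move=> lp cn hT uT hT1 uT1 c c0; have [_ h01 h02] := lowerP lp.
have nf : nilE a M k.*2.+2 (T1 *m PM c) by exact: (pair_nil hT1 c).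
have [|v [g [fE ng]]] := ker_ev0 cn nf; first by rewrite ev0M ev0_PM.
have [[x hx] [y hy]] := (uT.2 _ (cn v).1, uT.2 _ ng).
have [t ht] := pmod_tens_exists r L2.
have [Q [QE hQ]] := pair_factor hT1 uT1 (pair_lift hT ht).
pose E1 : 'cV[K]_3 := delta_mx i1 0; pose E2 : 'cV[K]_3 := delta_mx ord_max 0.
pose z : 'M[K]_(q * 3, 1 * 1) := x *t E1 + y *t E2.
have TE (w : 'M[K]_(q, 1)) j : PM (runit K d) *m (T *t T2 K) *m PM (w *t (delta_mx j 0 : 'cV_3)) =
    'X^j *: (T *m PM w *m PM (runit K 1)).
  rewrite map_mxT -mulmxA tensmx_mul map_delta_mx -colE.
  have -> : col j (T2 K) = 'X^j *: 1%:M.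
    by apply/matrixP => i' j'; rewrite !mxE (ord1 i') (ord1 j') eqxx mulr1.
  rewrite tensmxZr -scalemxAr; congr (_ *: _).
  have rE s : PM (runit K s) = runit {poly K} s by apply/matrixP => ? ?; rewrite !mxE rmorph_nat.
  by rewrite !rE -runit_tens.
have cE : c *m runit K 1 = Q *m z.
  apply: (universal_inj uT1); rewrite map_mxM [PM (Q *m _)]map_mxM !mulmxA -QE fE /z map_mxD mulmxDr !TE.
  by rewrite mulmxDl -!scalemxAl hx hy expr1.
apply: runit_inj; rewrite mul0mx -!mulmxA cE [sval p _ _ *m _]mulmxA -(par_nat p hQ) -mulmxA.
have -> : ev0 T1 *m (Q *m (sval p _ t *m z)) = ev0 T1 *m Q *m (sval p _ t *m z) by exact: mulmxA.
have -> : ev0 T1 *m Q = ev0 (T1 *m PM Q) by rewrite ev0M ev0_PM.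
rewrite -QE ev0M ev0_PM ev0_tens (par_tens p ht) -mulmxA [_ *m (_ *m z)]mulmxA tensmx_mul lower_row //.
have l0 j : j != ord0 -> ev0 (T2 K) *m (delta_mx j 0 : 'cV_3) = 0.
  move=> j0; rewrite -colE; apply/matrixP => i' j'; rewrite !mxE coefXn.
  have -> // : (0%N == j :> nat) = false.
  by apply/negbTE; apply: contraNneq j0 => j0; apply/eqP/val_inj.
by rewrite /z mulmxDr !tensmx_mul -!scalemxAl !l0 // !scaler0 !tensmx0 addr0 mulmx0.
Qed.

(** The data depend on M and not on p, so that the matrix entries of the resulting element of B are
    regular functions of p. *)
Record inducing d (M : bmod K G d) := Inducing {
  in_k : nat;
  in_q : nat;
  in_r : pmod K G a in_q;
  in_T : 'M[{poly K}]_(d, in_q);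
  in_B : 'M[K]_(in_q, d);
  in_TB : ev0 in_T *m in_B = 1%:M;
  in_pair : coind_pair M in_k in_r in_T;
  in_van : forall l, l != a -> emat M l = 0 -> emat in_r l = 0;
  in_acts : forall p k, lower p -> acts_at M p k (p_ p ord0 ord0 ^+ k *:
    (p_ p ord_max ord_max ^+ in_k *: (ev0 in_T *m sval p in_q in_r *m in_B))) }.

(** For large k constants are sections and evaluation is onto. By [acts_at_down] the actions at
    successive twists differ by a diagonal entry of p on [L2], and small twists are reached by
    descending from a large one. *)
Lemma inducing_exists d (M : bmod K G d) : exists I : inducing M, True.
Proof.
have [N0 cn] := const_nilE a M.
have cnk k (v : 'cV[K]_d) : (N0 <= k)%N -> nilE a M k.*2 (PM v) /\ nilE a M k.*2.+1 (PM v).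
  by move=> hk; split; apply: cn; lia.
have /choice[D hD] k : exists D : {q & (pmod K G a q * 'M[{poly K}]_(d, q))%type},
    [/\ coind_pair M k (projT2 D).1 (projT2 D).2, universal_pair a M k (projT2 D).2
    & forall l, l != a -> emat M l = 0 -> emat (projT2 D).1 l = 0].
  by have [q [r [T h]]] := coind_exists a M k; exists (existT _ q (r, T)).
have rinv k : (N0 < k)%N -> exists B, ev0 (projT2 (D k)).2 *m B = 1%:M.
  move=> hk; have [_ [_ uT] _] := hD k.
  have /choice[c hc] j : exists c, PM (delta_mx j 0 : 'cV_d) = (projT2 (D k)).2 *m PM c.
    by apply: uT; apply: cn; lia.
  exists (\matrix_(i, j) c j i 0); apply/matrixP => i j.
  have /(congr1 (@ev0 _ _ _))/matrixP/(_ i 0) := hc j; rewrite ev0M !ev0_PM mxE eqxx andbT => E.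
  by rewrite [RHS]mxE E !mxE; apply: eq_bigr => l _; rewrite !mxE.
have hB0 k : exists B, (N0 < k)%N -> ev0 (projT2 (D k)).2 *m B = 1%:M.
  by case: (ltnP N0 k) => [/rinv[B]|_]; [exists B|exists 0].
pose B k := sval (cid (hB0 k)); have hB k := svalP (cid (hB0 k)) : (N0 < k)%N -> ev0 (projT2 (D k)).2 *m B k = 1%:M.
pose C (p : par) k := ev0 (projT2 (D k)).2 *m sval p _ (projT2 (D k)).1 *m B k.
have act p k : lower p -> (N0 < k)%N -> acts_at M p k (C p k).
  case: k => // k lp hk; have [hT uT _] := hD k; have [hT1 uT1 _] := hD k.+1.
  apply: (univ_acts hT1 uT1 (hB _ hk)); apply: (lower_kernel lp _ hT uT hT1 uT1) => v.
  exact: cnk.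
have CS p k : lower p -> (N0 < k)%N -> C p k = p_ p ord_max ord_max *: C p k.+1.
  move=> lp hk; have [hT _ _] := hD k.
  have h1 := act _ _ lp hk _ _ _ hT.
  have h2 := acts_at_down lp (act _ _ lp (leqW hk)) hT.
  by rewrite -[LHS]mulmx1 -(hB k hk) mulmxA -h1 h2 -[LHS]mulmxA hB // mulmx1.
have [hT uT hv] := hD N0.+1.
unshelve eexists; last by [].
refine (@Inducing d M N0.+1 _ _ _ (B N0.+1) (hB _ (ltnSn _)) hT hv _).
move=> p k lp; have [z0 z2] := lower00 lp.
have CE s : C p N0.+1 = p_ p ord_max ord_max ^+ s *: C p (s + N0.+1)%N.
  elim: s => [|s IH]; first by rewrite scale1r.
  by rewrite IH CS ?scalerA -?exprSr //; lia.
have := @acts_at_downs d M p N0.+1 k (C p (N0.+1 + k)%N) lp (act _ _ lp _).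
rewrite -/(C p N0.+1) (CE k) addnC scalerA scalerA z2 -[_ * _ * _]mulrA [_ ^+ N0.+1 * _]mulrC mulrA.
rewrite -exprMn mulfV // expr1n mul1r; apply; lia.
Qed.

Definition ind d (M : bmod K G d) : inducing M := sval (cid (inducing_exists M)).

(* The action on M of an element of P_a fixing the base point of P_a / B. *)
Definition comat (p : par) d (M : bmod K G d) : 'M[K]_d :=
  p_ p ord_max ord_max ^+ in_k (ind M) *: (ev0 (in_T (ind M)) *m sval p _ (in_r (ind M)) *m in_B (ind M)).

Lemma comatP (p : par) d (M : bmod K G d) k q (r : pmod K G a q) U : lower p -> coind_pair M k r U ->
  ev0 U *m sval p q r = p_ p ord0 ord0 ^+ k *: (comat p M *m ev0 U).
Proof. by move=> lp hU; rewrite (in_acts (ind M) lp hU) -scalemxAl. Qed.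

(** One pair with surjective evaluation determines the matrix; the properties of [comat] below
    follow by exhibiting a suitable pair. *)
Lemma comat_uniq (p : par) d (M : bmod K G d) k q (r : pmod K G a q) U B C : lower p ->
  coind_pair M k r U -> ev0 U *m B = 1%:M ->
  ev0 U *m sval p q r = p_ p ord0 ord0 ^+ k *: (C *m ev0 U) -> C = comat p M.
Proof.
move=> lp hU UB h; have [z0 _] := lower00 lp; have := comatP lp hU; rewrite h.
move/(scalerI (expf_neq0 k z0))/(congr1 (mulmx^~ B)).
by rewrite -!mulmxA UB !mulmx1.
Qed.

Lemma comat_pmod (p : par) q (V : pmod K G a q) : lower p -> comat p V = sval p q V.
Proof.
move=> lp; have [U [hU U1]] := pair_self V.
by apply/esym/(comat_uniq (B := 1%:M) lp hU); rewrite U1 ?mulmx1 // mul1mx scale1r.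
Qed.

Lemma pvK (p : par) d (r : pmod K G a d) : sval p d r *m sval (pinvp p) d r = 1%:M.
Proof. by rewrite /= mulmxV // par_unit. Qed.

Lemma lower_inv (p : par) : lower p -> lower (pinvp p).
Proof.
move=> lp; have [h0 h1] := lp; have [z0 z2] := lower00 lp.
have zz : p_ p ord_max ord_max != 0 by rewrite z2 invr_eq0.
have vK : sval (pinvp p) _ L2 *m sval p _ L2 = 1%:M by rewrite /= mulVmx // par_unit.
split.
- have /matrixP/(_ ord0 ord_max) := vK; rewrite !mxE sum3 h0 h1 !mulr0 !add0r /= => /eqP.
  by rewrite mulf_eq0 (negPf zz) orbF => /eqP.
- have /matrixP/(_ i1 ord_max) := vK; rewrite !mxE sum3 h0 h1 !mulr0 !add0r /= => /eqP.
  by rewrite mulf_eq0 (negPf zz) orbF => /eqP.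
Qed.

Lemma lowerM (p p' : par) : lower p -> lower p' -> lower (pmulp p p').
Proof.
move=> lp [h0 h1]; have [g0 g1] := lp.
by split; rewrite /= mxE sum3 ?h0 ?h1 ?g0 ?g1 !(mulr0, mul0r) !addr0.
Qed.

Lemma lowerM00 (p p' : par) : lower p -> lower p' ->
  p_ (pmulp p p') ord0 ord0 = p_ p ord0 ord0 * p_ p' ord0 ord0.
Proof. by move=> /lowerP[_ h1 h2] _; rewrite /= mxE sum3 h1 h2 !mul0r !addr0. Qed.

Lemma comatM (p p' : par) d (M : bmod K G d) : lower p -> lower p' ->
  comat (pmulp p p') M = comat p M *m comat p' M.
Proof.
move=> lp lp'; pose I := ind M; apply/esym/(comat_uniq (lowerM lp lp') (in_pair I) (in_TB I)).
rewrite lowerM00 // /= mulmxA (comatP lp (in_pair I)) -scalemxAl -mulmxA.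
by rewrite (comatP lp' (in_pair I)) -scalemxAr scalerA mulmxA exprMn.
Qed.

Lemma comat1 (p : par) d (M : bmod K G d) : lower p -> (forall q (r : pmod K G a q), sval p q r = 1%:M) ->
  comat p M = 1%:M.
Proof.
move=> lp p1; pose I := ind M; apply/esym/(comat_uniq lp (in_pair I) (in_TB I)).
by rewrite !p1 mulmx1 mul1mx mxE eqxx expr1n scale1r.
Qed.

Lemma comat_taut (p : par) : lower p ->
  tensor_aut (@bmod_hom K n m G) (@bmod_tens K n m G) (@bmod_unit K n m G) (fun d M => comat p M).
Proof.
move=> lp; have [z0 _] := lower00 lp.
have nat d e (M : bmod K G d) (N : bmod K G e) F : bmod_hom M N F -> F *m comat p M = comat p N *m F.
  move=> hF; have IP := in_pair (ind M); have := comatP lp (pair_hom IP hF).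
  rewrite ev0M ev0_PM -mulmxA (comatP lp IP) -scalemxAr => /(scalerI (expf_neq0 _ z0)).
  by move/(congr1 (mulmx^~ (in_B (ind M)))); rewrite -!mulmxA in_TB !mulmx1.
split=> //.
- move=> d M; have h : comat p M *m comat (pinvp p) M = 1%:M.
    rewrite -comatM //; last exact: lower_inv.
    apply: comat1 => [|q r]; first exact/lowerM/lower_inv.
    by rewrite [sval _ _ _]pvK.
  by have [] := mulmx1_unit h.
- move=> d e M N t ht; have [s hs] := pmod_tens_exists (in_r (ind M)) (in_r (ind N)).
  have PM' := in_pair (ind M); have PN := in_pair (ind N).
  apply/esym/(@comat_uniq p _ _ _ _ _ _ (in_B (ind M) *t in_B (ind N)) _ lp (pair_tens ht hs PM' PN)).
    by rewrite ev0_tens tensmx_mul !in_TB tensmx11.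
  rewrite ev0_tens (par_tens p hs) tensmx_mul (comatP lp PM') (comatP lp PN).
  by rewrite tensmxZl tensmxZr scalerA tensmx_mul exprD.
- move=> t [th te]; have hom : bmod_hom (U1 K G) t 1%:M.
    by split=> *; rewrite ?th ?te mul0mx ?[hmat _ _ _]hmat0 mulmx0.
  have := nat _ _ _ _ _ hom; rewrite mul1mx mulmx1 => <-.
  by rewrite -[U1 K G]/(pmod_b (U1p K G a)) comat_pmod // (par_one p (U1p_unit _ _ _)).
Qed.

Definition descend (p : par) (lp : lower p) : borel K G := exist _ _ (comat_taut lp).

Lemma descendE p (lp : lower p) q (V : pmod K G a q) : sval (descend lp) q V = sval p q V.
Proof. exact: comat_pmod. Qed.

End Induction.

(** * Characters of B and elements that act through the torus *)

Section Torus.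
Variables (K : numFieldType) (n m : nat) (G : km_datum n m).
Implicit Types (b t : borel K G) (mu nu : 'rV[int]_m).

Lemma triv_he d (w : 'I_d -> 'rV[int]_m) k i :
  bracket (hmat K w k) 0 = (Defs.root G i k)%:~R *: (0 : 'M[K]_d).
Proof. by rewrite bracket0r scaler0. Qed.

Lemma triv_serre d (i j : 'I_n) : i != j -> iter `|1 - gcm G i j|%N (bracket (0 : 'M[K]_d)) 0 = 0.
Proof. by move=> _; elim: `|_|%N => //= s ->; rewrite bracket0r. Qed.

Definition triv d (w : 'I_d -> 'rV[int]_m) : bmod K G d :=
  @BMod K n m G d w (fun=> 0) (triv_he w) (triv_serre d).

Definition chi b mu : K := sval b 1%N (triv (fun _ : 'I_1 => mu)) 0 0.

Lemma chiE b mu : sval b 1%N (triv (fun _ : 'I_1 => mu)) = (chi b mu)%:M.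
Proof. by apply/matrixP => i j; rewrite (ord1 i) (ord1 j) mxE eqxx. Qed.

Lemma chi_neq0 b mu : chi b mu != 0.
Proof.
have := bor_unit b (triv (fun _ : 'I_1 => mu)).
by rewrite chiE unitmxE det_scalar1 unitfE.
Qed.

Lemma triv_chi b d (w : 'I_d -> 'rV[int]_m) : sval b d (triv w) = diag_mx (\row_j chi b (w j)).
Proof.
apply/matrixP => i j.
have hF : bmod_hom (triv (fun _ : 'I_1 => w j)) (triv w) (delta_mx j 0).
  split=> [k|l] /=; last by rewrite mulmx0 mul0mx.
  apply/matrixP => i' z; rewrite (ord1 z) -!colE !mxE /= big_ord1 !mxE.
  by have [->|h] := eqVneq i' j; rewrite ?eqxx ?mul1r //= ?(negPf h) mulr0n mul0r.
have /matrixP/(_ i 0) := bor_nat b hF; rewrite chiE -colE mul_mx_scalar !mxE eqxx andbT => <-.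
by have [->|_] := eqVneq i j; rewrite ?mulr1 ?mulr0.
Qed.

Lemma chi0 b : chi b 0 = 1.
Proof.
have hu : bmod_unit (triv (fun _ : 'I_1 => 0)) by split=> // k; exact: hmat0.
by rewrite /chi bor_one // mxE eqxx.
Qed.

Lemma chiD b mu nu : chi b (mu + nu) = chi b mu * chi b nu.
Proof.
pose l x := triv (fun _ : 'I_1 => x : 'rV[int]_m).
have [s hs] := bmod_tens_exists (l mu) (l nu).
have hF : bmod_hom s (l (mu + nu)) (1%:M : 'M_1).
  have [h1 h2] := hs; split=> [k|i]; rewrite mul1mx mulmx1 ?h1 ?h2 /tens_action.
    apply/matrixP => i j; rewrite !mxE !(ord1 i, ord1 j, ord1 (mxtens_unindex _).1, ord1 (mxtens_unindex _).2).
    by rewrite !eqxx !mulr1n mulr1 mul1r rmorphD.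
  by rewrite tens0mx tensmx0 addr0.
have /matrixP/(_ 0 0) := bor_nat b hF; rewrite mul1mx mulmx1 (bor_tens b hs) !chiE !mxE.
by rewrite !(ord1 (mxtens_unindex _).1, ord1 (mxtens_unindex _).2) !eqxx !mulr1n.
Qed.

Lemma chiN b mu : chi b (- mu) = (chi b mu)^-1.
Proof.
by apply: (mulfI (chi_neq0 b mu)); rewrite -chiD subrr chi0 mulfV ?chi_neq0.
Qed.

Lemma chi_one mu : chi (bone K G) mu = 1.
Proof. by rewrite /chi /= mxE eqxx. Qed.

(* [b] acts as an element of T on the modules killed by the e_l with l in L. *)
Definition torpart (L : 'I_n -> Prop) b : Prop :=
  forall d (M : bmod K G d), (forall l, L l -> emat M l = 0) -> sval b d M = sval b d (triv (wt M)).

Lemma torpart_one L : torpart L (bone K G). Proof. by []. Qed.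

Section Parabolic.
Variable a : 'I_n.
Local Notation al := (row a (Defs.root G)).
Local Notation L2 := (L2 K G a).
Local Notation i1 := (lift ord0 ord0 : 'I_3).
Local Notation p_ p i j := (sval p 3 L2 i j).

Lemma line_hom (M : bmod K G 3) (l0 : 'M[K]_(1, 3)) :
  wt M = wt2 G a -> (forall i, l0 *m emat M i = 0) -> l0 = delta_mx 0 ord0 ->
  bmod_hom M (triv (fun _ : 'I_1 => - al)) l0.
Proof.
move=> wM eM l0E; split=> [k|i]; last by rewrite mul0mx eM.
rewrite l0E wM; apply/matrixP => i j; rewrite (ord1 i) -rowE !mxE big_ord1 !mxE eqxx mulr1n.
by elim/ord3P: j; rewrite ?eqE /= ?mulr1n ?mulr0n ?mulr1 ?mulr0 // !mxE.
Qed.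

(** The first coordinate of [L2] is a B-morphism to the line of weight minus the root, which fixes
    the first row; the conic relation then kills the middle entry of the last column. *)
Lemma bor_row0 b : p_ (brestr a b) ord0 ord0 = chi b (- al) /\
  lower (brestr a b).
Proof.
have h : bmod_hom (pmod_b L2) (triv (fun _ : 'I_1 => - al)) (delta_mx 0 ord0).
  apply: line_hom => // i; rewrite -rowE; apply/matrixP => x j; rewrite !mxE /=.
  by case: eqP => _; rewrite !mxE //; elim/ord3P: j.
have /matrixP E := bor_nat b h; have {}E j : sval b 3%N L2 ord0 j = chi b (- al) * (ord0 == j)%:R.
  by have := E 0 j; rewrite chiE mul_scalar_mx -rowE !mxE eqxx => ->; rewrite eq_sym.
have h02 : p_ (brestr a b) ord0 ord_max = 0 by rewrite /= E mulr0.
split; first by rewrite /= E mulr1.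
split=> //; have := conic (brestr a b); rewrite h02 mulr0 mul0r => /eqP.
by rewrite expf_eq0 => /eqP.
Qed.

Lemma bor_lower b : lower (brestr a b). Proof. exact: (bor_row0 b).2. Qed.

(** Evaluation at the base point is a B-morphism from the induced module to M tensored with a
    character. Hence the action of b on M is determined by its action on a P_a-module. *)
Lemma bor_comat b d (M : bmod K G d) : sval b d M = comat (brestr a b) M.
Proof.
pose I := ind a M; have hU := in_pair I; set k := in_k I in hU; set U := in_T I in hU.
have chik j : chi b (- al *+ j) = chi b (- al) ^+ j.
  by elim: j => [|j IH]; rewrite ?chi0 // mulrS chiD IH exprS.
have [s hs] := bmod_tens_exists M (triv (fun _ : 'I_1 => - al *+ k)).
have hF : bmod_hom (in_r I) s ((runit K d)^T *m ev0 U).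
  have [h1 h2] := hs; split=> [l|i]; rewrite -mulmxA ?h1 ?h2.
    rewrite -(pair_h hU) /tens_action mulmxDl !mulmxA tr_runit_tens.
    have -> : (1%:M : 'M_d) *t hmat K (fun _ : 'I_1 => - al *+ k) l =
        (- ((Defs.root G a l)%:~R * k%:R)) *: ((1%:M : 'M_d) *t (1%:M : 'M_1)).
      rewrite -tensmxZr; congr (_ *t _); apply/matrixP => i j; rewrite (ord1 i) (ord1 j) !mxE eqxx mulr1n mulr1.
      by rewrite mulmxnE !mxE !raddfMn /= rmorphN /= mulNrn mulr_natr.
    by rewrite -scalemxAl tr_runit_tens mulmx1 scaleNr mulmxBr mulmxA -scalemxAr mulNmx -scalemxAl.
  by rewrite -(pair_e hU) /tens_action tensmx0 addr0 !mulmxA tr_runit_tens.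
have := bor_nat b hF; rewrite (bor_tens b hs) chiE chik => h.
apply: (comat_uniq (bor_lower b) hU (in_TB I)); rewrite (bor_row0 b).1.
apply: tr_runit_inj; rewrite mulmxA h.
have -> : (chi b (- al) ^+ k)%:M = chi b (- al) ^+ k *: (1%:M : 'M_1) by rewrite scalemx1.
by rewrite tensmxZr -!scalemxAl mulmxA tr_runit_tens -scalemxAr mulmxA.
Qed.

Lemma clear_he d (r : pmod K G a d) k i :
  bracket (hmat K (wt r) k) (if i == a then emat r a else 0) =
  (Defs.root G i k)%:~R *: (if i == a then emat r a else 0).
Proof. by case: eqP => [->|_]; rewrite ?bmod_he // bracket0r scaler0. Qed.

Lemma clear_ef d (r : pmod K G a d) i : bracket (if i == a then emat r a else 0) (fmat r) =
  if i == a then \sum_k (coroot G a k)%:~R *: hmat K (wt r) k else 0.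
Proof. by have := pmod_ef r a; rewrite eqxx; case: eqP => // _ _; exact: bracket0l. Qed.

Lemma clear_serre d (r : pmod K G a d) i j : i != j -> iter `|1 - gcm G i j|%N
  (bracket (if i == a then emat r a else 0)) (if j == a then emat r a else 0) = 0.
Proof.
pose em l := if l == a then emat r a else 0.
move=> ij; apply: (@serre_single K n m G d em a) => // l la; exact: ifN.
Qed.

Definition clear_b d (r : pmod K G a d) : bmod K G d :=
  @BMod K n m G d _ _ (clear_he r) (@clear_serre d r).

Definition clear d (r : pmod K G a d) : pmod K G a d :=
  @PMod K n m G a d (clear_b r) (fmat r) (pmod_hf r) (clear_ef r).

Lemma sig_clear e x d (r : pmod K G a d) : sval (sig G a e x) d (clear r) = sval (sig G a e x) d r.
Proof. by case: e; rewrite /= ?eqxx. Qed.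

(* Clearing the e_l with l <> a in the module induced from M gives a module induced from the
   trivial one, and [b] acts on both by the same matrix. *)
Lemma tor_step (L : 'I_n -> Prop) t b e x e' x' : ~ L a -> torpart L t ->
  (forall d (V : pmod K G a d), sval b d V =
     sval (pinvp (sig G a e x)) d V *m sval t d V *m sval (sig G a e' x') d V) ->
  torpart (fun l => L l \/ l = a) b.
Proof.
move=> La tL hb d M hM; pose I := ind a M; have hT := in_pair I; have lb := bor_lower b.
have hT' : coind_pair (triv (wt M)) (in_k I) (clear (in_r I)) (in_T I).
  have [hD _ hE hH] := hT; split=> //.
    by move=> i /negPf ia /=; rewrite ia !map_mx0 mul0mx mulmx0.
  by rewrite /= eqxx -hE /Ek /= hM //; right.
rewrite !bor_comat; apply: (comat_uniq lb hT' (in_TB I)); rewrite -(comatP lb hT) /=.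
have tr : sval t _ (in_r I) = sval t _ (clear (in_r I)).
  have la l : L l -> l != a by move=> Ll; apply: contra_notN La => /eqP <-.
  rewrite (tL _ (clear (in_r I))); first by apply: tL => l Ll; apply: in_van (la _ Ll) _; apply: hM; left.
  by move=> l /la/negPf /= ->.
by rewrite (hb _ (in_r I)) (hb _ (clear (in_r I))) /= -tr !sig_clear.
Qed.

Definition yc (e : bool) (x : K) := if e then x else 1.
Definition zc (e : bool) (x : K) := if e then 1 else x.

Lemma nexp2 d (X : 'M[K]_d) : X *m X = 0 -> nexp X = 1%:M + X.
Proof.
move=> h; rewrite (@nexpE _ _ _ 2) ?exprS ?expr0 ?mulr1 //.
by rewrite !big_ord_recl big_ord0 /= !fact0 !invr1 !scale1r expr0 expr1 addr0.
Qed.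

Lemma nexp3 d (X : 'M[K]_d) : X *m X *m X = 0 -> nexp X = 1%:M + X + 2^-1 *: (X *m X).
Proof.
move=> h; have X3 : X ^+ 3 = 0 by rewrite exprSr expr2 !mulE.
rewrite (nexpE X3) !big_ord_recl big_ord0 /= !invr1 !scale1r expr0 expr1 expr2 addr0.
by rewrite mulE addrA.
Qed.

Let bump00 : bump 0 0 = 1%N. Proof. by []. Qed.

Ltac case33' i j := elim/ord3P: i; elim/ord3P: j; rewrite ?eqE /= ?mxE ?mulr0n ?mulr1n ?bump00.

Lemma fexp_L2 x : nexp (x *: f2 K) = 1%:M + x *: f2 K + (x ^+ 2 / 2) *: (f2 K *m f2 K).
Proof.
rewrite nexp3; first by rewrite -scalemxAr -scalemxAl !scalerA; congr (_ + _ *: _); ring.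
rewrite -!scalemxAl -!scalemxAr -!scalemxAl !scalerA; apply/eqP; rewrite scaler_eq0; apply/orP; right; apply/eqP.
apply/matrixP => i j; rewrite !mxE !sum3 !mxE !sum3 !mxE.
by case33' i j; ring.
Qed.

Lemma eexp_L2 x : nexp (x *: e2 K) = 1%:M + x *: e2 K + (x ^+ 2 / 2) *: (e2 K *m e2 K).
Proof.
rewrite nexp3; first by rewrite -scalemxAr -scalemxAl !scalerA; congr (_ + _ *: _); ring.
rewrite -!scalemxAl -!scalemxAr -!scalemxAl !scalerA; apply/eqP; rewrite scaler_eq0; apply/orP; right; apply/eqP.
apply/matrixP => i j; rewrite !mxE !sum3 !mxE !sum3 !mxE.
by case33' i j; ring.
Qed.

(** The point of the conic with homogeneous coordinates (y : z). *)
Lemma sig_col e x : [/\ p_ (sig G a e x) ord0 ord_max = yc e x ^+ 2,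
  p_ (sig G a e x) i1 ord_max = 2 * yc e x * zc e x & p_ (sig G a e x) ord_max ord_max = zc e x ^+ 2].
Proof.
have n2 : (2 : K) != 0 by rewrite pnatr_eq0.
case: e => /=; rewrite ?eqxx ?mxE ?sum3 ?fexp_L2 ?eexp_L2 !(mxE, sum3) /= ?mulr0n ?mulr1n /yc /zc ?bump00;
  by split; field.
Qed.

End Parabolic.
End Torus.

Lemma invmx_mul (K : fieldType) d (A B : 'M[K]_d) : A \in unitmx -> B \in unitmx ->
  invmx (A *m B) = invmx B *m invmx A.
Proof.
move=> uA uB; have h : A *m B *m (invmx B *m invmx A) = 1%:M.
  by rewrite mulmxA mulmxK // mulmxV.
by rewrite -[LHS]mulmx1 -h mulmxA mulVmx ?unitmx_mul ?uA // mul1mx.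
Qed.

(** * One position of the expression *)

Section Step.
Variables (K : numFieldType) (n m : nat) (G : km_datum n m) (a : 'I_n).
Implicit Types (b t : borel K G) (mu nu : 'rV[int]_m).
Local Notation al := (row a (Defs.root G)).
Local Notation par := (parab K G a).
Local Notation L2 := (L2 K G a).
Local Notation i1 := (lift ord0 ord0 : 'I_3).
Local Notation p_ p i j := (sval p 3 L2 i j).
Local Notation yc := (@yc K).
Local Notation zc := (@zc K).

Lemma col_lower (p q : par) c : (forall i, p_ q i ord_max = c * p_ p i ord_max) ->
  lower (pmulp (pinvp p) q) /\ p_ (pmulp (pinvp p) q) ord_max ord_max = c.
Proof.
move=> h; have E i : p_ (pmulp (pinvp p) q) i ord_max = c * (i == ord_max)%:R.
  have vp : sval (pinvp p) _ L2 *m sval p _ L2 = 1%:M by rewrite /= mulVmx // par_unit.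
  have /matrixP/(_ i ord_max) := vp; rewrite [RHS]mxE => <-.
  by rewrite /= !mxE mulr_sumr; apply: eq_bigr => l _; rewrite h mulrCA.
by split; [split|]; rewrite E ?mulr0 ?mulr1.
Qed.

Lemma tor_L2 (L : 'I_n -> Prop) t : ~ L a -> torpart L t ->
  sval t 3%N L2 = diag_mx (\row_j chi t (wt2 G a j)).
Proof.
move=> La tL; rewrite (tL _ L2) ?triv_chi // => l Ll /=.
by case: eqP La Ll => // <-.
Qed.

Lemma wt2E t : [/\ chi t (wt2 G a ord0) = (chi t al)^-1, chi t (wt2 G a i1) = 1
  & chi t (wt2 G a ord_max) = chi t al].
Proof. by rewrite /wt2 /= chi0 chiN. Qed.

(** On [L2] the element t is diagonal, and the equations for [lam] say that t^-1 s(x) and s(x') have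
    proportional last columns, that is, the same image in P_a / B. They differ by an element fixing
    the base point, which descends to B. *)
Lemma step_lift (L : 'I_n -> Prop) t e x e' x' lam : ~ L a -> torpart L t -> lam != 0 ->
  yc e' x' = lam * (chi t al * yc e x) -> zc e' x' = lam * zc e x ->
  exists b, forall d (V : pmod K G a d), sval b d V =
    sval (pinvp (sig G a e x)) d V *m sval t d V *m sval (sig G a e' x') d V.
Proof.
move=> La tL l0 hy hz; have c0 := chi_neq0 t al; have [w0 w1 w2] := wt2E t.
pose q := pmulp (pinvp (brestr a t)) (sig G a e x).
have [|lq _] := @col_lower q (sig G a e' x') (lam ^+ 2 * chi t al).
  have D i : p_ q i ord_max = (chi t (wt2 G a i))^-1 * p_ (sig G a e x) i ord_max.
    have tu := bor_unit t (pmod_b L2).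
    have : sval t 3%N L2 *m sval q 3%N L2 = sval (sig G a e x) 3%N L2.
      by rewrite /= mulmxA mulmxV // mul1mx.
    move/matrixP/(_ i ord_max); rewrite (tor_L2 La tL) mul_diag_mx !mxE => <-.
    by rewrite mulKf // chi_neq0.
  have [s0 s1 s2] := sig_col G a e x; have [s0' s1' s2'] := sig_col G a e' x'.
  elim/ord3P; rewrite D ?w0 ?w1 ?w2 ?s0 ?s1 ?s2 ?s0' ?s1' ?s2' ?hz ?hy ?invrK; by field.
exists (descend lq) => d V; rewrite descendE /= invmx_mul ?invmxK ?unitmx_inv ?par_unit //.
exact: bor_unit.
Qed.

(** The end entries of the last column determine [lam] only up to sign; the middle entry y z fixes
    the sign. *)
Lemma step_lam (L : 'I_n -> Prop) t b e x e' x' : ~ L a -> torpart L t ->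
  (forall d (V : pmod K G a d), sval b d V =
     sval (pinvp (sig G a e x)) d V *m sval t d V *m sval (sig G a e' x') d V) ->
  exists lam, [/\ lam != 0, yc e' x' = lam * (chi t al * yc e x) & zc e' x' = lam * zc e x].
Proof.
move=> La tL hb; have c0 := chi_neq0 t al; have [w0 w1 w2] := wt2E t.
have n2 : (2 : K) != 0 by rewrite pnatr_eq0.
have [lb0 lb1] := bor_lower a b; rewrite /= in lb0 lb1.
have b0 : p_ (brestr a b) ord_max ord_max != 0.
  by have [z0 ->] := lower00 (bor_lower a b); rewrite invr_eq0.
rewrite /= in b0; set c := (X in X != 0) in b0.
have h : sval (sig G a e x) 3%N L2 *m sval b 3%N L2 = sval t 3%N L2 *m sval (sig G a e' x') 3%N L2.
  by rewrite hb -!mulmxA mulKVmx // par_unit.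
have E i : p_ (sig G a e x) i ord_max * c = chi t (wt2 G a i) * p_ (sig G a e' x') i ord_max.
  have /matrixP/(_ i ord_max) := h; rewrite (tor_L2 La tL) mul_diag_mx !mxE sum3 lb0 lb1 !mulr0 !add0r.
  exact.
have [s0 s1 s2] := sig_col G a e x; have [s0' s1' s2'] := sig_col G a e' x'.
have := E ord0; have := E i1; have := E ord_max; rewrite w0 w1 w2 s0 s1 s2 s0' s1' s2'.
set y' := yc e' x'; set z' := zc e' x'; set g := chi t al in c0 *.
rewrite mul1r => E2 E1 E0; have {}E1 : yc e x * zc e x * c = y' * z'.
  by apply: (mulfI n2); rewrite !mulrA in E1 *.
case: e {s0 s1 s2 h hb E} E0 E1 E2; rewrite /yc /zc /= ?expr1n ?mul1r ?mulr1.
- move=> E0 E1 E2; have z0 : z' != 0.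
    by apply: contraNneq b0 => z0; rewrite E2 z0 expr0n mulr0.
  exists z'; split; rewrite ?mulr1 //; apply: (mulIf z0); rewrite -E1 E2; ring.
- move=> E0 E1 E2; have y0 : y' != 0.
    by apply: contraNneq b0 => y0; rewrite E0 y0 expr0n mulr0.
  exists (y' / g); split; first by rewrite mulf_neq0 ?invr_eq0.
    by rewrite divfK.
  by apply: (mulfI y0); rewrite -E1 E0; field.
Qed.

Section Weight.
Variable mu : 'rV[int]_m.
Local Notation pr := (\sum_k coroot G a k * mu 0 k).

Lemma line_hf k : bracket (hmat K (fun _ : 'I_1 => mu) k) 0 = - (Defs.root G a k)%:~R *: (0 : 'M[K]_1).
Proof. by rewrite bracket0r scaler0. Qed.

Lemma line_ef : pr = 0 -> forall i, bracket (emat (triv K G (fun _ : 'I_1 => mu)) i) 0 =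
  if i == a then \sum_k (coroot G a k)%:~R *: hmat K (fun _ : 'I_1 => mu) k else 0.
Proof.
move=> pr0 i; rewrite bracket0r; case: eqP => // _; apply/esym/matrixP => x y.
rewrite (ord1 x) (ord1 y) summxE [RHS]mxE -[RHS](rmorph0 (intmul 1)) -pr0 rmorph_sum.
by apply: eq_bigr => k _; rewrite !mxE eqxx mulr1n rmorphM.
Qed.

Definition linep (h : pr = 0) : pmod K G a 1 :=
  @PMod K n m G a 1 (triv K G (fun _ : 'I_1 => mu)) 0 line_hf (line_ef h).

(** A weight orthogonal to the coroot gives a one-dimensional P_a-module, on which the chart
    representatives act trivially. *)
Lemma chi_step0 t b e x e' x' : pr = 0 ->
  (forall d (V : pmod K G a d), sval b d V =
     sval (pinvp (sig G a e x)) d V *m sval t d V *m sval (sig G a e' x') d V) ->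
  chi b mu = chi t mu.
Proof.
move=> pr0 hb; have := hb _ (linep pr0).
have s1 e0 y : sval (sig G a e0 y) 1%N (linep pr0) = 1%:M.
  by case: e0; rewrite /= !scaler0 !nexp0 //; exact: mul1mx.
by rewrite /= s1 invmx1 mul1mx s1 mulmx1 /chi => ->.
Qed.

Definition wtV (i : 'I_2) : 'rV[int]_m := if (i : nat) is 0%N then mu else mu + al.
Definition eV : 'M[K]_2 := delta_mx ord_max ord0.
Definition fV : 'M[K]_2 := delta_mx ord0 ord_max.

Lemma ord2P (P : 'I_2 -> Prop) : P ord0 -> P ord_max -> forall i, P i.
Proof.
move=> h0 h1 [[|[|//]] hi].
- by have -> : Ordinal hi = ord0 by exact: val_inj.
- by have -> : Ordinal hi = ord_max by exact: val_inj.
Qed.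

Lemma sum2 (V : nmodType) (F : 'I_2 -> V) : \sum_i F i = F ord0 + F ord_max.
Proof. by rewrite !big_ord_recl big_ord0 addr0; congr (_ + F _); exact: val_inj. Qed.

Ltac case22 i j := elim/ord2P: i; elim/ord2P: j; rewrite ?eqE /= ?mxE ?eqE /= ?mulr0n ?mulr1n
  ?rmorphN ?rmorph0 ?rmorphD /=.

Lemma heV k i : bracket (hmat K wtV k) (if i == a then eV else 0) =
  (Defs.root G i k)%:~R *: (if i == a then eV else 0).
Proof.
case: eqP => [->|_]; last by rewrite bracket0r scaler0.
apply/matrixP => i1 j1; rewrite /bracket mul_diag_mx mul_mx_diag !mxE /wtV.
by case22 i1 j1; ring.
Qed.

Lemma hfV k : bracket (hmat K wtV k) fV = - (Defs.root G a k)%:~R *: fV.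
Proof.
apply/matrixP => i1 j1; rewrite /bracket mul_diag_mx mul_mx_diag !mxE /wtV.
by case22 i1 j1; ring.
Qed.

Lemma efV : pr = -1 -> forall i, bracket (if i == a then eV else 0) fV =
  if i == a then \sum_k (coroot G a k)%:~R *: hmat K wtV k else 0.
Proof.
move=> pr1 i; case: eqP => _; last exact: bracket0l.
have -> : \sum_k (coroot G a k)%:~R *: hmat K wtV k =
    diag_mx (\row_j (2 * (j : nat)%:R - 1)) :> 'M[K]_2.
  apply/matrixP => i1 j1; rewrite summxE [RHS]mxE.
  have e2E : (2 : K) = (\sum_l coroot G a l * Defs.root G a l)%:~R.
    by rewrite -gcm_pair (gcm_diag (kmd_gcm G)).
  have e1E : (1 : K) = - (\sum_l coroot G a l * mu 0 l)%:~R by rewrite pr1 rmorphN opprK.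
  case: eqP => [->|/eqP/negPf h]; last first.
    by rewrite big1 // => l _; rewrite !mxE h mulr0n mulr0.
  rewrite mxE mulr1n [2 in RHS]e2E [X in _ - X]e1E opprK !rmorph_sum mulr_suml -big_split; apply: eq_bigr => l _.
  rewrite !mxE eqxx mulr1n !rmorphM /=.
  by elim/ord2P: j1; rewrite /wtV /= ?mxE ?rmorphD /=; ring.
apply/matrixP => i1 j1; rewrite /bracket !mxE !sum2 !mxE.
by case22 i1 j1; ring.
Qed.

Lemma serreV i j : i != j -> iter `|1 - gcm G i j|%N
  (bracket (if i == a then eV else 0)) (if j == a then eV else 0) = 0.
Proof.
pose em l := if l == a then eV else 0.
move=> ij; apply: (@serre_single K n m G _ em a) => // l la; exact: ifN.
Qed.

Definition Vb : bmod K G 2 := @BMod K n m G 2 _ _ heV serreV.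
Definition Vp (h : pr = -1) : pmod K G a 2 := @PMod K n m G a 2 Vb fV hfV (efV h).

Lemma fexp_V x : nexp (x *: fV) = 1%:M + x *: fV.
Proof.
by rewrite nexp2 // -scalemxAl -scalemxAr mul_delta_mx_0 ?scaler0.
Qed.

Lemma eexp_V x : nexp (x *: eV) = 1%:M + x *: eV.
Proof.
by rewrite nexp2 // -scalemxAl -scalemxAr mul_delta_mx_0 ?scaler0.
Qed.

Lemma sig_V h e x : let S := sval (sig G a e x) _ (Vp h) in
  [/\ S ord0 ord_max = yc e x, S ord_max ord_max = zc e x &
      S ord0 ord0 * S ord_max ord_max - S ord_max ord0 * S ord0 ord_max = 1].
Proof.
case: e => /=; rewrite ?eqxx ?mulE ?fexp_V ?eexp_V; split;
  rewrite ?mxE ?sum2 ?mxE ?sum2 ?mxE /= ?mulr0n ?mulr1n /yc /zc; ring.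
Qed.

(** On the two-dimensional module with weights mu and mu + alpha the chart representatives have
    determinant 1. Combining the two entries in the first column of the matrix relation with these
    determinants isolates lam chi_b(mu). *)
Lemma chi_step1 (L : 'I_n -> Prop) t b e x e' x' lam : pr = -1 -> ~ L a -> torpart L t ->
  (forall d (V : pmod K G a d), sval b d V =
     sval (pinvp (sig G a e x)) d V *m sval t d V *m sval (sig G a e' x') d V) ->
  yc e' x' = lam * (chi t al * yc e x) -> zc e' x' = lam * zc e x ->
  lam * chi b mu = chi t mu.
Proof.
move=> pr1 La tL hb hy hz; pose V := Vp pr1.
have tV : sval t 2%N V = diag_mx (\row_j chi t (wtV j)).
  by rewrite (tL _ V) ?triv_chi // => l Ll /=; case: eqP La Ll => // <-.
have hF : bmod_hom V (triv K G (fun _ : 'I_1 => mu)) (delta_mx 0 ord0).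
  split=> [k|i] /=.
    apply/matrixP => z j; rewrite (ord1 z) -rowE !mxE big_ord1 !mxE eqxx mulr1n.
    by elim/ord2P: j; rewrite ?eqE /= ?mulr1n ?mulr0n ?mulr1 ?mulr0.
  rewrite mul0mx; case: eqP => _; last by rewrite mulmx0.
  by rewrite mul_delta_mx_0.
have b00 : sval b 2%N V ord0 ord0 = chi b mu.
  have /matrixP/(_ 0 ord0) := bor_nat b hF.
  by rewrite -rowE chiE mul_scalar_mx !mxE eqxx mulr1.
have h : sval (sig G a e x) 2%N V *m sval b 2%N V = sval t 2%N V *m sval (sig G a e' x') 2%N V.
  by rewrite hb -!mulmxA mulKVmx // par_unit.
have [S0 S1 SD] := sig_V pr1 e x; have [S0' S1' SD'] := sig_V pr1 e' x'.
have /matrixP E := h; have := E ord0 ord0; have := E ord_max ord0.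
rewrite tV mul_diag_mx !mxE !sum2 b00 /wtV /= chiD.
rewrite -/V in S0 S1 SD S0' S1' SD'; rewrite S0 S1 in SD *; rewrite S0' S1' in SD'.
set s := sval (sig G a e x) 2%N V ord0 ord0 in SD *; set u := sval (sig G a e x) 2%N V ord_max ord0 in SD *.
set s' := sval (sig G a e' x') 2%N V ord0 ord0 in SD' *; set u' := sval (sig G a e' x') 2%N V ord_max ord0 in SD' *.
rewrite hy hz in SD'; move: (sval b 2%N V ord_max ord0) => v E1 E0.
have : lam * chi b mu * (s * zc e x - u * yc e x) = chi t mu * (s' * (lam * zc e x) - u' * (lam * (chi t al * yc e x))).
  transitivity (lam * (zc e x * (s * chi b mu + yc e x * v) - yc e x * (u * chi b mu + zc e x * v))); first ring.
  by rewrite E1 E0; ring.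
by rewrite SD SD' !mulr1.
Qed.

End Weight.
End Step.

(** * The projection to the torus and the twists by a cocharacter *)

Section Twist.
Variables (K : numFieldType) (n m : nat) (G : km_datum n m).
Implicit Types (b : borel K G) (mu nu : 'rV[int]_m).

Lemma bor_ext b b' : (forall d (M : bmod K G d), sval b d M = sval b' d M) -> b = b'.
Proof.
case: b b' => [f hf] [g hg] /= h; have E : f = g.
  by apply: functional_extensionality_dep => d; apply: funext => M; exact: h.
by case: g / E hg h => hg _; congr exist; exact: Prop_irrelevance.
Qed.

(** What the computation of orbits needs from the maps Psi_u. The exponents in [tw_reg] are natural
    numbers, so matrix entries remain polynomial in u down to u = 0. *)
Record twist_family (psi : K -> borel K G -> borel K G) : Prop := TwistFamily {
  tw_mul : forall u b b', psi u (bmul b b') = bmul (psi u b) (psi u b');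
  tw_chi : forall u b mu, chi (psi u b) mu = chi b mu;
  tw_tor : forall u L b, torpart L b -> torpart L (psi u b);
  tw_reg : forall d (M : bmod K G d) i j, exists c : nat, forall u b,
    sval (psi u b) d M i j = u ^+ c * sval b d M i j }.

Lemma tw_one psi u : twist_family psi -> psi u (bone K G) = bone K G.
Proof.
move=> h; set c := psi _ _; have cc : bmul c c = c.
  by rewrite -(tw_mul h); congr psi; apply: bor_ext => d M /=; rewrite mulmx1.
apply: bor_ext => d M; have := congr1 (fun x : borel K G => invmx (sval c d M) *m sval x d M) cc.
by rewrite /= mulKmx ?mulVmx // bor_unit.
Qed.

Lemma tw_inv psi u b : twist_family psi -> psi u (binv b) = binv (psi u b).
Proof.
move=> h; apply: bor_ext => d M; have bb : bmul (psi u b) (psi u (binv b)) = bone K G.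
  rewrite -(tw_mul h) -[RHS](tw_one u h); congr psi; apply: bor_ext => e N /=.
  by rewrite mulmxV // bor_unit.
have := congr1 (fun x : borel K G => invmx (sval (psi u b) d M) *m sval x d M) bb.
by rewrite /= mulKmx ?mulmx1 // bor_unit.
Qed.

Lemma tw_id : twist_family (fun _ b => b).
Proof. by split=> // d M i j; exists 0%N => u b; rewrite mul1r. Qed.

Lemma hom_wt d e (r : bmod K G d) (s : bmod K G e) F i j :
  (forall k, F *m hmat K (wt r) k = hmat K (wt s) k *m F) -> F i j != 0 -> wt s i = wt r j.
Proof.
move=> h f0; apply/rowP => k; have /matrixP/(_ i j) := h k.
rewrite mul_mx_diag mul_diag_mx !mxE [RHS]mulrC => /(mulfI f0)/eqP.
by rewrite eqr_int => /eqP.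
Qed.

Lemma tens_wt d e (r : bmod K G d) (s : bmod K G e) t i j : bmod_tens r s t ->
  wt t (mxtens_index (i, j)) = wt r i + wt s j.
Proof.
move=> [h _]; apply/rowP => k.
have /matrixP/(_ (mxtens_index (i, j)) (mxtens_index (i, j))) := h k.
rewrite !mxE !mxtens_indexK /= !eqxx !mulr1n mulr1 mul1r -rmorphD => /eqP.
by rewrite eqr_int => /eqP.
Qed.

Lemma unit_wt t i : @bmod_unit K n m G t -> wt t i = 0.
Proof.
move=> [h _]; apply/rowP => k; have /matrixP/(_ i i) := h k.
by rewrite !mxE eqxx mulr1n => /eqP; rewrite intr_eq0 => /eqP.
Qed.

Lemma char_valD (x : 'I_m -> K) mu nu : (forall k, x k != 0) ->
  char_val (mu + nu) x = char_val mu x * char_val nu x.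
Proof. by move=> x0; rewrite /char_val -big_split; apply: eq_bigr => k _; rewrite mxE expfzDr. Qed.

Lemma torus_taut (x : 'I_m -> K) : (forall k, x k != 0) ->
  tensor_aut (@bmod_hom K n m G) (@bmod_tens K n m G) (@bmod_unit K n m G) (@torus_elt K n m G x).
Proof.
move=> x0; split.
- move=> d r; rewrite unitmxE det_diag unitfE; apply/prodf_neq0 => i _; rewrite mxE.
  by apply/prodf_neq0 => k _; exact: expfz_neq0.
- move=> d e r s F [h _]; apply/matrixP => i j; rewrite mul_mx_diag mul_diag_mx !mxE.
  have [->|f0] := eqVneq (F i j) 0; first by rewrite mul0r mulr0.
  by rewrite (hom_wt h f0) mulrC.
- move=> d e r s t h; apply/matrixP => i j.
  case: (mxtens_indexP i) (mxtens_indexP j) => i1 i2 [j1 j2]; rewrite tensmxE !mxE (tens_wt _ _ h) char_valD //.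
  rewrite (inj_eq (can_inj (@mxtens_indexK _ _))) xpair_eqE.
  by case: (i1 == j1); case: (i2 == j2); rewrite ?mulr0n ?mulr1n ?mulr0 ?mul0r.
- move=> t h; apply/matrixP => i j; rewrite !mxE (unit_wt _ h) (ord1 i) (ord1 j) eqxx mulr1n.
  by rewrite /char_val big1 // => k _; rewrite mxE expr0z.
Qed.

Lemma triv_taut b : tensor_aut (@bmod_hom K n m G) (@bmod_tens K n m G) (@bmod_unit K n m G)
  (fun d M => sval b d (triv K G (wt M))).
Proof.
split.
- by move=> d r; exact: bor_unit.
- move=> d e r s F [h _]; apply: bor_nat; split=> // i; by rewrite mulmx0 mul0mx.
- move=> d e r s t [h _]; apply: bor_tens; split=> // i.
  by rewrite /tens_action tensmx0 tens0mx addr0.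
- by move=> t [h _]; apply: bor_one; split.
Qed.

Definition psi0 b : borel K G := exist _ _ (triv_taut b).

Section Cocharacter.
Variables (lam : 'rV[int]_m) (q : nat).
Hypothesis deg : degenerating K G lam q.

Definition ht mu : int := \sum_k lam 0 k * mu 0 k.

Lemma htD mu nu : ht (mu + nu) = ht mu + ht nu.
Proof. by rewrite /ht -big_split; apply: eq_bigr => k _; rewrite mxE mulrDr. Qed.

Lemma char_ht mu (u : K) : u != 0 -> char_val mu (cochar lam u) = u ^ ht mu.
Proof.
move=> u0; rewrite /char_val /ht; elim/big_rec2: _ => [|k y x _ ->]; first by rewrite expr0z.
by rewrite expfzDr // /cochar -exprz_exp.
Qed.

Lemma exp2z_eq1 (z : int) : (2 : K) ^ z = 1 -> z = 0.
Proof.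
have nat k : (2 : K) ^+ k = 1 -> k = 0%N.
  by move=> /eqP; rewrite -natrX -[1]/(1%:R) eqr_nat; case: k => // k; rewrite expnS; lia.
case: z => k; first by move=> /nat ->.
move=> h; have {}h : (2 ^+ k.+1 : K)^-1 = 1 by exact: h.
by have /nat : (2 : K) ^+ k.+1 = 1 by rewrite -[LHS]invrK h invr1.
Qed.

(** Evaluation at u = 2 suffices, since 2 is not a root of unity. *)
Lemma ht_root i : ht (row i (Defs.root G)) = q.
Proof.
case: deg => _ _ /(_ i 2); rewrite char_ht ?pnatr_eq0 // => /(_ isT).
rewrite -[2 ^+ q]/(2 ^ q%:Z) => h; apply/eqP; rewrite -subr_eq0; apply/eqP/exp2z_eq1.
by rewrite expfzDr ?pnatr_eq0 // h -expfzDr ?pnatr_eq0 // subrr expr0z.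
Qed.

Section Entries.
Variables (d : nat) (M : bmod K G d) (c : int).

Definition Pge : 'M[K]_d := diag_mx (\row_j ((c <= ht (wt M j))%R : bool)%:R).
Definition Peq : 'M[K]_d := diag_mx (\row_j (ht (wt M j) == c)%:R).

Lemma e_wt l i j : emat M l i j != 0 -> wt M i = wt M j + row l (Defs.root G).
Proof.
move=> e0; apply/rowP => k; have /matrixP/(_ i j) := bmod_he M k l.
rewrite /bracket mul_mx_diag mul_diag_mx !mxE mulrC -mulrBr [RHS]mulrC => /(mulfI e0)/eqP.
by rewrite -rmorphB eqr_int subr_eq addrC => /eqP.
Qed.

Lemma PeP l : Pge *m emat M l *m Pge = emat M l *m Pge.
Proof.
apply/matrixP => i j; rewrite !mul_mx_diag mul_diag_mx !mxE.
have [->|/e_wt e0] := eqVneq (emat M l i j) 0; first by rewrite mulr0 mul0r.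
case: (boolP (c <= ht (wt M j))) => h; last by rewrite !mulr0.
by rewrite e0 htD ht_root (le_trans h) ?lerDl // mul1r.
Qed.

Lemma SeP l : Peq *m (emat M l *m Pge) = 0.
Proof.
have q0 : (0 < q)%N by case: deg.
apply/matrixP => i j; rewrite mul_diag_mx mul_mx_diag !mxE.
have [->|/e_wt e0] := eqVneq (emat M l i j) 0; first by rewrite mul0r mulr0.
case: (boolP (c <= ht (wt M j))) => h; last by rewrite !mulr0.
rewrite e0 htD ht_root; case: eqP => [h'|]; last by rewrite mul0r.
move: h; rewrite -h' gerDl; lia.
Qed.

Lemma mul_eP (x y : 'M[K]_d) : Pge *m x *m Pge = x *m Pge -> Pge *m y *m Pge = y *m Pge ->
  bracket (x *m Pge) (y *m Pge) = bracket x y *m Pge /\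
  Pge *m (bracket x y) *m Pge = bracket x y *m Pge.
Proof.
have E (z w : 'M[K]_d) : Pge *m z *m Pge = z *m Pge -> Pge *m w *m Pge = w *m Pge ->
    Pge *m z *m w *m Pge = z *m w *m Pge.
  move=> hz hw; have hz' : z *m Pge = Pge *m (z *m Pge) by rewrite mulmxA.
  have hw' : w *m Pge = Pge *m (w *m Pge) by rewrite mulmxA.
  by rewrite -!mulmxA hw' !(mulmxA z) [LHS]mulmxA -hz'.
move=> hx hy; rewrite /bracket; split.
  by rewrite mulmxBl -!mulmxA ![Pge *m (_ *m _)]mulmxA hx hy.
rewrite mulmxBr !mulmxBl !mulmxA; congr (_ - _).
  exact: E.
exact: E.
Qed.

Lemma trunc_he k i : bracket (hmat K (wt M) k) (emat M i *m Pge) =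
  (Defs.root G i k)%:~R *: (emat M i *m Pge).
Proof.
rewrite scalemxAl -bmod_he /bracket mulmxBl !mulmxA; congr (_ - _).
by rewrite -!mulmxA /Pge /hmat !mulmx_diag; congr (_ *m diag_mx _); apply/rowP => j; rewrite !mxE mulrC.
Qed.

Lemma trunc_serre i j : i != j ->
  iter `|1 - gcm G i j|%N (bracket (emat M i *m Pge)) (emat M j *m Pge) = 0.
Proof.
move=> ij; suff /(_ `|1 - gcm G i j|%N) [-> _] : forall s,
    iter s (bracket (emat M i *m Pge)) (emat M j *m Pge) = iter s (bracket (emat M i)) (emat M j) *m Pge /\
    Pge *m iter s (bracket (emat M i)) (emat M j) *m Pge = iter s (bracket (emat M i)) (emat M j) *m Pge.
  by rewrite (bmod_serre M ij) mul0mx.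
elim=> [|s [IH1 IH2]] /=; first by split=> //; exact: PeP.
by rewrite IH1; exact: mul_eP (PeP i) IH2.
Qed.

Definition trunc : bmod K G d := @BMod K n m G d (wt M) _ trunc_he trunc_serre.

End Entries.

(* The submodule of weights of height >= c of M maps onto its part of height c, on which the
   e_l vanish. *)
Lemma bor_entry b d (M : bmod K G d) i j : ht (wt M i) <= ht (wt M j) ->
  sval b d M i j = chi b (wt M i) *+ (i == j).
Proof.
move=> hij; pose c := ht (wt M i).
have hP : bmod_hom (trunc M c) M (Pge M c).
  split=> [k|l]; last by rewrite mulmxA PeP.
  by rewrite /Pge /hmat !mulmx_diag; congr diag_mx; apply/rowP => s; rewrite !mxE mulrC.
have hS : bmod_hom (trunc M c) (triv K G (wt M)) (Peq M c).
  split=> [k|l]; last by rewrite SeP mul0mx.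
  by rewrite /Peq /hmat !mulmx_diag; congr diag_mx; apply/rowP => s; rewrite !mxE mulrC.
have /matrixP/(_ i j) := bor_nat b hP; have /matrixP/(_ i j) := bor_nat b hS.
rewrite triv_chi !mul_diag_mx !mul_mx_diag !mxE /c hij lexx eqxx !mul1r mulr1 => -> <-.
case: eqP => [->|_]; rewrite ?mulr1n ?mulr0n ?mulr0 //.
by rewrite mulr1.
Qed.

Lemma nz_neq0 (u : K) k : cochar lam (if u == 0 then 1 else u) k != 0.
Proof. by apply: expfz_neq0; case: ifP => [_|/negbT //]; rewrite oner_eq0. Qed.

(** The value at u = 0 is a placeholder, as [psil] uses [psi0] there. *)
Definition tau u : borel K G := exist _ _ (torus_taut (nz_neq0 u)).

Definition psil u b : borel K G :=
  if u == 0 then psi0 b else bmul (bmul (tau u) b) (binv (tau u)).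

Lemma psilE u b d (M : bmod K G d) : Psi lam u (sval b) M = sval (psil u b) d M.
Proof.
rewrite /Psi /psil; case: eqP => [_|/eqP/negPf u0] /=; last by rewrite u0.
by rewrite triv_chi; congr diag_mx; apply/rowP => j; rewrite !mxE bor_entry // eqxx.
Qed.

Lemma tau_entry u b d (M : bmod K G d) i j : u != 0 ->
  sval (bmul (bmul (tau u) b) (binv (tau u))) d M i j =
  u ^ ht (wt M i) * sval b d M i j * u ^ (- ht (wt M j)).
Proof.
move=> u0; rewrite /= (negPf u0); have vE : invmx (torus_elt (cochar lam u) M) =
    diag_mx (\row_j u ^ (- ht (wt M j))).
  have h : torus_elt (cochar lam u) M *m diag_mx (\row_j u ^ (- ht (wt M j))) = 1%:M.
    rewrite mulmx_diag; apply/matrixP => s t; rewrite !mxE char_ht // -expfzDr // subrr expr0z.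
    by [].
  have [ut _] := mulmx1_unit h.
  by rewrite -[LHS]mulmx1 -h mulKmx.
by rewrite vE mul_mx_diag mul_diag_mx !mxE char_ht.
Qed.

Lemma tw_psil : twist_family psil.
Proof.
split.
- move=> u b b'; apply: bor_ext => d M; rewrite /psil; case: eqP => //= _.
  rewrite -!mulmxA; congr (_ *m (_ *m _)); rewrite mulKmx //.
  exact: (bor_unit (tau u)).
- move=> u b mu; rewrite /psil; case: eqP => [//|/eqP u0].
  by rewrite /chi tau_entry // mulrAC -expfzDr // subrr expr0z mul1r.
- move=> u L b h d M hM; rewrite /psil; case: eqP => //= _.
  by rewrite h.
(* Conjugation multiplies the entry by u to the difference of the heights. Off the diagonal the
   entry vanishes by [bor_entry] unless this difference is positive, so the absolute value is
   harmless, and at u = 0 only the diagonal is left. *)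
- move=> d M i j; exists (if i == j then 0 else `|(ht (wt M i) - ht (wt M j))%R|)%N => u b.
  rewrite /psil; case: eqP => [->|/eqP u0].
    rewrite /= triv_chi !mxE; have [->|ij] := eqVneq i j; first by rewrite mul1r bor_entry // eqxx.
    rewrite mulr0n expr0n; case: eqP => [h|_]; last by rewrite mul0r.
    by rewrite bor_entry ?(negPf ij) ?mulr0n ?mulr0 //; lia.
  rewrite tau_entry //; have [->|ij] := eqVneq i j.
    by rewrite mul1r mulrAC -expfzDr // subrr expr0z mul1r.
  have [h|h] := leP (ht (wt M i)) (ht (wt M j)).
    by rewrite bor_entry // (negPf ij) mulr0n mulr0 mul0r mulr0.
  rewrite mulrAC -expfzDr //; congr (_ * _).
  by rewrite -[u ^+ _]/(u ^ _%:Z); congr (u ^ _); lia.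
Qed.

End Cocharacter.
End Twist.

(** * Charts of Bott-Samelson varieties *)

Section Orbit.
Variables (K : numFieldType) (n m : nat) (G : km_datum n m) (r : nat) (w : r.-tuple 'I_n).
Variable psi : K -> borel K G -> borel K G.
Hypothesis tw : twist_family psi.
Implicit Types (b c : nat -> borel K G) (p y : forall i, parab K G (tnth w i)).
Local Notation al i := (row (tnth w i) (Defs.root G)).

Definition pb u b (i : nat) : borel K G := if i is k.+1 then psi u (b k) else bone K G.

Definition orb u p y : Prop := exists b, forall (i : 'I_r) d (M : pmod K G (tnth w i) d),
  sval (y i) d M = invmx (sval (pb u b i) d M) *m sval (p i) d M *m sval (b i) d M.

Lemma pb_inv u b i : pb u (fun k => binv (b k)) i = binv (pb u b i).
Proof.
by case: i => [|k] /=; [apply: bor_ext => d M /=; rewrite invmx1|exact: tw_inv].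
Qed.

Lemma pb_mul u b c i : pb u (fun k => bmul (b k) (c k)) i = bmul (pb u b i) (pb u c i).
Proof.
by case: i => [|k] /=; [apply: bor_ext => d M /=; rewrite mulmx1|exact: tw_mul].
Qed.

Lemma orb_refl u p : orb u p p.
Proof.
exists (fun=> bone K G) => i d M; rewrite /= mulmx1.
by case: (val i) => [|k] /=; rewrite ?tw_one //= invmx1 mul1mx.
Qed.

Lemma orb_sym u p y : orb u p y -> orb u y p.
Proof.
move=> [b hb]; exists (fun k => binv (b k)) => i d M; rewrite pb_inv /= invmxK hb -!mulmxA.
by rewrite mulmxV ?mulmx1 ?mulKVmx // bor_unit.
Qed.

Lemma orb_trans u p y z : orb u p y -> orb u y z -> orb u p z.
Proof.
move=> [b hb] [c hc]; exists (fun k => bmul (b k) (c k)) => i d M.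
by rewrite pb_mul /= hc hb invmx_mul ?bor_unit // !mulmxA.
Qed.

Definition sigs (e : signs r) (x : 'I_r -> K) : forall i, parab K G (tnth w i) :=
  fun i => sig G (tnth w i) (e i) (x i).

Definition nx (k i : 'I_r) : bool := (k < i)%N && (beta G w k i == -1).

Definition letters (i : nat) (l : 'I_n) : Prop := exists2 k : 'I_r, (k < i)%N & tnth w k = l.

Hypothesis letters_inj : forall k i : 'I_r, (k < i)%N -> tnth w k != tnth w i.
Hypothesis beta01 : forall k i : 'I_r, (k < i)%N -> beta G w k i = 0 \/ beta G w k i = -1.

Lemma letters_new (i : 'I_r) : ~ letters i (tnth w i).
Proof. by case=> k ki /eqP; apply/negP/letters_inj. Qed.

Section Relation.
Variables (u : K) (e e' : signs r) (a a' : 'I_r -> K) (b : nat -> borel K G) (s : nat).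
Hypothesis rel : forall i : 'I_r, (i < s)%N -> forall d (M : pmod K G (tnth w i) d),
  sval (b i) d M = sval (pinvp (sigs e a i)) d M *m sval (pb u b i) d M *m sval (sigs e' a' i) d M.

(** The letters are distinct, so [tor_step] adds each new letter to those whose e_l must act by
    zero. *)
Lemma rel_tor i : (i <= s)%N -> (i <= r)%N -> torpart (letters i) (pb u b i).
Proof.
elim: i => [|i IH] si ri; first exact: torpart_one.
have hi := IH (ltnW si) (ltnW ri); apply: (tw_tor tw) => d M hM.
have := tor_step (@letters_new (Ordinal ri)) hi (rel (i := Ordinal ri) si); apply => l [hl|->]; apply: hM.
  by case: hl => k ki <-; exists k => //; exact: leqW.
by exists (Ordinal ri).
Qed.

Variable lam : 'I_r -> K.
Hypothesis lamP : forall i : 'I_r, (i < s)%N -> [/\ lam i != 0,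
  yc (e' i) (a' i) = lam i * (chi (pb u b i) (al i) * yc (e i) (a i))
  & zc (e' i) (a' i) = lam i * zc (e i) (a i)].

(** Position k changes the value at the root of j by the factor 1 / lam_k if beta_kj = -1
    ([chi_step1]), and not at all if beta_kj = 0 ([chi_step0]). *)
Lemma rel_chi i (j : 'I_r) : (i <= s)%N -> (i <= j)%N ->
  chi (pb u b i) (al j) * \prod_(k | nx k j && (k < i)%N) lam k = 1.
Proof.
elim: i => [|i IH] si ij.
  by rewrite /= chi_one big1 ?mulr1 // => k; rewrite andbF.
have ri : (i < r)%N by exact: ltn_trans (ltn_ord j).
pose o := Ordinal ri; have ho := rel (i := o) si; have [l0 hy hz] := lamP (i := o) si.
have ti := rel_tor (ltnW si) (ltnW ri).
have pr : \sum_k coroot G (tnth w o) k * (al j) 0 k = beta G w o j.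
  by rewrite /beta gcm_pair; apply: eq_bigr => k _; rewrite mxE.
rewrite /= (tw_chi tw); have [h|h] := beta01 (k := o) (i := j) ij.
  rewrite (chi_step0 _ ho) ?pr // -[RHS](IH (ltnW si) (ltnW ij)); congr (_ * _).
  apply: eq_bigl => k; rewrite ltnS leq_eqVlt -[X in X == _]/(val k) -[i in _ == i]/(val o) val_eqE.
  by case: eqP => // -> /=; rewrite /nx h ltnn !andbF.
rewrite (bigD1 o) /=; last by rewrite /nx h eqxx /= ij ltnSn.
rewrite mulrA [_ * lam o]mulrC (chi_step1 _ (@letters_new o) ti ho hy hz) ?pr //.
rewrite -[RHS](IH (ltnW si) (ltnW ij)); congr (_ * _); apply: eq_bigl => k.
rewrite -andbA; congr (_ && _); rewrite -val_eqE /=; lia.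
Qed.

End Relation.

Lemma sigs_rel u e a e' a' b (i : 'I_r) : (forall d (M : pmod K G (tnth w i) d),
    sval (sigs e' a' i) d M = invmx (sval (pb u b i) d M) *m sval (sigs e a i) d M *m sval (b i) d M) <->
  forall d (M : pmod K G (tnth w i) d),
  sval (b i) d M = sval (pinvp (sigs e a i)) d M *m sval (pb u b i) d M *m sval (sigs e' a' i) d M.
Proof.
split=> h d M; rewrite h /=.
  rewrite -!mulmxA (mulmxA (sval (pb u b i) d M)) mulmxV ?bor_unit // mul1mx mulKmx //.
  exact: par_unit.
rewrite -!mulmxA (mulmxA (sval (sigs e a i) d M)) mulmxV ?par_unit // mul1mx mulKmx //.
exact: bor_unit.
Qed.

Lemma ycoxE (e : signs r) (a : 'I_r -> K) i : ycox e a i = yc (e i) (a i). Proof. by []. Qed.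
Lemma nx_prod (lam : 'I_r -> K) (j : 'I_r) :
  \prod_(k | nx k j && (k < j)%N) lam k = \prod_(k | nx k j) lam k.
Proof. by apply: eq_bigl => k; rewrite /nx; case: (k < j)%N; rewrite ?andbT ?andbF. Qed.

(** The entries of [lam] are read off position by position by [step_lam], and conversely the
    elements of B are built by [step_lift]. In both directions [rel_chi] turns the character values
    into the products of the Cox relation. *)
Lemma orb_sigs u e a e' a' :
  orb u (sigs e a) (sigs e' a') <-> exists lam, cox_rel nx e a e' a' lam.
Proof.
split=> [[b hb]|[lam hl]].
  have rel (i : 'I_r) := (sigs_rel u e a e' a' b i).1 (hb i).
  have /choice[lam hl] (i : 'I_r) : exists lam, [/\ lam != 0,
      yc (e' i) (a' i) = lam * (chi (pb u b i) (al i) * yc (e i) (a i))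
      & zc (e' i) (a' i) = lam * zc (e i) (a i)].
    apply: step_lam (@letters_new i) _ (rel i).
    apply: (@rel_tor u e e' a a' b r _ i (ltnW (ltn_ord i)) (ltnW (ltn_ord i))) => j _; exact: rel.
  exists lam => i; have [l0 hy hz] := hl i; split=> //.
  have := @rel_chi u e e' a a' b r (fun i _ => rel i) lam (fun i _ => hl i) i i (ltnW (ltn_ord i)) (leqnn i).
  rewrite nx_prod ycoxE hy => h.
  move: h; set P := \prod_(k | _) _ => h; rewrite -[RHS]mulr1 -h ycoxE; ring.
have [lam0 hz hy] : [/\ forall i, lam i != 0, forall i, zc (e' i) (a' i) = lam i * zc (e i) (a i)
    & forall i, yc (e' i) (a' i) * \prod_(k | nx k i) lam k = lam i * yc (e i) (a i)].
  by split=> i; have [] := hl i.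
suff /(_ r (leqnn r))[b [hb _]] : forall s, (s <= r)%N -> exists b,
    (forall i : 'I_r, (i < s)%N -> forall d (M : pmod K G (tnth w i) d),
      sval (b i) d M = sval (pinvp (sigs e a i)) d M *m sval (pb u b i) d M *m sval (sigs e' a' i) d M) /\
    (forall i : 'I_r, (i < s)%N -> yc (e' i) (a' i) = lam i * (chi (pb u b i) (al i) * yc (e i) (a i))).
  by exists b => i d M; apply: (sigs_rel u e a e' a' b i).2 => d' M'; exact: hb.
elim=> [|s IH] sr; first by exists (fun=> bone K G); split.
have [b [hb hc]] := IH (ltnW sr); pose o := Ordinal sr.
have ho : yc (e' o) (a' o) = lam o * (chi (pb u b o) (al o) * yc (e o) (a o)).
  have := @rel_chi u e e' a a' b s hb lam (fun i si => And3 (lam0 i) (hc i si) (hz i)) s o (leqnn s) (leqnn s).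
  rewrite nx_prod => h; rewrite -[LHS]mulr1 -h mulrCA hy; ring.
have [bo hbo] := step_lift (@letters_new o) (rel_tor hb (leqnn s) (ltnW sr)) (lam0 o) ho (hz o).
pose b' k := if k == s then bo else b k.
have pbE i : (i <= s)%N -> pb u b' i = pb u b i.
  by case: i => [//|i] hi; rewrite /= /b' ltn_eqF.
exists b'; split=> i; rewrite ltnS leq_eqVlt => /orP[/eqP io|hi].
- have -> : i = o by exact: val_inj.
  by move=> d M; rewrite pbE // /b' eqxx hbo.
- by move=> d M; rewrite pbE ?(ltnW hi) // /b' ltn_eqF // hb.
- have -> : i = o by exact: val_inj.
  by rewrite pbE // ho.
- by rewrite pbE ?(ltnW hi) // hc.
Qed.

End Orbit.

(** * Functions that are fractions on a principal open set *)

Section Frac.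
Variables (K : fieldType) (X : Type) (S : set (X -> K)).
Implicit Types (D A f g : X -> K).

Definition locfrac D f : Prop := exists A N, gen_alg S A /\ forall z, D z != 0 -> f z = A z / D z ^+ N.

Lemma gen_exp A N : gen_alg S A -> gen_alg S (fun z => A z ^+ N).
Proof.
move=> hA; elim: N => [|N IH]; first exact: gen_cst.
have -> : (fun z => A z ^+ N.+1) = (fun z => A z * A z ^+ N) by apply: funext => z; rewrite exprS.
exact: gen_mul.
Qed.

Lemma locfrac_gen D A : gen_alg S A -> locfrac D A.
Proof. by move=> hA; exists A, 0%N; split=> // z _; rewrite expr0 divr1. Qed.

Lemma locfrac_cst D c : locfrac D (fun=> c). Proof. exact/locfrac_gen/gen_cst. Qed.

Lemma locfrac_ext D f g : locfrac D f -> (forall z, D z != 0 -> g z = f z) -> locfrac D g.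
Proof. by move=> [A [N [hA h]]] fg; exists A, N; split=> // z Dz; rewrite fg ?h. Qed.

Lemma locfrac_add D f g : gen_alg S D -> locfrac D f -> locfrac D g -> locfrac D (fun z => f z + g z).
Proof.
move=> hD [A [N [hA hf]]] [B [L [hB hg]]].
exists (fun z => A z * D z ^+ L + B z * D z ^+ N), (N + L)%N; split.
  by apply: gen_add; apply: gen_mul => //; exact: gen_exp.
move=> z Dz; rewrite hf ?hg // exprD.
by rewrite addf_div ?expf_neq0.
Qed.

Lemma locfrac_mul D f g : locfrac D f -> locfrac D g -> locfrac D (fun z => f z * g z).
Proof.
move=> [A [N [hA hf]]] [B [L [hB hg]]].
exists (fun z => A z * B z), (N + L)%N; split; first exact: gen_mul.
by move=> z Dz; rewrite hf ?hg // exprD mulf_div.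
Qed.

Lemma locfrac_exp D f N : locfrac D f -> locfrac D (fun z => f z ^+ N).
Proof.
move=> hf; elim: N => [|N IH]; first exact: locfrac_cst.
by apply: locfrac_ext (locfrac_mul hf IH) _ => z _; rewrite exprS.
Qed.

Lemma locfrac_sum D (I : Type) (s : seq I) (F : I -> X -> K) : gen_alg S D ->
  (forall i, locfrac D (F i)) -> locfrac D (fun z => \sum_(i <- s) F i z).
Proof.
move=> hD hF; elim: s => [|i s IH].
  by apply: locfrac_ext (locfrac_cst D 0) _ => z _; rewrite big_nil.
by apply: locfrac_ext (locfrac_add hD (hF i) IH) _ => z _; rewrite big_cons.
Qed.

Lemma locfrac_poly D x (P : {poly K}) : gen_alg S D -> locfrac D x -> locfrac D (fun z => P.[x z]).
Proof.
move=> hD hx; apply: locfrac_ext (locfrac_sum (index_enum 'I_(size P)) (F := fun i z => P`_i * x z ^+ i) hD _) _.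
  by move=> i; apply: locfrac_mul; [exact: locfrac_cst|exact: locfrac_exp].
by move=> z _; rewrite horner_coef.
Qed.

Lemma locfrac_mpoly D s (x : 'I_s -> X -> K) (P : {mpoly K[s]}) : gen_alg S D -> (forall i, locfrac D (x i)) ->
  locfrac D (fun z => P.@[fun i => x i z]).
Proof.
move=> hD hx; elim/mpoly_gen_ind: P => [c|i|p q hp hq|p q hp hq].
- by apply: locfrac_ext (locfrac_cst D c) _ => z _; rewrite mevalC.
- by apply: locfrac_ext (hx i) _ => z _; rewrite mevalXU.
- by apply: locfrac_ext (locfrac_add hD hp hq) _ => z _; rewrite mevalD.
- by apply: locfrac_ext (locfrac_mul hp hq) _ => z _; rewrite mevalM.
Qed.

Lemma locfrac_loc D E f : gen_alg S E -> locfrac D f -> locfrac (fun z => D z * E z) f.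
Proof.
move=> hE [A [N [hA hf]]]; exists (fun z => A z * E z ^+ N), N; split.
  by apply: gen_mul => //; exact: gen_exp.
move=> z; rewrite mulf_eq0 negb_or => /andP[Dz Ez].
by rewrite hf // exprMn -mulf_div mulfV ?mulr1 ?expf_neq0.
Qed.

Lemma locfrac_inv D A f N : gen_alg S D -> gen_alg S A -> (forall z, D z != 0 -> f z = A z / D z ^+ N) ->
  locfrac (fun z => D z * A z) (fun z => (f z)^-1).
Proof.
move=> hD hA hf; exists (fun z => D z ^+ N.+1), 1%N; split; first exact: gen_exp.
move=> z; rewrite mulf_eq0 negb_or => /andP[Dz Az].
by rewrite hf // invf_div expr1 exprS invfM mulrACA mulfV // mul1r.
Qed.

End Frac.

(** * Chart coordinates of a point, regular in the point *)

Section NormalForm.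
Variables (K : numFieldType) (n m : nat) (G : km_datum n m) (r : nat) (w : r.-tuple 'I_n).
Variable psi : K -> borel K G -> borel K G.
Hypothesis tw : twist_family psi.
Variables (X : Type) (S : set (X -> K)) (uu : X -> K) (pp : X -> forall i, parab K G (tnth w i)).
Hypothesis Su : gen_alg S uu.
Hypothesis Sp : forall i d (M : pmod K G (tnth w i) d) k l, gen_alg S (fun z => parab_coef M k l (pp z i)).
Local Notation L2 a := (L2 K G a).

Lemma locfrac_mulmx D s t l (A : X -> 'M[K]_(s, t)) (B : X -> 'M[K]_(t, l)) : gen_alg S D ->
  (forall i j, locfrac S D (fun z => A z i j)) -> (forall i j, locfrac S D (fun z => B z i j)) ->
  forall i j, locfrac S D (fun z => (A z *m B z) i j).
Proof.
move=> hD hA hB i j.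
apply: locfrac_ext (locfrac_sum (index_enum 'I_t) (F := fun k z => A z i k * B z k j) hD _) _.
  by move=> k; exact: locfrac_mul.
by move=> z _; rewrite mxE.
Qed.

Lemma sig_poly a e d (V : pmod K G a d) i j :
  exists P : {poly K}, forall x, sval (sig G a e x) d V i j = P.[x].
Proof.
case: e => /=; first exact/nexp_poly/nil_f.
have /choice[P hP] k := nexp_poly i k (nil_e a V).
exists (\sum_k (P k \Po ('X - 1)) * (nexp (1 *: fmat V) k j)%:P) => x.
rewrite mxE horner_sum; apply: eq_bigr => k _.
by rewrite hP !hornerE horner_comp !hornerE.
Qed.

Lemma sig_inv_poly a e d (V : pmod K G a d) i j :
  exists P : {poly K}, forall x, sval (pinvp (sig G a e x)) d V i j = P.[x].
Proof.
have invE (Y : 'M[K]_d) : nilmx Y -> nexp Y \in unitmx /\ invmx (nexp Y) = nexp (- Y).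
  move=> nY; have h := nexpN nY; rewrite mulE in h; have [u1 _] := mulmx1_unit h.
  by split=> //; rewrite -[LHS]mulmx1 -[1%:M]h mulKmx.
case: e => /=.
  have [P hP] := nexp_poly i j (nil_f V).
  exists (P \Po (- 'X)) => x; have [_ ->] := invE _ (nilmxZ x (nil_f V)).
  by rewrite -scaleNr hP horner_comp !hornerE.
have /choice[P hP] k := nexp_poly k j (nil_e a V).
exists (\sum_k (nexp (- (1 *: fmat V)) i k)%:P * (P k \Po (1 - 'X))) => x.
have [u1 i1] := invE _ (nilmxZ (x - 1) (nil_e a V)); have [u2 i2] := invE _ (nilmxZ 1 (nil_f V)).
rewrite invmx_mul // i1 i2 mxE horner_sum; apply: eq_bigr => k _.
by rewrite -(scaleNr (x - 1)) opprB hP !hornerE horner_comp !hornerE.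
Qed.

Lemma locfrac_sig_inv D a e x d (V : pmod K G a d) i j : gen_alg S D -> locfrac S D x ->
  locfrac S D (fun z => sval (pinvp (sig G a e (x z))) d V i j).
Proof.
move=> hD hx; have [P hP] := sig_inv_poly e V i j.
by apply: locfrac_ext (locfrac_poly P hD hx) _ => z _; rewrite hP.
Qed.

Lemma locfrac_comat D a (q : X -> parab K G a) d (M : bmod K G d) : gen_alg S D ->
  (forall e (V : pmod K G a e) i j, locfrac S D (fun z => sval (q z) e V i j)) ->
  forall i j, locfrac S D (fun z => comat (q z) M i j).
Proof.
move=> hD hq i j; rewrite /comat.
apply: locfrac_ext (locfrac_mul (locfrac_exp (in_k (ind a M)) (hq _ (L2 a) ord_max ord_max))
  (locfrac_mulmx (B := fun=> in_B (ind a M)) hD (locfrac_mulmx (A := fun=> ev0 (in_T (ind a M))) hD _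
     (hq _ (in_r (ind a M)))) _ i j)) _.
- by move=> *; exact: locfrac_cst.
- by move=> *; exact: locfrac_cst.
- by move=> z _; rewrite mxE.
Qed.

(** Otherwise the conic relation would make the last column of an invertible matrix zero. *)
Lemma col_neq0 a (p : parab K G a) : sval p 3 (L2 a) ord_max ord_max = 0 ->
  sval p 3 (L2 a) ord0 ord_max != 0.
Proof.
move=> h; apply/negP => /eqP h0; have h1 : sval p 3 (L2 a) (lift ord0 ord0) ord_max = 0.
  by have := conic p; rewrite h mulr0 => /eqP; rewrite expf_eq0 => /eqP.
have /matrixP/(_ ord_max ord_max) := mulVmx (par_unit p (L2 a)).
by rewrite !mxE sum3 h h0 h1 !mulr0 !addr0 => /eqP; rewrite eq_sym oner_eq0.
Qed.

(** A conic point (y^2 : 2 y z : z^2) has the affine coordinate y / z or z / y, which is half the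
    middle entry over the chosen end entry. *)
Lemma chart_col a (p : parab K G a) (e : bool) :
  let v := sval p 3 (L2 a) (if e then ord_max else ord0) ord_max in v != 0 ->
  lower (pmulp (pinvp (sig G a e (sval p 3 (L2 a) (lift ord0 ord0) ord_max / 2 * v^-1))) p).
Proof.
move=> v v0; have n2 : (2 : K) != 0 by rewrite pnatr_eq0.
have n4 : (4 : K) != 0 by rewrite pnatr_eq0.
set x := (X in sig G a e X); apply: (col_lower (c := v) _).1.
have [s0 s1 s2] := sig_col G a e x; have cn := conic p.
elim/ord3P; rewrite ?s0 ?s1 ?s2 /yc /zc /x; move: @v v0 {x s0 s1 s2}; case: e => /= v0.
- apply: (mulfI n4); apply: (mulfI v0); rewrite mulrCA [in LHS]mulrA mulrAC -cn; by field.
- by rewrite expr1n mulr1.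
- by field.
- by field.
- by rewrite expr1n mulr1.
- apply: (mulfI n4); apply: (mulfI v0); rewrite mulrCA [in LHS]mulrA -cn; by field.
Qed.

(** On the neighbourhood D != 0 of [z0] the first s factors are in normal form, and both the
    coordinates and the elements of B used are regular there. *)
Record stage (z0 : X) (s : nat) (e : signs r) (D : X -> K) (x : 'I_r -> X -> K)
    (c : X -> nat -> borel K G) : Prop := Stage {
  st_gen : gen_alg S D;
  st_neq0 : D z0 != 0;
  st_rel : forall z, D z != 0 -> forall i : 'I_r, (i < s)%N -> forall d (V : pmod K G (tnth w i) d),
    sval (c z i) d V = sval (pinvp (sig G (tnth w i) (e i) (x i z))) d V *m
      (sval (pb psi (uu z) (c z) i) d V *m sval (pp z i) d V);
  st_x : forall i : 'I_r, (i < s)%N -> locfrac S D (x i);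
  st_c : forall k, (k < s)%N -> forall d (M : bmod K G d) i j, locfrac S D (fun z => sval (c z k) d M i j) }.

(** Take a chart of P_a / B that contains the current point at [z0], shrink so that it contains the
    nearby ones, divide by the representative and descend to B. Regularity persists because [comat]
    is made from fixed matrices and entries of p. *)
Lemma stage_exists z0 s : (s <= r)%N -> exists e D x c, stage z0 s e D x c.
Proof.
elim: s => [|s IH] sr.
  exists [ffun=> true], (fun=> 1), (fun _ _ => 0), (fun _ _ => bone K G); split=> //; first exact: gen_cst.
  by rewrite oner_eq0.
have [e [D [x [c hs]]]] := IH (ltnW sr); pose o := Ordinal sr; pose a := tnth w o.
have hD := st_gen hs.
pose q z : parab K G a := pmulp (brestr a (pb psi (uu z) (c z) s)) (pp z o).
have fpb d (M : bmod K G d) i j : locfrac S D (fun z => sval (pb psi (uu z) (c z) s) d M i j).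
  case: (s) (st_c hs) => [_|k hk] /=; first exact: locfrac_cst.
  have [N hN] := tw_reg tw M i j.
  by apply: locfrac_ext (locfrac_mul (locfrac_exp N (locfrac_gen D Su)) (hk k (ltnSn k) _ M i j)) _ => z _.
have fq d (V : pmod K G a d) i j : locfrac S D (fun z => sval (q z) d V i j).
  apply: (locfrac_mulmx (A := fun z => sval (pb psi (uu z) (c z) s) d V)
    (B := fun z => sval (pp z o) d V) hD (fpb d V) _ i j) => i' j'.
  exact: (locfrac_gen D (@Sp o d V i' j')).
(* The positive chart, unless the current point at [z0] is its point at infinity. *)
pose eo := sval (q z0) 3 (L2 a) ord_max ord_max != 0.
pose v z := sval (q z) 3 (L2 a) (if eo then ord_max else ord0) ord_max.
have v0 : v z0 != 0.
  rewrite /v; case: (boolP eo) => // /negPn/eqP; exact: col_neq0.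
have [A [N [hA hv]]] : locfrac S D v by exact: fq.
pose D' z := D z * A z.
have hD' : gen_alg S D' by exact: gen_mul.
have D'D z : D' z != 0 -> D z != 0 by rewrite mulf_eq0 negb_or => /andP[].
have D'v z : D' z != 0 -> v z != 0.
  by rewrite mulf_eq0 negb_or => /andP[Dz Az]; rewrite hv // mulf_neq0 ?invr_eq0 ?expf_neq0.
pose xo z := sval (q z) 3 (L2 a) (lift ord0 ord0) ord_max / 2 * (v z)^-1.
have fxo : locfrac S D' xo.
  by apply: locfrac_mul; [apply: locfrac_mul; [exact/locfrac_loc|exact: locfrac_cst]|exact: locfrac_inv hv].
pose q' z : parab K G a := pmulp (pinvp (sig G a eo (xo z))) (q z).
have lq z : D' z != 0 -> lower (q' z) by move/D'v; exact: chart_col.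
have fq' d (V : pmod K G a d) i j : locfrac S D' (fun z => sval (q' z) d V i j).
  by apply: locfrac_mulmx => // i' j'; [exact: locfrac_sig_inv|exact/locfrac_loc].
pose co z : borel K G := if pselect (lower (q' z)) is left l then descend l else bone K G.
have coE z : D' z != 0 -> forall d M, sval (co z) d M = comat (q' z) M.
  by move=> /lq l d M; rewrite /co; case: pselect.
have fco d (M : bmod K G d) i j : locfrac S D' (fun z => sval (co z) d M i j).
  by apply: locfrac_ext (locfrac_comat M hD' fq' i j) _ => z /coE ->.
pose c' z k := if k == s then co z else c z k.
have pbE z i : (i <= s)%N -> pb psi (uu z) (c' z) i = pb psi (uu z) (c z) i.
  by case: i => [//|i] hi; rewrite /= /c' ltn_eqF.
exists [ffun i : 'I_r => if i == o then eo else e i], D', (fun i => if i == o then xo else x i), c'.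
split=> //.
- by have := v0; rewrite hv ?(st_neq0 hs) // !mulf_eq0 !negb_or (st_neq0 hs) => /andP[].
- move=> z Dz i; rewrite ltnS leq_eqVlt => /orP[/eqP io|hi].
    have {io} -> : i = o by exact: val_inj.
    move=> d V; rewrite ffunE eqxx pbE // /c' eqxx (coE _ Dz) comat_pmod //.
    exact: lq.
  have io : i != o by rewrite -val_eqE /= ltn_eqF.
  move=> d V; rewrite ffunE (negPf io) pbE ?(ltnW hi) // /c' ltn_eqF //.
  exact: (st_rel hs (D'D _ Dz)).
- move=> i; rewrite ltnS leq_eqVlt => /orP[/eqP io|hi].
    by have -> : i == o; [rewrite -val_eqE /= io|].
  have io : i != o by rewrite -val_eqE /= ltn_eqF.
  by rewrite (negPf io); apply: locfrac_loc => //; exact: (st_x hs).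
- move=> k; rewrite ltnS leq_eqVlt /c' => /orP[/eqP ks|hk] d M i j.
    by rewrite ks eqxx; exact: fco.
  by rewrite ltn_eqF //; apply: locfrac_loc => //; exact: (st_c hs).
Qed.

Theorem normal_form z0 : exists (e : signs r) D x, [/\ gen_alg S D, D z0 != 0, forall i, locfrac S D (x i)
  & forall z, D z != 0 -> orb psi (uu z) (pp z) (sigs G w e (fun i => x i z))].
Proof.
have [e [D [x [c hs]]]] := stage_exists z0 (leqnn r).
exists e, D, x; split; [exact: st_gen hs|exact: st_neq0 hs|by move=> i; exact: st_x hs _ (ltn_ord i)|].
move=> z Dz; apply: (orb_sym tw); exists (c z) => i d V.
rewrite (st_rel hs Dz (ltn_ord i)) -!mulmxA [sval (pinvp _) d V]/= mulKVmx ?par_unit // mulKmx //.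
exact: bor_unit.
Qed.

End NormalForm.

Section Quotient.
Variables (X : Type) (E : X -> X -> Prop).
Hypotheses (Er : forall x, E x x) (Es : forall x y, E x y -> E y x)
  (Et : forall x y z, E x y -> E y z -> E x z).

Lemma quot_projP x y : quot_proj E x = quot_proj E y <-> E x y.
Proof.
split=> [/(congr1 sval)/= h|xy].
  have : [set z | E y z] y by exact: Er.
  by rewrite -h.
apply: eq_exist; apply/seteqP; split=> z /=; apply: Et => //; exact: Es.
Qed.

Lemma quot_proj_surj (c : quot_point E) : exists x, c = quot_proj E x.
Proof. by case: c => c [x hx]; exists x; exact: eq_exist. Qed.

End Quotient.

(** * Charts of a quotient, possibly fibred over a parameter *)

Section Charts.
Variables (K : numFieldType) (n m : nat) (G : km_datum n m) (r : nat) (w : r.-tuple 'I_n).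
Variable psi : K -> borel K G -> borel K G.
Hypothesis tw : twist_family psi.
Hypothesis letters_inj : forall k i : 'I_r, (k < i)%N -> tnth w k != tnth w i.
Hypothesis beta01 : forall k i : 'I_r, (k < i)%N -> beta G w k i = 0 \/ beta G w k i = -1.
Variables (X : Type) (S : set (X -> K)) (uu : X -> K) (pp : X -> forall i, parab K G (tnth w i)).
Hypothesis Su : gen_alg S uu.
Hypothesis Sp : forall i d (M : pmod K G (tnth w i) d) k l, gen_alg S (fun z => parab_coef M k l (pp z i)).
Variable E : X -> X -> Prop.
Hypothesis EP : forall z z', E z z' <-> uu z = uu z' /\ orb psi (uu z) (pp z) (pp z').
Variable pt : K -> signs r -> ('I_r -> K) -> X.
Hypothesis ptu : forall z e a, uu (pt (uu z) e a) = uu z.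
Hypothesis ptp : forall z e a, pp (pt (uu z) e a) = sigs G w e a.
Hypothesis pt_poly : forall f z e, S f -> exists P : {mpoly K[r]}, forall a, f (pt (uu z) e a) = P.@[a].
Local Notation pr := (quot_proj E).
Local Notation Q := (@quotient K (zariski S) E).

Lemma E_refl z : E z z. Proof. by apply/EP; split=> //; exact: orb_refl. Qed.

Lemma E_sym z z' : E z z' -> E z' z.
Proof. by move=> /EP[h1 h2]; apply/EP; split=> //; rewrite -h1; exact: (orb_sym tw). Qed.

Lemma E_trans z z' z'' : E z z' -> E z' z'' -> E z z''.
Proof.
move=> /EP[h1 h2] /EP[h3 h4]; apply/EP; split; first by rewrite h1.
by apply: (orb_trans tw) h2 _; rewrite h1.
Qed.

Lemma pr_eq z z' : pr z = pr z' <-> E z z'.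
Proof. exact: quot_projP E_refl E_sym E_trans _ _. Qed.

Lemma pr_pt z z' e a e' a' : pr (pt (uu z) e a) = pr (pt (uu z') e' a') <->
  uu z = uu z' /\ exists lam, cox_rel (nx G w) e a e' a' lam.
Proof. by rewrite pr_eq EP !ptu !ptp orb_sigs. Qed.

Lemma pt_gen f z e : gen_alg S f -> exists P : {mpoly K[r]}, forall a, f (pt (uu z) e a) = P.@[a].
Proof.
elim=> [g hg|c|g h _ [P hP] _ [P' hP']|g h _ [P hP] _ [P' hP']].
- exact: pt_poly.
- by exists c%:MP => a; rewrite mevalC.
- by exists (P + P') => a; rewrite mevalD hP hP'.
- by exists (P * P') => a; rewrite mevalM hP hP'.
Qed.

Lemma charts_at z0 : exists (e : signs r) D x, [/\ gen_alg S D, D z0 != 0, forall i, locfrac S D (x i)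
  & forall z, D z != 0 -> E z (pt (uu z) e (fun i => x i z))].
Proof.
have [e [D [x [h1 h2 h3 h4]]]] := normal_form tw Su Sp z0.
by exists e, D, x; split=> // z Dz; apply/EP; rewrite ptu ptp; split=> //; exact: h4.
Qed.

Lemma pr_surj (c : Q) : exists z e a, c = pr (pt (uu z) e a).
Proof.
have [z ->] := quot_proj_surj c; have [e [D [x [_ Dz _ h]]]] := charts_at z.
by exists z, e, (fun i => x i z); apply/pr_eq/h.
Qed.

Lemma opn_pt (W : set Q) z e a : opn W -> W (pr (pt (uu z) e a)) ->
  exists P : {mpoly K[r]}, P.@[a] != 0 /\ forall b, P.@[b] != 0 -> W (pr (pt (uu z) e b)).
Proof.
move=> oW Wz; have [f [hf fz fW]] := oW _ Wz; have [P hP] := pt_gen z e hf.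
by exists P; split=> [|b]; rewrite -hP // => /fW.
Qed.

(** The polynomial must serve for all values of the parameter at once, since a neighbourhood in the
    family meets nearby fibres. The open sets to which this is applied have the same description in
    every fibre. *)
Lemma pt_opn (W : set Q) : (forall z e a, W (pr (pt (uu z) e a)) ->
    exists P : {mpoly K[r]}, P.@[a] != 0 /\ forall b z', P.@[b] != 0 -> W (pr (pt (uu z') e b))) -> opn W.
Proof.
move=> h z0 Wz0; have [e [D [x [hD Dz hx hE]]]] := charts_at z0.
have Wz : W (pr (pt (uu z0) e (fun i => x i z0))) by rewrite -((pr_eq _ _).2 (hE _ Dz)).
have [P [P0 hP]] := h _ _ _ Wz; have [A [N [hA fA]]] := locfrac_mpoly P hD hx.
have neq z : D z != 0 -> (A z != 0) = (P.@[fun i => x i z] != 0).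
  by move=> zD; rewrite fA // mulf_eq0 invr_eq0 expf_eq0 (negPf zD) andbF orbF.
exists (fun z => D z * A z); split; first exact: gen_mul.
  by rewrite mulf_neq0 // neq.
move=> z; rewrite mulf_eq0 negb_or => /andP[zD zA].
by rewrite /preimage /= ((pr_eq _ _).2 (hE _ zD)); apply: hP; rewrite -neq.
Qed.

Lemma reg_pt (W : set Q) (f : Q -> K) z e a : reg W f -> W (pr (pt (uu z) e a)) ->
  exists p q : {mpoly K[r]}, q.@[a] != 0 /\ forall b, W (pr (pt (uu z) e b)) -> q.@[b] != 0 ->
    f (pr (pt (uu z) e b)) = p.@[b] / q.@[b].
Proof.
move=> rf Wz; have [g [h [hg hh hz hf]]] := rf _ Wz.
have [p hp] := pt_gen z e hg; have [q hq] := pt_gen z e hh.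
exists p, q; split=> [|b Wb]; rewrite -hq // => q0.
by rewrite -hp; exact: hf.
Qed.

Lemma pt_reg (W : set Q) (f : Q -> K) : (forall z e a, W (pr (pt (uu z) e a)) ->
    exists p q : {mpoly K[r]}, q.@[a] != 0 /\ forall b z', W (pr (pt (uu z') e b)) -> q.@[b] != 0 ->
      f (pr (pt (uu z') e b)) = p.@[b] / q.@[b]) -> reg W f.
Proof.
move=> h z0 Wz0; have [e [D [x [hD Dz hx hE]]]] := charts_at z0.
have prE z : D z != 0 -> pr z = pr (pt (uu z) e (fun i => x i z)) by move/hE => ?; exact/pr_eq.
have Wz : W (pr (pt (uu z0) e (fun i => x i z0))) by rewrite -prE.
have [p [q [q0 hf]]] := h _ _ _ Wz.
have [A [N [hA fA]]] := locfrac_mpoly p hD hx; have [B [L [hB fB]]] := locfrac_mpoly q hD hx.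
have neq z : D z != 0 -> (B z != 0) = (q.@[fun i => x i z] != 0).
  by move=> zD; rewrite fB // mulf_eq0 invr_eq0 expf_eq0 (negPf zD) andbF orbF.
exists (fun z => A z * D z ^+ L.+1), (fun z => B z * D z ^+ N.+1); split.
- by apply: gen_mul => //; exact: gen_exp.
- by apply: gen_mul => //; exact: gen_exp.
- by rewrite mulf_neq0 ?expf_neq0 // neq.
move=> z Wpz; rewrite mulf_eq0 negb_or => /andP[zB]; rewrite expf_eq0 /= => zD.
rewrite /preimage /= prE // in Wpz *; rewrite hf // -?neq // fA ?fB //.
by rewrite !exprS; field; rewrite ?expf_neq0 ?zD ?zB.
Qed.

End Charts.

(** * The atlases of the two varieties *)

Section Atlases.
Variables (R : realType) (n m : nat) (G : km_datum n m) (r : nat) (w : r.-tuple 'I_n).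
Local Notation K := R[i].
Hypothesis wI : condition_I G w.

Lemma condI_le (k i : 'I_r) : (k < i)%N -> beta G w k i <= 0.
Proof.
move=> ki; have [/eqP h _ _] := wI k; rewrite leNgt; apply/negP => b0.
by move: h; rewrite cards_eq0 => /eqP/setP/(_ i); rewrite !inE ki b0.
Qed.

Lemma condI_neg (k i : 'I_r) : (k < i)%N -> beta G w k i < 0 -> eta_neg G w k = [set i]%SET.
Proof.
move=> ki b0; have [_ h _] := wI k; apply/eqP; rewrite eq_sym eqEcard cards1 h andbT.
by rewrite finset.sub1set inE ki b0.
Qed.

(** A repeated letter would give the positive entry beta = 2. *)
Lemma condI_inj (k i : 'I_r) : (k < i)%N -> tnth w k != tnth w i.
Proof.
move=> ki; apply/eqP => h; have := condI_le ki.
by rewrite /beta h (gcm_diag (kmd_gcm G)).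
Qed.

Lemma condI_beta (k i : 'I_r) : (k < i)%N -> beta G w k i = 0 \/ beta G w k i = -1.
Proof.
move=> ki; have := condI_le ki; rewrite le_eqVlt => /orP[/eqP|b0]; first by left.
by right; have [_ _] := wI k; apply; exact: condI_neg.
Qed.

Lemma condI_nx (i j j' : 'I_r) : nx G w i j -> nx G w i j' -> j = j'.
Proof.
move=> /andP[ij /eqP bj] /andP[ij' /eqP bj'].
have := condI_neg ij; rewrite bj => /(_ isT) h; have := condI_neg ij'; rewrite bj' => /(_ isT).
by rewrite h => /finset.set1_inj.
Qed.

Lemma nx_lt (k i : 'I_r) : nx G w k i -> (k < i)%N. Proof. by case/andP. Qed.

Lemma sigs_poly e (i : 'I_r) d (M : pmod K G (tnth w i) d) k l : exists P : {mpoly K[r]},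
  forall a, parab_coef M k l (sigs G w e a i) = P.@[a].
Proof.
have [P hP] := sig_poly (e i) M k l.
exists (map_poly (@mpolyC r K) P).['X_i] => a; rewrite /parab_coef hP.
by rewrite -(mevalXU a i) -[RHS]/(meval a _) -horner_map /= -map_poly_comp map_poly_id //= => c _; rewrite /= mevalC.
Qed.

Lemma twisted_orbitP (f : bfam K G -> bfam K G) (psi : K -> borel K G -> borel K G) u p y :
  (forall b d (M : bmod K G d), f (sval b) d M = sval (psi u b) d M) ->
  twisted_orbit f p y <-> orb (w := w) psi u p y.
Proof.
have E (b : nat -> borel K G) (i : 'I_r) d (M : pmod K G (tnth w i) d) :
    (forall b d (M : bmod K G d), f (sval b) d M = sval (psi u b) d M) ->
    (if val i is k.+1 then invmx (f (sval (b k)) d M) else 1%:M) = invmx (sval (pb psi u b i) d M).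
  by move=> h; case: i M => [[|k] ki] M /=; rewrite ?invmx1 // h.
by move=> h; split=> -[b hb]; exists b => i d M; rewrite hb E.
Qed.

Let bpt (u : K) (e : signs r) (a : 'I_r -> K) := sigs G w e a.
Let bS := [set f : (forall i, parab K G (tnth w i)) -> K |
    exists i d (M : pmod K G (tnth w i) d) k l, f = (fun p => parab_coef M k l (p i))].
Let bE (z z' : forall i, parab K G (tnth w i)) : twisted_orbit id z z' <->
  (1 : K) = 1 /\ orb (fun _ b => b) 1 z z'.
Proof.
rewrite (@twisted_orbitP id (fun _ b => b) 1) //.
by split=> [|[]].
Qed.
Let bSp i d (M : pmod K G (tnth w i) d) k l : gen_alg bS (fun z => parab_coef M k l (z i)).
Proof. by apply: gen_in; exists i, d, M, k, l. Qed.
Let bpoly f (z : forall i, parab K G (tnth w i)) e : bS f ->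
  exists P : {mpoly K[r]}, forall a, f (bpt 1 e a) = P.@[a].
Proof. by move=> [i [d [M [k [l ->]]]]]; exact: sigs_poly. Qed.

Definition bsdh_chart (e : signs r) (a : 'I_r -> K) : bsdh K G w :=
  quot_proj (twisted_orbit id) (sigs G w e a).

Lemma bsdh_atlas : bott_atlas (nx G w) bsdh_chart.
Proof.
(* The parameter is the constant 1, as the identity twist does not depend on it. *)
have tw := tw_id K G; have Su := gen_cst bS (1 : K).
have ptu (z : forall i, parab K G (tnth w i)) (e : signs r) (a : 'I_r -> K) : (1 : K) = 1 by [].
have ptp (z : forall i, parab K G (tnth w i)) e a : bpt 1 e a = sigs G w e a by [].
pose z0 : forall i, parab K G (tnth w i) := sigs G w [ffun=> true] (fun=> 0).
split; first exact: nx_lt.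
- move=> c; have [z [e [a h]]] := pr_surj (pt := bpt) (uu := fun=> 1) tw Su bSp bE ptu ptp c.
  by exists e, a.
- move=> e a e' a'; have := pr_pt (pt := bpt) (uu := fun=> 1) tw condI_inj condI_beta bE ptu ptp z0 z0 e a e' a'.
  by move=> h; split=> [/h[]|hl]; [|apply/h].
- move=> U; split=> [oU e a Ua|h].
    exact: (opn_pt (pt := bpt) (uu := fun=> 1) (z := z0) bpoly oU Ua).
  apply: (pt_opn (pt := bpt) (uu := fun=> 1) tw Su bSp bE ptu ptp) => z e a /h[P [P0 hP]].
  by exists P; split=> // b _; exact: hP.
- move=> U f oU; split=> [rf e a Ua|h].
    exact: (reg_pt (pt := bpt) (uu := fun=> 1) (z := z0) bpoly rf Ua).
  apply: (pt_reg (pt := bpt) (uu := fun=> 1) tw Su bSp bE ptu ptp) => z e a /h[p [q [q0 hf]]].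
  by exists p, q; split=> // b _; exact: hf.
Qed.

Section Toric.
Variables (lam : 'rV[int]_m) (q : nat).
Hypothesis deg : degenerating K G lam q.
Local Notation PX := (forall i, parab K G (tnth w i)).

Let tpt (u : K) (e : signs r) (a : 'I_r -> K) : K * PX := (u, sigs G w e a).
Let tS := [set f : K * PX -> K | f = fst \/
    exists i d (M : pmod K G (tnth w i) d) k l, f = (fun p => parab_coef M k l (p.2 i))].
Let tE (z z' : K * PX) : family_orbit lam z z' <-> z.1 = z'.1 /\ orb (psil (G := G) lam) z.1 z.2 z'.2.
Proof.
rewrite /family_orbit (@twisted_orbitP (Psi lam z.1) (psil (G := G) lam) z.1) //.
by move=> b d M; exact: (psilE deg).
Qed.
Let tSp i d (M : pmod K G (tnth w i) d) k l : gen_alg tS (fun z => parab_coef M k l (z.2 i)).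
Proof. by apply: gen_in; right; exists i, d, M, k, l. Qed.
Let tpoly f (z : K * PX) e : tS f -> exists P : {mpoly K[r]}, forall a, f (tpt z.1 e a) = P.@[a].
Proof.
move=> [->|[i [d [M [k [l ->]]]]]]; last exact: sigs_poly.
by exists (z.1)%:MP => a; rewrite mevalC.
Qed.

Definition toric_chart (e : signs r) (a : 'I_r -> K) : toric_limit K G w lam :=
  exist _ (quot_proj (family_orbit lam) (0, sigs G w e a)) (ex_intro _ (sigs G w e a) erefl).

Lemma toric_atlas : bott_atlas (nx G w) toric_chart.
Proof.
have tw := tw_psil deg; have Su : gen_alg tS fst by apply: gen_in; left.
have ptu (z : K * PX) (e : signs r) (a : 'I_r -> K) : (tpt z.1 e a).1 = z.1 by [].
have ptp (z : K * PX) e a : (tpt z.1 e a).2 = sigs G w e a by [].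
pose z0 : K * PX := (0, sigs G w [ffun=> true] (fun=> 0)).
pose pr := quot_proj (@family_orbit K n m G r w lam).
have prE (z z' : K * PX) e a e' a' : pr (tpt z.1 e a) = pr (tpt z'.1 e' a') <->
    z.1 = z'.1 /\ exists lam, cox_rel (nx G w) e a e' a' lam.
  exact: (pr_pt tw condI_inj condI_beta tE ptu ptp).
have eqP e a e' a' : toric_chart e a = toric_chart e' a' <-> exists lam, cox_rel (nx G w) e a e' a' lam.
  split=> [/(congr1 sval) h|hl]; first by have [_] := (prE z0 z0 e a e' a').1 h.
  by apply: eq_exist; apply/(prE z0 z0).
have surj (x : toric_limit K G w lam) : exists e a, x = toric_chart e a.
  case: x => c [p cE]; have [z [e [a hz]]] := pr_surj (pt := tpt) tw Su tSp tE ptu ptp c.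
  have z1 : z.1 = 0.
    by move: hz; rewrite cE => /(pr_eq tw tE _ _).1[/= <-].
  exists e, a; apply: eq_exist; rewrite hz.
  exact: (congr1 (fun u => quot_proj (@family_orbit K n m G r w lam) (tpt u e a)) z1).
(* A subset of the special fibre is extended to the family by the same chart coordinates for every
   u; regular functions are extended in the same way by [F]. *)
pose U (V : set (toric_limit K G w lam)) :=
  [set c | exists (z : K * PX) e a, c = pr (tpt z.1 e a) /\ V (toric_chart e a)].
have UV (V : set (toric_limit K G w lam)) (z : K * PX) e a : U V (pr (tpt z.1 e a)) -> V (toric_chart e a).
  move=> [z' [e' [a' [h1 h2]]]]; have [_ h3] := (prE _ _ _ _ _ _).1 h1.
  by rewrite ((eqP _ _ _ _).2 h3).
have oUV (V : set (toric_limit K G w lam)) : (forall e a, V (toric_chart e a) ->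
    exists P : {mpoly K[r]}, P.@[a] != 0 /\ forall b, P.@[b] != 0 -> V (toric_chart e b)) ->
    @opn _ (toric_family K G w lam) (U V).
  move=> h; apply: (pt_opn (pt := tpt) (uu := fst) tw Su tSp tE ptu ptp) => z e a /UV/h[P [P0 hP]].
  by exists P; split=> // b z' /hP Vb; exists z', e, b.
have oV (V : set (toric_limit K G w lam)) : opn V -> forall e a, V (toric_chart e a) ->
    exists P : {mpoly K[r]}, P.@[a] != 0 /\ forall b, P.@[b] != 0 -> V (toric_chart e b).
  move=> [W oW VW] e a; rewrite VW => Wa.
  exact: (opn_pt (pt := tpt) (uu := fst) (z := z0) tpoly oW Wa).
split; first exact: nx_lt.
- exact: surj.
- exact: eqP.
- move=> V; split=> [|h]; first exact: oV.
  exists (U V); first exact: oUV.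
  apply/seteqP; split=> c; have [e [a ->]] := surj c.
    by move=> Vc; exists z0, e, a.
  by move=> h1; exact: (UV V z0 e a h1).
- move=> V f Vo; split=> [rf e a Va|h].
    have [W [F [oW Wa rF hF]]] := rf _ Va.
    have [P [P0 hP]] := opn_pt (pt := tpt) (uu := fst) (z := z0) tpoly oW Wa.
    have [g [k [k0 hgk]]] := reg_pt (pt := tpt) (uu := fst) (z := z0) tpoly rF Wa.
    exists (g * P), (k * P); rewrite mevalM mulf_neq0 //; split=> // b Vb.
    rewrite mevalM mulf_eq0 negb_or => /andP[kb Pb]; have Wb := hP _ Pb.
    by rewrite hF // hgk // mevalM -mulf_div mulfV // mulr1.
  pose F c := xget 0 [set y | exists (z : K * PX) e a, c = pr (tpt z.1 e a) /\ y = f (toric_chart e a)].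
  have FE (z : K * PX) e a : F (pr (tpt z.1 e a)) = f (toric_chart e a).
    rewrite /F; case: xgetP => [y _ [z' [e' [a' [h1 ->]]]]|/(_ (f (toric_chart e a)))[]].
      by have [_ h3] := (prE _ _ _ _ _ _).1 h1; rewrite ((eqP _ _ _ _).2 h3).
    by exists z, e, a.
  move=> x Vx; exists (U V), F; split=> //.
  + exact/oUV/oV.
  + by have [e [a hx]] := surj x; rewrite hx in Vx *; exists z0, e, a.
  + apply: (pt_reg (pt := tpt) (uu := fst) tw Su tSp tE ptu ptp) => z e a /UV/h[g [k [k0 hgk]]].
    exists g, k; split=> // b z' /UV Vb kb; rewrite FE; exact: hgk.
  + by move=> y Vy _; have [e [a ->]] := surj y; rewrite (FE z0).
Qed.

End Toric.

End Atlases.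

Theorem corollary6p12 (R : realType) (n m : nat) (G : km_datum n m)
    (r : nat) (w : r.-tuple 'I_n) :
  (condition_I G w ->
    forall (lam : 'rV[int]_m) (q : nat), degenerating R[i] G lam q ->
      (forall p : nat, (1 <= p)%N ->
         tangent_cohomology_vanishes (toric_limit R[i] G w lam) p) /\
      locally_rigid (toric_limit R[i] G w lam)) /\
  (condition_I G w ->
    (forall p : nat, (1 <= p)%N ->
       tangent_cohomology_vanishes (bsdh R[i] G w) p) /\
    locally_rigid (bsdh R[i] G w)).
Proof.
split=> wI; [move=> lam q deg; have atl := toric_atlas wI deg|have atl := bsdh_atlas R wI];
  have van p (p0 : (1 <= p)%N) := bott_vanishing atl (condI_nx wI) p0;
  split=> //; exact: bott_rigid atl (van 1%N isT).
Qed.
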